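(* Let $d\ge2$ and let $\hat H=-\Delta+|x|^2$ be the harmonic oscillator on $L^2(\mathbb{R}^d)$. Let $A\in S(1,1)$, and for $B=(\varphi_{j,\ell})_{j\in\mathbb{N},\,1\le\ell\le N_{h_j}}\in\mathcal{B}$ denote $$D_j(B)=\max_{1\le\ell\le N_{h_j}}\big|\langle\varphi_{j,\ell},\hat A\varphi_{j,\ell}\rangle-L_2(A)\big|.$$ Then $$\lim_{j\to+\infty}D_j(B)=0\quad\text{for }\rho\text{-almost every }B\in\mathcal{B}.$$ In other words, a random orthonormal basis of Hermite functions is quantum uniquely ergodic.
   Context: For $j\in\mathbb{N}$ let $\mathcal{E}_{h_j}\subset L^2(\mathbb{R}^d)$ be the eigenspace of $\hat H=-\Delta+|x|^2$ for the eigenvalue $2j+d$ (with $h_j=1/j$), and $N_{h_j}=\dim\mathcal{E}_{h_j}$ ($\sim cj^{d-1}$). The set of orthonormal bases of $\mathcal{E}_{h_j}$ is identified (by fixing a reference orthonormal basis) with the unitary group $U(N_{h_j})$, endowed with its Haar probability measure $\rho_j$. The space of Hilbertian bases of $L^2(\mathbb{R}^d)$ made of eigenfunctions of $\hat H$ is identified with $\mathcal{B}=\prod_{j\in\mathbb{N}}U(N_{h_j})$ and endowed with the product probability $\rho=\otimes_{j\in\mathbb{N}}\rho_j$; an element $B=(\varphi_{j,\ell})$ is such that for each $j$, $(\varphi_{j,\ell})_{1\le\ell\le N_{h_j}}$ is an orthonormal basis of $\mathcal{E}_{h_j}$. $L_2$ is the uniform probability measure on $\{(x,\xi)\in\mathbb{R}^{2d}:|x|^2+|\xi|^2=2\}=\sqrt2\,\mathbb{S}^{2d-1}$,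 and $L_2(A)$ is the integral of $A$ against it. $S(1,1)$ is the class of $A\in C^\infty(\mathbb{R}^{2d})$ which are homogeneous of degree 0 outside a small neighborhood of $(0,0)$: $A(\lambda x,\lambda\xi)=A(x,\xi)$ for every $\lambda\ge1$ and $|(x,\xi)|\ge\varepsilon$, with $\varepsilon>0$ small (in particular $\varepsilon<\sqrt2$). $\hat A$ is the Weyl quantization with $h=1$: $\hat Af(x)=(2\pi)^{-d}\iint e^{i(x-y)\cdot\xi}A(\frac{x+y}{2},\xi)f(y)\,dy\,d\xi$. *)

(* Defs.v *)
From HB Require Import structures.
From mathcomp Require Import all_boot all_order all_algebra.
From mathcomp Require Import all_classical all_reals all_analysis.
From mathcomp Require Import complex.

Set Implicit Arguments.
Unset Strict Implicit.
Unset Printing Implicit Defensive.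

Import Order.TTheory GRing.Theory Num.Theory.
Import numFieldNormedType.Exports.

Local Open Scope classical_set_scope.
Local Open Scope complex_scope.
Local Open Scope ring_scope.

Section row_measurable.
Context {R : realType} {n : nat}.

Let coord (i : 'I_n) (x : 'rV[R]_n) : measurableTypeR R := x ord0 i.

Let row_set0 : g_sigma_preimage coord set0.
Proof. exact: sigma_algebra0. Qed.

Let row_setC A : g_sigma_preimage coord A -> g_sigma_preimage coord (~` A).
Proof. exact: sigma_algebraC. Qed.

Let row_bigcup (F : _^nat) : (forall i, g_sigma_preimage coord (F i)) ->
  g_sigma_preimage coord (\bigcup_i (F i)).
Proof. exact: sigma_algebra_bigcup. Qed.

(* The product sigma-algebra of R^n, i.e. its Borel sigma-algebra. *)
HB.instance Definition _ :=
  @isMeasurable.Build (measure_tuple_display R.-ocitv.-measurable.-sigma)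
    'rV[R]_n (g_sigma_preimage coord) row_set0 row_setC row_bigcup.

Lemma measurable_coord (i : 'I_n) :
  measurable_fun [set: 'rV[R]_n] (fun x => x ord0 i : measurableTypeR R).
Proof.
move=> _ Y mY; rewrite setTI; apply: sub_sigma_algebra => /=.
rewrite -bigcup_seq/=; exists i => /=; first by rewrite mem_index_enum.
by exists Y => //; rewrite setTI.
Qed.

Lemma measurable_rowP d (T : measurableType d) (f : T -> 'rV[R]_n) :
  (forall i, measurable_fun setT (fun t => f t ord0 i : measurableTypeR R)) ->
  measurable_fun setT f.
Proof.
move=> mf _ A mA; rewrite setTI.
suff sub : g_sigma_preimage coord `<=` [set B | measurable (f @^-1` B)].
  exact: sub.
apply: smallest_sub.
- split.
  + by rewrite /= preimage_set0.
  + by move=> B /= mB; rewrite setTD preimage_setC; exact: measurableC.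
  + by move=> F mF /=; rewrite preimage_bigcup; exact: bigcupT_measurable.
- move=> B /=; rewrite -bigcup_seq => -[i _ [Y mY <-]] /=.
  by rewrite setTI; have := mf i measurableT _ mY; rewrite setTI.
Qed.

End row_measurable.

Section lebesgue_row.
Context {R : realType}.

Definition cons_row n (p : measurableTypeR R * 'rV[R]_n) : 'rV[R]_n.+1 :=
  row_mx (const_mx p.1 : 'rV_1) p.2.

Definition uncons_row n (x : 'rV[R]_n.+1) : measurableTypeR R * 'rV[R]_n :=
  (x ord0 ord0, @rsubmx R 1 1 n x).

Lemma uncons_rowK n : cancel (@uncons_row n) (@cons_row n).
Proof.
move=> x; rewrite /cons_row /uncons_row /=.
rewrite (_ : const_mx _ = @lsubmx R 1 1 n x) ?(@hsubmxK R 1 1 n)//.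
by apply/rowP => i; rewrite !mxE !ord1; congr (x _ _); exact: val_inj.
Qed.

Lemma cons_rowK n : cancel (@cons_row n) (@uncons_row n).
Proof.
move=> [t x]; rewrite /cons_row /uncons_row /= row_mxKr; congr pair.
by rewrite mxE; case: splitP => [j _|j]; rewrite ?mxE.
Qed.

Lemma measurable_cons_row n : measurable_fun setT (@cons_row n).
Proof.
apply: measurable_rowP => i; rewrite /cons_row.
case: (@splitP 1 n i) => j ij.
- rewrite (_ : (fun _ => _) = fst)//.
  apply/funext => -[t x] /=; rewrite mxE; case: splitP => k; first by rewrite mxE.
  by rewrite ij => jk; have := ltn_ord j; rewrite jk ltnNge.
- rewrite (_ : (fun _ => _) = (fun x : 'rV[R]_n => x ord0 j) \o snd)//; last first.
    apply/funext => -[t x] /=; rewrite mxE; case: splitP => k.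
      by rewrite ij => kj; have := ltn_ord k; rewrite -kj ltnNge.
    by rewrite ij => /addnI/val_inj ->.
  by apply: measurableT_comp => //; exact: measurable_coord.
Qed.

Lemma measurable_uncons_row n : measurable_fun setT (@uncons_row n).
Proof.
apply/measurable_fun_pairP; split; first exact: measurable_coord.
apply: measurable_rowP => i.
rewrite (_ : (fun _ => _) = fun x : 'rV[R]_n.+1 => x ord0 (@rshift 1 n i)).
  exact: measurable_coord.
by apply/funext => x; rewrite !mxE.
Qed.

Section step.
Variables (n : nat) (m : {sigma_finite_measure set 'rV[R]_n -> \bar R}).

Definition lebesgue_row_step : set 'rV[R]_n.+1 -> \bar R :=
  pushforward (@lebesgue_measure R \x m)%E (@cons_row n).

Let lebesgue_row_step0 : lebesgue_row_step set0 = 0%E.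
Proof. by rewrite /lebesgue_row_step /pushforward preimage_set0 measure0. Qed.

Let lebesgue_row_step_ge0 A : (0 <= lebesgue_row_step A)%E.
Proof. exact: (measure_ge0 (@lebesgue_measure R \x m)%E). Qed.

Let lebesgue_row_step_sigma_additive : semi_sigma_additive lebesgue_row_step.
Proof.
move=> F mF tF mUF; rewrite /lebesgue_row_step /pushforward preimage_bigcup.
apply: measure_semi_sigma_additive.
- by move=> k; rewrite -[X in measurable X]setTI; exact: measurable_cons_row.
- apply/trivIsetP => /= i j _ _ ij; rewrite -preimage_setI.
  by move/trivIsetP : tF => /(_ _ _ _ _ ij) ->//; rewrite preimage_set0.
- by rewrite -preimage_bigcup -[X in measurable X]setTI;
    exact: measurable_cons_row.
Qed.

HB.instance Definition _ := isMeasure.Build _ _ _ lebesgue_row_step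
  lebesgue_row_step0 lebesgue_row_step_ge0 lebesgue_row_step_sigma_additive.

Let lebesgue_row_step_sigma_finite : sigma_finite setT lebesgue_row_step.
Proof.
have /sigma_finiteP[F [TF ndF Foo]] := sigma_finiteT (@lebesgue_measure R).
have /sigma_finiteP[G [TG ndG Goo]] := sigma_finiteT m.
exists (fun k => @uncons_row n @^-1` (F k `*` G k)).
  rewrite -preimage_bigcup -[LHS](preimage_setT (@uncons_row n)); congr (_ @^-1` _).
  rewrite -setXTT TF TG predeqE => -[x y]; split.
    move=> [/= [k _ Fkx] [l _ Gly]]; exists (maxn k l) => //; split.
    - by move: x Fkx; exact/subsetPset/ndF/leq_maxl.
    - by move: y Gly; exact/subsetPset/ndG/leq_maxr.
  by move=> [k _ []/= ? ?]; split; exists k.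
move=> k; have [mFk Fkoo] := Foo k; have [mGk Gkoo] := Goo k; split.
  rewrite -[X in measurable X]setTI; apply: measurable_uncons_row => //.
  exact: measurableX.
rewrite /lebesgue_row_step /pushforward.
rewrite (_ : _ @^-1` _ = F k `*` G k); last first.
  rewrite -comp_preimage (_ : _ \o _ = id) ?preimage_id//.
  by apply/funext; exact: cons_rowK.
by rewrite product_measure1E// lte_mul_pinfty// ge0_fin_numE.
Qed.

HB.instance Definition _ := Measure_isSigmaFinite.Build _ _ _
  lebesgue_row_step lebesgue_row_step_sigma_finite.

End step.

Fixpoint lebesgue_row n : {sigma_finite_measure set 'rV[R]_n -> \bar R} :=
  match n with
  | 0 => \d_(0 : 'rV[R]_0)
  | k.+1 => lebesgue_row_step (lebesgue_row k)
  end.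

End lebesgue_row.

Section calculus.
Context {R : realType} {n : nat}.
Local Notation C := R[i].
Implicit Types (f g : 'rV[R]_n -> C) (h : 'rV[R]_n -> R).

(* The norm that the library puts on 'rV[R]_n is the sup norm. *)
Definition dotp (x y : 'rV[R]_n) : R := \sum_(i < n) x ord0 i * y ord0 i.
Definition enorm (x : 'rV[R]_n) : R := Num.sqrt (dotp x x).

Definition partial (i : 'I_n) h : 'rV[R]_n -> R :=
  fun x => 'D_(delta_mx ord0 i) h x.
Definition partials (s : seq 'I_n) h : 'rV[R]_n -> R := foldr partial h s.

Definition smooth h : Prop := forall s : seq 'I_n,
  continuous (partials s h) /\
  forall (i : 'I_n) (x : 'rV[R]_n),
    derivable (partials s h) x (delta_mx ord0 i).

Definition csmooth f : Prop :=
  smooth (fun x => complex.Re (f x)) /\ smooth (fun x => complex.Im (f x)).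

Definition cpartials (s : seq 'I_n) f : 'rV[R]_n -> C := fun x =>
  (partials s (fun y => complex.Re (f y)) x +i*
   partials s (fun y => complex.Im (f y)) x)%C.

Definition schwartz f : Prop :=
  csmooth f /\
  forall (k : nat) (s : seq 'I_n), exists M : R, forall x : 'rV[R]_n,
    enorm x ^+ k * Normc.normc (cpartials s f x) <= M.

(* [Rintegral] is total: this is the integral only when the real and imaginary
   parts of f are integrable. *)
Definition cint d (T : measurableType d) (mu : {measure set T -> \bar R})
    (f : T -> C) : C :=
  (Rintegral mu setT (fun x => complex.Re (f x)) +i*
   Rintegral mu setT (fun x => complex.Im (f x)))%C.

Definition square_integrable f : Prop :=
  [/\ measurable_fun setT (fun x => complex.Re (f x) : measurableTypeR R),
      measurable_fun setT (fun x => complex.Im (f x) : measurableTypeR R) &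
      (\int[lebesgue_row n]_x (Normc.normc (f x) ^+ 2)%:E < +oo)%E].

(* Antilinear in the first argument and linear in the second one. *)
Definition inner f g : C := cint (lebesgue_row n) (fun x => conjc (f x) * g x).

End calculus.

Section oscillator.
Context {R : realType} {d : nat}.
Implicit Types f g u : 'rV[R]_d -> R[i].

Definition oscillator u : 'rV[R]_d -> R[i] := fun x =>
  - (\sum_(i < d) cpartials [:: i; i] u x) + (dotp x x)%:C * u x.

(* Graph of the self-adjoint operator on L^2 obtained from [oscillator], which
   is essentially self-adjoint on the Schwartz space: its closure is its
   adjoint, i.e. Hf = g holds in the sense of tempered distributions. *)
Definition oscillator_graph f g : Prop :=
  [/\ square_integrable f, square_integrable g &
      forall u, schwartz u -> inner u g = inner (oscillator u) f].

Definition oscillator_eigenspace (lambda : R) f : Prop :=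
  oscillator_graph f (fun x => lambda%:C * f x).

(* Elements of L^2 are represented by functions, so that being spanned by the
   family is to be understood almost everywhere. *)
Definition orthonormal_basis (E : ('rV[R]_d -> R[i]) -> Prop) (m : nat)
    (e : 'I_m -> 'rV[R]_d -> R[i]) : Prop :=
  [/\ forall k, E (e k),
      forall k l, inner (e k) (e l) = (k == l)%:R &
      forall f, E f -> exists c : 'I_m -> R[i],
        {ae lebesgue_row d, forall x, f x = \sum_(k < m) c k * e k x}].

End oscillator.

Section weyl.
Context {R : realType} {d : nat}.

(* A point (x, xi) of the phase space is [row_mx x xi]. *)
Definition symbol_S11 (A : 'rV[R]_(d + d) -> R[i]) : Prop :=
  csmooth A /\
  exists eps : R, [/\ 0 < eps, eps < Num.sqrt 2 &
    forall (lambda : R) (z : 'rV[R]_(d + d)),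
      1 <= lambda -> eps <= enorm z -> A (lambda *: z) = A z].

Definition cexpi (t : R) : R[i] := (cos t +i* sin t)%C.

(* For f Schwartz (in particular for an eigenfunction of the oscillator) the
   integral in y is absolutely convergent and rapidly decreasing in xi. *)
Definition weyl (A : 'rV[R]_(d + d) -> R[i]) (f : 'rV[R]_d -> R[i]) :
    'rV[R]_d -> R[i] := fun x =>
  ((2 * pi) ^- d)%:C *
  cint (lebesgue_row d) (fun xi : 'rV[R]_d =>
    cint (lebesgue_row d) (fun y : 'rV[R]_d =>
      cexpi (dotp (x - y) xi) * A (row_mx (2^-1 *: (x + y)) xi) * f y)).

End weyl.

(* The uniform probability measure on the sphere of radius r: the only
   probability measure on it which is invariant under the orthogonal group. *)
Definition uniform_on_sphere {R : realType} {n : nat} (r : R)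
    (mu : probability 'rV[R]_n R) : Prop :=
  mu [set z | enorm z = r] = 1%E /\
  forall (Q : 'M[R]_n) (S : set 'rV[R]_n), Q *m Q^T = 1%:M -> measurable S ->
    mu [set z | S (z *m Q)] = mu S.

Section unitary.
Variables (R : realType) (n : nat).

Definition unitary : Type := {M : 'M[R[i]]_n | M \is unitarymx}.

HB.instance Definition _ := Choice.on unitary.

Lemma unitarymx1 : (1%:M : 'M[R[i]]_n) \is unitarymx.
Proof. by apply/unitarymxP; rewrite trmx1 map_mx1 mulmx1. Qed.

HB.instance Definition _ :=
  isPointed.Build unitary (exist _ 1%:M unitarymx1).

(* The Borel sigma-algebra, generated by the real and imaginary parts of the
   matrix entries. *)
Definition unitary_gen : set (set unitary) :=
  [set S | exists (i k : 'I_n) (Y : set (measurableTypeR R)), measurable Y /\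
    (S = [set U : unitary | Y (complex.Re (val U i k))] \/
     S = [set U : unitary | Y (complex.Im (val U i k))])].

Definition unitary_group := g_sigma_algebraType unitary_gen.

Definition unitary_mul (U V : unitary_group) : unitary_group :=
  exist (fun M : 'M[R[i]]_n => M \is unitarymx) (val U *m val V)
    (mul_unitarymx (valP U) (valP V)).

Definition haar_probability (mu : probability unitary_group R) : Prop :=
  forall (V : unitary_group) (S : set unitary_group), measurable S ->
    mu [set U | S (unitary_mul V U)] = mu S.

End unitary.

Section bases.
Variables (R : realType) (N : nat -> nat).

Definition basis_gen : set (set (forall j, unitary_group R (N j))) :=
  [set S | exists (j : nat) (Y : set (unitary_group R (N j))), measurable Y /\
    S = [set B : forall j, unitary_group R (N j) | Y (B j)]].

Definition basis_space := g_sigma_algebraType basis_gen.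

Definition product_probability
    (rhoj : forall j, probability (unitary_group R (N j)) R)
    (rho : probability basis_space R) : Prop :=
  forall (m : nat) (S : forall j, set (unitary_group R (N j))),
    (forall j, measurable (S j)) ->
    rho [set B : basis_space | forall j, (j < m)%N -> S j (B j)] =
    (\prod_(j < m) rhoj j (S j))%E.

End bases.

(* The orthonormal basis associated with U once e is the reference one. *)
Definition rotate {R : realType} {d m : nat} (e : 'I_m -> 'rV[R]_d -> R[i])
    (U : unitary_group R m) (l : 'I_m) : 'rV[R]_d -> R[i] := fun x =>
  \sum_(k < m) val U l k * e k x.

Definition max_deviation {R : realType} {d m : nat}
    (A : 'rV[R]_(d + d) -> R[i]) (a : R[i])
    (phi : 'I_m -> 'rV[R]_d -> R[i]) : R :=
  \big[Num.max/0]_(l < m) Normc.normc (inner (phi l) (weyl A (phi l)) - a).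

(* Main.v *)
(* For a random unit vector phi of C^N and a matrix T, the invariance of the Haar measure
   under infinitesimal rotations gives a recurrence for the moments of <phi, T phi>, so
   that its sixth central moment is O(N^-3) as soon as the squared Hilbert-Schmidt norm
   of T is O(N).  With N_j > j, Borel-Cantelli then shows that almost surely
   max_l |<phi_l, A phi_l> - tr / N_j| tends to 0, where tr is the trace of the
   quantized symbol on the j-th eigenspace.

   There remain the Hilbert-Schmidt bound and the limit tr / N_j -> L2(A).  Let G be the
   normalized gaussian.  Then A is a finite sum of averages a_k * G, where
   a_k = (1 - G * )^k A has order -k, and of a remainder of very negative order.  The
   Weyl quantization of a * G is an anti-Wick operator: its matrix in the Hermite basis is
   the integral of a psi_alpha conj(psi_beta), where the psi_alpha, the transforms of the
   Hermite functions by coherent states, are orthonormal.  Bessel's inequality bounds its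
   rows, and its trace is the integral of a against eta_j, the sum of the |psi_alpha|^2
   over |alpha| = j.  This eta_j is radial, has mass N_j and keeps a bounded mass in every
   ball, so that the trace is L2(A) N_j + O(1) for a = A, by homogeneity, and o(N_j) when
   a decays.  The remainder is a Hilbert-Schmidt operator, hence has trace O(sqrt N_j). *)
From HB Require Import structures.
Require Import Defs.
From mathcomp Require Import all_boot all_order all_algebra.
From mathcomp Require Import all_classical all_reals all_analysis.
From mathcomp Require Import complex ring lra zify measurable_realfun.

Set Implicit Arguments.
Unset Strict Implicit.
Unset Printing Implicit Defensive.

Import Order.TTheory GRing.Theory Num.Theory.
Import numFieldNormedType.Exports.

Local Open Scope classical_set_scope.
Local Open Scope complex_scope.
Local Open Scope ring_scope.

(** The exponent 6 is the smallest even one that works for every d >= 2: summed over the N_j vectors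
    of a basis, fourth moments give O(1/N_j), which for d = 2 is O(1/j) and not summable, while
    sixth moments give O(1/N_j^2). Such moments are reached by algebra, without any concentration
    inequality on the sphere.

    The other obstacle is that the Weyl integral of a symbol of order 0 is only an iterated
    integral: neither its additivity in the symbol nor an exchange of its integrals is free.
    Gaussian averages and decaying symbols are the two cases where absolute convergence can be
    established, and the decomposition of the symbol reduces everything to them. It also takes the
    place of a pseudodifferential calculus: neither a composition formula nor a boundedness theorem
    on L^2 enters.

    The given eigenfunctions are known only almost everywhere and as weak solutions. Completeness of
    the Hermite functions is what identifies N_j and the change of basis to an explicit Hermite
    basis. *)

Local Notation normc := Normc.normc.

(** * Integration *)

Section integrals.
Context d (T : measurableType d) {R : realType} (mu : {measure set T -> \bar R}).
Local Notation C := R[i].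
Implicit Types (f g : T -> R) (u v : T -> C).

Definition rintg f := mu.-integrable setT (EFin \o f).

Lemma rintg_meas f : rintg f -> measurable_fun setT f.
Proof. by move/measurable_int => /measurable_EFinP. Qed.

Lemma rintg_le f g : measurable_fun setT f -> rintg g ->
  (forall x, `|f x| <= g x) -> rintg f.
Proof.
move=> mf ig fg; apply: (le_integrable _ _ _ ig) => //.
  exact/measurable_EFinP.
by move=> x _ /=; rewrite lee_fin (le_trans (fg x))// ler_norm.
Qed.

Lemma eq_rintg f g : f =1 g -> rintg f -> rintg g.
Proof. by move=> /funext ->. Qed.

Lemma rintg0 : rintg (fun=> 0).
Proof. exact: integrable0. Qed.

Lemma rintgD f g : rintg f -> rintg g -> rintg (fun x => f x + g x).
Proof. by move=> ? ?; exact: (@integrableD _ _ _ mu setT measurableT (EFin \o f) (EFin \o g)). Qed.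

Lemma rintgZ c f : rintg f -> rintg (fun x => c * f x).
Proof. by move=> ?; exact: (@integrableZl _ _ _ mu setT measurableT c (EFin \o f)). Qed.

Lemma rintgN f : rintg f -> rintg (fun x => - f x).
Proof. by move=> ?; exact: (@integrableN _ _ _ mu setT (EFin \o f)). Qed.

Lemma rintgB f g : rintg f -> rintg g -> rintg (fun x => f x - g x).
Proof. by move=> ? ?; apply: rintgD => //; exact: rintgN. Qed.

Lemma rintg_norm f : rintg f -> rintg (fun x => `|f x|).
Proof. by move=> /integrable_norm. Qed.

Lemma rintg_sum I (s : seq I) (P : pred I) (h : I -> T -> R) :
  (forall i, P i -> rintg (h i)) -> rintg (fun x => \sum_(i <- s | P i) h i x).
Proof.
move=> ih; rewrite /rintg (_ : _ \o _ =
  fun x => (\sum_(i <- s | P i) (EFin \o h i) x)%E); last first.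
  by apply/funext => x /=; rewrite sumEFin.
by apply: integrable_sum.
Qed.

Lemma Rint_sum I (s : seq I) (P : pred I) (h : I -> T -> R) :
  (forall i, P i -> rintg (h i)) ->
  \int[mu]_x (\sum_(i <- s | P i) h i x) = \sum_(i <- s | P i) \int[mu]_x h i x.
Proof.
move=> ih; elim: s => [|i s IH].
  by rewrite big_nil; under eq_Rintegral do rewrite big_nil; rewrite Rintegral_cst ?mul0r.
rewrite big_cons; under eq_Rintegral do rewrite big_cons.
case: ifPn => // Pi; rewrite RintegralD ?IH//; first exact: ih.
exact: rintg_sum.
Qed.

Lemma RintZ c f : rintg f -> \int[mu]_x (c * f x) = c * \int[mu]_x f x.
Proof. by move=> intf; rewrite RintegralZl. Qed.

Lemma RintZr c f : rintg f -> \int[mu]_x (f x * c) = (\int[mu]_x f x) * c.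
Proof. by move=> intf; rewrite RintegralZr. Qed.

Lemma RintD f g : rintg f -> rintg g ->
  \int[mu]_x (f x + g x) = \int[mu]_x f x + \int[mu]_x g x.
Proof. by move=> intf intg; rewrite RintegralD. Qed.

Lemma RintB f g : rintg f -> rintg g ->
  \int[mu]_x (f x - g x) = \int[mu]_x f x - \int[mu]_x g x.
Proof. by move=> intf intg; rewrite RintegralB. Qed.

Lemma Rint_cst0 : \int[mu]_x 0 = 0 :> R.
Proof. by rewrite Rintegral_cst// mul0r. Qed.

Lemma Rint_le f g : rintg f -> rintg g -> (forall x, f x <= g x) ->
  \int[mu]_x f x <= \int[mu]_x g x.
Proof. by move=> ? ? fg; apply: le_Rintegral. Qed.

Lemma norm_Rint_le f g : rintg f -> rintg g -> (forall x, `|f x| <= g x) ->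
  `|\int[mu]_x f x| <= \int[mu]_x g x.
Proof.
move=> intf intg fg; apply: le_trans (le_normr_Rintegral _ intf) _ => //.
by apply: Rint_le => //; exact: rintg_norm.
Qed.

Lemma EFin_Rint f : rintg f -> (\int[mu]_x (f x))%:E = (\int[mu]_x (f x)%:E)%E.
Proof. by move=> intf; rewrite /Rintegral fineK//; exact: integrable_fin_num. Qed.

Lemma ge0_rintg f : measurable_fun setT f -> (forall x, 0 <= f x) ->
  (\int[mu]_x (f x)%:E < +oo)%E -> rintg f.
Proof.
move=> mf f0 fy; apply/integrableP; split; first exact/measurable_EFinP.
by under eq_integral => x _ do rewrite /= ger0_norm//.
Qed.

Lemma rintg_lty f : rintg f -> (forall x, 0 <= f x) -> (\int[mu]_x (f x)%:E < +oo)%E.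
Proof.
move=> /integrableP[_ +] f0.
by under eq_integral => x _ do rewrite /= ger0_norm//.
Qed.

Lemma Rint_cvg (f_ : nat -> T -> R) f g :
  (forall n, measurable_fun setT (f_ n)) -> rintg g ->
  (forall x, f_ ^~ x @ \oo --> f x) -> (forall n x, `|f_ n x| <= g x) ->
  rintg f /\ (fun n => \int[mu]_x f_ n x) @ \oo --> \int[mu]_x f x.
Proof.
move=> mf ig cf fg.
have mflim : measurable_fun setT f.
  by apply: (measurable_fun_cvg (h := f_)) => // x _; exact: cf.
have [] := @dominated_convergence _ _ _ mu setT measurableT
   (fun n => EFin \o f_ n) (EFin \o f) (EFin \o g) _ _ _ ig _.
- by move=> n; exact/measurable_EFinP.
- exact/measurable_EFinP.
- by apply: aeW => x _ /=; apply: cvg_EFin; [exact: nearW|exact: cf].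
- by apply: aeW => x n _ /=; rewrite lee_fin.
move=> intf _ cv; split => //.
apply: fine_cvg; rewrite fineK//.
exact: integrable_fin_num.
Qed.

Lemma Rint_ae f g : measurable_fun setT f -> measurable_fun setT g ->
  {ae mu, forall x, f x = g x} -> \int[mu]_x f x = \int[mu]_x g x.
Proof.
move=> mf mg fg; congr fine; apply: ae_eq_integral => //.
- exact/measurable_EFinP.
- exact/measurable_EFinP.
- by apply: filterS fg => x /= -> _.
Qed.

Lemma Rint_eq0_ae f : rintg f -> (forall x, 0 <= f x) -> \int[mu]_x f x = 0 ->
  {ae mu, forall x, f x = 0}.
Proof.
move=> intf f0 If.
have : (\int[mu]_x `|(f x)%:E| = 0)%E.
  under eq_integral => x _ do rewrite /= ger0_norm//.
  by rewrite -EFin_Rint// If.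
move/(ae_eq_integral_abs mu measurableT (measurable_int mu intf)).
by apply: filterS => x /(_ I) [].
Qed.

Definition cmeas u := measurable_fun setT (fun x => complex.Re (u x)) /\
  measurable_fun setT (fun x => complex.Im (u x)).
Definition cintg u := rintg (fun x => complex.Re (u x)) /\
  rintg (fun x => complex.Im (u x)).

Lemma cintg_meas u : cintg u -> cmeas u.
Proof. by move=> [/rintg_meas ? /rintg_meas ?]. Qed.

Lemma eq_cmeas u v : u =1 v -> cmeas u -> cmeas v.
Proof. by move=> /funext ->. Qed.

Lemma eq_cintg u v : u =1 v -> cintg u -> cintg v.
Proof. by move=> /funext ->. Qed.

Lemma eq_cint u v : u =1 v -> cint mu u = cint mu v.
Proof. by move=> /funext ->. Qed.

Lemma ReD (a b : C) : complex.Re (a + b) = complex.Re a + complex.Re b.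
Proof. by case: a b => ? ? []. Qed.
Lemma ImD (a b : C) : complex.Im (a + b) = complex.Im a + complex.Im b.
Proof. by case: a b => ? ? []. Qed.
Lemma ReN (a : C) : complex.Re (- a) = - complex.Re a. Proof. by case: a. Qed.
Lemma ImN (a : C) : complex.Im (- a) = - complex.Im a. Proof. by case: a. Qed.
Lemma ReM (a b : C) : complex.Re (a * b) =
  complex.Re a * complex.Re b - complex.Im a * complex.Im b.
Proof. by case: a b => ? ? []. Qed.
Lemma ImM (a b : C) : complex.Im (a * b) =
  complex.Re a * complex.Im b + complex.Im a * complex.Re b.
Proof. by case: a b => ? ? []. Qed.
Lemma Re_sum I (s : seq I) (P : pred I) (a : I -> C) :
  complex.Re (\sum_(i <- s | P i) a i) = \sum_(i <- s | P i) complex.Re (a i).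
Proof. by rewrite (big_morph _ ReD (erefl _)). Qed.
Lemma Im_sum I (s : seq I) (P : pred I) (a : I -> C) :
  complex.Im (\sum_(i <- s | P i) a i) = \sum_(i <- s | P i) complex.Im (a i).
Proof. by rewrite (big_morph _ ImD (erefl _)). Qed.

Lemma complex_eqP (a b : C) : complex.Re a = complex.Re b ->
  complex.Im a = complex.Im b -> a = b.
Proof. by case: a b => ? ? [? ?] /= -> ->. Qed.

Lemma normc_ge0 (a : C) : 0 <= Normc.normc a.
Proof. by case: a => a b; rewrite /= sqrtr_ge0. Qed.
Lemma Re_le_normc (a : C) : `|complex.Re a| <= Normc.normc a.
Proof.
case: a => a b /=; rewrite -sqrtr_sqr ler_wsqrtr// lerDl sqr_ge0//.
Qed.
Lemma Im_le_normc (a : C) : `|complex.Im a| <= Normc.normc a.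
Proof.
case: a => a b /=; rewrite -sqrtr_sqr ler_wsqrtr// lerDr sqr_ge0//.
Qed.
Lemma normcR (a : R) : Normc.normc a%:C = `|a|.
Proof. by rewrite /= expr0n addr0 sqrtr_sqr. Qed.
Lemma normc_sqr (a : C) : Normc.normc a ^+ 2 = complex.Re a ^+ 2 + complex.Im a ^+ 2.
Proof. by case: a => a b /=; rewrite sqr_sqrtr// addr_ge0// sqr_ge0. Qed.
Lemma normc_conj (a : C) : Normc.normc (conjc a) = Normc.normc a.
Proof. by case: a => a b /=; rewrite sqrrN. Qed.
Lemma mulcJ (a : C) : a * conjc a = (Normc.normc a ^+ 2)%:C.
Proof.
rewrite normc_sqr; case: a => a b /=; apply: complex_eqP; rewrite ?(ReM, ImM) /=; ring.
Qed.
Lemma normcD_le (a b : C) : Normc.normc (a + b) <= Normc.normc a + Normc.normc b.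
Proof. exact: le_normcD. Qed.
Lemma normc_le_ReIm (a : C) : Normc.normc a <= `|complex.Re a| + `|complex.Im a|.
Proof.
case: a => a b /=.
rewrite -[leRHS]ger0_norm ?addr_ge0// -sqrtr_sqr ler_wsqrtr//.
rewrite sqrrD !real_normK ?num_real// lerD2r lerDl mulrn_wge0// mulr_ge0//.
Qed.
Lemma normc_sum_le I (s : seq I) (P : pred I) (a : I -> C) :
  Normc.normc (\sum_(i <- s | P i) a i) <= \sum_(i <- s | P i) Normc.normc (a i).
Proof.
elim/big_ind2 : _ => //; first by rewrite Normc.normc0.
by move=> x x' y y' xx' yy'; rewrite (le_trans (normcD_le _ _))// lerD.
Qed.
Lemma normc_prod I (s : seq I) (P : pred I) (a : I -> C) :
  Normc.normc (\prod_(i <- s | P i) a i) = \prod_(i <- s | P i) Normc.normc (a i).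
Proof. by rewrite (big_morph _ (@Normc.normcM R) (Normc.normc1 R)). Qed.

Lemma cmeasD u v : cmeas u -> cmeas v -> cmeas (fun x => u x + v x).
Proof.
move=> [? ?] [? ?]; split.
- under eq_fun do rewrite ReD; exact: measurable_funD.
- under eq_fun do rewrite ImD; exact: measurable_funD.
Qed.
Lemma cmeasN u : cmeas u -> cmeas (fun x => - u x).
Proof.
move=> [? ?]; split.
- under eq_fun do rewrite ReN; exact: measurableT_comp.
- under eq_fun do rewrite ImN; exact: measurableT_comp.
Qed.
Lemma cmeasB u v : cmeas u -> cmeas v -> cmeas (fun x => u x - v x).
Proof. by move=> ? ?; apply: cmeasD => //; exact: cmeasN. Qed.
Lemma cmeasM u v : cmeas u -> cmeas v -> cmeas (fun x => u x * v x).
Proof.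
move=> [? ?] [? ?]; split.
- under eq_fun do rewrite ReM; apply: measurable_funB; exact: measurable_funM.
- under eq_fun do rewrite ImM; apply: measurable_funD; exact: measurable_funM.
Qed.
Lemma cmeas_conj u : cmeas u -> cmeas (fun x => conjc (u x)).
Proof.
move=> [mr mi]; split.
- by rewrite (_ : (fun _ => _) = fun x => complex.Re (u x))//; apply/funext => x; case: (u x).
- rewrite (_ : (fun _ => _) = fun x => - complex.Im (u x)); last by apply/funext => x; case: (u x).
  exact: measurableT_comp.
Qed.
Lemma cmeas_cst (c : C) : cmeas (fun=> c).
Proof. by split; exact: measurable_cst. Qed.
Lemma cmeas_real f : measurable_fun setT f -> cmeas (fun x => (f x)%:C).
Proof. by split => //; exact: measurable_cst. Qed.
Lemma cmeas_sum I (s : seq I) (P : pred I) (h : I -> T -> C) :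
  (forall i, P i -> cmeas (h i)) -> cmeas (fun x => \sum_(i <- s | P i) h i x).
Proof.
move=> ih; elim: s => [|i s IH].
  by under eq_fun do rewrite big_nil; exact: cmeas_cst.
case: (boolP (P i)) => Pi; last by under eq_fun do rewrite big_cons (negbTE Pi).
under eq_fun do rewrite big_cons Pi.
by apply: cmeasD => //; exact: ih.
Qed.
Lemma cmeas_prod I (s : seq I) (P : pred I) (h : I -> T -> C) :
  (forall i, P i -> cmeas (h i)) -> cmeas (fun x => \prod_(i <- s | P i) h i x).
Proof.
move=> ih; elim: s => [|i s IH].
  by under eq_fun do rewrite big_nil; exact: cmeas_cst.
case: (boolP (P i)) => Pi; last by under eq_fun do rewrite big_cons (negbTE Pi).
under eq_fun do rewrite big_cons Pi.
by apply: cmeasM => //; exact: ih.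
Qed.
Lemma cmeas_normc u : cmeas u -> measurable_fun setT (fun x => Normc.normc (u x)).
Proof.
move=> [mr mi]; rewrite (_ : (fun _ => _) =
  fun x => Num.sqrt (complex.Re (u x) ^+ 2 + complex.Im (u x) ^+ 2)); last first.
  by apply/funext => x; case: (u x).
have mS : measurable_fun [set: R] (@Num.sqrt R).
  by apply: continuous_measurable_fun; exact: sqrt_continuous.
apply: (measurableT_comp mS).
by apply: measurable_funD; exact: measurable_funX.
Qed.

Lemma cintg_le u g : cmeas u -> rintg g ->
  (forall x, Normc.normc (u x) <= g x) -> cintg u.
Proof.
move=> [mr mi] ig ug; split; apply: (rintg_le _ ig) => // x.
  exact: le_trans (Re_le_normc _) (ug x).
exact: le_trans (Im_le_normc _) (ug x).
Qed.

Lemma cintg_normc u : cintg u -> rintg (fun x => Normc.normc (u x)).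
Proof.
move=> iu; have [ir ii] := iu.
apply: (rintg_le (g := fun x => `|complex.Re (u x)| + `|complex.Im (u x)|)).
- exact/cmeas_normc/cintg_meas.
- by apply: rintgD; exact: rintg_norm.
- by move=> x; rewrite ger0_norm ?normc_ge0// normc_le_ReIm.
Qed.

Lemma cintg_real f : rintg f -> cintg (fun x => (f x)%:C).
Proof. by split => //; exact: rintg0. Qed.

Lemma cint_real f : cint mu (fun x => (f x)%:C) = (\int[mu]_x f x)%:C.
Proof. by rewrite /cint /= Rintegral_cst// mul0r. Qed.

Lemma cintgD u v : cintg u -> cintg v -> cintg (fun x => u x + v x).
Proof.
move=> [? ?] [? ?]; split.
- by apply: eq_rintg (fun x => esym (ReD _ _)) _; exact: rintgD.
- by apply: eq_rintg (fun x => esym (ImD _ _)) _; exact: rintgD.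
Qed.

Lemma cintgZ c u : cintg u -> cintg (fun x => c * u x).
Proof.
move=> [? ?]; split.
- by apply: eq_rintg (fun x => esym (ReM _ _)) _; apply: rintgB; exact: rintgZ.
- by apply: eq_rintg (fun x => esym (ImM _ _)) _; apply: rintgD; exact: rintgZ.
Qed.

Lemma cintgB u v : cintg u -> cintg v -> cintg (fun x => u x - v x).
Proof.
move=> iu iv; apply: cintgD => //; apply: eq_cintg (cintgZ (-1) iv) => x.
by rewrite mulN1r.
Qed.

Lemma cintg_sum I (s : seq I) (P : pred I) (h : I -> T -> C) :
  (forall i, P i -> cintg (h i)) -> cintg (fun x => \sum_(i <- s | P i) h i x).
Proof.
move=> ih; elim: s => [|i s IH].
  by under eq_fun do rewrite big_nil; split; exact: rintg0.
case: (boolP (P i)) => Pi; last by under eq_fun do rewrite big_cons (negbTE Pi).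
under eq_fun do rewrite big_cons Pi.
by apply: cintgD => //; exact: ih.
Qed.

Lemma cintg_conj u : cintg u -> cintg (fun x => conjc (u x)).
Proof.
move=> [ir ii]; split.
- by apply: eq_rintg ir => x; case: (u x).
- by apply: eq_rintg (rintgN ii) => x; case: (u x).
Qed.

Lemma cint0 : cint mu (fun=> 0) = 0.
Proof. by rewrite /cint /= Rintegral_cst// mul0r. Qed.

Lemma cintD u v : cintg u -> cintg v ->
  cint mu (fun x => u x + v x) = cint mu u + cint mu v.
Proof.
move=> [? ?] [? ?]; apply: complex_eqP; rewrite ?(ReD, ImD)/=.
- by under eq_Rintegral do rewrite ReD; rewrite RintegralD.
- by under eq_Rintegral do rewrite ImD; rewrite RintegralD.
Qed.

Lemma cintZ c u : cintg u -> cint mu (fun x => c * u x) = c * cint mu u.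
Proof.
move=> [? ?]; apply: complex_eqP; rewrite ?(ReM, ImM)/=.
- under eq_Rintegral do rewrite ReM.
  by rewrite RintegralB ?RintegralZl//; exact: rintgZ.
- under eq_Rintegral do rewrite ImM.
  by rewrite RintegralD ?RintegralZl//; exact: rintgZ.
Qed.

Lemma cintB u v : cintg u -> cintg v ->
  cint mu (fun x => u x - v x) = cint mu u - cint mu v.
Proof.
move=> iu iv; rewrite -mulN1r -cintZ// -(cintD iu (cintgZ _ iv)).
by apply: eq_cint => x; rewrite mulN1r.
Qed.

Lemma cint_sum I (s : seq I) (P : pred I) (h : I -> T -> C) :
  (forall i, P i -> cintg (h i)) ->
  cint mu (fun x => \sum_(i <- s | P i) h i x) = \sum_(i <- s | P i) cint mu (h i).
Proof.
move=> ih; elim: s => [|i s IH].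
  by rewrite big_nil; under eq_fun do rewrite big_nil; rewrite cint0.
case: (boolP (P i)) => Pi; last by rewrite big_cons (negbTE Pi); under eq_fun do rewrite big_cons (negbTE Pi).
rewrite big_cons Pi; under eq_fun do rewrite big_cons Pi.
by rewrite (cintD (ih _ Pi) (cintg_sum _ ih)) IH.
Qed.

Lemma cint_conj u : cintg u -> cint mu (fun x => conjc (u x)) = conjc (cint mu u).
Proof.
move=> [ir ii]; apply: complex_eqP => /=.
- by apply: eq_Rintegral => x _; case: (u x).
- rewrite -mulN1r -RintegralZl//; apply: eq_Rintegral => x _.
  by case: (u x) => a b /=; rewrite mulN1r.
Qed.

(* Rotating the value of the integral onto the real axis gives the constant 1. *)
Lemma normc_cint_le u g : cintg u -> rintg g ->
  (forall x, Normc.normc (u x) <= g x) -> Normc.normc (cint mu u) <= \int[mu]_x g x.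
Proof.
move=> iu ig ug; set c := cint mu u.
have [c0|c0] := eqVneq (Normc.normc c) 0.
  by rewrite c0; apply: Rintegral_ge0 => x _; exact: le_trans (normc_ge0 _) (ug x).
pose w : C := conjc c / (Normc.normc c)%:C.
have nw : Normc.normc w = 1.
  by rewrite Normc.normcM Normc.normcV normcR normc_conj ger0_norm ?normc_ge0// divff.
have -> : Normc.normc c = complex.Re (w * c).
  have : w * c = (Normc.normc c)%:C.
    rewrite /w mulrAC (mulrC _ c) mulcJ -rmorphV ?unitfE// -rmorphM/=; congr (_%:C).
    by rewrite expr2 mulfK.
  by move=> ->.
rewrite /c -cintZ// /cint /=.
apply: Rint_le => //; first exact: (cintgZ w iu).1.
move=> x; apply: le_trans (ug x); rewrite -[leRHS]mul1r -nw -Normc.normcM.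
exact: le_trans (ler_norm _) (Re_le_normc _).
Qed.

Lemma cint_ae u v : cmeas u -> cmeas v -> {ae mu, forall x, u x = v x} ->
  cint mu u = cint mu v.
Proof.
move=> [? ?] [? ?] uv; congr (fine _ +i* fine _)%C; apply: ae_eq_integral => //.
- exact/measurable_EFinP.
- exact/measurable_EFinP.
- by apply: filterS uv => x /= -> _.
- exact/measurable_EFinP.
- exact/measurable_EFinP.
- by apply: filterS uv => x /= -> _.
Qed.

End integrals.

(** * Product measures and Fubini's theorem *)

Section product_measure.
Context d1 d2 (T1 : measurableType d1) (T2 : measurableType d2) {R : realType}.
Variables (m1 : {sigma_finite_measure set T1 -> \bar R})
  (m2 : {sigma_finite_measure set T2 -> \bar R}).

Let sigma_finite_prodm : sigma_finite setT (m1 \x m2)%E.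
Proof.
have /sigma_finiteP[F [TF ndF Foo]] := sigma_finiteT m1.
have /sigma_finiteP[G [TG ndG Goo]] := sigma_finiteT m2.
exists (fun n => F n `*` G n).
  apply/seteqP; split=> // -[x y] _.
  have [i _ Fx] : (\bigcup_n F n) x by rewrite -TF.
  have [j _ Gy] : (\bigcup_n G n) y by rewrite -TG.
  exists (maxn i j) => //; split.
  - by move: (x) Fx; exact/subsetPset/ndF/leq_maxl.
  - by move: (y) Gy; exact/subsetPset/ndG/leq_maxr.
move=> k; have [mF Fk] := Foo k; have [mG Gk] := Goo k.
by split; [exact: measurableX|rewrite product_measure1E// lte_mul_pinfty// ge0_fin_numE].
Qed.

(* The library attaches no sigma-finite structure to [m1 \x m2] that unification finds. *)
Definition prodm : {sigma_finite_measure set (T1 * T2)%type -> \bar R} :=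
  HB.pack (m1 \x m2)%E
    (Measure_isSigmaFinite.Build _ _ _ (m1 \x m2)%E sigma_finite_prodm).

Lemma tonelli1 (f : T1 * T2 -> \bar R) : measurable_fun setT f ->
  (forall z, 0 <= f z)%E -> (\int[prodm]_z f z = \int[m1]_x \int[m2]_y f (x, y))%E.
Proof. by move=> mf f0; apply: fubini_tonelli1. Qed.

Lemma tonelli2 (f : T1 * T2 -> \bar R) : measurable_fun setT f ->
  (forall z, 0 <= f z)%E -> (\int[prodm]_z f z = \int[m2]_y \int[m1]_x f (x, y))%E.
Proof. by move=> mf f0; apply: fubini_tonelli2. Qed.
End product_measure.

Section fubini.
Context d1 d2 (T1 : measurableType d1) (T2 : measurableType d2) {R : realType}.
Variables (m1 : {sigma_finite_measure set T1 -> \bar R})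
  (m2 : {sigma_finite_measure set T2 -> \bar R}).
Local Notation C := R[i].

(** The partial integrals of Fubini's theorem take extended real values; being integrable they are
    finite almost everywhere, so that truncating them by [fine] changes neither integrability nor
    the integral. *)
Let ae_fine d (T : measurableType d) (m : {measure set T -> \bar R}) (F : T -> \bar R) :
  m.-integrable setT F ->
  rintg m (fun x => fine (F x)) /\ \int[m]_x fine (F x) = fine (\int[m]_x F x)%E.
Proof.
move=> iF.
have mF : measurable_fun setT (fun x => fine (F x)).
  exact: (measurableT_comp (fine_measurable measurableT) (measurable_int m iF)).
have ae : {ae m, forall x, setT x -> (fine (F x))%:E = F x}.
  by apply: filterS (integrable_ae measurableT iF) => x h Tx; rewrite fineK// h.
split; last first.
  congr fine; apply: ae_eq_integral => //; first exact/measurable_EFinP.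
  exact: measurable_int iF.
apply: (le_integrable _ _ _ iF) => //; first exact/measurable_EFinP.
by move=> x _ /=; case: (F x) => [r| |] /=; rewrite ?normr0 ?leey.
Qed.

Lemma rfubini1 (f : T1 * T2 -> R) : rintg (prodm m1 m2) f ->
  rintg m1 (fun x => \int[m2]_y f (x, y)) /\
  \int[m1]_x (\int[m2]_y f (x, y)) = \int[(prodm m1 m2)]_z f z.
Proof.
move=> intf; have [i1 e1] := ae_fine (integrable_fubini_F intf).
by split => //; apply: etrans e1 _; rewrite integral12_prod_meas1.
Qed.

Let integrable_fubini_G' (f : T1 * T2 -> \bar R) : (prodm m1 m2).-integrable setT f ->
  m2.-integrable setT (fubini_G m1 f).
Proof.
move=> intf; have mf : measurable_fun setT f := measurable_int _ intf.
apply/integrableP; split; first exact: (measurable_fubini_G intf).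
apply: (@le_lt_trans _ _ (\int[m2]_y \int[m1]_x `|f (x, y)|)%E); last exact/integrable21ltyP.
apply: ge0_le_integral => //.
- by apply: measurableT_comp => //; exact: (measurable_fubini_G intf).
- apply: (measurable_fun_fubini_tonelli_G (fun z => `|f z|%E)) => //.
  exact: measurableT_comp.
- move=> y _; apply: le_abse_integral => //.
  by apply: (measurableT_comp mf); exact: pair2_measurable.
Qed.

Lemma rfubini2 (f : T1 * T2 -> R) : rintg (prodm m1 m2) f ->
  rintg m2 (fun y => \int[m1]_x f (x, y)) /\
  \int[m2]_y (\int[m1]_x f (x, y)) = \int[(prodm m1 m2)]_z f z.
Proof.
move=> intf; have [i1 e1] := ae_fine (integrable_fubini_G' intf).
by split => //; apply: etrans e1 _; rewrite integral21_prod_meas1.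
Qed.

Lemma cfubini1 (f : T1 * T2 -> C) : cintg (prodm m1 m2) f ->
  cintg m1 (fun x => cint m2 (fun y => f (x, y))) /\
  cint m1 (fun x => cint m2 (fun y => f (x, y))) = cint (prodm m1 m2) f.
Proof.
move=> [ir ii]; have [? er] := rfubini1 ir; have [? ei] := rfubini1 ii.
by split => //; rewrite /cint /= er ei.
Qed.

Lemma cfubini2 (f : T1 * T2 -> C) : cintg (prodm m1 m2) f ->
  cintg m2 (fun y => cint m1 (fun x => f (x, y))) /\
  cint m2 (fun y => cint m1 (fun x => f (x, y))) = cint (prodm m1 m2) f.
Proof.
move=> [ir ii]; have [? er] := rfubini2 ir; have [? ei] := rfubini2 ii.
by split => //; rewrite /cint /= er ei.
Qed.

Lemma cfubini_swap (f : T1 * T2 -> C) : cintg (prodm m1 m2) f ->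
  cint m1 (fun x => cint m2 (fun y => f (x, y))) =
  cint m2 (fun y => cint m1 (fun x => f (x, y))).
Proof. by move=> intf; rewrite (cfubini1 intf).2 (cfubini2 intf).2. Qed.

(** Tonelli's criterion, in the form used to check joint integrability: only a majorant [g] of the
    inner integrals has to be found. *)
Lemma rintg_fubini (f : T1 * T2 -> R) (g : T1 -> R) :
  measurable_fun setT f -> (forall x, rintg m2 (fun y => f (x, y))) ->
  rintg m1 g -> (forall x, \int[m2]_y `|f (x, y)| <= g x) ->
  rintg (prodm m1 m2) f.
Proof.
move=> mf if2 ig fg; apply/integrable12ltyP; first exact/measurable_EFinP.
apply: (@le_lt_trans _ _ (\int[m1]_x `|g x|%:E)%E); last first.
  by apply: rintg_lty => // ; exact: rintg_norm.
apply: ge0_le_integral => //.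
- by move=> x _; apply: integral_ge0 => y _; rewrite abse_ge0.
- apply: (measurable_fun_fubini_tonelli_F (fun z => `|(f z)%:E|%E)) => //.
  by apply: measurableT_comp => //; exact/measurable_EFinP.
- apply/measurable_EFinP/measurableT_comp => //.
  exact: rintg_meas ig.
- move=> x _; rewrite -(EFin_Rint (rintg_norm (if2 x))) lee_fin.
  exact: le_trans (fg x) (ler_norm _).
Qed.

Lemma rintgX (g : T1 -> R) (h : T2 -> R) : rintg m1 g -> rintg m2 h ->
  rintg (prodm m1 m2) (fun z => g z.1 * h z.2).
Proof.
move=> ig ih; apply: (rintg_fubini (g := fun x => (\int[m2]_y `|h y|) * `|g x|)).
- apply: measurable_funM.
    exact: measurableT_comp (rintg_meas ig) measurable_fst.
  exact: measurableT_comp (rintg_meas ih) measurable_snd.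
- by move=> x /=; exact: rintgZ.
- exact: (rintgZ _ (rintg_norm ig)).
- move=> x /=; rewrite mulrC -RintegralZl//; last exact: rintg_norm.
  apply: Rint_le; [|exact: (rintgZ _ (rintg_norm ih))|by move=> y; rewrite normrM].
  exact: (rintg_norm (rintgZ (g x) ih)).
Qed.

Lemma cmeas_comp d3 (T3 : measurableType d3) (f : T1 -> C) (phi : T3 -> T1) :
  cmeas f -> measurable_fun setT phi -> cmeas (fun x => f (phi x)).
Proof.
by move=> [? ?] mphi; split; [apply: (measurableT_comp (f := fun x => complex.Re (f x)))
  |apply: (measurableT_comp (f := fun x => complex.Im (f x)))].
Qed.
End fubini.

Section fubini_prod.
Context d1 d2 (T1 : measurableType d1) (T2 : measurableType d2) {R : realType}.
Variables (m1 : {sigma_finite_measure set T1 -> \bar R})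
  (m2 : {sigma_finite_measure set T2 -> \bar R}).
Local Notation C := R[i].

Lemma cintgX (u : T1 -> C) (v : T2 -> C) : cintg m1 u -> cintg m2 v ->
  cintg (prodm m1 m2) (fun z => u z.1 * v z.2).
Proof.
move=> iu iv; apply: (cintg_le _ (rintgX (cintg_normc iu) (cintg_normc iv))).
  by apply: cmeasM; [exact: (cmeas_comp (cintg_meas iu) measurable_fst)
    |exact: (cmeas_comp (cintg_meas iv) measurable_snd)].
by move=> z; rewrite Normc.normcM.
Qed.

Lemma cintX (u : T1 -> C) (v : T2 -> C) : cintg m1 u -> cintg m2 v ->
  cint (prodm m1 m2) (fun z => u z.1 * v z.2) = cint m1 u * cint m2 v.
Proof.
move=> iu iv; rewrite -(cfubini1 (cintgX iu iv)).2 /=.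
under eq_fun do rewrite cintZ//.
by rewrite mulrC -cintZ//; apply: eq_cint => x; rewrite mulrC.
Qed.

Lemma cintg_fubini (f : T1 * T2 -> C) (g : T1 -> R) (h : T1 * T2 -> R) :
  cmeas f -> measurable_fun setT h -> (forall z, Normc.normc (f z) <= h z) ->
  (forall x, rintg m2 (fun y => h (x, y))) ->
  rintg m1 g -> (forall x, \int[m2]_y h (x, y) <= g x) ->
  cintg (prodm m1 m2) f.
Proof.
move=> mf mh fh ih ig hg; apply: (cintg_le (g := h)) => //.
apply: (rintg_fubini (g := g)) => // x.
under eq_Rintegral do rewrite ger0_norm ?(le_trans (normc_ge0 _) (fh _))//.
exact: hg.
Qed.
End fubini_prod.

(** * Measure-preserving maps *)

Section measure_preserving.
Context {R : realType}.
Local Notation C := R[i].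

Definition mpres d1 d2 (T1 : measurableType d1) (T2 : measurableType d2)
  (m1 : {measure set T1 -> \bar R}) (m2 : {measure set T2 -> \bar R}) (phi : T1 -> T2) :=
  measurable_fun setT phi /\ forall A, measurable A -> m1 (phi @^-1` A) = m2 A.

Section one.
Context d1 d2 (T1 : measurableType d1) (T2 : measurableType d2)
  (m1 : {measure set T1 -> \bar R}) (m2 : {measure set T2 -> \bar R}) (phi : T1 -> T2).
Hypothesis mp : mpres m1 m2 phi.
Let mphi := mp.1.

Lemma mpres_ge0 (f : T2 -> \bar R) : measurable_fun setT f -> (forall y, 0 <= f y)%E ->
  (\int[m2]_y f y = \int[m1]_x f (phi x))%E.
Proof.
move=> mf f0; transitivity (\int[pushforward m1 phi]_y f y)%E; last first.
  by rewrite ge0_integral_pushforward.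
by apply: eq_measure_integral => A mA _ /=; rewrite /pushforward mp.2.
Qed.

Lemma mpres_integrable (f : T2 -> \bar R) :
  m2.-integrable setT f -> m1.-integrable setT (f \o phi).
Proof.
move=> /integrableP[mf fy]; apply/integrableP; split; first exact: measurableT_comp.
rewrite (mpres_ge0 (f := fun y => `|f y|%E)) in fy => //.
exact: measurableT_comp.
Qed.

Lemma mpres_rintg (f : T2 -> R) : rintg m2 f -> rintg m1 (fun x => f (phi x)).
Proof. exact: mpres_integrable. Qed.

Lemma mpres_Rint (f : T2 -> R) : rintg m2 f ->
  \int[m2]_y f y = \int[m1]_x f (phi x).
Proof.
move=> intf; congr fine.
transitivity (\int[pushforward m1 phi]_y (f y)%:E)%E; last first.
  by rewrite (integral_pushforward mphi (measurable_int _ intf) (mpres_integrable intf)).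
by apply: eq_measure_integral => A mA _ /=; rewrite /pushforward mp.2.
Qed.

Lemma mpres_cintg (f : T2 -> C) : cintg m2 f -> cintg m1 (fun x => f (phi x)).
Proof. by move=> [/mpres_rintg ? /mpres_rintg ?]. Qed.

Lemma mpres_cint (f : T2 -> C) : cintg m2 f ->
  cint m2 f = cint m1 (fun x => f (phi x)).
Proof. by move=> [/mpres_Rint er /mpres_Rint ei]; rewrite /cint er ei. Qed.
End one.

Lemma mpres_comp d1 d2 d3 (T1 : measurableType d1) (T2 : measurableType d2)
  (T3 : measurableType d3)
  (m1 : {measure set T1 -> \bar R}) (m2 : {measure set T2 -> \bar R})
  (m3 : {measure set T3 -> \bar R}) (phi : T1 -> T2) (psi : T2 -> T3) :
  mpres m1 m2 phi -> mpres m2 m3 psi -> mpres m1 m3 (psi \o phi).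
Proof.
move=> [mphi p1] [mpsi p2]; split; first exact: measurableT_comp.
move=> A mA; rewrite comp_preimage p1 ?p2//.
by rewrite -[X in measurable X]setTI; exact: mpsi.
Qed.

Lemma mpres_of_ge0 d1 d2 (T1 : measurableType d1) (T2 : measurableType d2)
  (m1 : {measure set T1 -> \bar R}) (m2 : {measure set T2 -> \bar R}) (phi : T1 -> T2) :
  measurable_fun setT phi ->
  (forall f : T2 -> \bar R, measurable_fun setT f -> (forall y, 0 <= f y)%E ->
    (\int[m1]_x f (phi x) = \int[m2]_y f y)%E) -> mpres m1 m2 phi.
Proof.
move=> mphi H; split => // A mA.
have := H (fun y => (\1_A y)%:E).
have mpA : measurable (phi @^-1` A) by rewrite -[X in measurable X]setTI; exact: mphi.
rewrite !integral_indic// !setIT; apply; last by move=> y; rewrite lee_fin.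
by apply/measurable_EFinP; exact: measurable_indic.
Qed.

Lemma mpres_inv d1 d2 (T1 : measurableType d1) (T2 : measurableType d2)
  (m1 : {measure set T1 -> \bar R}) (m2 : {measure set T2 -> \bar R}) (phi : T1 -> T2)
  (psi : T2 -> T1) : mpres m1 m2 phi -> measurable_fun setT psi -> cancel phi psi ->
  mpres m2 m1 psi.
Proof.
move=> [mphi p] mpsi K; split => // A mA.
have mpA : measurable (psi @^-1` A) by rewrite -[X in measurable X]setTI; exact: mpsi.
by rewrite -p// -comp_preimage (_ : _ \o _ = id) ?preimage_id//; apply/funext => x /=.
Qed.

Section products.
Context d1 d2 (T1 : measurableType d1) (T2 : measurableType d2).
Variables (m1 : {sigma_finite_measure set T1 -> \bar R})
  (m2 : {sigma_finite_measure set T2 -> \bar R}).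

(** Tonelli, integrating the moved coordinate first: for each value of the other one the inner
    integral is unchanged. *)
Lemma mpres_shear2 (phi : T1 -> T2 -> T2) :
  measurable_fun setT (fun z => phi z.1 z.2) -> (forall x, mpres m2 m2 (phi x)) ->
  mpres (prodm m1 m2) (prodm m1 m2) (fun z => (z.1, phi z.1 z.2)).
Proof.
move=> mphi p; have ms : measurable_fun setT (fun z => (z.1, phi z.1 z.2)).
  by apply/measurable_fun_pairP; split; [exact: measurable_fst|exact: mphi].
apply: mpres_of_ge0 => // f mf f0.
rewrite tonelli1//; last exact: measurableT_comp.
rewrite tonelli1//; apply: eq_integral => x _.
rewrite /= -(mpres_ge0 (p x) (f := fun y => f (x, y)))//.
by apply: (measurableT_comp mf); exact: pair1_measurable.
Qed.

Lemma mpres_shear1 (phi : T2 -> T1 -> T1) :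
  measurable_fun setT (fun z => phi z.2 z.1) -> (forall x, mpres m1 m1 (phi x)) ->
  mpres (prodm m1 m2) (prodm m1 m2) (fun z => (phi z.2 z.1, z.2)).
Proof.
move=> mphi p; have ms : measurable_fun setT (fun z => (phi z.2 z.1, z.2)).
  by apply/measurable_fun_pairP; split; [exact: mphi|exact: measurable_snd].
apply: mpres_of_ge0 => // f mf f0.
rewrite tonelli2//; last exact: measurableT_comp.
rewrite tonelli2//; apply: eq_integral => y _.
rewrite /= -(mpres_ge0 (p y) (f := fun x => f (x, y)))//.
by apply: (measurableT_comp mf); exact: pair2_measurable.
Qed.

Lemma mpres_shear2g d3 (T3 : measurableType d3)
  (m3 : {sigma_finite_measure set T3 -> \bar R}) (phi : T2 -> T3) :
  mpres m2 m3 phi -> mpres (prodm m1 m2) (prodm m1 m3) (fun z => (z.1, phi z.2)).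
Proof.
move=> p; have ms : measurable_fun setT (fun z : T1 * T2 => (z.1, phi z.2)).
  by apply/measurable_fun_pairP; split;
    [exact: measurable_fst|exact: (measurableT_comp p.1 measurable_snd)].
apply: mpres_of_ge0 => // f mf f0.
rewrite tonelli1//; last exact: measurableT_comp.
rewrite tonelli1//; apply: eq_integral => x _.
rewrite /= -(mpres_ge0 p (f := fun y => f (x, y)))//.
by apply: (measurableT_comp mf); exact: pair1_measurable.
Qed.

Lemma mpres_shear1g d3 (T3 : measurableType d3)
  (m3 : {sigma_finite_measure set T3 -> \bar R}) (phi : T1 -> T3) :
  mpres m1 m3 phi -> mpres (prodm m1 m2) (prodm m3 m2) (fun z => (phi z.1, z.2)).
Proof.
move=> p; have ms : measurable_fun setT (fun z : T1 * T2 => (phi z.1, z.2)).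
  by apply/measurable_fun_pairP; split;
    [exact: (measurableT_comp p.1 measurable_fst)|exact: measurable_snd].
apply: mpres_of_ge0 => // f mf f0.
rewrite tonelli2//; last exact: measurableT_comp.
rewrite tonelli2//; apply: eq_integral => x _.
rewrite /= -(mpres_ge0 p (f := fun y => f (y, x)))//.
by apply: (measurableT_comp mf); exact: pair2_measurable.
Qed.

Lemma mpres_assoc d3 (T3 : measurableType d3)
  (m3 : {sigma_finite_measure set T3 -> \bar R}) :
  mpres (prodm (prodm m1 m2) m3) (prodm m1 (prodm m2 m3)) (fun z => (z.1.1, (z.1.2, z.2))).
Proof.
have ms : measurable_fun setT (fun z : T1 * T2 * T3 => (z.1.1, (z.1.2, z.2))).
  apply/measurable_fun_pairP; split; first exact: (measurableT_comp measurable_fst measurable_fst).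
  apply/measurable_fun_pairP; split; last exact: measurable_snd.
  exact: (measurableT_comp measurable_snd measurable_fst).
apply: mpres_of_ge0 => // f mf f0.
rewrite tonelli1//; last exact: measurableT_comp.
rewrite tonelli1//; last first.
- by move=> x; apply: integral_ge0.
- apply: (measurable_fun_fubini_tonelli_F (fun z => f (z.1.1, (z.1.2, z.2)))) => //.
  exact: measurableT_comp.
rewrite tonelli1//; apply: eq_integral => x _.
rewrite /= tonelli1//.
by apply: (measurableT_comp mf); exact: pair1_measurable.
Qed.
End products.
End measure_preserving.

(** * Measurability of vector operations *)

Section row_measurability.
Context {R : realType} d (T : measurableType d).
Implicit Types n m : nat.

Lemma meas_rowD n (f g : T -> 'rV[R]_n) : measurable_fun setT f -> measurable_fun setT g ->
  measurable_fun setT (fun x => f x + g x).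
Proof.
move=> mf mg; apply: measurable_rowP => i; under eq_fun do rewrite mxE.
by apply: measurable_funD; apply: measurableT_comp (measurable_coord i) _.
Qed.

Lemma meas_rowZ n (c : R) (f : T -> 'rV[R]_n) : measurable_fun setT f ->
  measurable_fun setT (fun x => c *: f x).
Proof.
move=> mf; apply: measurable_rowP => i; under eq_fun do rewrite mxE.
by apply: measurable_funM => //; apply: measurableT_comp (measurable_coord i) _.
Qed.

Lemma meas_rowN n (f : T -> 'rV[R]_n) : measurable_fun setT f ->
  measurable_fun setT (fun x => - f x).
Proof. by move=> mf; under eq_fun do rewrite -scaleN1r; exact: meas_rowZ. Qed.

Lemma meas_rowB n (f g : T -> 'rV[R]_n) : measurable_fun setT f -> measurable_fun setT g ->
  measurable_fun setT (fun x => f x - g x).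
Proof. by move=> mf mg; apply: meas_rowD => //; exact: meas_rowN. Qed.

Lemma meas_row_mx m n (f : T -> 'rV[R]_m) (g : T -> 'rV[R]_n) :
  measurable_fun setT f -> measurable_fun setT g ->
  measurable_fun setT (fun x => row_mx (f x) (g x)).
Proof.
move=> mf mg; apply: measurable_rowP => i; case: (splitP i) => j ij.
- rewrite (_ : (fun _ => _) = fun t => f t ord0 j).
    exact: measurableT_comp (measurable_coord j) _.
  apply/funext => t; rewrite -(row_mxEl (f t) (g t)); congr (_ _ _); exact: val_inj.
- rewrite (_ : (fun _ => _) = fun t => g t ord0 j).
    exact: measurableT_comp (measurable_coord j) _.
  apply/funext => t; rewrite -(row_mxEr (f t) (g t)); congr (_ _ _); exact: val_inj.
Qed.

Lemma meas_mulmx m n (Q : 'M[R]_(m, n)) (f : T -> 'rV[R]_m) : measurable_fun setT f ->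
  measurable_fun setT (fun x => f x *m Q).
Proof.
move=> mf; apply: measurable_rowP => i; under eq_fun do rewrite mxE.
apply: measurable_sum => k; apply: measurable_funM => //.
exact: measurableT_comp (measurable_coord k) _.
Qed.

Lemma meas_dotp n (f g : T -> 'rV[R]_n) : measurable_fun setT f -> measurable_fun setT g ->
  measurable_fun setT (fun x => dotp (f x) (g x)).
Proof.
move=> mf mg; apply: measurable_sum => k.
by apply: measurable_funM; apply: measurableT_comp (measurable_coord k) _.
Qed.

Lemma meas_enorm n (f : T -> 'rV[R]_n) : measurable_fun setT f ->
  measurable_fun setT (fun x => enorm (f x)).
Proof.
move=> mf; have mS : measurable_fun [set: R] (@Num.sqrt R).
  by apply: continuous_measurable_fun; exact: sqrt_continuous.
by apply: (measurableT_comp mS); exact: meas_dotp.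
Qed.

End row_measurability.

Section row_continuity.
Context {R : realType} (n : nat).

(* A continuous function is the pointwise limit of its compositions with the
   roundings to the grids of mesh 1/(k+1), which take countably many values. *)
Lemma continuous_row_measurable (f : 'rV[R]_n -> R) : continuous f ->
  measurable_fun setT f.
Proof.
move=> cf; pose fl k (x : 'rV[R]_n) : 'rV[int]_n :=
  \row_i Num.floor (k.+1%:R * x ord0 i).
pose gr k (q : 'rV[int]_n) : 'rV[R]_n := \row_i (k.+1%:R^-1 * (q ord0 i)%:~R).
apply: (measurable_fun_cvg (h := fun k x => f (gr k (fl k x)))); last first.
  move=> x _; apply: continuous_cvg; first exact: cf.
  apply/cvg_ballP => e e0; near=> k.
  split => // i j; rewrite !mxE (ord1 i).
  have k0 : 0 < k.+1%:R :> R by rewrite ltr0n.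
  have [h1 h2] : (Num.floor (k.+1%:R * x 0 j))%:~R <= k.+1%:R * x 0 j
     /\ k.+1%:R * x 0 j < (Num.floor (k.+1%:R * x 0 j))%:~R + 1.
    by split; [exact: floor_le|have := floorD1_gt (k.+1%:R * x 0 j); rewrite intrD].
  apply: (@le_lt_trans _ _ k.+1%:R^-1); last first.
    by near: k; exact: near_infty_natSinv_lt (PosNum e0).
  rewrite -(ler_pM2l k0) divff ?gt_eqF// -[X in X * _]gtr0_norm// -normrM mulrBr.
  rewrite mulrA divff ?gt_eqF// mul1r ger0_norm ?subr_ge0//.
  by rewrite lerBlDl ltW.
(* The rounded function is constant on each of countably many grid cells, and a cell is a finite
   intersection of preimages of half-open intervals. *)
move=> k _ Y mY; rewrite setTI.
have -> : (fun x => f (gr k (fl k x))) @^-1` Y =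
    \bigcup_q ([set x | fl k x = q] `&` [set x | Y (f (gr k q))]).
  apply/seteqP; split => x /=; first by move=> ?; exists (fl k x).
  by move=> [q] _ [/= <-].
apply: countable_bigcupT_measurable; first exact: countableP.
move=> q; have [Yq|Yq] := pselect (Y (f (gr k q))); last first.
  rewrite (_ : _ `&` _ = set0); first exact: measurable0.
  by apply/seteqP; split => x //= [].
rewrite (_ : _ `&` _ = \bigcap_(i in [set: 'I_n])
   ((fun x : 'rV[R]_n => k.+1%:R * x ord0 i) @^-1`
     `[(q ord0 i)%:~R, (q ord0 i + 1)%:~R[%classic)).
  apply: fin_bigcap_measurable => // i _.
  rewrite -[X in measurable X]setTI.
  by apply: measurable_funM => //; exact: measurable_coord.
apply/seteqP; split => x /=.
  by move=> [<- _] i _ /=; rewrite mxE in_itv/= floor_itv.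
move=> H; split => //; apply/rowP => i; rewrite mxE.
by apply: floor_def; have := H i I; rewrite /= in_itv.
Unshelve. all: by end_near. Qed.

End row_continuity.

(** * Invariance of Lebesgue measure *)

Section lebesgue_measure_invariance.
Context {R : realType}.
Local Notation lam := (@lebesgue_measure R).

(** The translated measure agrees with Lebesgue measure on half-open intervals, which characterize
    it. *)
Lemma lebesgue_addr (a : R) :
  mpres lam lam (fun x => (x : R) + a : measurableTypeR R).
Proof.
have mf : measurable_fun setT (fun x : measurableTypeR R => (x : R) + a : measurableTypeR R).
  exact: measurable_funD.
split => // A mA; apply/esym.
pose m := measure_function_pushforward__canonical__measure_function_Measure lam mf.
apply: (@lebesgue_measure_unique R m) => // _ [[u v] _ <-] /=.
rewrite /pushforward (_ : _ @^-1` _ = `]u - a, v - a]%classic); last first.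
  by apply/seteqP; split => x /=; rewrite !in_itv/= ltrBlDr lerBrDr.
by rewrite !lebesgue_measure_itv/= !lte_fin ltrD2r -!EFinB opprD addrACA subrr addr0.
Qed.

Lemma lebesgue_opp : mpres lam lam (fun x => - (x : R) : measurableTypeR R).
Proof. by split; [exact: oppr_measurable|exact: lebesgue_measureN]. Qed.

End lebesgue_measure_invariance.

Section lebesgue_row_invariance.
Context {R : realType}.
Local Notation lam := (@lebesgue_measure R).
Local Notation lr n := (@lebesgue_row R n).

Lemma mpres_cons n : mpres (prodm lam (lr n)) (lr n.+1) (@cons_row R n).
Proof. by split; [exact: measurable_cons_row|]. Qed.

Lemma mpres_uncons n : mpres (lr n.+1) (prodm lam (lr n)) (@uncons_row R n).
Proof.
apply: mpres_inv (mpres_cons n) (@measurable_uncons_row R n) _; exact: cons_rowK.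
Qed.

Lemma mpres_id d (T : measurableType d) (m : {measure set T -> \bar R}) : mpres m m id.
Proof. by split => //; exact: measurable_id. Qed.

Lemma row0E (x y : 'rV[R]_0) : x = y.
Proof. by apply/rowP => -[]. Qed.

Lemma mpres_coordinatewise n (phi : 'I_n -> R -> R) :
  (forall i, mpres lam lam (phi i : measurableTypeR R -> measurableTypeR R)) ->
  mpres (lr n) (lr n) (fun x => \row_i phi i (x ord0 i)).
Proof.
elim: n phi => [|n IH] phi mp.
  by rewrite (_ : (fun _ => _) = id); [exact: mpres_id|apply/funext => x; exact: row0E].
pose psi (z : measurableTypeR R * 'rV[R]_n) : measurableTypeR R * 'rV[R]_n :=
  (phi ord0 z.1, \row_i phi (lift ord0 i) (z.2 ord0 i)).
have mpsi : mpres (prodm lam (lr n)) (prodm lam (lr n)) psi.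
  have h1 := mpres_shear1g (lr n) (mp ord0).
  have h2 := mpres_shear2g lam (IH _ (fun i => mp (lift ord0 i))).
  exact: mpres_comp h1 h2.
have := mpres_comp (mpres_comp (mpres_uncons n) mpsi) (mpres_cons n).
congr (mpres _ _ _); apply/funext => x /=; apply/rowP => i.
rewrite /cons_row /psi /uncons_row /= !mxE; case: splitP => j ij.
  rewrite !mxE; congr (phi _ _); first by apply: val_inj; rewrite /= ij ord1.
  by congr (x _ _); apply: val_inj; rewrite /= ij ord1.
have -> : i = lift ord0 j by apply: val_inj; rewrite /= ij.
by rewrite !mxE; congr (phi _ (x _ _)); exact: val_inj.
Qed.

Lemma mpres_rowD n (a : 'rV[R]_n) : mpres (lr n) (lr n) (fun x => x + a).
Proof.
have := mpres_coordinatewise (fun i => lebesgue_addr (a ord0 i)).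
by congr (mpres _ _ _); apply/funext => x; apply/rowP => i; rewrite !mxE.
Qed.

Lemma mpres_rowN n : mpres (lr n) (lr n) (fun x => - x).
Proof.
have := mpres_coordinatewise (fun i : 'I_n => @lebesgue_opp R).
by congr (mpres _ _ _); apply/funext => x; apply/rowP => i; rewrite !mxE.
Qed.

Lemma mpres_rowB n (a : 'rV[R]_n) : mpres (lr n) (lr n) (fun x => a - x).
Proof.
have := mpres_comp (mpres_rowN n) (mpres_rowD a).
by congr (mpres _ _ _); apply/funext => x /=; rewrite addrC.
Qed.

(** By induction on m: the point mass of dimension 0 integrates out, and the step splits off the
    first coordinate, reassociates the product and glues the coordinate back. *)
Lemma mpres_row_mx m n : mpres (prodm (lr m) (lr n)) (lr (m + n)%N)
  (fun z => row_mx z.1 z.2).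
Proof.
elim: m => [|m IH].
  apply: mpres_of_ge0 => [|f mf f0].
    by apply: meas_row_mx; [exact: measurable_fst|exact: measurable_snd].
  rewrite tonelli1//; last first.
    apply: (measurableT_comp mf).
    by apply: meas_row_mx; [exact: measurable_fst|exact: measurable_snd].
  rewrite integral_dirac//=; last first.
    apply: (measurable_fun_fubini_tonelli_F (fun z => f (row_mx z.1 z.2))) => //.
    apply: (measurableT_comp mf).
    by apply: meas_row_mx; [exact: measurable_fst|exact: measurable_snd].
  rewrite diracT mul1e; apply: eq_integral => y _; congr f.
  apply/rowP => i; rewrite !mxE; case: splitP => [[]//|j ij].
  by congr (y _ _); apply: val_inj.
have h1 := mpres_shear1g (lr n) (mpres_uncons m).
have h2 := mpres_assoc lam (lr m) (lr n).
have h3 := mpres_shear2g lam IH.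
have := mpres_comp (mpres_comp (mpres_comp h1 h2) h3) (mpres_cons (m + n)%N).
congr (mpres _ _ _); apply/funext => -[x y] /=; apply/rowP => i.
have ltv := ltn_ord i.
rewrite /cons_row /uncons_row /= !mxE; case: splitP => j ij; rewrite !mxE; case: splitP => k ik.
all: have {}ij := etrans (erefl (nat_of_ord i)) ij; try (have {}ik := etrans (erefl (nat_of_ord i)) ik).
all: rewrite ?mxE; try (case: splitP => l jl; rewrite ?mxE; have {}jl := etrans (erefl (nat_of_ord i)) jl).
all: try (by congr (x _ _); apply: val_inj => /=; move: (ltn_ord j) ltv; lia).
all: try (by congr (y _ _); apply: val_inj => /=; move: (ltn_ord j) ltv; lia).
all: try (exfalso; move: (ltn_ord j) (ltn_ord k) ltv; lia).
all: try (exfalso; move: (ltn_ord l) (ltn_ord j) (ltn_ord k) ltv; lia).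
Qed.

End lebesgue_row_invariance.

Section row_integrals.
Context {R : realType}.
Local Notation C := R[i].
Local Notation lam := (@lebesgue_measure R).
Local Notation lr n := (@lebesgue_row R n).

(** [lebesgue_row 0] is a point mass on the only vector, so that every function is integrable: the
    base case of products over coordinates. *)
Lemma cint_row0 (f : 'rV[R]_0 -> C) : cintg (lr 0) f /\ cint (lr 0) f = f 0.
Proof.
have l1 : lr 0 setT = 1%E by exact: diracT.
have [i1 e1] : rintg (lr 0) (fun x => complex.Re (f x)) /\
    \int[lr 0]_x complex.Re (f x) = complex.Re (f 0).
  have -> : (fun x => complex.Re (f x)) = cst (complex.Re (f 0)).
    by apply/funext => x; rewrite (row0E x 0).
  split; last by rewrite Rintegral_cst// [X in fine X]l1 mulr1.
  by apply: measurable_bounded_integrable => //; rewrite ?l1 ?ltry//; exact: bounded_cst.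
have [i2 e2] : rintg (lr 0) (fun x => complex.Im (f x)) /\
    \int[lr 0]_x complex.Im (f x) = complex.Im (f 0).
  have -> : (fun x => complex.Im (f x)) = cst (complex.Im (f 0)).
    by apply/funext => x; rewrite (row0E x 0).
  split; last by rewrite Rintegral_cst// [X in fine X]l1 mulr1.
  by apply: measurable_bounded_integrable => //; rewrite ?l1 ?ltry//; exact: bounded_cst.
by split => //; rewrite /cint e1 e2; case: (f 0).
Qed.

Lemma cons_row_ord0 n (z : measurableTypeR R * 'rV[R]_n) : cons_row z ord0 ord0 = z.1.
Proof. by rewrite -[z in RHS]cons_rowK. Qed.

Lemma cons_row_lift n (z : measurableTypeR R * 'rV[R]_n) (i : 'I_n) :
  cons_row z ord0 (lift ord0 i) = z.2 ord0 i.
Proof.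
by rewrite -[z in RHS]cons_rowK /uncons_row /= [RHS]mxE; congr (fun_of_matrix _ _ _); exact: val_inj.
Qed.

Lemma cint_row_prod n (f : 'I_n -> R -> C) :
  (forall i, @cintg _ (measurableTypeR R) R lam (f i)) ->
  cintg (lr n) (fun x => \prod_(i < n) f i (x ord0 i)) /\
  cint (lr n) (fun x => \prod_(i < n) f i (x ord0 i)) = \prod_(i < n) cint lam (f i).
Proof.
elim: n f => [|n IH] f intf.
  have [? ->] := cint_row0 (fun x => \prod_(i < 0) f i (x ord0 i)).
  by split => //; rewrite !big_ord0.
have [iT eT] := IH _ (fun i => intf (lift ord0 i)).
have eqf (z : measurableTypeR R * 'rV[R]_n) :
    \prod_(i < n.+1) f i (cons_row z ord0 i) =
    f ord0 z.1 * \prod_(i < n) f (lift ord0 i) (z.2 ord0 i).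
  rewrite big_ord_recl cons_row_ord0; congr (_ * _).
  by apply: eq_bigr => i _; rewrite cons_row_lift.
have iX := cintgX (intf ord0) iT.
have ic : cintg (lr n.+1) (fun x => \prod_(i < n.+1) f i (x ord0 i)).
  have := mpres_cintg (mpres_uncons n) iX.
  by apply: eq_cintg => x; rewrite -eqf uncons_rowK.
split => //; rewrite (mpres_cint (mpres_cons n) ic) (eq_cint _ eqf) big_ord_recl -eT.
exact: cintX.
Qed.

Lemma rint_row_prod n (f : 'I_n -> R -> R) :
  (forall i, @rintg _ (measurableTypeR R) R lam (f i)) ->
  rintg (lr n) (fun x => \prod_(i < n) f i (x ord0 i)) /\
  \int[lr n]_x \prod_(i < n) f i (x ord0 i) = \prod_(i < n) \int[lam]_t f i t.
Proof.
move=> intf.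
have E (x : 'rV[R]_n) : \prod_(i < n) (f i (x ord0 i))%:C = (\prod_(i < n) f i (x ord0 i))%:C :> C.
  by rewrite rmorph_prod.
have [i1 e1] := cint_row_prod (fun i => cintg_real (intf i)).
have {}i1 := eq_cintg E i1; split; first exact: i1.1.
move: e1; rewrite (eq_cint _ E) cint_real; under eq_bigr do rewrite cint_real.
by rewrite -rmorph_prod => -[].
Qed.

Lemma mpres_row_split m n : mpres (lr (m + n)%N) (prodm (lr m) (lr n))
  (fun z => (lsubmx z, rsubmx z)).
Proof.
apply: (mpres_inv (mpres_row_mx m n)).
  apply/measurable_fun_pairP; split; apply: measurable_rowP => i.
  - rewrite (_ : (fun _ => _) = fun z : 'rV[R]_(m + n) => z ord0 (lshift n i)).
      exact: measurable_coord.
    by apply/funext => z; rewrite /= mxE.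
  - rewrite (_ : (fun _ => _) = fun z : 'rV[R]_(m + n) => z ord0 (rshift m i)).
      exact: measurable_coord.
    by apply/funext => z; rewrite /= mxE.
by move=> [x y] /=; rewrite row_mxKl row_mxKr.
Qed.

(** The passage from midpoint and difference to the two points, used for Weyl kernels, is a
    composition of two shears: (q, p) goes to (q + p/2, p), and (x, p) to (x, x - p). *)
Lemma mpres_midpoint n :
  mpres (prodm (lr n) (lr n)) (prodm (lr n) (lr n))
    (fun z => (z.1 + 2^-1 *: z.2, z.1 - 2^-1 *: z.2)).
Proof.
have m1 : measurable_fun setT (fun z : 'rV[R]_n * 'rV[R]_n => z.1 + 2^-1 *: z.2).
  by apply: meas_rowD; [exact: measurable_fst|apply: meas_rowZ; exact: measurable_snd].
have h1 := mpres_shear1 (lr n) m1 (fun p => mpres_rowD (2^-1 *: p)).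
have m2 : measurable_fun setT (fun z : 'rV[R]_n * 'rV[R]_n => z.1 - z.2).
  by apply: meas_rowB; [exact: measurable_fst|exact: measurable_snd].
have h2 := mpres_shear2 (lr n) m2 (fun x => mpres_rowB x).
have := mpres_comp h1 h2; congr (mpres _ _ _); apply/funext => -[q p] /=; congr pair.
apply/rowP => i; rewrite !mxE; lra.
Qed.

End row_integrals.

Section orthogonal_invariance.
Context {R : realType} (n : nat).
Local Notation lr := (@lebesgue_row R n).
Variable Q : 'M[R]_n.
Hypothesis QQ : Q *m Q^T = 1%:M.

Lemma enorm_mul (x : 'rV[R]_n) : enorm (x *m Q) = enorm x.
Proof.
have E (y : 'rV[R]_n) : dotp y y = (y *m y^T) ord0 ord0.
  by rewrite mxE; apply: eq_bigr => i _; rewrite mxE.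
by rewrite /enorm !E trmx_mul mulmxA -(mulmxA x) QQ mulmx1.
Qed.

(* Both sides of I(f) J(g) = J(f) I(g), where I is the integral and J(f) is the
   integral of f(xQ), come from the integral of f(xQ + y) g(y); when g is radial
   J(g) = I(g). *)
Lemma mpres_mul : mpres lr lr (fun x => x *m Q).
Proof.
have mQ : measurable_fun setT (fun x : 'rV[R]_n => x *m Q).
  by apply: meas_mulmx; exact: measurable_id.
apply: mpres_of_ge0 => // f mf f0.
(* A radial function with finite positive integral: the final identity can be divided by this
   integral even when [f] has infinite integral. *)
pose g (x : 'rV[R]_n) : \bar R := (expR (- enorm x ^+ 2))%:E.
have g0 x : (0 <= g x)%E by rewrite lee_fin expR_ge0.
have mg : measurable_fun setT g.
  apply/measurable_EFinP; apply: (measurableT_comp (@measurable_expR R)).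
  apply: measurable_funN; apply: measurable_funX; apply: meas_enorm; exact: measurable_id.
have gE x : g x = (\prod_(i < n) expR (- (x ord0 i) ^+ 2))%:E.
  rewrite /g /enorm sqr_sqrtr; last by apply: sumr_ge0 => i _; rewrite -expr2 sqr_ge0.
  by rewrite /dotp -sumrN expR_sum; under eq_bigr do rewrite -expr2.
have [ig eg] := rint_row_prod (fun (i : 'I_n) => @integrableT_gauss R).
have Ig : (\int[lr]_x g x = (Num.sqrt pi ^+ n)%:E)%E.
  under eq_integral do rewrite gE.
  rewrite -EFin_Rint// eg /Rintegral integralT_gauss /=.
  by rewrite prodr_const card_ord.
have mx1 (h : 'rV[R]_n -> \bar R) : measurable_fun setT h ->
    measurable_fun setT (fun z : 'rV[R]_n * 'rV[R]_n => h z.1).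
  by move=> mh; apply: (measurableT_comp mh); exact: measurable_fst.
have mx2 (h : 'rV[R]_n -> \bar R) : measurable_fun setT h ->
    measurable_fun setT (fun z : 'rV[R]_n * 'rV[R]_n => h z.2).
  by move=> mh; apply: (measurableT_comp mh); exact: measurable_snd.
have mfQ : measurable_fun setT (fun x => f (x *m Q)) by exact: measurableT_comp.
have If0 : (0 <= \int[lr]_x f x)%E by apply: integral_ge0.
have Jf0 : (0 <= \int[lr]_x f (x *m Q))%E by apply: integral_ge0.
have mA : measurable_fun setT (fun z : 'rV[R]_n * 'rV[R]_n => f (z.1 *m Q + z.2)).
  apply: (measurableT_comp mf); apply: meas_rowD; last exact: measurable_snd.
  by apply: meas_mulmx; exact: measurable_fst.
have mB : measurable_fun setT (fun z : 'rV[R]_n * 'rV[R]_n => g (z.2 - z.1 *m Q)).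
  apply: (measurableT_comp mg); apply: meas_rowB; first exact: measurable_snd.
  by apply: meas_mulmx; exact: measurable_fst.
pose F (z : 'rV[R]_n * 'rV[R]_n) : \bar R := (f (z.1 *m Q + z.2)%R * g z.2)%E.
pose G (z : 'rV[R]_n * 'rV[R]_n) : \bar R := (f z.2 * g (z.2 - z.1 *m Q)%R)%E.
have mF : measurable_fun setT F by apply: emeasurable_funM => //; exact: mx2.
have F0 z : (0 <= F z)%E by rewrite mule_ge0.
have mG : measurable_fun setT G by apply: emeasurable_funM => //; exact: mx2.
have G0 z : (0 <= G z)%E by rewrite mule_ge0.
(* For fixed y, x Q + y = (x + y Q^T) Q, so that a translation in x removes y. *)
have H1 : (\int[prodm lr lr]_z F z = (\int[lr]_x f (x *m Q)) * (\int[lr]_y g y))%E.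
  rewrite (tonelli2 lr lr mF F0) -ge0_integralZl//; apply: eq_integral => y _.
  rewrite /F /= ge0_integralZr//; last first.
    by apply: (measurableT_comp mf); exact: meas_rowD.
  congr (_ * _)%E; rewrite (mpres_ge0 (mpres_rowD (y *m Q^T)) mfQ)//.
  apply: eq_integral => x _; congr f.
  by rewrite mulmxDl -mulmxA (mulmx1C QQ) mulmx1.
(* For fixed x, a translation of y by x Q turns [F] into [G]; then g(y - x Q) depends only on the
   norm of y Q^T - x, and its integral in x is that of g. *)
have H2 : (\int[prodm lr lr]_z F z = (\int[lr]_x f x) * (\int[lr]_y g y))%E.
  transitivity (\int[prodm lr lr]_z G z)%E.
    rewrite (tonelli1 lr lr mF F0) (tonelli1 lr lr mG G0).
    apply: eq_integral => x _.
    have mFx : measurable_fun setT (fun y => F (x, y)).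
      by apply: (measurableT_comp mF); exact: pair1_measurable.
    apply: etrans (mpres_ge0 (mpres_rowD (- x *m Q)) mFx (fun y => F0 (x, y))) _.
    by apply: eq_integral => y _; rewrite /F /G /= mulNmx addrCA subrr addr0.
  rewrite (tonelli2 lr lr mG G0) -ge0_integralZr//=; last by apply: integral_ge0.
  apply: eq_integral => y _.
  have mGy : measurable_fun setT (fun x => g (y - x *m Q)).
    apply: (measurableT_comp mg); apply: meas_rowB; first exact: measurable_cst.
    exact: mQ.
  have Eg : (\int[lr]_x g (y - x *m Q)%R = \int[lr]_x g x)%E.
    apply: etrans _ (esym (mpres_ge0 (mpres_rowB (y *m Q^T)) mg g0)).
    apply: eq_integral => x _; rewrite /g -[in RHS]enorm_mul.
    by rewrite mulmxBl -mulmxA (mulmx1C QQ) mulmx1.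
  apply: etrans (ge0_integralZl lr measurableT mGy (fun x _ => g0 _) (f0 y)) _.
  by rewrite Eg.
have pn : (0 < Num.sqrt pi ^+ n :> R) by rewrite exprn_gt0// sqrtr_gt0 pi_gt0.
have cK (a : \bar R) : (a * (Num.sqrt pi ^+ n)%:E * ((Num.sqrt pi ^+ n)^-1)%:E = a)%E.
  by rewrite -muleA -EFinM divff ?gt_eqF// mule1.
move: H1; rewrite H2 Ig => H.
by rewrite -[LHS]cK -H cK.
Qed.

End orthogonal_invariance.

(** * Rotation-invariant measures *)

Section euclidean.
Context {R : realType} (n : nat).
Implicit Types x y z : 'rV[R]_n.

Lemma dotp_ge0 x : 0 <= dotp x x.
Proof. by apply: sumr_ge0 => i _; rewrite -expr2 sqr_ge0. Qed.

Lemma enorm_ge0 x : 0 <= enorm x. Proof. exact: sqrtr_ge0. Qed.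

Lemma enorm_sqr x : enorm x ^+ 2 = dotp x x.
Proof. by rewrite sqr_sqrtr// dotp_ge0. Qed.

Lemma dotpE x y : dotp x y = (x *m y^T) ord0 ord0.
Proof. by rewrite mxE; apply: eq_bigr => i _; rewrite mxE. Qed.

Lemma dotpC x y : dotp x y = dotp y x.
Proof. by apply: eq_bigr => i _; rewrite mulrC. Qed.

Lemma dotpDl x y z : dotp (x + y) z = dotp x z + dotp y z.
Proof. by rewrite -big_split; apply: eq_bigr => i _; rewrite mxE mulrDl. Qed.

Lemma dotpZl (c : R) x y : dotp (c *: x) y = c * dotp x y.
Proof. by rewrite mulr_sumr; apply: eq_bigr => i _; rewrite mxE mulrA. Qed.

Lemma dotpNl x y : dotp (- x) y = - dotp x y.
Proof. by rewrite -scaleN1r dotpZl mulN1r. Qed.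

Lemma dotpDr x y z : dotp z (x + y) = dotp z x + dotp z y.
Proof. by rewrite dotpC dotpDl !(dotpC z). Qed.

Lemma dotpZr (c : R) x y : dotp y (c *: x) = c * dotp y x.
Proof. by rewrite dotpC dotpZl (dotpC y). Qed.

Lemma dotpNr x y : dotp x (- y) = - dotp x y.
Proof. by rewrite dotpC dotpNl dotpC. Qed.

Lemma coord_le_enorm x i : `|x ord0 i| <= enorm x.
Proof.
rewrite -sqrtr_sqr ler_wsqrtr// /dotp (bigD1 i)//= -expr2 lerDl.
by apply: sumr_ge0 => j _; rewrite -expr2 sqr_ge0.
Qed.

Lemma enormZ (c : R) x : enorm (c *: x) = `|c| * enorm x.
Proof. by rewrite /enorm dotpZl dotpZr mulrA -expr2 sqrtrM ?sqr_ge0// sqrtr_sqr. Qed.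

Lemma enormN x : enorm (- x) = enorm x.
Proof. by rewrite /enorm dotpNl dotpNr opprK. Qed.

(** When neither norm is 0, the vector |y| x - |x| y has squared norm 2 |x| |y| (|x| |y| - <x, y>),
    and this is nonnegative. *)
Lemma cauchy_schwarz x y : dotp x y <= enorm x * enorm y.
Proof.
have [y0|y0] := eqVneq (enorm y) 0.
  have y00 i : y ord0 i = 0.
    by apply/eqP; rewrite -normr_le0 -y0 coord_le_enorm.
  by rewrite y0 mulr0 /dotp big1// => i _; rewrite y00 mulr0.
have py : 0 < enorm y by rewrite lt_def y0 enorm_ge0.
have := dotp_ge0 (enorm y *: x - (enorm x) *: y).
have [x0|x0] := eqVneq (enorm x) 0.
  move=> _; have x00 i : x ord0 i = 0.
    by apply/eqP; rewrite -normr_le0 -x0 coord_le_enorm.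
  by rewrite x0 mul0r /dotp big1// => i _; rewrite x00 mul0r.
have px : 0 < enorm x by rewrite lt_def x0 enorm_ge0.
rewrite dotpDl !dotpDr !(dotpNl, dotpNr, dotpZl, dotpZr) -!enorm_sqr (dotpC y x).
move=> H; rewrite -(ler_pM2l (mulr_gt0 px py)).
by nra.
Qed.

Lemma enorm_triangle x y : enorm (x + y) <= enorm x + enorm y.
Proof.
rewrite -ler_sqr ?nnegrE ?enorm_ge0// ?addr_ge0 ?enorm_ge0//.
rewrite enorm_sqr dotpDl !dotpDr -!enorm_sqr (dotpC y x) sqrrD.
have := cauchy_schwarz x y; lra.
Qed.

Lemma enorm_continuous : continuous (@enorm R n).
Proof.
have H (s : seq 'I_n) : continuous (fun x : 'rV[R]_n => \sum_(i <- s) x ord0 i * x ord0 i).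
  elim: s => [|i s IH] x.
    rewrite (_ : (fun _ => _) = cst 0); last by apply/funext => y; rewrite big_nil.
    exact: cst_continuous.
  rewrite (_ : (fun _ => _) = fun y : 'rV[R]_n => y ord0 i * y ord0 i +
    \sum_(j <- s) y ord0 j * y ord0 j); last by apply/funext => y; rewrite big_cons.
  by apply: cvgD (IH x); apply: cvgM; exact: coord_continuous.
by move=> x; apply: continuous_comp; [exact: H|exact: sqrt_continuous].
Qed.

Lemma enorm_eq0 x : enorm x = 0 -> x = 0.
Proof.
move=> x0; apply/rowP => i; rewrite mxE; apply/eqP.
by rewrite -normr_le0 -x0 coord_le_enorm.
Qed.

(* The Householder reflection along x - y. *)
Lemma orthogonal_transitive x y : enorm x = enorm y ->
  exists2 Q : 'M[R]_n, Q *m Q^T = 1%:M & x *m Q = y.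
Proof.
move=> xy; have [->|xny] := eqVneq x y.
  by exists 1%:M; rewrite ?trmx1 ?mulmx1.
have [v vE] : exists v, v = x - y by exists (x - y).
pose a := dotp v v.
have a0 : a != 0.
  rewrite /a vE -enorm_sqr expf_eq0/=; apply: contra xny => /eqP /enorm_eq0.
  by move/eqP; rewrite subr_eq0.
have vv : v *m v^T = a%:M.
  by rewrite [LHS]mx11_scalar -dotpE.
pose Q : 'M[R]_n := 1%:M - (2 / a) *: (v^T *m v).
have QT : Q^T = Q.
  by rewrite /Q linearB/= linearZ/= trmx_mul trmxK trmx1.
exists Q.
  have SS : v^T *m v *m (v^T *m v) = a *: (v^T *m v).
    by rewrite mulmxA -(mulmxA v^T) vv -scalemx1 -scalemxAr mulmx1 -scalemxAl.
  rewrite QT /Q mulmxBl mul1mx mulmxBr mulmx1 -scalemxAl -scalemxAr SS !scalerA.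
  rewrite (_ : 2 / a * (2 / a) * a = 2 / a + 2 / a); last by field.
  rewrite scalerDl; move: (_ *: _) => X.
  by apply/matrixP => i j; rewrite !mxE; ring.
rewrite /Q mulmxBr mulmx1 -scalemxAr mulmxA [x *m v^T]mx11_scalar -dotpE.
(* Since x and y have the same norm, <v, v> = 2 <x, v>: the reflection subtracts exactly v from
   x. *)
rewrite mul_scalar_mx scalerA (_ : 2 / a * dotp x v = 1).
  by rewrite scale1r vE opprB addrC subrK.
have -> : 2 / a * dotp x v = (2 * dotp x v) / a by rewrite mulrAC.
apply/eqP; rewrite -(inj_eq (mulIf a0)) mul1r mulfVK// /a vE.
rewrite !(dotpDl, dotpDr, dotpNl, dotpNr) (dotpC y x) -!enorm_sqr xy; apply/eqP; ring.
Qed.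

(** Compactness of the sphere. The radius may depend on the center, so that the lemma serves both
    for uniform continuity and for a cover at a fixed scale. *)
Lemma sphere_cover (r : R) (delta : 'rV[R]_n -> R) : (forall x, 0 < delta x) ->
  exists s : seq 'rV[R]_n, (forall p, p \in s -> enorm p = r) /\
    forall x, enorm x = r -> exists2 p, p \in s & enorm (x - p) < delta p.
Proof.
move=> d0; pose S : set 'rV[R]_n := [set x | enorm x = r].
have cS : compact S.
  apply: bounded_closed_compact.
    exists r; split; first exact: num_real.
    move=> M rM x /= xr; rewrite (le_trans _ (ltW rM))// -xr /Num.Def.normr/= mx_normrE.
    apply/bigmax_leP; split; first exact: enorm_ge0.
    by move=> [i j] _; rewrite (ord1 i)/= coord_le_enorm.
  change (closed (@enorm R n @^-1` [set r])).
  apply: preimage_closed; last exact: closed_eq.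
  by move=> x _; exact: enorm_continuous.
have := cS; rewrite compact_cover => /(_ _ S (fun p => [set x | enorm (x - p) < delta p])).
case.
- move=> p _; change (open ((fun x => enorm (x - p)) @^-1` [set t | t < delta p])).
  apply: (@open_comp _ _ (fun x => enorm (x - p)) [set t | t < delta p]); last first.
    exact: open_lt.
  have H : continuous (fun y : 'rV[R]_n => y - p).
    by move=> z; apply: continuousB; [exact: cvg_id|exact: cst_continuous].
  by move=> x _; apply: continuous_comp; [exact: H|exact: enorm_continuous].
- move=> x Sx; exists x => //=; rewrite subrr.
  by rewrite -(scale0r x) enormZ normr0 mul0r.
move=> D DS SD; exists (finmap.enum_fset D); split.
  by move=> p /DS; rewrite inE.
by move=> x /SD [p /= pD xp]; exists p.
Qed.
End euclidean.

Section uniform_measure.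
Context {R : realType} (n : nat).
Variables (r : R) (L : probability 'rV[R]_n R).
Hypotheses (r0 : 0 < r) (uL : uniform_on_sphere r L).
Local Notation lr := (@lebesgue_row R n).
Implicit Types x y z : 'rV[R]_n.

Let pr z : 'rV[R]_n := (r / enorm z) *: z.

Let enorm_pr z : z != 0 -> enorm (pr z) = r.
Proof.
move=> z0; have ez : enorm z != 0 by apply: contra z0 => /eqP/enorm_eq0 ->.
rewrite /pr enormZ ger0_norm ?mulfVK//.
by rewrite divr_ge0 ?enorm_ge0// ltW.
Qed.

Lemma uniform_sphere_mpres (Q : 'M[R]_n) : Q *m Q^T = 1%:M -> mpres L L (fun x => x *m Q).
Proof.
move=> QQ; split; first by apply: meas_mulmx; exact: measurable_id.
by move=> A mA; exact: uL.2.
Qed.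

Lemma uniform_sphere_ae : {ae L, forall x, enorm x = r}.
Proof.
have mS : measurable [set x : 'rV[R]_n | enorm x = r].
  have mE : measurable_fun setT (@enorm R n) by apply: meas_enorm; exact: measurable_id.
  rewrite -[X in measurable X]setTI; apply: (mE measurableT [set r]).
  exact: measurable_set1.
exists (~` [set x | enorm x = r]); split => //.
  exact: measurableC.
by rewrite probability_setC// uL.1 subee.
Qed.

(* Two rotation-invariant measures that see the same functions of the direction:
   average both against a kernel k concentrated near the diagonal; by
   invariance its two marginal integrals are constant, so that the two averages
   of A differ by at most the oscillation of A at the scale of k. *)
Lemma radial_average (A W : 'rV[R]_n -> R) (M : R) :
  continuous A -> (forall z, `|A z| <= M) -> (forall z, r <= enorm z -> A z = A (pr z)) ->
  (forall z, 0 <= W z) -> rintg lr W -> (forall z, enorm z < r -> W z = 0) ->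
  (forall (Q : 'M[R]_n) z, Q *m Q^T = 1%:M -> W (z *m Q) = W z) ->
  \int[lr]_z (A z * W z) = (\int[L]_x A x) * \int[lr]_z W z.
Proof.
move=> cA AM hA W0 iW W1 WQ.
have mA := continuous_row_measurable cA.
have mW : measurable_fun setT W := rintg_meas iW.
have M0 : 0 <= M by apply: le_trans (normr_ge0 _) (AM 0).
set I := \int[lr]_z W z.
have I0 : 0 <= I by apply: Rintegral_ge0.
have mpr : measurable_fun setT pr.
  apply: measurable_rowP => i; under eq_fun do rewrite mxE -powR_inv1 ?enorm_ge0//.
  apply: measurable_funM; last exact: measurable_coord.
  apply: measurable_funM => //; apply: (measurableT_comp (measurable_powR (-1))).
  by apply: meas_enorm; exact: measurable_id.
suff H e : 0 < e -> `|\int[lr]_z (A z * W z) - (\int[L]_x A x) * I| <= e * I.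
  apply/eqP; rewrite -subr_eq0 -normr_le0; apply/ler_addgt0Pl => e e0; rewrite addr0.
  have e1 : 0 < e / (I + 1) by rewrite divr_gt0// ltr_wpDl.
  apply: le_trans (H _ e1) _.
  by rewrite mulrAC ler_pdivrMr ?ltr_wpDl// ler_pM2l// lerDl.
move=> e0.
(* A scale at which A oscillates by at most e on the sphere. The condition dl <= r will exclude the
   origin, whose projection [pr] is 0. *)
have [dl /andP[dl0 dlr] Adl] : exists2 dl, 0 < dl <= r & forall x y, enorm x = r -> enorm y = r ->
    enorm (x - y) < dl -> `|A x - A y| <= e.
  have cAe p : exists2 t, 0 < t & forall x, enorm (x - p) < t -> `|A x - A p| < e / 2.
    have := cA p; move/cvgrPdist_lt => /(_ (e / 2)); rewrite divr_gt0// => /(_ isT).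
    move=> /nbhs_ballP[t /= t0 H]; exists t => // x xp; rewrite distrC.
    apply: H; split => // i j; rewrite (ord1 i) /ball /= distrC.
    by have := coord_le_enorm (x - p) j; rewrite !mxE => /le_lt_trans; apply.
  pose gd p := sval (cid2 (cAe p)).
  have gd0 p : 0 < gd p / 2 by rewrite divr_gt0// /gd; case: (cid2 (cAe p)).
  have gdP p x : enorm (x - p) < gd p -> `|A x - A p| < e / 2.
    by rewrite /gd; case: (cid2 (cAe p)) => /= t _; apply.
  have [s [sr sP]] := sphere_cover r gd0.
  have [dl dl0 dls] : exists2 dl, 0 < dl & forall p, p \in s -> dl <= gd p / 2.
    elim: s {sr sP} => [|q s [dl dl0 IH]]; first by exists 1.
    exists (Num.min dl (gd q / 2)); first by rewrite lt_min dl0 gd0.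
    move=> p; rewrite inE => /orP[/eqP ->|/IH]; rewrite ge_min ?lexx ?orbT//.
    by move=> ->.
  exists (Num.min dl r); first by rewrite lt_min dl0 r0 ge_min lexx orbT.
  move=> x y xr yr; rewrite lt_min => /andP[xy _].
  have [p ps xp] := sP x xr.
  have h1 := gdP p x; have h2 := gdP p y.
  have xp' : enorm (x - p) < gd p by apply: lt_trans xp _; have := gd0 p; lra.
  have yp' : enorm (y - p) < gd p.
    rewrite (_ : y - p = - (x - y) + (x - p)); last by rewrite opprB addrA subrK.
    rewrite (le_lt_trans (enorm_triangle _ _))// enormN.
    have := dls p ps; lra.
  have := ltrD (h1 xp') (h2 yp'); rewrite (distrC (A y)) => H.
  rewrite (_ : A x - A y = (A x - A p) + (A p - A y)); last by rewrite addrA subrK.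
  by rewrite (le_trans (ler_normD _ _))// ltW// (lt_le_trans H)//; lra.
(* The kernel is a cone of radius [dl] in the distance between directions: bounded, nonnegative, and
   unchanged when both arguments are rotated. *)
have [k kE] : exists k, forall x z, k x z = Num.max 0 (dl - enorm (pr x - pr z)).
  by exists (fun x z => Num.max 0 (dl - enorm (pr x - pr z))).
have k0 x z : 0 <= k x z by rewrite kE le_max lexx.
have kdl x z : k x z <= dl by rewrite kE ge_max ltW//= lerBlDr lerDl enorm_ge0.
have mk : measurable_fun setT (fun p : 'rV[R]_n * 'rV[R]_n => k p.1 p.2).
  under eq_fun do rewrite kE.
  apply: measurable_maxr => //; apply: measurable_funB => //; apply: meas_enorm.
  apply: meas_rowB; first exact: measurableT_comp mpr measurable_fst.
  exact: measurableT_comp mpr measurable_snd.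
have prQ Q z : Q *m Q^T = 1%:M -> pr (z *m Q) = pr z *m Q.
  by move=> QQ; rewrite /pr (enorm_mul QQ) scalemxAl.
have kQ Q x z : Q *m Q^T = 1%:M -> k (x *m Q) (z *m Q) = k x z.
  by move=> QQ; rewrite !kE !prQ// -mulmxBl (enorm_mul QQ).
have mkx z : measurable_fun setT (fun x => k x z).
  exact: (measurableT_comp mk (pair2_measurable z)).
have mkz x : measurable_fun setT (fun z => k x z).
  exact: (measurableT_comp mk (pair1_measurable x)).
have ikL z : rintg L (fun x => k x z).
  apply: (rintg_le (g := cst dl)) => //; last by move=> x; rewrite ger0_norm.
  exact: finite_measure_integrable_cst.
have ikW x : rintg lr (fun z => k x z * W z).
  apply: (rintg_le (g := fun z => dl * W z)); first exact: measurable_funM.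
    exact: rintgZ.
  by move=> z; rewrite ger0_norm ?mulr_ge0// ler_wpM2r.
(* Two nonzero vectors have directions exchanged by some orthogonal matrix, under which L is
   invariant. *)
have [c cE] : exists c, forall z, z != 0 -> \int[L]_x k x z = c.
  have [[z1 z10]|H] := pselect (exists z, z != 0); last first.
    by exists 0 => z z0; exfalso; apply: H; exists z.
  exists (\int[L]_x k x z1) => z z0.
  have [Q QQ zQ] := orthogonal_transitive (etrans (enorm_pr z10) (esym (enorm_pr z0))).
  rewrite (mpres_Rint (uniform_sphere_mpres QQ) (ikL z)); apply: eq_Rintegral => x _.
  by rewrite !kE prQ// -zQ -mulmxBl (enorm_mul QQ).
have prr x : enorm x = r -> pr x = x.
  by move=> xr; rewrite /pr xr divff ?gt_eqF// scale1r.
have n0r x : enorm x = r -> x != 0.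
  move=> xr; apply/eqP => x0; move: xr r0.
  by rewrite x0 -(scale0r x) enormZ normr0 mul0r => <-; rewrite ltxx.
have [d dE] : exists d, forall x, enorm x = r -> \int[lr]_z (k x z * W z) = d.
  have [[x1 x1r]|H] := pselect (exists x : 'rV[R]_n, enorm x = r); last first.
    by exists 0 => x xr; exfalso; apply: H; exists x.
  exists (\int[lr]_z (k x1 z * W z)) => x xr.
  have [Q QQ xQ] := orthogonal_transitive (etrans x1r (esym xr)).
  rewrite (mpres_Rint (mpres_mul QQ) (ikW x)); apply: eq_Rintegral => z _.
  by rewrite -xQ kQ// WQ.
have aeF : ~ {ae L, forall x : 'rV[R]_n, False}.
  move=> [N [_ N0 sN]]; have NT : N = setT.
    by apply/seteqP; split => // x _; apply: sN => /=; apply.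
  by move: N0; rewrite NT probability_setT => /eqP; rewrite onee_eq0.
(* If c were 0, every cap of radius dl would be L-null, while finitely many caps cover the sphere,
   which has full measure. *)
have c0 : 0 < c.
  rewrite lt_neqAle; apply/andP; split; last first.
    have [[z1 z10]|H] := pselect (exists z : 'rV[R]_n, z != 0).
      by rewrite -(cE _ z10); apply: Rintegral_ge0.
    exfalso; apply: aeF; apply: filterS uniform_sphere_ae => x xr.
    by apply: H; exists x; exact: n0r.
  apply/eqP => /esym c0.
  have [s [sr sP]] := @sphere_cover R n r (fun=> dl) (fun=> dl0).
  apply: aeF.
  have aes : {ae L, forall x, forall p, p \in s -> k x p = 0}.
    elim: s sr {sP} => [|q s IH] sr.
      by apply: aeW => x p; rewrite in_nil.
    have /IH IHs : forall p, p \in s -> enorm p = r.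
      by move=> p ps; apply: sr; rewrite inE ps orbT.
    have aeq : {ae L, forall x, k x q = 0}.
      apply: Rint_eq0_ae => //.
      by rewrite -c0; apply/cE/n0r/sr; rewrite inE eqxx.
    apply: filterS2 IHs aeq => x h1 h2 p; rewrite inE => /orP[/eqP ->//|].
    exact: h1.
  apply: filterS2 aes uniform_sphere_ae => x ks xr.
  have [p ps xp] := sP x xr; have := ks p ps.
  rewrite kE !prr//; last exact: sr.
  by rewrite max_r ?subr_ge0 ?ltW// => /eqP; rewrite subr_eq0 => /eqP dlE; move: xp; rewrite -dlE ltxx.
pose F (p : 'rV[R]_n * 'rV[R]_n) := k p.1 p.2 * W p.2.
have mW2 : measurable_fun setT (fun p : 'rV[R]_n * 'rV[R]_n => W p.2).
  exact: measurableT_comp mW measurable_snd.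
have mF : measurable_fun setT F by exact: measurable_funM.
have F0 p : 0 <= F p by rewrite /F mulr_ge0.
have iF : rintg (prodm L lr) F.
  apply: (rintg_fubini (g := cst (dl * I))) => //.
    exact: finite_measure_integrable_cst.
  move=> x; rewrite -RintegralZl//; apply: Rint_le.
  - exact/rintg_norm/ikW.
  - exact: rintgZ.
  - by move=> z; rewrite ger0_norm// ler_wpM2r.
have Wz0 z : W z != 0 -> r <= enorm z.
  by move=> Wz; rewrite leNgt; apply/negP => /W1 W1z; rewrite W1z eqxx in Wz.
have z0r z : r <= enorm z -> z != 0.
  move=> rz; apply/eqP => z0; move: rz.
  by rewrite z0 -(scale0r z) enormZ normr0 mul0r leNgt r0.
(* The two orders of integration of [F] give c I and d, hence d = c I. This lets the common factor c
   be cancelled at the end. *)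
have E2 : \int[prodm L lr]_p F p = c * I.
  rewrite -(rfubini2 iF).2 -(RintZ c iW); apply: eq_Rintegral => z _.
  rewrite /F /= (RintZr _ (ikL z)).
  have [->|Wz] := eqVneq (W z) 0; first by rewrite !mulr0.
  by rewrite cE//; exact/z0r/Wz0.
have Ksph : {ae L, forall x, \int[lr]_z F (x, z) = d}.
  by apply: filterS uniform_sphere_ae => x xr; rewrite /F /= dE.
have E1 : \int[prodm L lr]_p F p = d.
  rewrite -(rfubini1 iF).2 (Rint_ae (rintg_meas (rfubini1 iF).1) _ Ksph)//.
  by rewrite Rintegral_cst// [X in fine X](@probability_setT _ _ _ L) mulr1.
have mA1 : measurable_fun setT (fun p : 'rV[R]_n * 'rV[R]_n => A (pr p.1)).
  exact: measurableT_comp mA (measurableT_comp mpr measurable_fst).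
have mA2 : measurable_fun setT (fun p : 'rV[R]_n * 'rV[R]_n => A p.2).
  exact: measurableT_comp mA measurable_snd.
(* [G1] evaluates A at the direction of x, [G2] at z. Their integrals are d times the mean of A and
   c times the weighted integral, and they differ by at most e [F] pointwise, since [F] vanishes
   unless the directions are within dl. *)
pose G1 p := A (pr p.1) * F p; pose G2 p := A p.2 * F p.
have iG1 : rintg (prodm L lr) G1.
  apply: (rintg_le (g := fun p => M * F p)); [exact: measurable_funM|exact: rintgZ|].
  by move=> p; rewrite /G1 normrM ler_pM// ger0_norm.
have iG2 : rintg (prodm L lr) G2.
  apply: (rintg_le (g := fun p => M * F p)); [exact: measurable_funM|exact: rintgZ|].
  by move=> p; rewrite /G2 normrM ler_pM// ger0_norm.
have iAW : rintg lr (fun z => A z * W z).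
  apply: (rintg_le (g := fun z => M * W z)); [exact: measurable_funM|exact: rintgZ|].
  by move=> p; rewrite normrM ler_pM// ger0_norm.
have E3 : \int[prodm L lr]_p G2 p = c * \int[lr]_z (A z * W z).
  rewrite -(rfubini2 iG2).2 -(RintZ c iAW); apply: eq_Rintegral => t _.
  rewrite /G2 /F /=.
  have [->|Wz] := eqVneq (W t) 0.
    by under eq_Rintegral do rewrite !mulr0; rewrite !mulr0 Rintegral_cst// mul0r.
  under eq_Rintegral do rewrite mulrCA.
  rewrite RintZr// cE; last exact/z0r/Wz0.
  by rewrite mulrC.
have E4 : \int[prodm L lr]_p G1 p = d * \int[L]_x A x.
  have iA : rintg L A.
    apply: (rintg_le (g := cst M)) => //.
    exact: finite_measure_integrable_cst.
  rewrite -(rfubini1 iG1).2 -(RintZ d iA).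
  apply: Rint_ae; [exact: rintg_meas (rfubini1 iG1).1|exact: measurable_funM|].
  apply: filterS2 uniform_sphere_ae Ksph => x xr <-.
  by rewrite /G1 /= prr// (RintZ _ (ikW x)) mulrC.
have Fe p : `|G2 p - G1 p| <= e * F p.
  rewrite /G1 /G2 -mulrBl normrM (ger0_norm (F0 p)).
  have [->|Fp] := eqVneq (F p) 0; first by rewrite !mulr0.
  rewrite ler_wpM2r//.
  have Wp : W p.2 != 0 by apply: contra Fp => /eqP Wp; rewrite /F Wp mulr0.
  have kp : enorm (pr p.1 - pr p.2) < dl.
    rewrite ltNge; apply: contra Fp => kp; rewrite /F kE max_l ?mul0r//.
    by rewrite subr_le0.
  have p2r := enorm_pr (z0r _ (Wz0 _ Wp)).
  have p10 : p.1 != 0.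
    apply/eqP => p10; move: kp; rewrite p10 /pr scaler0 sub0r enormN.
    by rewrite p2r ltNge dlr.
  rewrite (hA _ (Wz0 _ Wp)); apply: Adl => //; first exact: enorm_pr.
  by rewrite -enormN opprB.
have := norm_Rint_le (rintgB iG2 iG1) (rintgZ e iF) Fe.
rewrite RintB// RintZ// E2 E3 E4 -E1 E2.
rewrite -(mulrA c I) -mulrBr normrM (gtr0_norm c0) mulrCA ler_pM2l//.
by rewrite (mulrC I).
Qed.
End uniform_measure.

(** * Gaussian integrals on the line *)

Section weight.
Context {R : realType}.
Local Notation C := R[i].
Local Notation lam := (@lebesgue_measure R).

(** An integrable weight that dominates every polynomial times a gaussian; it is also the decay
    produced by two integrations by parts against an oscillating factor. *)
Definition wt (x : R) : R := (1 + x ^+ 2)^-1.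

Lemma oneDsqr_gt0 (x : R) : 0 < 1 + x ^+ 2.
Proof. by rewrite ltr_pwDl// sqr_ge0. Qed.

Lemma wt_gt0 x : 0 < wt x. Proof. by rewrite invr_gt0 oneDsqr_gt0. Qed.
Lemma wt_ge0 x : 0 <= wt x. Proof. exact/ltW/wt_gt0. Qed.
Lemma wt_le1 x : wt x <= 1.
Proof. by rewrite invf_le1 ?oneDsqr_gt0// lerDl sqr_ge0. Qed.
Lemma wtN x : wt (- x) = wt x. Proof. by rewrite /wt sqrrN. Qed.

Lemma measurable_wt : measurable_fun [set: R] wt.
Proof. by apply: continuous_measurable_fun; exact: continuous_oneDsqrV. Qed.

Lemma rintg_wt : rintg lam wt.
Proof.
apply: ge0_rintg; [exact: measurable_wt|exact: wt_ge0|].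
rewrite ge0_symfun_integralT//=; last 3 first.
- exact: wt_ge0.
- exact: continuous_oneDsqrV.
- by move=> x /=; rewrite wtN.
rewrite (_ : [set x | _] = `[0, +oo[%classic); last first.
  by apply/seteqP; split => x /=; rewrite in_itv/= andbT.
by rewrite [X in (_ * X)%E]integral0y_oneDsqr -EFinM ltry.
Qed.

Lemma near_nat_ge (t : R) : \forall n \near \oo, t <= n.+1%:R.
Proof.
exists (Num.bound `|t|) => // n /= tn.
rewrite (le_trans (ler_norm _))// (le_trans (ltW (archi_boundP (normr_ge0 t))))//.
by rewrite ler_nat (leq_trans tn).
Qed.

(** Since |x|^i <= i! exp |x|, a polynomial is at most a multiple of exp |x|; the factor 1 + x^2
    that pays for the weight is put into the polynomial. The remaining exponent (1 + |b|) |x| - a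
    x^2 is at most (1 + |b|)^2 / (4 a). *)
Lemma poly_gauss_bounded (P : {poly C}) (a b : R) : 0 < a ->
  exists2 M, 0 <= M & forall x,
    Normc.normc P.[x%:C] * expR (- (a * x ^+ 2) + b * x) <= M * wt x.
Proof.
move=> a0; pose Q := P * (1 + 'X ^+ 2).
pose S := \sum_(i < size Q) Normc.normc Q`_i * i`!%:R.
have S0 : 0 <= S by apply: sumr_ge0 => i _; rewrite mulr_ge0// normc_ge0.
exists (S * expR ((1 + `|b|) ^+ 2 / (4 * a))).
  by rewrite mulr_ge0// expR_ge0.
move=> x; rewrite /wt -[leRHS]/(_ / _) ler_pdivlMr ?oneDsqr_gt0//.
rewrite mulrAC (_ : _ * (1 + x ^+ 2) = Normc.normc Q.[x%:C]); last first.
  rewrite /Q hornerM Normc.normcM; congr (_ * _).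
  rewrite hornerD hornerXn hornerC (_ : 1 + x%:C ^+ 2 = (1 + x ^+ 2)%:C); last first.
    by rewrite rmorphD rmorph1 rmorphXn.
  rewrite normcR.
  by rewrite ger0_norm// ltW// oneDsqr_gt0.
have h1 : Normc.normc Q.[x%:C] <= S * expR `|x|.
  rewrite horner_coef (le_trans (normc_sum_le _ _ _))// mulr_suml.
  apply: ler_sum => i _; rewrite Normc.normcM -rmorphXn normcR normrX -mulrA.
  rewrite ler_wpM2l ?normc_ge0//.
  case: (nat_of_ord i) => [|k].
    by rewrite expr0 fact0 mul1r -[leLHS]expR0 ler_expR.
  rewrite -ler_pdivrMl ?ltr0n ?fact_gt0// mulrC.
  by apply: le_trans (expR_ge1Dxn k (normr_ge0 x)); rewrite lerDr.
apply: le_trans (ler_wpM2r (expR_ge0 _) h1) _.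
rewrite -mulrA ler_wpM2l// -expRD ler_expR.
have hx : `|x| + (- (a * x ^+ 2) + b * x) <= (1 + `|b|) * `|x| - a * `|x| ^+ 2.
  have := le_trans (ler_norm (b * x)) (_ : _ <= `|b| * `|x|).
  by rewrite normrM lexx real_normK ?num_real// => /(_ isT); lra.
apply: le_trans hx _; rewrite ler_pdivlMr ?mulr_gt0//.
have := sqr_ge0 (2 * a * `|x| - (1 + `|b|)); nra.
Qed.

(** The fundamental theorem of calculus on growing symmetric intervals, with dominated convergence;
    the boundary terms are O(1/n) by the decay of F. *)
Lemma ibp_line (F F' : R -> R) (M : R) : (forall x : R, is_derive x (1 : R) F (F' x)) ->
  continuous F' -> (forall x, `|F x| <= M * wt x) -> rintg lam F' ->
  \int[lam]_x F' x = 0.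
Proof.
move=> dF cF' FM iF'.
have cF : continuous F.
  by move=> x; apply: differentiable_continuous; apply/derivable1_diffP; have [] := dF x.
pose f_ n x := F' x * \1_(`[- n.+1%:R, n.+1%:R]%classic : set R) x.
have [] := @Rint_cvg _ _ _ lam f_ F' (fun x => `|F' x|).
- move=> n; apply: measurable_funM; first exact: rintg_meas iF'.
  by apply: measurable_indic; exact: measurable_itv.
- exact: rintg_norm.
- move=> x; apply: cvg_near_cst; near=> n.
  rewrite /f_ indicE mem_set ?mulr1//= in_itv/= -ler_norml.
  by near: n; exact: near_nat_ge.
- move=> n x; rewrite /f_ normrM indicE; case: (_ \in _); rewrite ?normr1 ?mulr1//.
  by rewrite normr0 mulr0.
move=> _ h; apply: cvg_unique h _ => //.
have E n : \int[lam]_x f_ n x = F n.+1%:R - F (- n.+1%:R).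
  rewrite /f_ /Rintegral.
  transitivity (fine (\int[lam]_(x in `[(- n.+1%:R)%R, n.+1%:R]) (F' x)%:E)%E).
    congr fine; rewrite [in RHS]integral_mkcond; apply: eq_integral => x _.
    by rewrite patchE indicE; case: ifPn; rewrite ?mulr1 ?mulr0.
  rewrite (@continuous_FTC2 _ F' F)//.
  - by rewrite gtrN.
  - exact: continuous_subspaceT.
  - split.
    + by move=> x _; have [] := dF x.
    + by apply: cvg_at_right_filter; exact: cF.
    + by apply: cvg_at_left_filter; exact: cF.
  - by move=> x _; rewrite derive1E; apply: derive_val.
rewrite (_ : (fun n => _) = fun n => F n.+1%:R - F (- n.+1%:R)); last exact/funext.
apply/cvgr0Pnorm_le => e e0.
near=> n.
have wn : wt n.+1%:R <= n.+1%:R^-1.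
  rewrite lef_pV2 ?posrE ?ltr0n ?oneDsqr_gt0// expr2.
  by rewrite ler_wpDl// ler_peMr// ler1n.
have M0 : 0 <= M.
  by have := le_trans (normr_ge0 _) (FM 0); rewrite pmulr_lge0// wt_gt0.
apply: (@le_trans _ _ (2 * M / n.+1%:R)).
  apply: le_trans (ler_normB _ _) _.
  apply: le_trans (lerD (FM _) (FM _)) _; rewrite wtN.
  have := ler_wpM2l M0 wn; move: (wt _) (_^-1) => u v uv.
  by rewrite -mulrA mulrDl !mul1r lerD.
rewrite ler_pdivrMr ?ltr0n// -ler_pdivrMl//.
by near: n; exact: near_nat_ge.
Unshelve. all: by end_near. Qed.
End weight.

Section complex_derivative.
Context {R : realType}.
Local Notation C := R[i].
Local Notation lam := (@lebesgue_measure R).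

Definition cder (f f' : R -> C) : Prop := forall x : R,
  is_derive x (1 : R) (fun t => complex.Re (f t)) (complex.Re (f' x)) /\
  is_derive x (1 : R) (fun t => complex.Im (f t)) (complex.Im (f' x)).

Lemma eq_cder f f' g g' : f =1 g -> f' =1 g' -> cder f f' -> cder g g'.
Proof. by move=> /funext -> /funext ->. Qed.

Lemma cder_cst c : cder (fun=> c) (fun=> 0).
Proof. by move=> x; split; exact: is_derive_cst. Qed.

Lemma cder_real (f f' : R -> R) : (forall x : R, is_derive x (1 : R) f (f' x)) ->
  cder (fun x => (f x)%:C) (fun x => (f' x)%:C).
Proof. by move=> df x; split => //=; exact: is_derive_cst. Qed.

Lemma cderD f f' g g' : cder f f' -> cder g g' ->
  cder (fun x => f x + g x) (fun x => f' x + g' x).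
Proof.
move=> df dg x; have [fr fi] := df x; have [gr gi] := dg x; split.
- by rewrite ReD; under eq_fun do rewrite ReD; exact: is_deriveD.
- by rewrite ImD; under eq_fun do rewrite ImD; exact: is_deriveD.
Qed.

Lemma cderM f f' g g' : cder f f' -> cder g g' ->
  cder (fun x => f x * g x) (fun x => f' x * g x + f x * g' x).
Proof.
move=> df dg x; have [fr fi] := df x; have [gr gi] := dg x; split.
- under eq_fun do rewrite ReM.
  apply: is_derive_eq (is_deriveB (is_deriveM fr gr) (is_deriveM fi gi)) _.
  rewrite /GRing.scale/= ReD !ReM; ring.
- under eq_fun do rewrite ImM.
  apply: is_derive_eq (is_deriveD (is_deriveM fr gi) (is_deriveM fi gr)) _.
  rewrite /GRing.scale/= ImD !ImM; ring.
Qed.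

Lemma cder_poly (P : {poly C}) : cder (fun x => P.[x%:C]) (fun x => P^`().[x%:C]).
Proof.
elim/poly_ind: P => [|P c IH].
  by apply: eq_cder (cder_cst 0) => x; rewrite ?deriv0 horner0.
have dX : cder (fun x => x%:C) (fun=> 1).
  by apply: cder_real (fun=> 1) _ => x; exact: is_derive_id.
apply: eq_cder (cderD (cderM IH dX) (cder_cst c)) => x.
- by rewrite hornerMXaddC.
- by rewrite derivMXaddC hornerD hornerM hornerX addr0 mulr1 addrC.
Qed.

Lemma cexpiD (s t : R) : cexpi (s + t) = cexpi s * cexpi t.
Proof. by apply: complex_eqP; rewrite ?ReM ?ImM /= ?cosD ?sinD//; ring. Qed.
Lemma cexpi0 : cexpi (0 : R) = 1.
Proof. by rewrite /cexpi cos0 sin0. Qed.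
Lemma cexpiN (t : R) : cexpi (- t) = conjc (cexpi t).
Proof. by rewrite /cexpi cosN sinN. Qed.
Lemma normc_cexpi (t : R) : Normc.normc (cexpi t) = 1.
Proof. by rewrite /cexpi /= cos2Dsin2 sqrtr1. Qed.
Lemma cexpi_sum I (s : seq I) (P : pred I) (f : I -> R) :
  cexpi (\sum_(i <- s | P i) f i) = \prod_(i <- s | P i) cexpi (f i).
Proof. by rewrite (big_morph _ cexpiD cexpi0). Qed.

Lemma cmeas_cexpi d (T : measurableType d) (f : T -> R) : measurable_fun setT f ->
  cmeas (fun x => cexpi (f x)).
Proof.
move=> mf; split => /=.
- apply: (measurableT_comp (f := @cos R)) mf.
  by apply: continuous_measurable_fun; exact: continuous_cos.
- apply: (measurableT_comp (f := @sin R)) mf.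
  by apply: continuous_measurable_fun; exact: continuous_sin.
Qed.

Lemma is_derive_quadratic (a b x : R) :
  is_derive x (1 : R) (fun t => - (a * t ^+ 2) + b * t) (- (2 * a * x) + b).
Proof.
have h : is_derive x (1 : R) (fun t : R => t) 1 by exact: is_derive_id.
apply: is_derive_eq (is_deriveD (is_deriveN (is_deriveZ a (is_deriveM h h)))
  (is_deriveZ b h)) _.
rewrite /GRing.scale/=; ring.
Qed.

(* The gaussian exp(- a x^2 + b x) for a complex b. *)
Definition cgauss (a : R) (b : C) (x : R) : C :=
  (expR (- (a * x ^+ 2) + complex.Re b * x))%:C * cexpi (complex.Im b * x).

Lemma normc_cgauss a b x :
  Normc.normc (cgauss a b x) = expR (- (a * x ^+ 2) + complex.Re b * x).
Proof.
by rewrite /cgauss Normc.normcM normc_cexpi mulr1 normcR ger0_norm// expR_ge0.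
Qed.

Lemma cder_cgauss a b :
  cder (cgauss a b) (fun x => (b - (2 * a * x)%:C) * cgauss a b x).
Proof.
have de : cder (fun x => (expR (- (a * x ^+ 2) + complex.Re b * x))%:C)
   (fun x => (expR (- (a * x ^+ 2) + complex.Re b * x) *
     (- (2 * a * x) + complex.Re b))%:C).
  apply: cder_real => x.
  exact: is_derive1_comp (is_derive_expR _) (is_derive_quadratic _ _ _).
have dx (c x : R) : is_derive x (1 : R) (fun t => c * t) c.
  apply: is_derive_eq (is_deriveZ c (is_derive_id _ _)) _.
  by rewrite /GRing.scale/= mulr1.
have dc : cder (fun x => cexpi (complex.Im b * x))
   (fun x => (0 +i* complex.Im b)%C * cexpi (complex.Im b * x)).
  move=> x; split.
  - apply: is_derive_eq (is_derive1_comp (is_derive_cos _) (dx _ _)) _.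
    by rewrite ReM /=; ring.
  - apply: is_derive_eq (is_derive1_comp (is_derive_sin _) (dx _ _)) _.
    by rewrite ImM /=; ring.
apply: eq_cder (cderM de dc) => // x; rewrite /cgauss.
by case: b {de dc} => b1 b2 /=; apply: complex_eqP; rewrite /= ?(ReD, ImD, ReM, ImM, ReN, ImN) /=; ring.
Qed.

Lemma cder_continuous f f' : cder f f' ->
  continuous (fun x => complex.Re (f x)) /\ continuous (fun x => complex.Im (f x)).
Proof.
by move=> df; split => x; apply: differentiable_continuous;
  apply/derivable1_diffP; have [[? ?] [? ?]] := df x.
Qed.

Lemma cder_cmeas f f' : cder f f' -> @cmeas _ (measurableTypeR R) R f.
Proof.
by move=> /cder_continuous [? ?]; split; exact: continuous_measurable_fun.
Qed.

Variable (a : R).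
Hypothesis a0 : 0 < a.

Let pg (P : {poly C}) b x := P.[x%:C] * cgauss a b x.

Let cder_pg P b : cder (pg P b) (pg (P^`() + (b%:P - (2 * a)%:C *: 'X) * P) b).
Proof.
apply: eq_cder (cderM (cder_poly P) (cder_cgauss a b)) => // x.
rewrite /pg hornerD hornerM hornerD hornerN hornerC hornerZ hornerX rmorphM/=.
by move: (P.[_]) (P^`().[_]) (cgauss a b x) => p p' g; ring.
Qed.

Let pg_bound P b : exists2 M, 0 <= M & forall x, Normc.normc (pg P b x) <= M * wt x.
Proof.
have [M M0 H] := poly_gauss_bounded P (complex.Re b) a0; exists M => // x.
by rewrite /pg Normc.normcM normc_cgauss.
Qed.

Lemma cintg_poly_cgauss P b : @cintg _ (measurableTypeR R) R lam (fun x => P.[x%:C] * cgauss a b x).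
Proof.
have [M M0 H] := pg_bound P b.
apply: (cintg_le (cder_cmeas (cder_pg P b)) _ H).
exact/rintgZ/rintg_wt.
Qed.

(** The integrand is the derivative of P times the gaussian, again a polynomial times the same
    gaussian. The integrations by parts on the line below are all instances of this identity. *)
Lemma cint_deriv_poly_cgauss P b :
  cint lam (fun x => (P^`() + (b%:P - (2 * a)%:C *: 'X) * P).[x%:C] * cgauss a b x) = 0.
Proof.
have [M M0 H] := pg_bound P b; set P' := (_ + _).
have [ir ii] := cintg_poly_cgauss P' b.
have [cr ci] := cder_continuous (cder_pg P' b).
apply: complex_eqP => /=.
- apply: (@ibp_line R (fun x => complex.Re (pg P b x)) _ M) => // x.
    exact: (cder_pg P b x).1.
  exact: le_trans (Re_le_normc _) (H x).
- apply: (@ibp_line R (fun x => complex.Im (pg P b x)) _ M) => // x.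
    exact: (cder_pg P b x).2.
  exact: le_trans (Im_le_normc _) (H x).
Qed.

Lemma rintg_gauss : rintg lam (fun x => expR (- (a * x ^+ 2))).
Proof.
have [+ _] := cintg_poly_cgauss 1 0; apply: eq_rintg => x.
have -> // : 1.[x%:C] * cgauss a 0 x = (expR (- (a * x ^+ 2)))%:C.
by rewrite hornerC mul1r /cgauss [complex.Re 0]/= [complex.Im 0]/= !mul0r addr0 cexpi0 mulr1.
Qed.

Lemma Rint_gauss : \int[lam]_x expR (- (a * x ^+ 2)) = Num.sqrt (pi / a).
Proof.
(* Up to a factor, the gaussian is the normal density of variance 1 / (2 a), whose integral is 1. *)
pose s := Num.sqrt (2 * a)^-1.
have s0 : 0 < s by rewrite sqrtr_gt0 invr_gt0 mulr_gt0.
have ss : s ^+ 2 = (2 * a)^-1 by rewrite sqr_sqrtr// invr_ge0 mulr_ge0// ltW.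
have : \int[lam]_x normal_pdf 0 s x = 1 by rewrite /Rintegral integral_normal_pdf.
rewrite normal_pdfE ?lt0r_neq0//.
under eq_Rintegral => x _.
  rewrite /normal_fun subr0 ss (_ : - x ^+ 2 / _ = - (a * x ^+ 2)); last first.
    by rewrite -mulr_natl; field; rewrite lt0r_neq0.
  over.
rewrite (RintZ _ rintg_gauss) /normal_peak ss => H.
have pk : Num.sqrt ((2 * a)^-1 * pi *+ 2) = Num.sqrt (pi / a).
  by congr Num.sqrt; rewrite -mulr_natl; field; rewrite lt0r_neq0.
rewrite pk in H; apply/esym.
have q0 : Num.sqrt (pi / a) != 0 by rewrite lt0r_neq0// sqrtr_gt0 divr_gt0// pi_gt0.
by rewrite -[LHS]mulr1 -H mulrA divff// mul1r.
Qed.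

(* The Fourier transform of the gaussian, as the solution of 2 a phi' = - xi phi. *)
Lemma cint_gauss_cexpi (xi : R) :
  cint lam (fun x => (expR (- (a * x ^+ 2)))%:C * cexpi (xi * x)) =
  (Num.sqrt (pi / a) * expR (- (xi ^+ 2 / (4 * a))))%:C.
Proof.
have gE x t : cgauss a (0 +i* t)%C x = (expR (- (a * x ^+ 2)))%:C * cexpi (t * x).
  by rewrite /cgauss /= mul0r addr0.
have iP P t : cintg lam (fun x : measurableTypeR R => P.[x%:C] * ((expR (- (a * x ^+ 2)))%:C * cexpi (t * x))).
  by apply: eq_cintg (cintg_poly_cgauss P (0 +i* t)%C) => x; rewrite gE.
have iG t : cintg lam (fun x : measurableTypeR R => (expR (- (a * x ^+ 2)))%:C * cexpi (t * x)).
  by apply: eq_cintg (iP 1 t) => x; rewrite hornerC mul1r.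
pose phi t := \int[lam]_x (expR (- (a * x ^+ 2)) * cos (t * x)).
pose psi t := \int[lam]_x (expR (- (a * x ^+ 2)) * sin (t * x)).
have E0 t : cint lam (fun x => (expR (- (a * x ^+ 2)))%:C * cexpi (t * x)) = (phi t +i* psi t)%C.
  by rewrite /cint /phi /psi; congr (_ +i* _)%C; apply: eq_Rintegral => x _; rewrite ?ReM ?ImM /=; ring.
(* The sine part is odd, and Lebesgue measure is invariant under reflection. *)
have psi0 t : psi t = 0.
  have i2 : rintg lam (fun x : measurableTypeR R => expR (- (a * x ^+ 2)) * sin (t * x)).
    by have [_] := iG t; apply: eq_rintg => x; rewrite ImM /=; ring.
  have := mpres_Rint (@lebesgue_opp R) i2.
  under [X in _ = X -> _]eq_Rintegral do rewrite sqrrN mulrN sinN mulrN -mulN1r.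
  by rewrite (RintZ _ i2) -/(psi t); lra.
have dphi t : is_derive t (1 : R) phi (- (t / (2 * a)) * phi t).
  pose f s x := expR (- (a * x ^+ 2)) * cos (s * x).
  have df s x : is_derive s (1 : R) (f ^~ x) (- (x * expR (- (a * x ^+ 2)) * sin (s * x))).
    have ds : is_derive s (1 : R) (fun t => t * x) x.
      have := is_deriveM (is_derive_id s (1 : R)) (is_derive_cst x s (1 : R)).
      by move=> h; apply: is_derive_eq h _; rewrite /GRing.scale/=; ring.
    apply: is_derive_eq (is_deriveZ (expR (- (a * x ^+ 2))) (is_derive1_comp (is_derive_cos _) ds)) _.
    by rewrite /GRing.scale/=; ring.
  have pE s x : partial1of2 f s x = - (x * expR (- (a * x ^+ 2)) * sin (s * x)).
    by rewrite partial1of2E; exact: derive_val.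
  have iX : rintg lam (fun x : measurableTypeR R => `|x * expR (- (a * x ^+ 2))|).
    apply: rintg_norm; have [+ _] := iP 'X 0; apply: eq_rintg => x.
    by rewrite hornerX mul0r cexpi0 mulr1 -rmorphM.
  have ifs s : rintg lam (f s).
    by have [+ _] := iG s; apply: eq_rintg => x; rewrite ReM /=; rewrite /f; ring.
  have tI : (`]t - 1, t + 1[%classic : set R) t by rewrite /= in_itv/= ltrBlDr ltrDl ltr01.
  have Gub (x y : R) : `]t - 1, t + 1[%classic x -> [set: R] y ->
      `|partial1of2 f x y| <= `|y * expR (- (a * y ^+ 2))|.
    by move=> _ _; rewrite pE normrN normrM ler_piMr// ler_norml sin_geN1 sin_le1.
  have dfs (x y : R) : `]t - 1, t + 1[%classic x -> [set: R] y -> derivable (f ^~ y) x 1.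
    by move=> _ _; have [] := df x y.
  have D1 := @derivable_under_integral R _ (measurableTypeR R) lam f setT measurableT t (t - 1) (t + 1) tI (fun s _ => ifs s) dfs (fun x => `|x * expR (- (a * x ^+ 2))|) (fun=> normr_ge0 _) iX Gub.
  have D2 := @differentiation_under_integral R _ (measurableTypeR R) lam f setT measurableT t (t - 1) (t + 1) tI (fun s _ => ifs s) dfs (fun x => `|x * expR (- (a * x ^+ 2))|) (fun=> normr_ge0 _) iX Gub.
  apply: DeriveDef => //; rewrite -derive1E [LHS]D2.
  (* For P = 1 the imaginary part of the identity reads t phi(t) = 2 a J, where -J is the derivative
     found under the integral sign. *)
  have := cint_deriv_poly_cgauss 1 (0 +i* t)%C.
  have -> : 1^`() + ((0 +i* t)%C%:P - (2 * a)%:C *: 'X) * 1 = (0 +i* t)%C%:P - (2 * a)%:C *: 'X :> {poly C}.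
    by rewrite -polyC1 derivC add0r mulr1.
  have E x : ((0 +i* t)%C%:P - (2 * a)%:C *: 'X).[x%:C] * cgauss a (0 +i* t)%C x =
      (0 +i* t)%C * ((expR (- (a * x ^+ 2)))%:C * cexpi (t * x)) -
      (2 * a)%:C * ('X.[x%:C] * ((expR (- (a * x ^+ 2)))%:C * cexpi (t * x))).
    by rewrite gE hornerD hornerN hornerC hornerZ hornerX; ring.
  move=> H0; have := etrans (esym (eq_cint lam E)) H0.
  rewrite cintB; [|exact: cintgZ|exact: cintgZ].
  rewrite !cintZ// E0 psi0 => /(congr1 (@complex.Im R)).
  rewrite ImD ImN !ImM /= !(mul0r, add0r, addr0, mulr0) => H.
  have -> : \int[lam]_y partial1of2 f t y = - \int[lam]_x complex.Im ('X.[x%:C] * ((expR (- (a * x ^+ 2)))%:C * cexpi (t * x))).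
    rewrite -mulN1r -RintZ; last exact: (iP 'X t).2.
    by apply: eq_Rintegral => x _; rewrite pE hornerX !ImM /=; ring.
  move: H; set J := \int[lam]_x _ => H.
  have -> : J = t * phi t / (2 * a).
    apply: (mulfI (_ : 2 * a != 0)); first by rewrite mulf_neq0// lt0r_neq0.
    rewrite mulrC [RHS]mulrC mulfVK ?mulf_neq0 ?lt0r_neq0// mulrC; lra.
  by field; rewrite lt0r_neq0.
(* The quotient by the expected solution has derivative 0, so it keeps its value at 0. *)
pose g t := phi t * expR (t ^+ 2 / (4 * a)).
have dg t : is_derive t (1 : R) g 0.
  have dq : is_derive t (1 : R) (fun t : R => t ^+ 2 / (4 * a)) (t / (2 * a)).
    have h : is_derive t (1 : R) (fun t : R => t) 1 by exact: is_derive_id.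
    apply: is_derive_eq (is_deriveM (is_deriveM h h) (is_derive_cst (4 * a)^-1 t (1 : R))) _.
    by rewrite /GRing.scale/=; field; rewrite lt0r_neq0.
  apply: is_derive_eq (is_deriveM (dphi t) (is_derive1_comp (is_derive_expR _) dq)) _.
  by rewrite /GRing.scale/=; ring.
have gc : g xi = g 0 by exact: is_derive_0_is_cst.
rewrite E0 psi0; congr (_ +i* _)%C.
have phi0 : phi 0 = Num.sqrt (pi / a).
  by rewrite -Rint_gauss; apply: eq_Rintegral => x _; rewrite mul0r cos0 mulr1.
move: gc; rewrite /g expr0n/= mul0r expR0 mulr1 phi0 => <-.
by rewrite -mulrA -expRD subrr expR0 mulr1.
Qed.

End complex_derivative.

(** * Hermite functions and coherent states of the line *)

Section hermite_line.
Context {R : realType}.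
Local Notation C := R[i].
Local Notation lam := (@lebesgue_measure R).
Local Notation toC := (map_poly (real_complex R)).

(** The Hermite polynomials in the physicists' normalization, generated by the ladder operator 2 X -
    d/dX. *)
Fixpoint herm (n : nat) : {poly R} :=
  if n is m.+1 then 2 *: ('X * herm m) - (herm m)^`() else 1.

Lemma hermS n : herm n.+1 = 2 *: ('X * herm n) - (herm n)^`().
Proof. by []. Qed.

Lemma herm0 : herm 0 = 1%:P. Proof. by rewrite polyC1. Qed.

Lemma deriv_herm n : (herm n)^`() = (2 * n%:R) *: herm n.-1.
Proof.
elim: n => [|n IH]; first by rewrite herm0 derivC mulr0 scale0r.
rewrite hermS derivB derivZ derivM derivX mul1r.
case: n IH => [_|m IH].
  by rewrite herm0 !derivC mulr0 addr0 subr0 mulr1.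
rewrite IH [m.+1.-1]/= [m.+2.-1]/= derivZ -scalerAr.
have -> : (2 * m.+2%:R) *: herm m.+1 = 2 *: herm m.+1 + (2 * m.+1%:R) *: herm m.+1.
  by rewrite -scalerDl; congr (_ *: _); rewrite -[m.+2%:R]natr1; ring.
rewrite [X in _ + _ *: X]hermS; move: (herm m.+1) ('X * herm m) ((herm m)^`()) => w u v.
by apply/polyP => k; rewrite !(coefD, coefN, coefZ); ring.
Qed.

(** The squared norm of [herm n] for the weight exp(- x^2). *)
Definition hcst (n : nat) : R := 2 ^+ n * n`!%:R * Num.sqrt pi.
Lemma hcst_gt0 n : 0 < hcst n.
Proof. by rewrite /hcst !mulr_gt0 ?exprn_gt0 ?ltr0n ?fact_gt0// sqrtr_gt0 pi_gt0. Qed.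

Definition hfun (n : nat) (x : R) : R :=
  (Num.sqrt (hcst n))^-1 * ((herm n).[x] * expR (- (x ^+ 2 / 2))).

Lemma hornerC_map (P : {poly R}) (x : R) : (toC P).[x%:C] = (P.[x])%:C.
Proof. by rewrite horner_map. Qed.

Let one0 : 0 < (1 : R). Proof. exact: ltr01. Qed.

Let gint (P : {poly R}) : R := \int[lam]_x (P.[x] * expR (- (1 * x ^+ 2))).

Let gE (P : {poly R}) x : (toC P).[x%:C] * cgauss 1 0 x = (P.[x] * expR (- (1 * x ^+ 2)))%:C.
Proof.
rewrite hornerC_map /cgauss [complex.Re 0]/= [complex.Im 0]/= !mul0r addr0 cexpi0 mulr1.
by rewrite rmorphM.
Qed.

Lemma rintg_poly_gauss1 (P : {poly R}) : rintg lam (fun x : measurableTypeR R => P.[x] * expR (- (1 * x ^+ 2))).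
Proof. by have [+ _] := cintg_poly_cgauss one0 (toC P) 0; apply: eq_rintg => x; rewrite gE. Qed.

Let gintD (P Q : {poly R}) : gint (P + Q) = gint P + gint Q.
Proof.
rewrite /gint -(RintD (rintg_poly_gauss1 P) (rintg_poly_gauss1 Q)).
by apply: eq_Rintegral => x _; rewrite hornerD mulrDl.
Qed.

Let gintZ (c : R) (P : {poly R}) : gint (c *: P) = c * gint P.
Proof.
rewrite /gint -(RintZ _ (rintg_poly_gauss1 P)).
by apply: eq_Rintegral => x _; rewrite hornerZ -mulrA.
Qed.

Let gint_deriv (P : {poly R}) : gint P^`() = gint (2 *: ('X * P)).
Proof.
have := cint_deriv_poly_cgauss one0 (toC P) 0.
have -> : (toC P)^`() + (0%:P - (2 * 1)%:C *: 'X) * (toC P) = (toC (P^`() - 2 *: ('X * P))).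
  rewrite mulr1 rmorphB/= deriv_map map_polyZ/= rmorphM/= map_polyX sub0r mulNr.
  by rewrite scalerAl.
under eq_fun do rewrite gE.
rewrite cint_real => -[] H; apply/eqP; rewrite -subr_eq0; apply/eqP.
rewrite -[X in _ - X]mul1r -mulNr -gintZ scaleN1r -gintD; exact: H.
Qed.

(** For the weight exp(- x^2), the ladder operator 2 x - d/dx is the adjoint of d/dx. Moving it
    across the product reduces orthogonality to a lower degree. *)
Let gint_hermS m (P : {poly R}) : gint (herm m.+1 * P) = gint (herm m * P^`()).
Proof.
have := gint_deriv (herm m * P).
rewrite derivM gintD mulrA [herm m.+1]hermS mulrBl gintD -scalerAl.
rewrite -[- ((herm m)^`() * P)]scaleN1r gintZ.
by rewrite (gintZ (-1)); move: (gint _) (gint _) (gint _) => u v w; lra.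
Qed.

Let gint1 : gint 1 = Num.sqrt pi.
Proof.
rewrite /gint; under eq_Rintegral do rewrite hornerC mul1r.
by rewrite (Rint_gauss one0) divr1.
Qed.

Lemma hermite_orthogonal m n : gint (herm m * herm n) = (m == n)%:R * hcst n.
Proof.
elim: m n => [|m IH] n.
  case: n => [|n]; last first.
    by rewrite mul1r -[herm _]mulr1 gint_hermS -polyC1 derivC mulr0 -(scale0r 0) gintZ !mul0r.
  by rewrite mul1r gint1 /hcst expr0 fact0 !mul1r.
rewrite gint_hermS deriv_herm -scalerAr gintZ IH.
case: n => [|n]; first by rewrite mulr0 !mul0r.
by rewrite eqSS /= /hcst exprS factS natrM; ring.
Qed.

Lemma hfunM m n x : hfun m x * hfun n x = (Num.sqrt (hcst m))^-1 * (Num.sqrt (hcst n))^-1 *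
  ((herm m * herm n).[x] * expR (- (1 * x ^+ 2))).
Proof.
rewrite /hfun hornerM (_ : - (1 * x ^+ 2) = - (x ^+ 2 / 2) + - (x ^+ 2 / 2)); last by field.
by rewrite expRD; ring.
Qed.

Lemma hfun_orthonormal m n : rintg lam (fun x : measurableTypeR R => hfun m x * hfun n x) /\
  \int[lam]_x (hfun m x * hfun n x) = (m == n)%:R.
Proof.
split.
  apply: eq_rintg (rintgZ ((Num.sqrt (hcst m))^-1 * (Num.sqrt (hcst n))^-1) (rintg_poly_gauss1 (herm m * herm n))) => x.
  by rewrite hfunM.
under eq_Rintegral do rewrite hfunM.
rewrite (RintZ _ (rintg_poly_gauss1 _)) -/(gint _) hermite_orthogonal.
case: eqVneq => [->|_]; last by rewrite mul0r mulr0.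
rewrite mul1r -invfM -expr2 sqr_sqrtr ?mulVf ?lt0r_neq0 ?hcst_gt0//.
exact/ltW/hcst_gt0.
Qed.

Lemma X_herm n : 'X * herm n = 2^-1 *: herm n.+1 + n%:R *: herm n.-1.
Proof.
rewrite hermS deriv_herm scalerBr !scalerA (mulrA 2^-1) mulVf ?pnatr_eq0// mul1r scale1r.
by rewrite subrK.
Qed.

(** Multiplication by X sends a Hermite polynomial to a combination of its two neighbours, so every
    X^k, which is X^k times [herm 0], is reached. *)
Lemma herm_span (Z : {poly R} -> Prop) : (forall P Q, Z P -> Z Q -> Z (P + Q)) ->
  (forall c P, Z P -> Z (c *: P)) -> (forall n, Z (herm n)) -> forall P, Z P.
Proof.
move=> ZD ZZ Zh; have ZX k n : Z ('X^k * herm n).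
  elim: k n => [|k IH] n; first by rewrite expr0 mul1r.
  rewrite exprSr -mulrA X_herm mulrDr -!scalerAr; apply: ZD; apply: ZZ; exact: IH.
move=> P; rewrite -[P]coefK poly_def; elim/big_ind : _ => //.
- by rewrite -(scale0r (herm 0)); exact: ZZ.
- by move=> i _; apply: ZZ; have := ZX i 0; rewrite mulr1.
Qed.

Lemma herm_eigen n : (herm n)^`()^`() - 2 *: ('X * (herm n)^`()) = - (2 * n%:R) *: herm n.
Proof.
case: n => [|n]; first by rewrite herm0 derivC mulr0 scaler0 subr0 deriv0 mulr0 oppr0 scale0r.
rewrite [(herm n.+1)^`()]deriv_herm [n.+1.-1]/= derivZ -scalerAr [in RHS]hermS.
move: ('X * herm n) ((herm n)^`()) => u v.
by apply/polyP => k; rewrite !(coefD, coefN, coefZ); ring.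
Qed.

Lemma hfun_wt n : exists2 M, 0 <= M & forall x, `|hfun n x| <= M * wt x.
Proof.
have [M M0 H] := @poly_gauss_bounded R (toC (herm n)) (1/2) 0 (divr_gt0 ltr01 (ltr0n _ 2)).
exists ((Num.sqrt (hcst n))^-1 * M); first by rewrite mulr_ge0// invr_ge0 sqrtr_ge0.
move=> x; have c0 : 0 <= (Num.sqrt (hcst n))^-1 by rewrite invr_ge0 sqrtr_ge0.
rewrite /hfun normrM (ger0_norm c0) -[leRHS]mulrA; apply: ler_wpM2l => //.
apply: le_trans (H x).
rewrite hornerC_map normcR normrM (ger0_norm (expR_ge0 _)) mul0r addr0 div1r.
by rewrite (mulrC 2^-1).
Qed.

Lemma hfun_continuous n : continuous (hfun n).
Proof.
move=> x; apply: cvgM; first exact: cvg_cst.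
apply: cvgM; first exact: continuous_horner.
apply: (cvg_comp (fun x => - (x ^+ 2 / 2)) expR); last exact: continuous_expR.
apply: (@cvgN _ R^o); apply: cvgM; last exact: cvg_cst.
exact: sqr_continuous.
Qed.

Lemma measurable_hfun n : measurable_fun [set: R] (hfun n).
Proof. by apply: continuous_measurable_fun; exact: hfun_continuous. Qed.

(* The normalized coherent-state transforms of the Hermite functions. *)
Definition psi1 (m : nat) (x zeta : R) : C :=
  ((Num.sqrt (2 * pi * 2 ^+ m * m`!%:R))^-1 * expR (- ((x ^+ 2 + zeta ^+ 2) / 4)))%:C *
  cexpi (zeta * x / 2) * (x +i* zeta)%C ^+ m.

(** Integration by parts turns the ladder operator into multiplication by b = x + i zeta. Hence the
    transform of the m-th Hermite polynomial is b^m times that of 1, which is the Fourier transform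
    of a gaussian. *)
Lemma coherent_hfun m x zeta :
  cint lam (fun s => (expR (- ((x - s) ^+ 2 / 2)) * hfun m s)%:C * cexpi (s * zeta)) =
  (Num.sqrt (2 * pi * Num.sqrt pi))%:C * psi1 m x zeta.
Proof.
pose b : C := (x +i* zeta)%C.
pose K (P : {poly R}) := cint lam (fun s => (toC P).[s%:C] * cgauss 1 b s).
have iK P : cintg lam (fun s : measurableTypeR R => (toC P).[s%:C] * cgauss 1 b s).
  exact: cintg_poly_cgauss.
have KS n : K (herm n.+1) = b * K (herm n).
  have := cint_deriv_poly_cgauss one0 (toC (herm n)) b.
  have -> : (toC (herm n))^`() + (b%:P - (2 * 1)%:C *: 'X) * (toC (herm n)) =
      b *: (toC (herm n)) - (toC (herm n.+1)).
    rewrite mulr1 hermS rmorphB/= deriv_map map_polyZ/= rmorphM/= map_polyX mulrBl mul_polyC.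
    by rewrite -scalerAl opprB addrCA.
  have E s : (b *: (toC (herm n)) - (toC (herm n.+1))).[s%:C] * cgauss 1 b s =
     b * ((toC (herm n)).[s%:C] * cgauss 1 b s) - (toC (herm n.+1)).[s%:C] * cgauss 1 b s.
    by rewrite hornerD hornerN hornerZ mulrBl -mulrA.
  move=> H0; have := etrans (esym (eq_cint lam E)) H0.
  by rewrite (cintB (cintgZ b (iK _)) (iK _)) (cintZ _ (iK _)) => /eqP; rewrite subr_eq0 => /eqP.
have KE n : K (herm n) = b ^+ n * K 1.
  by elim: n => [|n IH]; rewrite ?expr0 ?mul1r// KS IH exprS mulrA.
(* Completing the square moves the gaussian to x / 2, which produces the phase exp(i zeta x / 2). *)
have K1 : K 1 = (Num.sqrt pi * expR ((x ^+ 2 - zeta ^+ 2) / 4))%:C * cexpi (zeta * x / 2).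
  have i1 : cintg lam (fun s : measurableTypeR R => (expR (- (1 * s ^+ 2)))%:C * cexpi (zeta * s)).
    apply: eq_cintg (cintg_poly_cgauss one0 1 (0 +i* zeta)%C) => s.
    by rewrite hornerC mul1r /cgauss /= mul0r addr0.
  have := mpres_cint (lebesgue_addr (- (x / 2))) i1.
  rewrite cint_gauss_cexpi// => H.
  have E s : (toC 1).[s%:C] * cgauss 1 b s = ((expR (x ^+ 2 / 4))%:C * cexpi (zeta * x / 2)) *
      ((expR (- (1 * (s - x / 2) ^+ 2)))%:C * cexpi (zeta * (s - x / 2))).
    rewrite rmorph1 hornerC mul1r /cgauss /b /=.
    rewrite (_ : - (1 * s ^+ 2) + x * s = x ^+ 2 / 4 + - (1 * (s - x / 2) ^+ 2)); last by field.
    rewrite (_ : zeta * s = zeta * x / 2 + zeta * (s - x / 2)); last by field.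
    by rewrite expRD cexpiD rmorphM/=; ring.
  rewrite /K (eq_cint lam E) cintZ; last exact: (mpres_cintg (lebesgue_addr (- (x / 2))) i1).
  rewrite -[cint lam _]H divr1 mulrAC -rmorphM/=; congr (_%:C * _).
  by rewrite mulrCA -expRD; congr (_ * expR _); field.
have E s : (expR (- ((x - s) ^+ 2 / 2)) * hfun m s)%:C * cexpi (s * zeta) =
    ((Num.sqrt (hcst m))^-1 * expR (- (x ^+ 2 / 2)))%:C * ((toC (herm m)).[s%:C] * cgauss 1 b s).
  have key : expR (- ((x - s) ^+ 2 / 2)) * expR (- (s ^+ 2 / 2)) =
      expR (- (x ^+ 2 / 2)) * expR (- (1 * s ^+ 2) + x * s).
    by rewrite -!expRD; congr expR; field.
  rewrite hornerC_map /hfun /cgauss /b /= (mulrC s zeta).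
  rewrite (_ : expR (- ((x - s) ^+ 2 / 2)) * _ = (Num.sqrt (hcst m))^-1 * (herm m).[s] *
    (expR (- ((x - s) ^+ 2 / 2)) * expR (- (s ^+ 2 / 2)))); last by ring.
  by rewrite key !rmorphM/=; ring.
rewrite (eq_cint lam E) (cintZ _ (iK _)) -/(K _) KE K1 /psi1 -/b.
rewrite -/b; set c := cexpi _; set bm := b ^+ m.
have sp : 0 < Num.sqrt pi :> R by rewrite sqrtr_gt0 pi_gt0.
pose t := 2 ^+ m * m`!%:R : R.
have t0 : 0 < t by rewrite mulr_gt0 ?exprn_gt0 ?ltr0n ?fact_gt0.
have E1 : (Num.sqrt (hcst m))^-1 * Num.sqrt pi =
    Num.sqrt (2 * pi * Num.sqrt pi) * (Num.sqrt (2 * pi * 2 ^+ m * m`!%:R))^-1.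
  have -> : 2 * pi * 2 ^+ m * m`!%:R = 2 * pi * t by rewrite /t; ring.
  rewrite /hcst -/t sqrtrM ?(ltW t0)// [Num.sqrt (2 * pi * Num.sqrt pi)]sqrtrM; last first.
    by rewrite mulr_ge0// pi_ge0.
  rewrite [Num.sqrt (2 * pi * t)]sqrtrM; last by rewrite mulr_ge0// pi_ge0.
  have q : Num.sqrt pi = Num.sqrt (Num.sqrt pi) ^+ 2 :> R by rewrite sqr_sqrtr// ltW.
  have p2 : 0 < 2 * pi :> R by rewrite mulr_gt0// pi_gt0.
  have n1 : Num.sqrt (2 * pi) != 0 :> R by rewrite lt0r_neq0// sqrtr_gt0.
  have n2 : Num.sqrt t != 0 by rewrite lt0r_neq0// sqrtr_gt0.
  have n3 : Num.sqrt (Num.sqrt pi) != 0 :> R by rewrite lt0r_neq0// sqrtr_gt0.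
  by rewrite {2}q; field; rewrite ?n1 ?n2 ?n3.
have E2 : expR (- (x ^+ 2 / 2)) * expR ((x ^+ 2 - zeta ^+ 2) / 4) =
    expR (- ((x ^+ 2 + zeta ^+ 2) / 4)).
  by rewrite -expRD; congr expR; field.
rewrite (_ : _ * (bm * _) = ((Num.sqrt (hcst m))^-1 * Num.sqrt pi *
    (expR (- (x ^+ 2 / 2)) * expR ((x ^+ 2 - zeta ^+ 2) / 4)))%:C * (c * bm)); last first.
  by rewrite !rmorphM/=; ring.
by rewrite E1 E2 !rmorphM/=; ring.
Qed.
End hermite_line.

(** * Orthonormality of the coherent-state transforms *)

Section coherent_orthonormal.
Context {R : realType}.
Local Notation C := R[i].
Local Notation lam := (@lebesgue_measure R).
Local Notation pl := (prodm lam lam).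

Let w (x : R) : R := expR (- (2^-1 * x ^+ 2)).
(** With z = x + i y this is z^m times the n-th power of the conjugate of z, times exp(- |z|^2 / 2):
    orthogonality reduces to the integrals of these monomials. *)
Let f (m n : nat) (p : measurableTypeR R * measurableTypeR R) : C :=
  (p.1 +i* p.2)%C ^+ m * (p.1 -i* p.2)%C ^+ n * (w p.1 * w p.2)%:C.

Let half0 : 0 < 2^-1 :> R. Proof. by rewrite invr_gt0. Qed.

Let meas_f m n : cmeas (f m n).
Proof.
have m1 : cmeas (fun p : measurableTypeR R * measurableTypeR R => (p.1 +i* p.2)%C).
  by split => /=; [exact: measurable_fst|exact: measurable_snd].
have mX (u : measurableTypeR R * measurableTypeR R -> C) k : cmeas u -> cmeas (fun p => u p ^+ k).
  move=> mu; elim: k => [|k IH]; first by under eq_fun do rewrite expr0; exact: cmeas_cst.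
  by under eq_fun do rewrite exprS; exact: cmeasM.
have mw : measurable_fun [set: measurableTypeR R] (w : measurableTypeR R -> measurableTypeR R).
  exact: rintg_meas (rintg_gauss half0).
apply: cmeasM.
  by apply: cmeasM; apply: mX => //; exact: cmeas_conj m1.
apply: cmeas_real; apply: measurable_funM.
  exact: measurableT_comp mw measurable_fst.
exact: measurableT_comp mw measurable_snd.
Qed.

Let cintg_f m n : cintg pl (f m n).
Proof.
pose Q : {poly C} := (1 + 'X ^+ 2) ^+ (m + n).
have [M M0 H] := poly_gauss_bounded Q 0 half0.
have HQ x : (1 + x ^+ 2) ^+ (m + n) * w x <= M * wt x.
  apply: le_trans (H x); rewrite mul0r addr0 ler_wpM2r ?expR_ge0//.
  rewrite horner_exp hornerD hornerXn hornerC (_ : 1 + x%:C ^+ 2 = (1 + x ^+ 2)%:C); last first.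
    by rewrite rmorphD rmorph1 rmorphXn.
  by rewrite -rmorphXn normcR ler_norm.
have iw := rintgX (rintgZ M (@rintg_wt R)) (rintgZ M (@rintg_wt R)).
apply: (cintg_le (meas_f m n) iw) => -[x y] /=; rewrite /f /=.
have z1 : Normc.normc (x +i* y)%C <= (1 + x ^+ 2) * (1 + y ^+ 2).
  apply: (@le_trans _ _ (1 + (x ^+ 2 + y ^+ 2))).
    rewrite -ler_sqr ?nnegrE ?normc_ge0 ?addr_ge0 ?sqr_ge0// normc_sqr /=.
    by have := addr_ge0 (sqr_ge0 x) (sqr_ge0 y); nra.
  have := mulr_ge0 (sqr_ge0 x) (sqr_ge0 y); nra.
have nX (u : C) k : Normc.normc (u ^+ k) = Normc.normc u ^+ k.
  by elim: k => [|k IH]; rewrite ?expr0 ?Normc.normc1// !exprS Normc.normcM IH.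
rewrite !Normc.normcM !nX (_ : (x -i* y)%C = conjc (x +i* y)%C)// normc_conj -exprD.
rewrite normcR ger0_norm ?mulr_ge0 ?expR_ge0//.
apply: (@le_trans _ _ (((1 + x ^+ 2) * (1 + y ^+ 2)) ^+ (m + n) * (w x * w y))).
  by rewrite ler_wpM2r ?mulr_ge0 ?expR_ge0// lerXn2r ?nnegrE ?normc_ge0// (le_trans (normc_ge0 _) z1).
rewrite exprMn mulrACA; apply: ler_pM; rewrite ?HQ// mulr_ge0 ?expR_ge0// exprn_ge0//.
  exact/ltW/oneDsqr_gt0.
exact/ltW/oneDsqr_gt0.
Qed.

Let J m n := cint pl (f m n).

(** The polynomial factor of the derivative of A^m B^n exp(- t^2 / 2), to be used with A and B the
    restrictions of z and of its conjugate to a horizontal or vertical line. *)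
Let lineP (A B : {poly C}) m n : {poly C} := m%:R *: (A^`() * A ^+ m.-1 * B ^+ n) +
  n%:R *: (B^`() * A ^+ m * B ^+ n.-1) - 'X * (A ^+ m * B ^+ n).

Let lineF (A B : {poly C}) m n (t : R) : C := (m%:R * (A^`().[t%:C] * A.[t%:C] ^+ m.-1 * B.[t%:C] ^+ n) +
  n%:R * (B^`().[t%:C] * A.[t%:C] ^+ m * B.[t%:C] ^+ n.-1) -
  t%:C * (A.[t%:C] ^+ m * B.[t%:C] ^+ n)) * (w t)%:C.

Let line (A B : {poly C}) m n :
  cintg lam (lineF A B m n : measurableTypeR R -> C) /\ cint lam (lineF A B m n) = 0.
Proof.
have E t : (lineP A B m n).[t%:C] * cgauss 2^-1 0 t = lineF A B m n t.
  rewrite /lineF /lineP !(hornerD, hornerN, hornerZ, hornerM, horner_exp, hornerX); congr (_ * _).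
  by rewrite /cgauss [complex.Re 0]/= [complex.Im 0]/= !mul0r addr0 cexpi0 mulr1.
split; first by apply: eq_cintg (cintg_poly_cgauss half0 (lineP A B m n) 0) => t; rewrite E.
rewrite -(eq_cint lam E) -[RHS](cint_deriv_poly_cgauss half0 (A ^+ m * B ^+ n) 0).
apply: eq_cint => t; congr (_.[_] * _); apply/esym.
rewrite mulfV// scale1r sub0r mulNr; congr (_ - _).
rewrite derivM !deriv_exp mulrnAl mulrnAr !scaler_nat; congr (_ *+ m + _ *+ n).
by rewrite mulrCA mulrA.
Qed.

Let z1 (y : R) : {poly C} := 'X + (0 +i* y)%C%:P.
Let z1b (y : R) : {poly C} := 'X - (0 +i* y)%C%:P.
Let z2 (x : R) : {poly C} := (0 +i* 1)%C *: 'X + x%:C%:P.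
Let z2b (x : R) : {poly C} := x%:C%:P - (0 +i* 1)%C *: 'X.

Let z1E x y : ((z1 y).[x%:C] = (x +i* y)%C) * ((z1b y).[x%:C] = (x -i* y)%C).
Proof.
split; rewrite /z1 /z1b !hornerE; apply: complex_eqP; rewrite ?(ReD, ImD, ReN, ImN)/=; ring.
Qed.

Let z2E x y : ((z2 x).[y%:C] = (x +i* y)%C) * ((z2b x).[y%:C] = (x -i* y)%C).
Proof.
split; rewrite /z2 /z2b !hornerE; apply: complex_eqP;
  rewrite ?(ReD, ImD, ReN, ImN, ReM, ImM)/=; ring.
Qed.

(** [D1] is the x-derivative of [f m n] and [D2] is -i times its y-derivative, where x and i y have
    been written as half the sum and half the difference of z and its conjugate. *)
Let D1 m n p := m%:R * f m.-1 n p + n%:R * f m n.-1 p - 2^-1 * (f m.+1 n p + f m n.+1 p).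
Let D2 m n p := m%:R * f m.-1 n p - n%:R * f m n.-1 p + 2^-1 * (f m.+1 n p - f m n.+1 p).

Let iZ c k l : cintg pl (fun p => c * f k l p). Proof. exact: (cintgZ c (cintg_f k l)). Qed.
Let iD1 m n : cintg pl (D1 m n).
Proof. exact: (cintgB (cintgD (iZ _ _ _) (iZ _ _ _)) (cintgZ _ (cintgD (cintg_f _ _) (cintg_f _ _)))). Qed.
Let iD2 m n : cintg pl (D2 m n).
Proof. exact: (cintgD (cintgB (iZ _ _ _) (iZ _ _ _)) (cintgZ _ (cintgB (cintg_f _ _) (cintg_f _ _)))). Qed.

Let dz1 y : (((z1 y)^`() = 1) * ((z1b y)^`() = 1)).
Proof. by rewrite /z1 /z1b derivD derivB derivX derivC addr0 subr0. Qed.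
Let dz2 x : (((z2 x)^`() = (0 +i* 1)%C%:P) * ((z2b x)^`() = (- (0 +i* 1)%C)%:P)).
Proof.
rewrite /z2 /z2b derivD derivB !derivZ derivX !derivC addr0 sub0r.
by rewrite -!mul_polyC !mulr1 polyCN.
Qed.

Let cD1 m n : cint pl (D1 m n) = 0.
Proof.
rewrite -(cfubini2 (iD1 m n)).2 -[RHS](cint0 lam); apply: eq_cint => y.
have [iP] := line (z1 y) (z1b y) m n => /(congr1 (fun u => (w y)%:C * u)); rewrite mulr0.
rewrite -(cintZ _ iP) => <-; apply: eq_cint => x.
rewrite /lineF !dz1 !z1E !hornerC /D1 /f [(x, y).1]/= [(x, y).2]/= rmorphM/=.
have -> : x%:C = 2^-1 * ((x +i* y)%C + (x -i* y)%C).
  have e2 : x%:C + x%:C = (x +i* y)%C + (x -i* y)%C.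
    by apply: complex_eqP; rewrite !(ReD, ImD)/=; ring.
  by rewrite -e2; field.
rewrite !exprS; move: (x +i* y)%C (x -i* y)%C => u v.
move: (u ^+ m.-1) (v ^+ n.-1) (u ^+ m) (v ^+ n) (w x)%:C (w y)%:C => *; ring.
Qed.

Let cD2 m n : cint pl (D2 m n) = 0.
Proof.
rewrite -(cfubini1 (iD2 m n)).2 -[RHS](cint0 lam); apply: eq_cint => x.
have [iP] := line (z2 x) (z2b x) m n => /(congr1 (fun u => (- (0 +i* 1)%C * (w x)%:C) * u)); rewrite mulr0.
rewrite -(cintZ _ iP) => <-; apply: eq_cint => y.
rewrite /lineF !dz2 !z2E !hornerC /D2 /f [(x, y).1]/= [(x, y).2]/= rmorphM/=.
set i := (0 +i* 1)%C; have ii : i * i = -1.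
  by apply: complex_eqP; rewrite ?(ReM, ImM)/= ?oppr0; ring.
have yE : i * y%:C = 2^-1 * ((x +i* y)%C - (x -i* y)%C).
  have e2 : i * y%:C + i * y%:C = (x +i* y)%C - (x -i* y)%C.
    by apply: complex_eqP; rewrite ?(ReM, ImM, ReD, ImD, ReN, ImN)/=; ring.
  by rewrite -e2; field.
rewrite !exprS; move: (x +i* y)%C (x -i* y)%C yE => u v.
move: (u ^+ m.-1) (v ^+ n.-1) (u ^+ m) (v ^+ n) (w x)%:C (w y)%:C => p q r s W1 W2 yE.
have -> : 2^-1 * (u * r * s * (W1 * W2) - r * (v * s) * (W1 * W2)) = (i * y%:C) * r * s * (W1 * W2).
  by rewrite yE; ring.
transitivity (- (i * i) * (m%:R * (p * s * (W1 * W2))) + (i * i) * (n%:R * (r * q * (W1 * W2))) +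
  (i * y%:C) * r * s * (W1 * W2)); first by rewrite ii; ring.
ring.
Qed.

(** The difference [D1 - D2] is twice the derivative with respect to the conjugate of z, in which
    the powers of z are constants: one power of each factor is removed. *)
Let JS m n : J m.+1 n = 2 * n%:R * J m n.-1.
Proof.
have e1 := cD1 m n; have e2 := cD2 m n.
rewrite /D1 (cintB (cintgD (iZ _ _ _) (iZ _ _ _)) (cintgZ _ (cintgD (cintg_f _ _) (cintg_f _ _))))
  (cintD (iZ _ _ _) (iZ _ _ _)) (cintZ _ (cintgD (cintg_f _ _) (cintg_f _ _)))
  (cintD (cintg_f _ _) (cintg_f _ _)) !(cintZ _ (cintg_f _ _)) in e1.
rewrite /D2 (cintD (cintgB (iZ _ _ _) (iZ _ _ _)) (cintgZ _ (cintgB (cintg_f _ _) (cintg_f _ _))))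
  (cintB (iZ _ _ _) (iZ _ _ _)) (cintZ _ (cintgB (cintg_f _ _) (cintg_f _ _)))
  (cintB (cintg_f _ _) (cintg_f _ _)) !(cintZ _ (cintg_f _ _)) in e2.
rewrite -/(J _ _) -/(J _ _) -/(J _ _) -/(J _ _) in e1.
rewrite -/(J _ _) -/(J _ _) -/(J _ _) -/(J _ _) in e2.
apply/eqP; rewrite -subr_eq0 -(subrr (0 : C)) -{1}e2 -e1; apply/eqP.
by field.
Qed.

Let J0 n : J 0 n.+1 = 0.
Proof.
have h : J n.+1 0 = 0 by rewrite JS mulr0 mul0r.
rewrite -(conjc0 R) -h /J -cint_conj//; apply: eq_cint => p.
rewrite /f !rmorphM/= !rmorphXn/= oppr0 expr0 !mul1r mulr1; congr (_ * _).
Qed.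

Let J00 : J 0 0 = (2 * pi)%:C.
Proof.
have iw : cintg lam (fun x : measurableTypeR R => (w x)%:C).
  by apply: cintg_real; exact: (rintg_gauss half0).
transitivity (cint pl (fun p => (w p.1)%:C * (w p.2)%:C)).
  by apply: eq_cint => p; rewrite /f !expr0 !mul1r rmorphM.
rewrite (cintX iw iw) cint_real (Rint_gauss half0) -rmorphM/= -expr2 sqr_sqrtr ?invrK ?(mulrC 2)//.
by rewrite mulr_ge0 ?pi_ge0.
Qed.

Lemma psi1_orthonormal m n :
  cintg pl (fun p => psi1 m p.1 p.2 * conjc (psi1 n p.1 p.2)) /\
  cint pl (fun p => psi1 m p.1 p.2 * conjc (psi1 n p.1 p.2)) = (m == n)%:R.
Proof.
have JE : J m n = (m == n)%:R * (2 * pi * 2 ^+ n * n`!%:R)%:C.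
  elim: m n => [|m IH] [|n]; rewrite ?J0 ?mul0r//.
  - by rewrite J00 expr0 fact0 !mulr1 mul1r.
  - by rewrite JS mulr0 mul0r.
  rewrite JS IH eqSS [n.+1.-1]/= exprS factS natrM !rmorphM/= rmorph_nat; ring.
have E p : psi1 m p.1 p.2 * conjc (psi1 n p.1 p.2) =
   ((Num.sqrt (2 * pi * 2 ^+ m * m`!%:R))^-1 * (Num.sqrt (2 * pi * 2 ^+ n * n`!%:R))^-1)%:C * f m n p.
  case: p => x y; rewrite [(x, y).1]/= [(x, y).2]/=.
  have cJ : conjc (psi1 n x y) = ((Num.sqrt (2 * pi * 2 ^+ n * n`!%:R))^-1 *
      expR (- ((x ^+ 2 + y ^+ 2) / 4)))%:C * conjc (cexpi (y * x / 2)) * (x -i* y)%C ^+ n.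
    rewrite /psi1 2!(rmorphM (@conjc R)) (rmorphXn (@conjc R)); congr (_ * _ * _).
    by apply: complex_eqP => //=; rewrite oppr0.
  have g2 : expR (- (2^-1 * x ^+ 2)) * expR (- (2^-1 * y ^+ 2)) =
    expR (- ((x ^+ 2 + y ^+ 2) / 4)) * expR (- ((x ^+ 2 + y ^+ 2) / 4)).
    by rewrite -!expRD; congr expR; field.
  have := mulcJ (cexpi (y * x / 2)); rewrite normc_cexpi expr1n cJ /psi1 /f /w [(x, y).1]/= [(x, y).2]/= g2.
  set u := cexpi _; set v := (u^*)%C => uv.
  rewrite !rmorphM/=; set c1 := ((Num.sqrt _)^-1)%:C; set c2 := ((Num.sqrt _)^-1)%:C; set g := (expR _)%:C.
  set a := _ ^+ m; set b := _ ^+ n.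
  transitivity ((u * v) * (c1 * c2 * (a * b * (g * g)))); first by ring.
  by rewrite uv mul1r.
split; first by apply: eq_cintg (cintgZ _ (cintg_f m n)) => p; rewrite E.
apply: etrans (eq_cint pl E) _; rewrite (cintZ _ (cintg_f m n)) -/(J m n) JE.
case: eqVneq => [->|_]; last by rewrite mul0r mulr0.
rewrite mul1r -rmorphM/= -invfM -expr2 sqr_sqrtr ?mulVf//.
  by rewrite lt0r_neq0// !mulr_gt0 ?exprn_gt0 ?ltr0n ?fact_gt0 ?pi_gt0.
by rewrite !mulr_ge0 ?exprn_ge0 ?pi_ge0.
Qed.

(** The squared modulus is radial in phase space: with t = |z|^2 / 2 it is the Poisson weight t^m
    exp(- t) / m! over 2 pi. The sum over a level of products of such weights is therefore
    explicit. *)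
Lemma psi1_sqr m (x zeta : R) : Normc.normc (psi1 m x zeta) ^+ 2 =
  (2 * pi)^-1 * ((x ^+ 2 + zeta ^+ 2) / 2) ^+ m / m`!%:R * expR (- ((x ^+ 2 + zeta ^+ 2) / 2)).
Proof.
have nX (u : C) k : Normc.normc (u ^+ k) = Normc.normc u ^+ k.
  by elim: k => [|k IH]; rewrite ?expr0 ?Normc.normc1// !exprS Normc.normcM IH.
rewrite /psi1 !Normc.normcM normc_cexpi mulr1 nX normcR normrM (ger0_norm (expR_ge0 (- ((x ^+ 2 + zeta ^+ 2) / 4)))).
rewrite ger0_norm ?invr_ge0 ?sqrtr_ge0// !exprMn -exprM mulnC exprM normc_sqr /=.
rewrite exprVn sqr_sqrtr; last by rewrite !mulr_ge0 ?exprn_ge0 ?pi_ge0.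
have -> : expR (- ((x ^+ 2 + zeta ^+ 2) / 4)) ^+ 2 = expR (- ((x ^+ 2 + zeta ^+ 2) / 2)) :> R.
  by rewrite expr2 -expRD; congr expR; field.
have p0 : pi != 0 :> R by rewrite lt0r_neq0// pi_gt0.
have f0 : m`!%:R != 0 :> R by rewrite pnatr_eq0 -lt0n fact_gt0.
have t0 : 2 ^+ m != 0 :> R by rewrite expf_neq0 ?pnatr_eq0.
by move: pi p0 => q q0; rewrite ?exprVn; field; rewrite q0 f0 t0.
Qed.

End coherent_orthonormal.

(** * Moments of the Haar measure *)

Section conjugation.
Context {R : realType}.
Implicit Types a b : R[i].

Lemma normcN a : normc (- a) = normc a.
Proof. by case: a => x y /=; rewrite !sqrrN. Qed.
Lemma normcB_le a b : normc (a - b) <= normc a + normc b.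
Proof. by apply: le_trans (normcD_le _ _) _; rewrite normcN. Qed.
Lemma conjcD a b : conjc (a + b) = conjc a + conjc b. Proof. exact: rmorphD. Qed.
Lemma conjcB a b : conjc (a - b) = conjc a - conjc b. Proof. exact: rmorphB. Qed.
Lemma conjcM a b : conjc (a * b) = conjc a * conjc b. Proof. exact: rmorphM. Qed.
Lemma conjc_sum I (s : seq I) (P : pred I) (f : I -> R[i]) :
  conjc (\sum_(i <- s | P i) f i) = \sum_(i <- s | P i) conjc (f i).
Proof. exact: rmorph_sum. Qed.
Lemma conjc_prod I (s : seq I) (P : pred I) (f : I -> R[i]) :
  conjc (\prod_(i <- s | P i) f i) = \prod_(i <- s | P i) conjc (f i).
Proof. exact: rmorph_prod. Qed.
End conjugation.

Lemma integral_probability_cst d (T : measurableType d) (R : realType) (mu : probability T R) (c : \bar R) :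
  (\int[mu]_x (cst c x) = c)%E.
Proof.
transitivity (c * 1)%E; last by rewrite mule1.
by rewrite integral_cst//; congr (_ * _)%E; exact: probability_setT.
Qed.

Section unitary_group_measurability.
Context {R : realType} (n : nat).
Local Notation C := R[i].
Local Notation G := (unitary_group R n).

Lemma cmeas_entry i k : cmeas (fun U : G => val U i k : C).
Proof.
by split => _ Y mY; rewrite setTI; apply: sub_sigma_algebra; exists i, k, Y; split=> //; [left|right].
Qed.

Lemma measurable_unitary d (T : measurableType d) (f : T -> G) :
  (forall i k, cmeas (fun t => val (f t) i k : C)) -> measurable_fun setT f.
Proof.
move=> mf _ A mA; rewrite setTI.
suff sub : @unitary_gen R n `<=` [set B | measurable (f @^-1` B)].
  have sa : sigma_algebra setT [set B : set G | measurable (f @^-1` B)].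
    split.
    - by rewrite /= preimage_set0.
    - by move=> B /= mB; rewrite setTD preimage_setC; exact: measurableC.
    - by move=> F mF /=; rewrite preimage_bigcup; exact: bigcupT_measurable.
  exact: (smallest_sub sa sub mA).
move=> B /= [i [k [Y [mY [->|->]]]]].
  by have := (mf i k).1 measurableT _ mY; rewrite setTI.
by have := (mf i k).2 measurableT _ mY; rewrite setTI.
Qed.

Lemma unitaryP (U : G) : val U *m map_mx conjc (val U)^T = 1%:M.
Proof.
have /unitarymxP <- := valP U; congr (_ *m _).
Qed.

Lemma unitary_rowP (U : G) l : \sum_k normc (val U l k) ^+ 2 = 1.
Proof.
have := congr1 (fun A : 'M[C]_n => A l l) (unitaryP U); rewrite !mxE eqxx => H.
have : \sum_k (normc (val U l k) ^+ 2)%:C = 1.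
  by rewrite -[RHS]H; apply: eq_bigr => k _; rewrite !mxE mulcJ.
by move=> /(congr1 (@complex.Re R)); rewrite Re_sum.
Qed.

Lemma unitary_rowC (U : G) l : \sum_k val U l k * conjc (val U l k) = 1.
Proof.
have := congr1 (fun A : 'M[C]_n => A l l) (unitaryP U); rewrite !mxE eqxx => H.
by rewrite -[RHS]H; apply: eq_bigr => k _; rewrite !mxE.
Qed.

Lemma normc_entry_le1 (U : G) l k : normc (val U l k) <= 1.
Proof.
rewrite -(@ler_pXn2r _ 2) ?nnegrE ?normc_ge0// expr1n -(unitary_rowP U l).
by rewrite (bigD1 k)//= lerDl sumr_ge0// => i _; exact: sqr_ge0.
Qed.

Definition unitary_inv (U : G) : G :=
  exist (fun M : 'M[C]_n => M \is unitarymx) (map_mx conjc (val U)^T)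
    (etrans (trmxC_unitary (val U)) (valP U)).

Lemma unitary_eq (U V : G) : val U = val V -> U = V. Proof. exact: val_inj. Qed.

Lemma unitary_inv_mul (U V : G) :
  unitary_inv (unitary_mul (unitary_inv U) V) = unitary_mul (unitary_inv V) U.
Proof.
apply: unitary_eq; rewrite /= trmx_mul map_mxM/=; congr (_ *m _).
by apply/matrixP => i j; rewrite !mxE conjcK.
Qed.

Lemma measurable_unitary_inv : measurable_fun setT unitary_inv.
Proof.
apply: measurable_unitary => i k.
by apply: eq_cmeas (cmeas_conj (cmeas_entry k i)) => U; rewrite !mxE.
Qed.

Lemma measurable_unitary_mul d (T : measurableType d) (f g : T -> G) :
  measurable_fun setT f -> measurable_fun setT g ->
  measurable_fun setT (fun t => unitary_mul (f t) (g t)).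
Proof.
move=> mf mg; apply: measurable_unitary => i k.
have := @cmeas_sum _ T R _ (index_enum 'I_n) xpredT (fun j t => val (f t) i j * val (g t) j k : C).
move=> /(_ (fun j _ => cmeasM (cmeas_comp (cmeas_entry i j) mf) (cmeas_comp (cmeas_entry j k) mg))).
by apply: eq_cmeas => t; rewrite /= mxE.
Qed.

Section haar.
Variable mu : probability G R.
Hypothesis haar : haar_probability mu.

(* Fubini for the indicator of {(V, U) : U^-1 V in S}: a left invariant probability is
   invariant under inversion. *)
Lemma haar_inv (S : set G) : measurable S -> mu (unitary_inv @^-1` S) = mu S.
Proof.
move=> mS; pose f (z : G * G) : \bar R := (\1_S (unitary_mul (unitary_inv z.1) z.2) : R)%:E.
have mf : measurable_fun setT f.
  apply/measurable_EFinP; apply: (measurableT_comp (measurable_indic mS)).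
  apply: measurable_unitary_mul; last exact: measurable_snd.
  exact: measurableT_comp measurable_unitary_inv measurable_fst.
have f0 z : (0 <= f z)%E by rewrite lee_fin.
have int1 (S' : set G) : measurable S' -> (\int[mu]_x (\1_S' x : R)%:E)%E = mu S'.
  by move=> mS'; rewrite integral_indic// setIT.
have e1 : (\int[prodm mu mu]_z f z = mu S)%E.
  rewrite (tonelli1 mu mu mf f0) (eq_integral (cst (mu S))); last first.
    move=> V _; rewrite -(haar (unitary_inv V) mS) -int1; last first.
      rewrite -[X in measurable X]setTI; apply: measurable_unitary_mul => //; exact: measurable_cst.
    by apply: eq_integral => U _; rewrite /f /= !indicE.
  exact: integral_probability_cst.
have e2 : (\int[prodm mu mu]_z f z = mu (unitary_inv @^-1` S))%E.
  have mI : measurable (unitary_inv @^-1` S).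
    by rewrite -[X in measurable X]setTI; exact: measurable_unitary_inv.
  rewrite (tonelli2 mu mu mf f0) (eq_integral (cst (mu (unitary_inv @^-1` S)))); last first.
    move=> U _; rewrite -(haar (unitary_inv U) mI) -int1; last first.
      rewrite -[X in measurable X]setTI; apply: measurable_unitary_mul => //; exact: measurable_cst.
    by apply: eq_integral => V _; rewrite /f /= -unitary_inv_mul !indicE.
  exact: integral_probability_cst.
by rewrite -e1 -e2.
Qed.

(** U V is the inverse of V^-1 U^-1, so left invariance and invariance under inversion suffice.
    Right translations are the ones needed, because they act on each row of U, that is on a single
    random vector. *)
Lemma haar_right (V : G) : mpres mu mu (fun U => unitary_mul U V).
Proof.
have mV : measurable_fun setT (fun U => unitary_mul U V).
  by apply: measurable_unitary_mul => //; exact: measurable_cst.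
split=> // S mS.
have mI : measurable (unitary_inv @^-1` S).
  by rewrite -[X in measurable X]setTI; exact: measurable_unitary_inv.
have mS' : measurable ((fun U => unitary_mul U V) @^-1` S).
  by rewrite -[X in measurable X]setTI; exact: mV.
apply: etrans (esym (haar_inv mS')) _; apply: etrans _ (haar_inv mS).
apply: etrans _ (haar (unitary_inv V) mI); congr (mu _).
apply/seteqP; split => U /=; rewrite /preimage /= unitary_inv_mul//.
Qed.

End haar.
End unitary_group_measurability.

(** * Uniform first-order expansions *)

Section expansions.
Context {R : realType} (T : Type).
Local Notation C := R[i].

(* First order expansion at 0, uniform in the second variable. *)
Definition expands (f : R -> T -> C) (f0 f1 : T -> C) : Prop := exists2 B, 0 <= B & forall (s : R) U, `|s| <= 1 ->
  [/\ normc (f0 U) <= B, normc (f1 U) <= B & normc (f s U - f0 U - s%:C * f1 U) <= B * s ^+ 2].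

Lemma eq_expands (f g : R -> T -> C) (f0 g0 f1 g1 : T -> C) : (forall s, f s =1 g s) -> f0 =1 g0 -> f1 =1 g1 ->
  expands f f0 f1 -> expands g g0 g1.
Proof. by move=> e e0 e1 [B B0 H]; exists B => // s U hs; rewrite -e -e0 -e1; exact: H. Qed.

Lemma expands_cst (c : C) : expands (fun _ _ => c) (fun=> c) (fun=> 0).
Proof.
exists (normc c); first exact: normc_ge0.
move=> s U _; split => //; first by rewrite Normc.normc0 normc_ge0.
by rewrite subrr mulr0 subr0 Normc.normc0 mulr_ge0 ?normc_ge0 ?sqr_ge0.
Qed.

Lemma expandsD (f g : R -> T -> C) (f0 g0 f1 g1 : T -> C) : expands f f0 f1 -> expands g g0 g1 ->
  expands (fun s U => f s U + g s U) (fun U => f0 U + g0 U) (fun U => f1 U + g1 U).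
Proof.
move=> [B B0 H] [D D0 K]; exists (B + D); first exact: addr_ge0.
move=> s U hs; have [h1 h2 h3] := H s U hs; have [k1 k2 k3] := K s U hs; split.
- by apply: le_trans (normcD_le _ _) _; exact: lerD.
- by apply: le_trans (normcD_le _ _) _; exact: lerD.
rewrite (_ : _ - _ = (f s U - f0 U - s%:C * f1 U) + (g s U - g0 U - s%:C * g1 U)); last by ring.
by rewrite mulrDl; apply: le_trans (normcD_le _ _) _; exact: lerD.
Qed.

Lemma expandsM (f g : R -> T -> C) (f0 g0 f1 g1 : T -> C) : expands f f0 f1 -> expands g g0 g1 ->
  expands (fun s U => f s U * g s U) (fun U => f0 U * g0 U) (fun U => f1 U * g0 U + f0 U * g1 U).
Proof.
(* The remainder of the product splits into three terms, of size 3, 2 and 1 times B D s^2. *)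
move=> [B B0 H] [D D0 K]; exists (6 * (B * D)); first by rewrite !mulr_ge0.
move=> s U hs; have [h1 h2 h3] := H s U hs; have [k1 k2 k3] := K s U hs.
have BD : 0 <= B * D by exact: mulr_ge0.
have s1 : 0 <= s ^+ 2 <= 1.
  have e : `|s| ^+ 2 = s ^+ 2 by rewrite real_normK ?num_real.
  by rewrite sqr_ge0 -e; have := normr_ge0 s; nra.
split.
- rewrite Normc.normcM; apply: (@le_trans _ _ (B * D)); last by lra.
  by apply: ler_pM; rewrite ?normc_ge0.
- apply: le_trans (normcD_le _ _) _; rewrite !Normc.normcM.
  have := ler_pM (normc_ge0 _) (normc_ge0 _) h2 k1.
  have := ler_pM (normc_ge0 _) (normc_ge0 _) h1 k2; lra.
set rf := f s U - f0 U - s%:C * f1 U in h3; set rg := g s U - g0 U - s%:C * g1 U in k3.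
rewrite (_ : _ - _ = rf * (g0 U + s%:C * g1 U + rg) + (f0 U + s%:C * f1 U) * rg +
   (s%:C * s%:C) * (f1 U * g1 U)); last by rewrite /rf /rg; ring.
have ns : normc s%:C <= 1 by rewrite normcR.
have b1 (x y z : R) (a b : C) : normc a <= x -> normc b <= y -> x * y <= z -> normc (a * b) <= z.
  by move=> ha hb; apply: le_trans; rewrite Normc.normcM; apply: ler_pM; rewrite ?normc_ge0.
have g3 : normc (g0 U + s%:C * g1 U + rg) <= 3 * D.
  apply: le_trans (normcD_le _ _) _; apply: le_trans (lerD (normcD_le _ _) (lexx _)) _.
  have : normc (s%:C * g1 U) <= D by apply: (b1 1 D); rewrite ?mul1r.
  have : normc rg <= D by apply: le_trans k3 _; nra.
  lra.
have f2 : normc (f0 U + s%:C * f1 U) <= 2 * B.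
  apply: le_trans (normcD_le _ _) _.
  have : normc (s%:C * f1 U) <= B by apply: (b1 1 B); rewrite ?mul1r.
  lra.
have t1 : normc (rf * (g0 U + s%:C * g1 U + rg)) <= 3 * (B * D) * s ^+ 2.
  by apply: (b1 _ _ _ _ _ h3 g3); nra.
have t2 : normc ((f0 U + s%:C * f1 U) * rg) <= 2 * (B * D) * s ^+ 2.
  by apply: (b1 _ _ _ _ _ f2 k3); nra.
have t3 : normc (s%:C * s%:C * (f1 U * g1 U)) <= (B * D) * s ^+ 2.
  rewrite !Normc.normcM normcR -expr2 real_normK ?num_real// mulrC ler_wpM2r ?sqr_ge0//.
  by apply: ler_pM; rewrite ?normc_ge0.
apply: le_trans (normcD_le _ _) _; apply: le_trans (lerD (normcD_le _ _) (lexx _)) _.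
lra.
Qed.

Lemma expands_sum I (r : seq I) (f : I -> R -> T -> C) (f0 f1 : I -> T -> C) :
  (forall i, expands (f i) (f0 i) (f1 i)) ->
  expands (fun s U => \sum_(i <- r) f i s U) (fun U => \sum_(i <- r) f0 i U) (fun U => \sum_(i <- r) f1 i U).
Proof.
move=> H; elim: r => [|i r IH].
  by apply: eq_expands (expands_cst 0) => [s U|U|U]; rewrite big_nil.
by apply: eq_expands (expandsD (H i) IH) => [s U|U|U]; rewrite big_cons.
Qed.

Lemma expandsX (f : R -> T -> C) (f0 f1 : T -> C) m : expands f f0 f1 ->
  expands (fun s U => f s U ^+ m) (fun U => f0 U ^+ m) (fun U => m%:R * f0 U ^+ m.-1 * f1 U).
Proof.
move=> H; elim: m => [|m IH].
  by apply: eq_expands (expands_cst 1) => [s U|U|U]; rewrite ?expr0 ?mul0r.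
apply: eq_expands (expandsM H IH) => [s U|U|U]; rewrite ?exprS//.
case: m {IH} => [|m]; first by rewrite !expr0; ring.
by rewrite /= exprS -[m.+2%:R]natr1; ring.
Qed.

Lemma expands_conj (f : R -> T -> C) (f0 f1 : T -> C) : expands f f0 f1 ->
  expands (fun s U => conjc (f s U)) (fun U => conjc (f0 U)) (fun U => conjc (f1 U)).
Proof.
move=> [B B0 H]; exists B => // s U hs; have [h1 h2 h3] := H s U hs; split; rewrite ?normc_conj//.
rewrite (_ : _ - _ = conjc (f s U - f0 U - s%:C * f1 U)) ?normc_conj//.
by rewrite 2!rmorphB rmorphM /= oppr0.
Qed.

End expansions.

(** * The moment recurrence *)

Section haar_moments.
Context {R : realType} (n : nat).
Local Notation C := R[i].
Local Notation G := (unitary_group R n).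
Variable mu : probability G R.
Hypothesis haar : haar_probability mu.

Lemma rintg_bounded (f : G -> R) (B : R) : measurable_fun setT f -> (forall U, `|f U| <= B) -> rintg mu f.
Proof.
move=> mf H; apply: (rintg_le mf _ H); apply/integrableP; split.
  by apply/measurable_EFinP; exact: measurable_cst.
apply: (@le_lt_trans _ _ (\int[mu]_x (`|B|%:E))%E); first by [].
by rewrite (integral_probability_cst mu (`|B|%:E)) ltry.
Qed.

Lemma Rint_prob_cst (c : R) : \int[mu]_U c = c.
Proof. by rewrite /Rintegral (integral_probability_cst mu c%:E). Qed.

Lemma cintg_bounded (f : G -> C) (B : R) : cmeas f -> (forall U, normc (f U) <= B) -> cintg mu f.
Proof.
move=> mf H; have rB : rintg mu (fun=> B) by apply: (@rintg_bounded _ `|B|) => //; exact: measurable_cst.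
exact: cintg_le mf rB H.
Qed.

(** If the integral of [f s] does not depend on s, then s times the integral of [f1] is O(s^2), so
    this integral is 0. The uniform expansion makes differentiation under the integral sign
    unnecessary. *)
Lemma expands_invariant (f : R -> G -> C) (f0 f1 : G -> C) : expands f f0 f1 ->
  (forall s, cmeas (f s)) -> cmeas f1 -> (forall s, cintg mu f0 -> cint mu (f s) = cint mu f0) -> cmeas f0 ->
  cint mu f1 = 0.
Proof.
move=> [B B0 H] mf mf1 inv mf0.
have i0 : cintg mu f0.
  by apply: (cintg_bounded (B := B)) => // U; have [] := H 0 U; rewrite ?normr0.
have i1 : cintg mu f1.
  by apply: (cintg_bounded (B := B)) => // U; have [] := H 0 U; rewrite ?normr0.
have key s : `|s| <= 1 -> `|s| * normc (cint mu f1) <= B * s ^+ 2.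
  move=> hs; have is1 := cintgZ s%:C i1.
  have ir : cintg mu (fun U => f s U - f0 U - s%:C * f1 U).
    apply: (cintg_bounded (B := B * s ^+ 2)); last by move=> U; have [] := H s U hs.
    by apply: cmeasB; [apply: cmeasB|exact: (cintg_meas is1)].
  have is0 : cintg mu (f s).
    apply: (eq_cintg _ (cintgD ir (cintgD i0 is1))) => U; ring.
  have : normc (cint mu (fun U => f s U - f0 U - s%:C * f1 U)) <= \int[mu]_U (B * s ^+ 2).
    apply: (normc_cint_le ir); last by move=> U; have [] := H s U hs.
    by apply: (@rintg_bounded _ `|B * s ^+ 2|) => //; exact: measurable_cst.
  rewrite Rint_prob_cst (cintB (cintgB is0 i0) is1) (cintB is0 i0) (cintZ _ i1) inv//.
  by rewrite subrr sub0r normcN Normc.normcM normcR.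
apply: Normc.eq0_normc; apply/eqP; rewrite eq_le normc_ge0 andbT leNgt; apply/negP => q0.
set q := normc _ in q0; pose s := Num.min 1 (q / (2 * (B + 1))).
have B1 : 0 < 2 * (B + 1) by lra.
have s0 : 0 < s by rewrite lt_min ltr01 divr_gt0.
have s1 : s <= 1 by rewrite ge_min lexx.
have s2 : s * (2 * (B + 1)) <= q by rewrite -ler_pdivlMr// ge_min lexx orbT.
have := key s; rewrite (gtr0_norm s0) => /(_ s1).
rewrite expr2 mulrCA ler_pM2l// -/q; nra.
Qed.

Variable l : 'I_n.
Let u (U : G) k : C := val U l k.

Section generator.
Variable K : 'M[C]_n.
Hypotheses (Kadj : map_mx conjc K^T = - K) (K3 : K *m K *m K = - K).

(** When K^3 = - K, the exponential of theta K is 1 + sin(theta) K + (1 - cos(theta)) K^2. With s =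
    tan(theta / 2), [alpha] and [sigma] are 1 - cos(theta) and sin(theta). *)
Let alpha (s : R) : R := 2 * s ^+ 2 / (1 + s ^+ 2).
Let sigma (s : R) : R := 2 * s / (1 + s ^+ 2).

(* K generates a group of rotations; in terms of its rational parametrization. *)
Definition rotation (s : R) : 'M[C]_n := 1%:M + (alpha s)%:C *: (K *m K) + (sigma s)%:C *: K.

Lemma rotation_unitary s : rotation s \is unitarymx.
Proof.
apply/unitarymxP.
change (rotation s *m map_mx conjc (rotation s)^T = 1%:M).
have -> : map_mx conjc (rotation s)^T = 1%:M + (alpha s)%:C *: (K *m K) - (sigma s)%:C *: K.
  have K2adj : map_mx conjc (K *m K)^T = K *m K by rewrite trmx_mul map_mxM Kadj mulNmx mulmxN opprK.
  rewrite /rotation; set K2 := K *m K in K2adj *; clearbody K2.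
  apply/matrixP => i j; have := congr1 (fun Y : 'M[C]_n => Y i j) K2adj.
  have := congr1 (fun Y : 'M[C]_n => Y i j) Kadj; rewrite !mxE => e1 e2.
  rewrite 2!conjcD 2!conjcM e1 e2 !(conjc_real _) (conjc_nat _ (j == i)).
  by rewrite eq_sym mulrN.
rewrite /rotation; set K2 := K *m K.
have KK2 : K *m K2 = - K by rewrite mulmxA.
have K2K : K2 *m K = - K by rewrite /K2.
have K22 : K2 *m K2 = - K2 by rewrite {1}/K2 -mulmxA KK2 mulmxN.
have KK : K *m K = K2 by [].
clearbody K2.
rewrite !(mulmxDl, mulmxDr, mulmxN, mulNmx, mul1mx, mulmx1) -!scalemxAl -!scalemxAr KK K22 KK2 K2K !scalerN.
set a := (alpha s)%:C; set c := (sigma s)%:C.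
have ac : a + a - a * a - c * c = 0.
  rewrite /a /c -!rmorphM -!rmorphD -!rmorphB /=.
  rewrite (_ : _ - _ = 0) ?rmorph0//= /alpha /sigma; field.
  by rewrite lt0r_neq0// ltr_wpDr ?sqr_ge0.
clearbody a c; transitivity (1%:M + (a + a - a * a - c * c) *: K2); last by rewrite ac scale0r addr0.
move: 1%:M => I1; apply/matrixP => i j; rewrite !mxE; ring.
Qed.

Let V (s : R) : G := exist (fun M : 'M[C]_n => M \is unitarymx) (rotation s) (rotation_unitary s).

(** The derivative at 0 is 2 K because sigma(s) = 2 s + O(s^2), while alpha(s) = O(s^2). *)
Lemma expands_entry k : expands (fun s U => u (unitary_mul U (V s)) k) (fun U => u U k)
  (fun U => \sum_c u U c * (2 * K c k)).
Proof.
have E s U : u (unitary_mul U (V s)) k = \sum_c u U c * rotation s c k by rewrite /u /= mxE.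
have F U : u U k = \sum_c u U c * (c == k)%:R.
  by rewrite (bigD1 k)//= eqxx mulr1 big1 ?addr0// => i /negPf ->; rewrite mulr0.
pose B c : R := 1 + normc (2 * K c k) + 2 * normc ((K *m K) c k) + 2 * normc (K c k).
have eR c : expands (fun s (_ : G) => rotation s c k) (fun=> (c == k)%:R) (fun=> 2 * K c k).
  exists (B c); first by rewrite /B !addr_ge0 ?mulr_ge0 ?normc_ge0.
  have p1 := normc_ge0 (2 * K c k); have p2 := normc_ge0 ((K *m K) c k); have p3 := normc_ge0 (K c k).
  move=> s _ hs; split.
  - have n1 : normc ((c == k)%:R : C) <= 1 by case: (c == k); rewrite ?Normc.normc1 ?Normc.normc0.
    by apply: le_trans n1 _; rewrite /B; lra.
  - by rewrite /B; lra.
  have s1 : 0 < 1 + s ^+ 2 by rewrite ltr_wpDr ?sqr_ge0.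
  have s2 : 0 <= s ^+ 2 by rewrite sqr_ge0.
  have a1 : `|alpha s| <= 2 * s ^+ 2.
    have al : 0 <= alpha s by rewrite divr_ge0 ?(ltW s1)// mulr_ge0.
    by rewrite (ger0_norm al) ler_pdivrMr//; nra.
  have a2 : `|sigma s - 2 * s| <= 2 * s ^+ 2.
    have [t tE] : exists t, t = s ^+ 2 / (1 + s ^+ 2) by eexists.
    have t0 : 0 <= t by rewrite tE divr_ge0 ?(ltW s1).
    have ts : t <= s ^+ 2 by rewrite tE ler_pdivrMr//; nra.
    have -> : sigma s - 2 * s = - (2 * s * t) by rewrite /sigma tE; field; rewrite lt0r_neq0.
    rewrite normrN !normrM normr_nat (ger0_norm t0); have := normr_ge0 s; nra.
  rewrite (_ : _ - _ = (alpha s)%:C * (K *m K) c k + (sigma s - 2 * s)%:C * K c k); last first.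
    have -> : rotation s c k = (c == k)%:R + (alpha s)%:C * (K *m K) c k + (sigma s)%:C * K c k.
      by rewrite /rotation; move: (K *m K) => K2; rewrite !mxE.
    have s2' : (sigma s - 2 * s)%:C = (sigma s)%:C - (s%:C + s%:C).
      by apply: complex_eqP; rewrite !(ReD, ReN, ImD, ImN)/=; ring.
    by rewrite s2'; ring.
  apply: le_trans (normcD_le _ _) _; rewrite !Normc.normcM !normcR.
  have := ler_wpM2r p2 a1; have := ler_wpM2r p3 a2; rewrite /B; nra.
have eU c : expands (fun _ => u ^~ c) (u ^~ c) (fun=> 0).
  exists 1 => // s U _; rewrite /u normc_entry_le1 Normc.normc0 subrr mulr0 subr0 Normc.normc0 mul1r sqr_ge0.
  by [].
apply: eq_expands (expands_sum (index_enum 'I_n) (fun c => expandsM (eU c) (eR c))) => [s U|U|U].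
- by rewrite E.
- by rewrite F.
- by apply: eq_bigr => c _; rewrite mul0r add0r.
Qed.

Lemma cint_rotation (f : G -> C) s : cintg mu f -> cint mu (fun U => f (unitary_mul U (V s))) = cint mu f.
Proof. by move=> cf; rewrite -(mpres_cint (haar_right haar (V s)) cf). Qed.

Lemma meas_rotation s : measurable_fun setT (fun U : G => unitary_mul U (V s)).
Proof. by apply: measurable_unitary_mul => //; exact: measurable_cst. Qed.

Lemma expands_rotation (F F1 : G -> C) : cmeas F -> cmeas F1 ->
  expands (fun s U => F (unitary_mul U (V s))) F F1 -> cint mu F1 = 0.
Proof.
move=> mF mF1 eF; apply: (expands_invariant eF) => // s; first exact: cmeas_comp (meas_rotation s).
by move=> iF; exact: cint_rotation.
Qed.

End generator.

Variable M : 'M[C]_n.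
Let ub (U : G) k : C := conjc (u U k).
Let v (U : G) b : C := \sum_k M b k * u U k.
Let w (U : G) b : C := \sum_k ub U k * M k b.
Let X (U : G) : C := \sum_b ub U b * v U b.
Let du (K : 'M[C]_n) U k : C := \sum_c u U c * K c k.
Let dub (K : 'M[C]_n) U k : C := \sum_c ub U c * K c k.
Let dv K U b : C := \sum_k M b k * du K U k.
Let dX K K' U : C := \sum_b (dub K' U b * v U b + ub U b * dv K U b).
(** Half the derivative of conj(u_a) (M u)_b X^m along the rotations generated by K, when K' is the
    entrywise conjugate of K. Making K' an independent argument lets the identity extend by complex
    linearity beyond antihermitian matrices. *)
Let L m a b K K' (U : G) : C := dub K' U a * v U b * X U ^+ m + ub U a * dv K U b * X U ^+ m +
  ub U a * v U b * (m%:R * X U ^+ m.-1 * dX K K' U).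

Let mu_ k : cmeas (u ^~ k). Proof. exact: cmeas_entry. Qed.
Let mub k : cmeas (ub ^~ k). Proof. exact: cmeas_conj. Qed.
Let mv b : cmeas (v ^~ b).
Proof. by apply: cmeas_sum => k _; apply: cmeasM => //; exact: cmeas_cst. Qed.
Let mX : cmeas X. Proof. by apply: cmeas_sum => k _; apply: cmeasM. Qed.
Let mdu K k : cmeas (du K ^~ k).
Proof. by apply: cmeas_sum => c _; apply: cmeasM => //; exact: cmeas_cst. Qed.
Let mdub K k : cmeas (dub K ^~ k).
Proof. by apply: cmeas_sum => c _; apply: cmeasM => //; exact: cmeas_cst. Qed.
Let mdv K b : cmeas (dv K ^~ b).
Proof. by apply: cmeas_sum => c _; apply: cmeasM => //; exact: cmeas_cst. Qed.
Let mdX K K' : cmeas (dX K K').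
Proof. by apply: cmeas_sum => c _; apply: cmeasD; apply: cmeasM. Qed.
Let mXm m : cmeas (fun U => X U ^+ m).
Proof.
elim: m => [|m IH]; first by apply: eq_cmeas (cmeas_cst _ 1) => U; rewrite expr0.
by apply: eq_cmeas (cmeasM mX IH) => U; rewrite exprS.
Qed.
Let mL m a b K K' : cmeas (L m a b K K').
Proof.
apply: cmeasD; [apply: cmeasD|]; apply: cmeasM => //; try exact: cmeasM.
by apply: cmeasM => //; apply: cmeasM => //; exact: cmeas_cst.
Qed.

Let bnd (f : G -> C) := exists B, forall U, normc (f U) <= B.
Let bndM f g : bnd f -> bnd g -> bnd (fun U => f U * g U).
Proof.
move=> [B H] [D K]; exists (B * D) => U; rewrite Normc.normcM.
by apply: ler_pM; rewrite ?normc_ge0.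
Qed.
Let bndD f g : bnd f -> bnd g -> bnd (fun U => f U + g U).
Proof. by move=> [B H] [D K]; exists (B + D) => U; apply: le_trans (normcD_le _ _) _; apply: lerD. Qed.
Let bnd_cst c : bnd (fun=> c). Proof. by exists (normc c). Qed.
Let bnd_sum (f : 'I_n -> G -> C) : (forall i, bnd (f i)) -> bnd (fun U => \sum_i f i U).
Proof.
move=> /choice[B H]; exists (\sum_i B i) => U; apply: le_trans (normc_sum_le _ _ _) _.
by apply: ler_sum => i _.
Qed.
Let bu k : bnd (u ^~ k). Proof. by exists 1 => U; exact: normc_entry_le1. Qed.
Let bub k : bnd (ub ^~ k). Proof. by exists 1 => U; rewrite normc_conj normc_entry_le1. Qed.
Let bv b : bnd (v ^~ b). Proof. by apply: bnd_sum => k; apply: bndM. Qed.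
Let bX : bnd X. Proof. by apply: bnd_sum => k; apply: bndM. Qed.
Let bXm m : bnd (fun U => X U ^+ m).
Proof.
have [B H] := bX; exists (B ^+ m) => U.
elim: m => [|m IH]; first by rewrite !expr0 Normc.normc1.
by rewrite !exprS Normc.normcM; apply: ler_pM; rewrite ?normc_ge0.
Qed.
Let bdu K k : bnd (du K ^~ k). Proof. by apply: bnd_sum => c; apply: bndM. Qed.
Let bdub K k : bnd (dub K ^~ k). Proof. by apply: bnd_sum => c; apply: bndM. Qed.
Let bdv K b : bnd (dv K ^~ b). Proof. by apply: bnd_sum => c; apply: bndM. Qed.
Let bdX K K' : bnd (dX K K'). Proof. by apply: bnd_sum => c; apply: bndD; apply: bndM. Qed.
Let bL m a b K K' : bnd (L m a b K K').
Proof.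
by apply: bndD; [apply: bndD|]; apply: bndM => //; try exact: bndM; apply: bndM => //; apply: bndM.
Qed.
Let ibnd f : cmeas f -> bnd f -> cintg mu f.
Proof. by move=> mf [B H]; exact: cintg_bounded mf H. Qed.
Let iL m a b K K' : cintg mu (L m a b K K'). Proof. exact: ibnd. Qed.

Let L_generator m a b (K : 'M[C]_n) : map_mx conjc K^T = - K -> K *m K *m K = - K ->
  cint mu (L m a b K (map_mx conjc K)) = 0.
Proof.
move=> Kadj K3; have eu := expands_entry Kadj K3.
have eub k := expands_conj (eu k).
have ev k := expands_sum (index_enum 'I_n) (fun c => expandsM (expands_cst G (M k c)) (eu c)).
have eX := expands_sum (index_enum 'I_n) (fun k => expandsM (eub k) (ev k)).
have eF := expandsM (expandsM (eub a) (ev b)) (expandsX m eX).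
have E U : conjc (\sum_c u U c * (2 * K c a)) = 2 * dub (map_mx conjc K) U a.
  rewrite conjc_sum /dub mulr_sumr; apply: eq_bigr => c _.
  by rewrite 2!conjcM (conjc_nat _ 2) mxE mulrCA.
have E' U k : conjc (\sum_c u U c * (2 * K c k)) = 2 * dub (map_mx conjc K) U k.
  rewrite conjc_sum /dub mulr_sumr; apply: eq_bigr => c _.
  by rewrite 2!conjcM (conjc_nat _ 2) mxE mulrCA.
have D U k : \sum_c u U c * (2 * K c k) = 2 * du K U k.
  by rewrite /du mulr_sumr; apply: eq_bigr => c _; rewrite mulrCA.
have V U k : \sum_c (0 * u U c + M k c * (\sum_c0 u U c0 * (2 * K c0 c))) = 2 * dv K U k.
  by rewrite /dv mulr_sumr; apply: eq_bigr => c _; rewrite D mul0r add0r mulrCA.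
pose F U := ub U a * v U b * X U ^+ m.
suff : cint mu (fun U => 2 * L m a b K (map_mx conjc K) U) = 0.
  rewrite cintZ// => /eqP; rewrite mulf_eq0 pnatr_eq0 /= => /eqP//.
apply: (@expands_rotation K Kadj K3 F).
- by apply: cmeasM => //; apply: cmeasM.
- by apply: cmeasM => //; exact: cmeas_cst.
apply: eq_expands eF => [s U|U|U] //.
rewrite /= E V /L.
have -> : \sum_i ((\sum_c u U c * (2 * K c i))^*%C * (\sum_i0 M i i0 * u U i0) +
   (u U i)^*%C * (\sum_i0 (0 * u U i0 + M i i0 * (\sum_c u U c * (2 * K c i0))))) =
   2 * dX K (map_mx conjc K) U.
  by rewrite /dX mulr_sumr; apply: eq_bigr => i _; rewrite E' V -/(v U i) -/(ub U i); ring.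
rewrite -/(v U b) -/(ub U a) -/(X U); ring.
Qed.

Let L_linear m a b (c1 c2 : C) K1 K2 K1' K2' U :
  L m a b (c1 *: K1 + c2 *: K2) (c1 *: K1' + c2 *: K2') U = c1 * L m a b K1 K1' U + c2 * L m a b K2 K2' U.
Proof.
have lin (f : 'I_n -> C) (A B : 'M[C]_n) k : \sum_c f c * (c1 *: A + c2 *: B) c k =
    c1 * (\sum_c f c * A c k) + c2 * (\sum_c f c * B c k).
  by rewrite !mulr_sumr -big_split; apply: eq_bigr => c _; rewrite !mxE /=; ring.
have ldv k : dv (c1 *: K1 + c2 *: K2) U k = c1 * dv K1 U k + c2 * dv K2 U k.
  by rewrite /dv !mulr_sumr -big_split; apply: eq_bigr => c _; rewrite /du lin /=; ring.
have ldX : dX (c1 *: K1 + c2 *: K2) (c1 *: K1' + c2 *: K2') U = c1 * dX K1 K1' U + c2 * dX K2 K2' U.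
  by rewrite /dX !mulr_sumr -big_split; apply: eq_bigr => c _; rewrite ldv /dub lin /=; ring.
by rewrite /L ldX ldv {1}/dub lin -/(dub K1' U a) -/(dub K2' U a); ring.
Qed.

(** For a != b, the elementary matrix E_ab is a complex combination of the antihermitian matrices
    E_ab - E_ba and i (E_ab + E_ba), both of which satisfy K^3 = - K; the same combination of their
    conjugates is - E_ba. For a = b, the matrix i E_aa plays this part. *)
Let L_elementary m a b : cint mu (L m a b (delta_mx a b) (- delta_mx b a)) = 0.
Proof.
have conj_delta (c : C) i j : map_mx conjc (c *: delta_mx i j : 'M[C]_n) = conjc c *: delta_mx i j.
  by apply/matrixP => p q; rewrite !mxE conjcM (conjc_nat _ _).
pose i : C := (0 +i* 1)%C; have ii : i * i = -1.
  by apply: complex_eqP; rewrite ?(ReM, ImM)/= ?oppr0; ring.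
have ci : conjc i = - i by apply: complex_eqP; rewrite /= ?oppr0.
have comb (c1 c2 : C) K1 K2 : cint mu (L m a b K1 (map_mx conjc K1)) = 0 ->
    cint mu (L m a b K2 (map_mx conjc K2)) = 0 ->
    delta_mx a b = c1 *: K1 + c2 *: K2 -> - delta_mx b a = c1 *: map_mx conjc K1 + c2 *: map_mx conjc K2 ->
    cint mu (L m a b (delta_mx a b) (- delta_mx b a)) = 0.
  move=> h1 h2 -> ->; rewrite (eq_cint mu (L_linear m a b c1 c2 K1 K2 _ _)).
  by rewrite cintD ?cintZ ?h1 ?h2 ?mulr0 ?addr0//; exact: cintgZ.
case: (eqVneq a b) comb => [<-|ab] comb.
  have g0 : cint mu (L m a a (i *: delta_mx a a) (map_mx conjc (i *: delta_mx a a))) = 0.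
    apply: L_generator.
      by apply/matrixP => p q; rewrite !mxE conjcM (conjc_nat _ _) ci mulNr andbC.
    rewrite -!scalemxAl -!scalemxAr -!scalemxAl !mul_delta_mx !scalerA ii -scaleNr; congr (_ *: _); ring.
  apply: (comb (- i) 0 (i *: delta_mx a a) (i *: delta_mx a a)) => //.
    by rewrite scale0r addr0 scalerA mulNr ii opprK scale1r.
  by rewrite conj_delta scale0r addr0 scalerA ci mulrNN ii scaleN1r.
have gen (z : C) : z * conjc z = 1 -> cint mu (L m a b (z *: delta_mx a b - conjc z *: delta_mx b a)
    (map_mx conjc (z *: delta_mx a b - conjc z *: delta_mx b a))) = 0.
  move=> zz; apply: L_generator.
    apply/matrixP => p q; rewrite !mxE conjcB 2!conjcM !(conjc_nat _ _) conjcK.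
    by rewrite (andbC (q == a)) (andbC (q == b)) opprB.
  have d1 : delta_mx a b *m delta_mx a b = 0 :> 'M[C]_n by rewrite mul_delta_mx_0// eq_sym.
  have d2 : delta_mx b a *m delta_mx b a = 0 :> 'M[C]_n by rewrite mul_delta_mx_0.
  have d3 : delta_mx a a *m delta_mx b a = 0 :> 'M[C]_n by rewrite mul_delta_mx_0.
  have d4 : delta_mx b b *m delta_mx a b = 0 :> 'M[C]_n by rewrite mul_delta_mx_0// eq_sym.
  have d5 : delta_mx a b *m delta_mx b a = delta_mx a a :> 'M[C]_n by rewrite mul_delta_mx.
  have d6 : delta_mx b a *m delta_mx a b = delta_mx b b :> 'M[C]_n by rewrite mul_delta_mx.
  have d7 : delta_mx a a *m delta_mx a b = delta_mx a b :> 'M[C]_n by rewrite mul_delta_mx.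
  have d8 : delta_mx b b *m delta_mx b a = delta_mx b a :> 'M[C]_n by rewrite mul_delta_mx.
  move: (delta_mx a b) (delta_mx b a) (delta_mx a a) (delta_mx b b) d1 d2 d3 d4 d5 d6 d7 d8.
  move=> A B P Q d1 d2 d3 d4 d5 d6 d7 d8.
  have -> : (z *: A - conjc z *: B) *m (z *: A - conjc z *: B) = - (P + Q).
    rewrite mulmxBl !mulmxBr -!scalemxAl -!scalemxAr d1 d2 d5 d6 !scaler0 !scalerA (mulrC _ z) zz.
    by rewrite !scale1r sub0r subr0 opprD.
  rewrite mulNmx mulmxDl !mulmxBr -!scalemxAr d3 d4 d7 d8 !scaler0 subr0 sub0r.
  by [].
have z1 : 1 * conjc 1 = 1 :> C by rewrite conjc1 mulr1.
have zi : i * conjc i = 1 by rewrite ci mulrN ii opprK.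
have h2 : (2^-1 : C) + 2^-1 = 1 by field.
have e1 : - (2^-1 * i) * i = 2^-1 by rewrite mulNr -mulrA ii mulrN1 opprK.
have e2 : - (2^-1 * i) * - i = - 2^-1 by rewrite mulrN e1.
apply: (comb 2^-1 (- (2^-1 * i)) _ _ (gen 1 z1) (gen i zi)).
  rewrite conjc1 ci !scalerBr !scalerA e1 e2 mulr1 scaleNr opprK addrACA addNr addr0.
  by rewrite -scalerDl h2 scale1r.
rewrite !(map_mxB (@conjc R)) !conj_delta !conjcK conjc1 ci !scalerBr !scalerA e1 e2 mulr1 scaleNr.
by rewrite addrACA subrr add0r -opprD -scalerDl h2 scale1r.
Qed.

(* Summing the identities of the elementary generators over all pairs (a, b). *)
Lemma haar_moment_recurrence m :
  (n + m)%:R * cint mu (fun U => X U ^+ m.+1) =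
  \tr M * cint mu (fun U => X U ^+ m) + m%:R * cint mu (fun U => X U ^+ m.-1 * \sum_b w U b * v U b).
Proof.
have bw b : bnd (w ^~ b) by apply: bnd_sum => k; apply: bndM.
have mw b : cmeas (w ^~ b) by apply: cmeas_sum => k _; apply: cmeasM => //; exact: cmeas_cst.
pose Y U := \sum_b w U b * v U b.
have bY : bnd Y by apply: bnd_sum => k; apply: bndM.
have mY : cmeas Y by apply: cmeas_sum => k _; apply: cmeasM.
have dE (f : 'I_n -> C) a b k : \sum_c f c * (delta_mx a b : 'M[C]_n) c k = f a * (k == b)%:R.
  rewrite (bigD1 a)//= mxE eqxx big1 ?addr0// => c ca.
  by rewrite mxE (negPf ca) mulr0.
have dNE (f : 'I_n -> C) a b k : \sum_c f c * (- delta_mx a b : 'M[C]_n) c k = - (f a * (k == b)%:R).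
  by rewrite -dE -sumrN; apply: eq_bigr => c _; rewrite mxE mulrN.
have sel (f : 'I_n -> C) b : \sum_k f k * (k == b)%:R = f b.
  by rewrite (bigD1 b)//= eqxx mulr1 big1 ?addr0// => k /negPf ->; rewrite mulr0.
have dvE a b b' U : dv (delta_mx a b) U b' = M b' b * u U a.
  rewrite /dv /du; under eq_bigr do rewrite dE mulrA.
  by rewrite (sel (fun k => M b' k * u U a)).
have dXE a b U : dX (delta_mx a b) (- delta_mx b a) U = w U b * u U a - ub U b * v U a.
  rewrite /dX big_split /= addrC; congr (_ + _).
    by under eq_bigr do rewrite dvE mulrA; rewrite -mulr_suml.
  rewrite /dub; under eq_bigr do rewrite dNE mulNr mulrAC.
  by rewrite sumrN (sel (fun k => ub U b * v U k)).
have LE a b U : L m a b (delta_mx a b) (- delta_mx b a) U =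
   (M b b * (u U a * ub U a)) * X U ^+ m - (ub U b * v U b) * X U ^+ m +
   m%:R * X U ^+ m.-1 * ((u U a * ub U a) * (w U b * v U b) - (ub U a * v U a) * (ub U b * v U b)).
  by rewrite /L dXE dvE /dub dNE eqxx mulr1; ring.
have nu U : \sum_a u U a * ub U a = 1.
  rewrite -[RHS](rmorph1 (real_complex R)) -(unitary_rowP U l) rmorph_sum /=.
  by apply: eq_bigr => a _; rewrite /ub mulcJ.
have S U : \sum_a \sum_b L m a b (delta_mx a b) (- delta_mx b a) U =
    \tr M * X U ^+ m + m%:R * (X U ^+ m.-1 * Y U) - (n + m)%:R * X U ^+ m.+1.
  have s1 : \sum_a \sum_b (M b b * (u U a * ub U a)) * X U ^+ m = \tr M * X U ^+ m.
    rewrite exchange_big /= /mxtrace mulr_suml; apply: eq_bigr => b _.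
    by rewrite -mulr_suml -mulr_sumr nu mulr1.
  have s2 : \sum_(a < n) \sum_b (ub U b * v U b) * X U ^+ m = n%:R * X U ^+ m.+1.
    by rewrite sumr_const card_ord -mulr_suml -/(X U) -exprS mulr_natl.
  have s3 : \sum_a \sum_b m%:R * X U ^+ m.-1 * ((u U a * ub U a) * (w U b * v U b) - (ub U a * v U a) * (ub U b * v U b)) =
     m%:R * (X U ^+ m.-1 * Y U) - m%:R * X U ^+ m.+1.
    transitivity (m%:R * X U ^+ m.-1 * (1 * Y U - X U * X U)).
      rewrite -(nu U) /Y {3}/X !mulr_suml -sumrB mulr_sumr; apply: eq_bigr => a _.
      by rewrite -mulr_sumr !mulr_sumr -sumrB mulr_sumr.
    (* For m = 0 the truncated predecessor in X^(m-1) is harmless, as the factor m is 0. *)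
    by case: (m) => [|k]; rewrite ?mul0r ?subrr//= !exprS; ring.
  under eq_bigr do under eq_bigr do rewrite LE.
  under eq_bigr do rewrite big_split /= sumrB.
  rewrite big_split /= sumrB s1 s2 s3 natrD; ring.
have iXm k : cintg mu (fun U => X U ^+ k) by exact: ibnd.
have iXY : cintg mu (fun U => X U ^+ m.-1 * Y U) by apply: ibnd; [exact: cmeasM|exact: bndM].
have Z : cint mu (fun U => \sum_a \sum_b L m a b (delta_mx a b) (- delta_mx b a) U) = 0.
  rewrite cint_sum; last by move=> a _; apply: cintg_sum.
  rewrite big1// => a _; rewrite (@cint_sum _ _ R mu _ (index_enum 'I_n) xpredT (fun b => L m a b (delta_mx a b) (- delta_mx b a)) (fun b _ => iL _ _ _ _ _)).
  by rewrite big1// => b _; exact: L_elementary.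
rewrite (eq_cint mu S) (cintB (cintgD (cintgZ _ (iXm _)) (cintgZ _ iXY)) (cintgZ _ (iXm _))) in Z.
rewrite (cintD (cintgZ _ (iXm _)) (cintgZ _ iXY)) !(cintZ _ (iXm _)) (cintZ _ iXY) in Z.
by apply/esym/eqP; rewrite -subr_eq0; apply/eqP.
Qed.

End haar_moments.

Lemma haar_arith1 (R : realType) (a p q : R) : a <= 2 * p + 2 * q -> q <= p -> a <= 4 * p.
Proof. lra. Qed.

(** 384 * 1000 = 4 * (750 * 64 + 750 * 64): 4 comes from [cube_sum], 750 from the Hermitian case
    applied to each of two parts, and 64 = 4^3 from the bound of their squared norms by 4 times that
    of T. *)
Lemma haar_arith2 (R : realType) (k I a1 a2 b1 b2 t : R) : k * a1 <= 750 * b1 -> k * a2 <= 750 * b2 ->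
  b1 <= 64 * t -> b2 <= 64 * t -> k * I <= k * (4 * (a1 + a2)) -> k * I <= 384 * 1000 * t.
Proof. lra. Qed.

Lemma cube_sum (R : realType) (p q : R) : 0 <= p -> 0 <= q -> (p + q) ^+ 3 <= 4 * (p ^+ 3 + q ^+ 3).
Proof.
move=> p0 q0; have : 0 <= (p - q) ^+ 2 * (p + q) by rewrite mulr_ge0 ?sqr_ge0 ?addr_ge0.
lra.
Qed.

Lemma sqr_triangle (R : realType) (x y z : R) : 0 <= x -> x <= y + z -> x ^+ 2 <= 2 * y ^+ 2 + 2 * z ^+ 2.
Proof.
move=> x0 xyz; have h : x ^+ 2 <= (y + z) ^+ 2 by rewrite lerXn2r ?nnegrE// (le_trans x0).
have := sqr_ge0 (y - z); lra.
Qed.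

(** * Sixth moments of quadratic forms *)

Section hermitian_moments.
Context {R : realType} (n : nat).
Local Notation C := R[i].
Local Notation G := (unitary_group R n).
Variable mu : probability G R.
Hypotheses (haar : haar_probability mu) (n0 : (0 < n)%N).
Variable l : 'I_n.

Definition qform (M : 'M[C]_n) (U : G) : C := \sum_b conjc (val U l b) * \sum_k M b k * val U l k.
Definition qimage (M : 'M[C]_n) (U : G) b : C := \sum_k M b k * val U l k.
Definition hsnorm2 (M : 'M[C]_n) : R := \sum_i \sum_k normc (M i k) ^+ 2.

Lemma complex_cauchy_schwarz m (a b : 'I_m -> C) : normc (\sum_k a k * b k) ^+ 2 <=
  (\sum_k normc (a k) ^+ 2) * (\sum_k normc (b k) ^+ 2).
Proof.
pose x : 'rV[R]_m := \row_k normc (a k); pose y : 'rV[R]_m := \row_k normc (b k).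
have e (z : 'I_m -> C) : dotp (\row_k normc (z k)) (\row_k normc (z k)) = \sum_k normc (z k) ^+ 2.
  by apply: eq_bigr => k _; rewrite !mxE expr2.
rewrite -!e -!enorm_sqr -exprMn; apply: lerXn2r; rewrite ?nnegrE ?normc_ge0 ?mulr_ge0 ?enorm_ge0//.
apply: le_trans (cauchy_schwarz x y); apply: le_trans (normc_sum_le _ _ _) _.
by apply: ler_sum => k _; rewrite !mxE Normc.normcM.
Qed.

Lemma cmeas_qimage M b : cmeas (qimage M ^~ b).
Proof. by apply: cmeas_sum => k _; apply: cmeasM; [exact: cmeas_cst|exact: cmeas_entry]. Qed.
Lemma cmeas_qform M : cmeas (qform M).
Proof.
by apply: cmeas_sum => k _; apply: cmeasM; [apply: cmeas_conj; exact: cmeas_entry|exact: cmeas_qimage].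
Qed.

Lemma hsnorm2_ge0 M : 0 <= hsnorm2 M.
Proof. by apply: sumr_ge0 => i _; apply: sumr_ge0 => k _; exact: sqr_ge0. Qed.

Lemma qimage_le M U : \sum_b normc (qimage M U b) ^+ 2 <= hsnorm2 M.
Proof.
apply: ler_sum => b _; rewrite -[leRHS]mulr1 -(unitary_rowP U l); exact: complex_cauchy_schwarz.
Qed.

Lemma qform_le M U : normc (qform M U) ^+ 2 <= hsnorm2 M.
Proof.
apply: le_trans (complex_cauchy_schwarz _ _) _.
under eq_bigr do rewrite normc_conj.
by rewrite (unitary_rowP U l) mul1r qimage_le.
Qed.

Let hermitian (M : 'M[C]_n) := map_mx conjc M^T = M.

Let qx M U : R := complex.Re (qform M U).
Let qy M U : R := \sum_b normc (qimage M U b) ^+ 2.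

Let mqx M : measurable_fun setT (qx M). Proof. by have [] := cmeas_qform M. Qed.
Let mqy M : measurable_fun setT (qy M).
Proof.
apply: measurable_sum => b; apply: measurable_funX; exact: cmeas_normc (cmeas_qimage M b).
Qed.
Let qx_le M U : `|qx M U| <= 1 + hsnorm2 M.
Proof.
have := qform_le M U; have := Re_le_normc (qform M U); rewrite -/(qx M U).
have := normc_ge0 (qform M U); have := normr_ge0 (qx M U); nra.
Qed.
Let qy_ge0 M U : 0 <= qy M U. Proof. by apply: sumr_ge0 => b _; exact: sqr_ge0. Qed.

Let iP M a b : rintg mu (fun U => qx M U ^+ a * qy M U ^+ b).
Proof.
apply: (rintg_bounded mu (B := (1 + hsnorm2 M) ^+ a * (1 + hsnorm2 M) ^+ b)).
  by apply: measurable_funM; apply: measurable_funX.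
have h0 := hsnorm2_ge0 M.
move=> U; rewrite normrM !normrX; apply: ler_pM; rewrite ?exprn_ge0//.
  by apply: lerXn2r; rewrite ?nnegrE// addr_ge0.
apply: lerXn2r; rewrite ?nnegrE ?addr_ge0// ger0_norm//.
by apply: le_trans (qimage_le M U) _; rewrite lerDr.
Qed.

Let E M a b := \int[mu]_U (qx M U ^+ a * qy M U ^+ b).

Let hermE M : hermitian M -> forall i k, conjc (M i k) = M k i.
Proof. by move=> hM i k; rewrite -[in RHS]hM !mxE. Qed.

Let herm_wv (M : 'M[C]_n) (U : G) (b : 'I_n) : hermitian M -> \sum_k conjc (val U l k) * M k b = conjc (qimage M U b).
Proof.
move=> hM; rewrite conjc_sum; apply: eq_bigr => k _.
by rewrite conjcM (hermE hM) mulrC.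
Qed.

Let herm_qform M U : hermitian M -> qform M U = (qx M U)%:C.
Proof.
move=> hM; have cq : conjc (qform M U) = qform M U.
  rewrite /qform conjc_sum; under eq_bigr do rewrite conjcM conjcK -/(qimage M U _) -(herm_wv _ _ hM) mulr_sumr.
  rewrite exchange_big; apply: eq_bigr => k _ /=; rewrite mulr_sumr; apply: eq_bigr => b _; ring.
apply: complex_eqP => //=; have := congr1 (@complex.Im R) cq.
by case: (qform M U) => x y /= ?; lra.
Qed.

(** For Hermitian M the form is real and the last factor of the recurrence, <u, M^2 u>, is |M u|^2:
    the mixed moments [E M a b] of these two quantities are then linked. *)
Let herm_rec M m : hermitian M -> (n + m)%:R * E M m.+1 0 =
  complex.Re (\tr M) * E M m 0 + m%:R * E M m.-1 1.
Proof.
move=> hM; have := haar_moment_recurrence haar l M m.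
have trE : \tr M = (complex.Re (\tr M))%:C.
  have : conjc (\tr M) = \tr M by rewrite conjc_sum; apply: eq_bigr => k _; rewrite (hermE hM).
  by case: (\tr M) => x y [] ?; apply: complex_eqP => //=; lra.
have XE k : cint mu (fun U => qform M U ^+ k) = (E M k 0)%:C.
  rewrite /E -cint_real; apply: eq_cint => U; rewrite (herm_qform _ hM).
  by rewrite expr0 mulr1 rmorphXn.
have YE k : cint mu (fun U => qform M U ^+ k * \sum_b (\sum_k0 conjc (val U l k0) * M k0 b) * qimage M U b) = (E M k 1)%:C.
  rewrite /E -cint_real; apply: eq_cint => U; rewrite (herm_qform _ hM).
  rewrite expr1 rmorphM rmorphXn; congr (_ * _); rewrite /qy rmorph_sum; apply: eq_bigr => b _.
  by rewrite (herm_wv _ _ hM) mulrC mulcJ.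
rewrite -/(qform M) in XE YE *.
rewrite (XE m.+1) (XE m) (YE m.-1) trE -[(n + m)%:R](rmorph_nat (real_complex R)) -[m%:R](rmorph_nat (real_complex R)).
by rewrite -!rmorphM -rmorphD => /(congr1 (@complex.Re R)).
Qed.

Let N : R := n%:R.
Let N0 : 0 < N. Proof. by rewrite ltr0n. Qed.

(* Y = <u, M^2 u> is itself the quadratic form of the nonnegative matrix B = M^2, for
   which <u, B^2 u> <= tr B <u, B u>. *)
Let EY3 M : hermitian M -> N ^+ 3 * E M 0 3 <= 6 * hsnorm2 M ^+ 3.
Proof.
move=> hM; pose B := M *m M.
have hB : hermitian B by rewrite /hermitian trmx_mul map_mxM hM.
have BE U b : qimage B U b = \sum_k M b k * qimage M U k.
  rewrite /qimage; under eq_bigr do rewrite mxE mulr_suml.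
  rewrite exchange_big; apply: eq_bigr => k _ /=; rewrite mulr_sumr.
  by apply: eq_bigr => j _; rewrite mulrA.
have xB U : qx B U = qy M U.
  suff : qform B U = (qy M U)%:C by rewrite (herm_qform _ hB) => -[].
  rewrite /qform -/(qimage B U _); under eq_bigr do rewrite -/(qimage B U _) BE mulr_sumr.
  rewrite exchange_big /qy rmorph_sum; apply: eq_bigr => k _ /=.
  under eq_bigr do rewrite mulrA; rewrite -mulr_suml (herm_wv _ _ hM) mulrC mulcJ.
  by rewrite rmorphXn.
have yB U : qy B U <= hsnorm2 M * qy M U.
  rewrite /hsnorm2 mulr_suml; apply: ler_sum => b _; rewrite BE; exact: complex_cauchy_schwarz.
have trB : complex.Re (\tr B) = hsnorm2 M.
  rewrite /mxtrace Re_sum; apply: eq_bigr => i _; rewrite mxE Re_sum; apply: eq_bigr => k _.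
  by rewrite -(hermE hM i k) mulcJ.
have EB a b : E B a b = \int[mu]_U (qy M U ^+ a * qy B U ^+ b).
  by apply: eq_Rintegral => U _; rewrite xB.
have E0 a : E B a 0 = E M 0 a.
  by rewrite EB; apply: eq_Rintegral => U _; rewrite !expr0 mulr1 mul1r.
have E1 a : E B a 1 <= hsnorm2 M * E M 0 a.+1.
  rewrite EB -(RintZ _ (iP M 0 a.+1)); apply: Rint_le.
  - by apply: eq_rintg (iP B a 1) => U; rewrite xB.
  - exact: rintgZ (iP M 0 a.+1).
  move=> U; rewrite expr0 mul1r expr1 exprS mulrC.
  have := ler_wpM2l (exprn_ge0 a (qy_ge0 M U)) (yB U); nra.
have E00 : E M 0 0 = 1.
  by rewrite /E -[RHS](Rint_prob_cst mu 1); apply: eq_Rintegral => U _; rewrite !expr0 mulr1.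
(* With h the squared norm of M and y_a the moments of |M u|^2, three recurrence steps give N y1 <=
   h, N y2 <= 2 h y1 and N y3 <= 3 h y2; hence the constant 6. *)
have := herm_rec 0 hB; have := herm_rec 1 hB; have := herm_rec 2 hB.
rewrite !E0 trB E00 mul0r addr0 /= addn0 !natrD -/N mulr1.
have := E1 0; have := E1 1; have h0 := hsnorm2_ge0 M; set h := hsnorm2 M in h0 *.
have Ep a : 0 <= E M 0 a.
  by rewrite /E; apply: Rintegral_ge0 => U _; rewrite expr0 mul1r exprn_ge0.
have := Ep 1; have := Ep 2; have := Ep 3.
move: (E M 0 1) (E M 0 2) (E M 0 3) (E B 0 1) (E B 1 1) => y1 y2 y3 b0 b1 p3 p2 p1 k1 k0 r3 r2 r1.
have q2 : N * y2 <= 2 * h * y1 by nra.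
have q3 : N * y3 <= 3 * h * y2 by nra.
have nn := N0; have := ltW N0 => nn'.
have q2' : N ^+ 2 * y2 <= 2 * h ^+ 2.
  have := ler_wpM2l nn' q2; nra.
have : N ^+ 3 * y3 <= N ^+ 2 * (3 * h * y2) by rewrite exprSr -mulrA ler_wpM2l// sqr_ge0.
have : h * (N ^+ 2 * y2) <= h * (2 * h ^+ 2) by rewrite ler_wpM2l.
nra.
Qed.

(** With zero trace the recurrence reads (N + 5) E x^6 = 5 E x^4 y. The inequality 3 p^2 q <= 2 p^3
    + q^3, for p = N x^2 and q = 5 y, gives N^3 E x^6 <= 125 E y^3, and 750 = 125 * 6. *)
Let EX6 M : hermitian M -> \tr M = 0 -> N ^+ 6 * E M 6 0 <= 750 * hsnorm2 M ^+ 3.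
Proof.
move=> hM tr0; have := herm_rec 5 hM; rewrite tr0 mul0r add0r natrD -/N [5.-1]/= => r.
have Ep : 0 <= E M 6 0.
  by rewrite /E; apply: Rintegral_ge0 => U _; rewrite expr0 mulr1 (exprM _ 2 3) exprn_ge0// sqr_ge0.
have y : 3 * (5 * N ^+ 2 * E M 4 1) <= 2 * (N ^+ 3 * E M 6 0) + 125 * E M 0 3.
  rewrite /E -!(RintZ _ (iP _ _ _)) -!(RintZ _ (rintgZ _ (iP _ _ _))) -RintD; last 2 first.
  - exact: rintgZ (rintgZ _ (iP M 6 0)).
  - exact: rintgZ (iP M 0 3).
  apply: Rint_le.
  - exact: rintgZ (rintgZ _ (iP M 4 1)).
  - apply: rintgD; [exact: rintgZ (rintgZ _ (iP M 6 0))|exact: rintgZ (iP M 0 3)].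
  move=> U; rewrite !expr0 expr1 mulr1 mul1r (exprM _ 2 2) (exprM _ 2 3).
  have := sqr_ge0 (qx M U); have := qy_ge0 M U; move: (qx M U ^+ 2) (qy M U) => p q q0 p0.
  have : 0 <= (N * p - 5 * q) ^+ 2 * (2 * (N * p) + 5 * q).
    by rewrite mulr_ge0 ?sqr_ge0// addr_ge0 ?mulr_ge0// (ltW N0).
  lra.
have e3 := EY3 hM; have nn := N0.
move: (E M 6 0) (E M 4 1) (E M 0 3) (hsnorm2 M ^+ 3) Ep y e3 r => x z w h x0 y e3 r.
have s1 : N ^+ 3 * x <= 125 * w.
  have n2 : 0 <= N ^+ 2 by exact: sqr_ge0.
  have : N ^+ 2 * (N * x) <= N ^+ 2 * (5 * z) by apply: ler_wpM2l => //; nra.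
  lra.
have : N ^+ 3 * (N ^+ 3 * x) <= N ^+ 3 * (125 * w) by rewrite ler_wpM2l// exprn_ge0// ltW.
lra.
Qed.

(** As u is a unit vector, subtracting the multiple tau = tr T / N of the identity centers the form.
    The traceless matrix that remains is H1 + i H2 with H1 and H2 Hermitian and traceless, and the
    previous bound applies to both. *)
Lemma haar_moment6 (T : 'M[C]_n) :
  N ^+ 6 * \int[mu]_U (normc (qform T U - \tr T / n%:R) ^+ 6) <= 384 * 1000 * hsnorm2 T ^+ 3.
Proof.
pose tau : C := \tr T / n%:R; pose T0 : 'M[C]_n := T - tau%:M.
have nC : (n%:R : C) != 0 by rewrite pnatr_eq0 -lt0n.
have q0 U : qform T U - tau = qform T0 U.
  rewrite /qform -[tau in LHS]mulr1 -(unitary_rowC U l) mulr_sumr -sumrB; apply: eq_bigr => b _.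
  have -> : \sum_k T0 b k * val U l k = (\sum_k T b k * val U l k) - tau * val U l b.
    under eq_bigr do rewrite !mxE mulrBl; rewrite sumrB; congr (_ - _).
    by rewrite (bigD1 b)//= eqxx mulr1n big1 ?addr0// => k; rewrite eq_sym => /negPf ->; rewrite mulr0n mul0r.
  by rewrite mulrBr; congr (_ - _); ring.
have tr0 : \tr T0 = 0 by rewrite linearB /= mxtrace_scalar -(mulr_natr tau) /tau divfK// subrr.
pose T0a := map_mx conjc T0^T; pose i : C := (0 +i* 1)%C.
pose H1 := 2^-1 *: (T0 + T0a); pose H2 := (- (2^-1 * i)) *: (T0 - T0a).
have ii : i * i = -1 by apply: complex_eqP; rewrite ?(ReM, ImM)/= ?oppr0; ring.
have ci : conjc i = - i by apply: complex_eqP; rewrite /= ?oppr0.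
have c2 : conjc (2^-1 : C) = 2^-1 by rewrite conjc_inv (conjc_nat _ 2).
have h1 : hermitian H1.
  have h1 (S : 'M[C]_n) : hermitian (2^-1 *: (S + map_mx conjc S^T)).
    apply/matrixP => p q; rewrite !mxE conjcM c2 conjcD conjcK; congr (_ * _); exact: addrC.
  exact: h1.
have h2 : hermitian H2.
  have h2 (S : 'M[C]_n) : hermitian ((- (2^-1 * i)) *: (S - map_mx conjc S^T)).
    apply/matrixP => p q; rewrite !mxE conjcM -mulNr conjcM (_ : conjc (- 2^-1) = - 2^-1 :> C); last first.
      by rewrite -{2}c2; apply: complex_eqP.
    by rewrite ci conjcB conjcK; move: (S p q) (conjc _) => x y; ring.
  exact: h2.
have tra : \tr T0a = 0.
  have -> : \tr T0a = conjc (\tr T0) by rewrite conjc_sum; apply: eq_bigr => k _; rewrite !mxE.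
  by rewrite tr0 conjc0.
have t1 : \tr H1 = 0 by rewrite linearZ linearD /= tr0 tra addr0 mulr0.
have t2 : \tr H2 = 0 by rewrite linearZ linearB /= tr0 tra subr0 mulr0.
have T0E : T0 = H1 + i *: H2.
  have hh : (2^-1 : C) + 2^-1 = 1 by field.
  have e1 : i * (- (2^-1 * i)) = 2^-1 by rewrite mulrN mulrCA ii mulrN1 opprK.
  by rewrite /H1 /H2 scalerA e1 -scalerDr addrACA subrr addr0 scalerDr -scalerDl hh scale1r.
have qE U : normc (qform T0 U) ^+ 2 = qx H1 U ^+ 2 + qx H2 U ^+ 2.
  have -> : qform T0 U = qform H1 U + i * qform H2 U.
    rewrite T0E /qform mulr_sumr -big_split; apply: eq_bigr => b _ /=.
    rewrite mulrCA -mulrDr; congr (_ * _); rewrite mulr_sumr -big_split; apply: eq_bigr => k _ /=.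
    by rewrite !mxE; ring.
  rewrite (herm_qform _ h1) (herm_qform _ h2); move: (qx H1 U) (qx H2 U) => x y.
  by rewrite normc_sqr !(ReD, ImD, ReM, ImM) /=; ring.
have hsle (A B : 'M[C]_n) (c : C) : normc c = 2^-1 -> hsnorm2 (c *: (A + B)) <= 2^-1 * (hsnorm2 A + hsnorm2 B).
  move=> hc; rewrite /hsnorm2 -big_split mulr_sumr; apply: ler_sum => p _ /=.
  rewrite -big_split mulr_sumr; apply: ler_sum => q _ /=; rewrite !mxE Normc.normcM hc exprMn.
  have := normcD_le (A p q) (B p q); have := normc_ge0 (A p q + B p q).
  move: (normc (A p q)) (normc (B p q)) (normc (A p q + B p q)) => y z x x0 xyz.
  have := sqr_ge0 (y - z); have : x ^+ 2 <= (y + z) ^+ 2 by rewrite lerXn2r ?nnegrE// (le_trans x0).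
  lra.
have hsa : hsnorm2 T0a = hsnorm2 T0.
  rewrite /hsnorm2 exchange_big; apply: eq_bigr => p _; apply: eq_bigr => q _.
  by rewrite !mxE normc_conj.
have hsN (A : 'M[C]_n) : hsnorm2 (- A) = hsnorm2 A.
  by apply: eq_bigr => p _; apply: eq_bigr => q _; rewrite mxE normcN.
have n2 : normc (2^-1 : C) = 2^-1.
  by rewrite (_ : 2^-1 = (2^-1)%:C) ?normcR ?ger0_norm// fmorphV rmorph_nat.
have b1 : hsnorm2 H1 <= hsnorm2 T0.
  by apply: le_trans (hsle _ _ _ n2) _; rewrite hsa; lra.
have b2 : hsnorm2 H2 <= hsnorm2 T0.
  apply: le_trans (hsle _ _ _ _) _; last by rewrite hsN hsa; lra.
  rewrite normcN Normc.normcM n2 (_ : normc i = 1) ?mulr1//.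
  by rewrite /= expr0n add0r expr1n sqrtr1.
have b0 : hsnorm2 T0 <= 4 * hsnorm2 T.
  (* Cauchy-Schwarz on the diagonal of T. *)
  have tau2 : n%:R * normc tau ^+ 2 <= hsnorm2 T.
    have := complex_cauchy_schwarz (fun k => T k k) (fun=> 1).
    under eq_bigr do rewrite mulr1; rewrite -/(\tr T).
    under [X in _ <= _ * X]eq_bigr do rewrite Normc.normc1 expr1n.
    rewrite sumr_const card_ord => H.
    have -> : n%:R * normc tau ^+ 2 = n%:R^-1 * normc (\tr T) ^+ 2.
      have hn : normc (n%:R^-1 : C) = n%:R^-1.
        by rewrite (_ : n%:R^-1 = (n%:R^-1)%:C) ?normcR ?ger0_norm// fmorphV rmorph_nat.
      have nn : n%:R != 0 :> R by rewrite pnatr_eq0 -lt0n.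
      by rewrite /tau Normc.normcM hn; field.
    rewrite mulrC ler_pdivrMr//; apply: le_trans H _; rewrite ler_wpM2r//.
    apply: ler_sum => p _; rewrite [leRHS](bigD1 p)//= lerDl sumr_ge0// => q _; exact: sqr_ge0.
  have : hsnorm2 T0 <= 2 * hsnorm2 T + 2 * (n%:R * normc tau ^+ 2).
    have cst : n%:R * normc tau ^+ 2 = \sum_(p < n) normc tau ^+ 2.
      by rewrite sumr_const card_ord mulr_natl.
    rewrite cst /hsnorm2 (mulr_sumr _ _ _ 2) [X in _ <= _ + X](mulr_sumr _ _ _ 2) -big_split.
    apply: ler_sum => p _ /=; rewrite (mulr_sumr _ _ _ 2).
    have -> : 2 * normc tau ^+ 2 = \sum_q 2 * ((p == q)%:R * normc tau ^+ 2).
      by rewrite (bigD1 p)//= eqxx mul1r big1 ?addr0// => q; rewrite eq_sym => /negPf ->; rewrite mul0r mulr0.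
    rewrite -big_split; apply: ler_sum => q _ /=; rewrite !mxE.
    have -> : (p == q)%:R * normc tau ^+ 2 = normc (tau *+ (p == q)) ^+ 2.
      by case: (p == q); rewrite ?mulr1n ?mulr0n ?mul1r ?mul0r ?Normc.normc0 ?expr0n.
    have := normcB_le (T p q) (tau *+ (p == q)); have := normc_ge0 (T p q - tau *+ (p == q)).
    move: (normc (T p q)) (normc (tau *+ (p == q))) (normc (T p q - tau *+ (p == q))) => y z x x0 xyz.
    exact: sqr_triangle.
  by move=> h; exact: haar_arith1 h tau2.
have h0 := hsnorm2_ge0 T; have h00 := hsnorm2_ge0 T0.
have le3 (x : R) : 0 <= x -> x <= hsnorm2 T0 -> x ^+ 3 <= 64 * hsnorm2 T ^+ 3.
  move=> x0 xle; have : x ^+ 3 <= (4 * hsnorm2 T) ^+ 3.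
    by apply: lerXn2r; rewrite ?nnegrE ?mulr_ge0// (le_trans xle b0).
  by rewrite exprMn (_ : 4 ^+ 3 = 64)// -natrX.
have e1 := EX6 h1 t1; have e2 := EX6 h2 t2.
have l1 := le3 _ (hsnorm2_ge0 H1) b1; have l2 := le3 _ (hsnorm2_ge0 H2) b2.
have pt U : normc (qform T U - tau) ^+ 6 <= 4 * (qx H1 U ^+ 6 * qy H1 U ^+ 0 + qx H2 U ^+ 6 * qy H2 U ^+ 0).
  have x6 (t : R) : t ^+ 6 = (t ^+ 2) ^+ 3 by rewrite -exprM.
  rewrite q0; have := qE U; move: (normc (qform T0 U)) (qx H1 U) (qx H2 U) (qy H1 U) (qy H2 U) => a b c y1 y2 abc.
  by rewrite !expr0 !mulr1 !x6 abc; apply: cube_sum; exact: sqr_ge0.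
have key : \int[mu]_U (normc (qform T U - tau) ^+ 6) <= 4 * (E H1 6 0 + E H2 6 0).
  rewrite /E -(RintD (iP _ _ _) (iP _ _ _)) -(RintZ _ (rintgD (iP _ _ _) (iP _ _ _))); apply: Rint_le.
  - apply: (rintg_bounded mu (B := (hsnorm2 T0) ^+ 3)).
      apply: measurable_funX; apply: cmeas_normc; apply: cmeasB; [exact: cmeas_qform|exact: cmeas_cst].
    move=> U; rewrite q0 ger0_norm ?exprn_ge0 ?normc_ge0// (exprM _ 2 3) lerXn2r ?nnegrE ?sqr_ge0//.
    exact: qform_le.
  - exact: rintgZ (rintgD (iP _ _ _) (iP _ _ _)).
  exact: pt.
have N6 : 0 <= N ^+ 6 by rewrite exprn_ge0// ltW.
exact: (haar_arith2 e1 e2 l1 l2 (ler_wpM2l N6 key)).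
Qed.

End hermitian_moments.

(** * The eigenspaces of the oscillator *)

Lemma eq_Rint d (T : measurableType d) (R : realType) (mu : {measure set T -> \bar R}) (f g : T -> R) :
  f =1 g -> \int[mu]_x f x = \int[mu]_x g x.
Proof. by move=> /funext ->. Qed.

Section directional.
Context {R : realType} (n : nat).
Implicit Types (f g : 'rV[R]_n -> R) (x v : 'rV[R]_n).
Local Notation e_ i := (delta_mx ord0 i : 'rV[R]_n).

Lemma is_derive_row f x v df : is_derive (0 : R) (1 : R) (fun t : R => f (x + t *: v)) df ->
  is_derive x v f df.
Proof.
move=> [dF vF]; pose F t := f (x + t *: v).
have E : (fun h : R => h^-1 *: ((f \o shift x) (h *: v) - f x)) =
    (fun h : R => h^-1 *: ((F \o shift 0) (h *: (1 : R)) - F 0)).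
  by apply/funext => h /=; rewrite /F /= scale0r addr0 addr0 scaler1 (addrC x).
split; first by rewrite /derivable E; exact: dF.
by rewrite -vF /derive E.
Qed.

Lemma is_derive_line f x v (t : R) : derivable f (x + t *: v) v ->
  is_derive t (1 : R) (fun s : R => f (x + s *: v)) ('D_v f (x + t *: v)).
Proof.
move=> df; pose F s := f (x + s *: v); pose y := x + t *: v.
have E : (fun h : R => h^-1 *: ((f \o shift y) (h *: v) - f y)) =
    (fun h : R => h^-1 *: ((F \o shift t) (h *: (1 : R)) - F t)).
  by apply/funext => h /=; rewrite /F /y /= scaler1 scalerDl addrCA.
by split; [rewrite /derivable -E|rewrite /derive -E].
Qed.

Lemma is_derive_rowM f g x v df dg : is_derive x v f df -> is_derive x v g dg ->
  is_derive x v (fun y => f y * g y) (df * g x + f x * dg).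
Proof.
move=> hf hg; have := @is_deriveM R _ f g x v df dg hf hg.
by rewrite addrC (mulrC df) => H; exact: H.
Qed.

Lemma addr_delta_coord x (t : R) i k : (x + t *: e_ i) ord0 k = x ord0 k + t *+ (k == i).
Proof. by rewrite !mxE eqxx /= mulr_natr. Qed.

Lemma continuous_row_prod (f : 'I_n -> R -> R) : (forall i, continuous (f i)) ->
  continuous (fun x : 'rV[R]_n => \prod_i f i (x ord0 i)).
Proof.
move=> cf; have H (r : seq 'I_n) : continuous (fun x : 'rV[R]_n => \prod_(i <- r) f i (x ord0 i)).
  elim: r => [|i r IH].
    by rewrite (_ : (fun x : 'rV[R]_n => _) = cst 1); [exact: cst_continuous|apply/funext => y; rewrite big_nil].
  rewrite (_ : (fun x : 'rV[R]_n => _) = (fun x : 'rV[R]_n => f i (x ord0 i) * \prod_(j <- r) f j (x ord0 j))); last first.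
    by apply/funext => y; rewrite big_cons.
  move=> x; have A : {for x, continuous (fun x : 'rV[R]_n => f i (x ord0 i))}.
    exact: (@continuous_comp _ _ _ (fun x : 'rV[R]_n => x ord0 i) (f i) x (@coord_continuous R 1 n ord0 i x) (cf i _)).
  exact: (cvgM A (IH x)).
exact: H.
Qed.

Definition rwt (x : 'rV[R]_n) : R := \prod_i wt (x ord0 i).

Lemma rwt_ge0 x : 0 <= rwt x. Proof. by apply: prodr_ge0 => i _; exact: wt_ge0. Qed.
Lemma rwt_le1 x : rwt x <= 1.
Proof. by apply: prodr_ile1 => i _; rewrite wt_ge0 wt_le1. Qed.
Lemma rintg_rwt : rintg (lebesgue_row n) rwt.
Proof. by have [] := @rint_row_prod R n (fun=> wt) (fun=> rintg_wt). Qed.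

Lemma wt_shift (x s : R) : `|s| <= 1 -> wt (x + s) <= 3 * wt x.
Proof.
move=> hs; rewrite /wt -(@ler_pM2l _ (1 + (x + s) ^+ 2)) ?oneDsqr_gt0//.
rewrite mulfV ?lt0r_neq0 ?oneDsqr_gt0// mulrA ler_pdivlMr ?oneDsqr_gt0// mul1r.
have : `|s| ^+ 2 = s ^+ 2 by rewrite real_normK ?num_real.
(* 3 (1 + (x + s)^2) - (1 + x^2) = 2 + 2 (x + 3 s / 2)^2 - 3 s^2 / 2. *)
have := normr_ge0 s; have := sqr_ge0 (x + 3 / 2 * s) => h1 h2 h3.
have s2 : s ^+ 2 <= 1 by rewrite -h3; nra.
nra.
Qed.

Lemma rwt_shift x (s : R) i : `|s| <= 1 -> rwt (x + s *: e_ i) <= 3 * rwt x.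
Proof.
move=> hs; rewrite /rwt (bigD1 i)//= [X in _ <= _ * X](bigD1 i)//= addr_delta_coord eqxx mulrA.
have -> : \prod_(k | k != i) wt ((x + s *: e_ i) ord0 k) = \prod_(k | k != i) wt (x ord0 k).
  by apply: eq_bigr => k /negPf ki; rewrite addr_delta_coord ki mulr0n addr0.
apply: ler_wpM2r; last exact: wt_shift.
by apply: prodr_ge0 => k _; exact: wt_ge0.
Qed.

(* Translations preserve the integral, so the difference quotients integrate to 0. *)
Lemma ibp_row f f' i (M : R) : (forall x, is_derive x (e_ i) f (f' x)) ->
  measurable_fun setT f -> measurable_fun setT f' ->
  (forall x, `|f x| <= M * rwt x) -> (forall x, `|f' x| <= M * rwt x) ->
  \int[lebesgue_row n]_x f' x = 0.
Proof.
move=> df mf mf' bf bf'; pose t (k : nat) : R := k.+1%:R^-1.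
have t0 k : 0 < t k by rewrite invr_gt0.
have t1 k : t k <= 1 by rewrite invf_le1 ?ler1n.
have iM := rintgZ M rintg_rwt.
have iF : rintg (lebesgue_row n) f := rintg_le mf iM bf.
have M0 : 0 <= M * rwt 0 := le_trans (normr_ge0 _) (bf 0).
pose D k x := (t k)^-1 * (f (x + t k *: e_ i) - f x).
have iD k : rintg (lebesgue_row n) (D k).
  exact: rintgZ (rintgB (mpres_rintg (mpres_rowD (t k *: e_ i)) iF) iF).
have D0 k : \int[lebesgue_row n]_x D k x = 0.
  have it := mpres_rintg (mpres_rowD (t k *: e_ i)) iF.
  by rewrite (RintZ _ (rintgB it iF)) (RintB it iF) -(mpres_Rint (mpres_rowD (t k *: e_ i)) iF) subrr mulr0.
have bD k x : `|D k x| <= 3 * (M * rwt x).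
  have dl (s : R) : is_derive s (1 : R) (fun s : R => f (x + s *: e_ i)) (f' (x + s *: e_ i)).
    have [d1 d2] := df (x + s *: e_ i); rewrite -d2; exact: is_derive_line.
  have [s hs sE] := @MVT _ (fun s : R => f (x + s *: e_ i)) (fun s => f' (x + s *: e_ i)) 0 (t k) (t0 k)
    (fun s _ => dl s) (derivable_within_continuous (fun s _ => @ex_derive _ _ _ _ _ _ _ (dl s))).
  rewrite /D; rewrite scale0r addr0 subr0 in sE; rewrite sE mulrC mulfK ?lt0r_neq0//.
  move: hs; rewrite in_itv /= => /andP[s0 s1].
  apply: le_trans (bf' _) _.
  have M00 : 0 <= M.
    by have := M0; rewrite /rwt; under eq_bigr do rewrite mxE /wt expr0n addr0 invr1; rewrite big1 ?mulr1.
  rewrite mulrCA; apply: ler_wpM2l => //; apply: rwt_shift.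
  by rewrite gtr0_norm// (le_trans (ltW s1)).
have cD x : D ^~ x @ \oo --> f' x.
  have [d1 d2] := df x; rewrite -d2.
  have H : (fun h : R => h^-1 *: ((f \o shift x) (h *: e_ i) - f x)) @ (0:R)^' --> 'D_(e_ i) f x by exact: d1.
  have tc : t @ \oo --> (0 : R)^'.
    move=> P nP; have : \forall k \near \oo, t k != 0 -> P (t k) := @cvg_harmonic R _ nP.
    by apply: filterS => k; apply; rewrite lt0r_neq0.
  rewrite (_ : D ^~ x = (fun h : R => h^-1 *: ((f \o shift x) (h *: e_ i) - f x)) \o t); last first.
    by apply/funext => k; rewrite /D /= (addrC x).
  exact: (cvg_comp _ _ tc H).
have [_] := Rint_cvg (fun k => rintg_meas (iD k)) (rintgZ 3 iM) cD bD.
under eq_fun do rewrite D0.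
move=> H; apply: (@cvg_unique _ (@Rhausdorff R) _ _ _ _ H); exact: cvg_cst.
Qed.
End directional.

(** * Polynomials times gaussians *)

Section gaussian_polynomials.
Context {R : realType} (n : nat).
Local Notation C := R[i].
Local Notation toC := (map_poly (real_complex R)).
Local Notation e_ i := (delta_mx ord0 i : 'rV[R]_n).
Implicit Types (P Q : 'I_n -> {poly R}) (x : 'rV[R]_n).

Definition gp (p : {poly R}) (t : R) : R := p.[t] * expR (- (t ^+ 2 / 2)).

Lemma gpE p t : (toC p).[t%:C] * cgauss 2^-1 0 t = (gp p t)%:C.
Proof.
rewrite hornerC_map /cgauss [complex.Re 0]/= [complex.Im 0]/= !mul0r addr0 cexpi0 mulr1 rmorphM.
by rewrite (mulrC 2^-1).
Qed.

Lemma is_derive_gp p (t : R) : is_derive t (1 : R) (gp p) (gp (p^`() - 'X * p) t).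
Proof.
have [+ _] := cderM (cder_poly (toC p)) (cder_cgauss 2^-1 0) t.
under eq_fun do rewrite gpE; rewrite [X in is_derive _ _ X _](_ : _ = gp p)//.
suff -> : (toC p)^`().[t%:C] * cgauss 2^-1 0 t +
   (toC p).[t%:C] * ((0 - (2 * 2^-1 * t)%:C) * cgauss 2^-1 0 t) = (gp (p^`() - 'X * p) t)%:C by [].
rewrite -gpE (_ : toC (p^`() - 'X * p) = (toC p)^`() - 'X * toC p); last first.
  by rewrite rmorphB /= deriv_map rmorphM /= map_polyX.
by rewrite hornerD hornerN hornerM hornerX mulfV// mul1r sub0r; ring.
Qed.

Lemma gp_wt p : exists2 M, 0 <= M & forall t, `|gp p t| <= M * wt t.
Proof.
have [M M0 H] := @poly_gauss_bounded R (toC p) 2^-1 0 (ltac:(by rewrite invr_gt0)).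
exists M => // t; apply: le_trans (H t); rewrite hornerC_map normcR mul0r addr0 /gp normrM.
by rewrite (ger0_norm (expR_ge0 _)) (mulrC 2^-1).
Qed.

Lemma gp_continuous p : continuous (gp p).
Proof.
move=> x; apply: differentiable_continuous; apply/derivable1_diffP.
by have [] := is_derive_gp p x.
Qed.

Definition gpoly P x : R := \prod_i gp (P i) (x ord0 i).

(** The partial derivative in x_i, acting on the tuple of polynomial factors. The products [gpoly]
    are stable under it, so that all iterated derivatives stay explicit. *)
Definition upd (i : 'I_n) P : 'I_n -> {poly R} :=
  fun k => if k == i then (P k)^`() - 'X * P k else P k.

Lemma gpoly_is_derive P i x : is_derive x (e_ i) (gpoly P) (gpoly (upd i P) x).
Proof.
apply: is_derive_row; pose c := \prod_(k | k != i) gp (P k) (x ord0 k).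
have E : (fun t : R => gpoly P (x + t *: e_ i)) = (fun t => c * gp (P i) (t + x ord0 i)).
  apply/funext => t; rewrite /gpoly (bigD1 i)//= addr_delta_coord eqxx mulr1n addrC mulrC; congr (_ * _).
  by apply: eq_bigr => k /negPf ki; rewrite addr_delta_coord ki mulr0n addr0.
rewrite E; have -> : gpoly (upd i P) x = c * gp ((P i)^`() - 'X * P i) (x ord0 i).
  rewrite /gpoly (bigD1 i)//= mulrC /upd eqxx; congr (_ * _).
  by apply: eq_bigr => k /negPf ->.
have h := is_derive_gp (P i) (0 + x ord0 i).
have s : is_derive (0 : R) (1 : R) (fun t : R => t + x ord0 i) 1.
  by rewrite -[X in is_derive _ _ _ X]addr0; apply: is_deriveD.
have := @is_derive1_comp R (gp (P i)) (fun t => t + x ord0 i) 0 _ _ h s.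
rewrite mulr1 => H; have := @is_deriveZ R _ _ _ c _ _ _ H; rewrite add0r; exact: id.
Qed.

Lemma partial_gpoly P i : partial i (gpoly P) = gpoly (upd i P).
Proof. by apply/funext => x; rewrite /partial; have [_ ->] := gpoly_is_derive P i x. Qed.

Lemma partials_gpoly P s : exists Q, partials s (gpoly P) = gpoly Q.
Proof.
elim: s => [|i s [Q IH]]; first by exists P.
by exists (upd i Q); rewrite /= IH partial_gpoly.
Qed.

Lemma gpoly_continuous P : continuous (gpoly P).
Proof. exact: (continuous_row_prod (f := fun i => gp (P i)) (fun i => @gp_continuous (P i))). Qed.

Lemma measurable_gpoly P : measurable_fun setT (gpoly P).
Proof. exact: continuous_row_measurable (@gpoly_continuous P). Qed.

Lemma gpoly_rwt P : exists2 M, 0 <= M & forall x, `|gpoly P x| <= M * rwt x.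
Proof.
have /choice[M HM] : forall i, exists M, 0 <= M /\ forall t, `|gp (P i) t| <= M * wt t.
  by move=> i; have [M M0 H] := gp_wt (P i); exists M.
exists (\prod_i M i); first by apply: prodr_ge0 => i _; have [] := HM i.
move=> x; rewrite normr_prod -big_split; apply: ler_prod => i _.
by apply/andP; split => //; exact: (HM i).2.
Qed.

Lemma rintg_gpoly P : rintg (lebesgue_row n) (gpoly P).
Proof.
have [M _ H] := gpoly_rwt P.
exact: rintg_le (measurable_gpoly P) (rintgZ M (@rintg_rwt R n)) H.
Qed.

Lemma smooth_gpoly P : smooth (gpoly P).
Proof.
move=> s; have [Q ->] := partials_gpoly P s; split; first exact: gpoly_continuous.
by move=> i x; have [] := gpoly_is_derive Q i x.
Qed.

Lemma partials0 (s : seq 'I_n) : partials s (fun=> 0 : R) = fun=> 0.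
Proof.
elim: s => [//|i s IH] /=; rewrite IH; apply/funext => x; exact: derive_cst.
Qed.

Lemma smooth0 : smooth (fun _ : 'rV[R]_n => 0 : R).
Proof.
move=> s; rewrite partials0; split; first exact: cst_continuous.
by move=> i x; exact: derivable_cst.
Qed.

Lemma enorm_le_prod x : 1 + enorm x ^+ 2 <= \prod_i (1 + x ord0 i ^+ 2).
Proof.
suff [] : 0 <= dotp x x /\ 1 + dotp x x <= \prod_i (1 + x ord0 i ^+ 2) by rewrite enorm_sqr.
rewrite /dotp; apply: (big_ind2 (fun a b => 0 <= a /\ 1 + a <= b)) => [|a b c e [a0 ha] [c0 hc]|i _].
- by rewrite addr0.
- by split; [exact: addr_ge0|nra].
- by rewrite -expr2; split=> //; exact: sqr_ge0.
Qed.

Lemma schwartz_gpoly P : schwartz (fun x => (gpoly P x)%:C).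
Proof.
split; first by split; [exact: smooth_gpoly|exact: smooth0].
move=> k s; have [Q E] := partials_gpoly P s.
(* The k-th power of the norm is at most the product of the (1 + x_i^2)^k, which is absorbed by the
   polynomial factors. *)
have [M M0 H] := gpoly_rwt (fun i => (1 + 'X ^+ 2) ^+ k * Q i).
exists M => x; rewrite /cpartials /= partials0 E /= (expr0n _ 2) addr0 sqrtr_sqr.
apply: (@le_trans _ _ ((\prod_i (1 + x ord0 i ^+ 2)) ^+ k * `|gpoly Q x|)).
  rewrite ler_wpM2r// lerXn2r ?nnegrE ?enorm_ge0//.
    by apply: prodr_ge0 => i _; exact/ltW/oneDsqr_gt0.
  apply: le_trans (enorm_le_prod x); have := sqr_ge0 (enorm x - 2^-1); lra.
apply: le_trans (le_trans (H x) _); last by rewrite ler_piMr// rwt_le1.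
have -> : gpoly (fun i => (1 + 'X ^+ 2) ^+ k * Q i) x = (\prod_i (1 + x ord0 i ^+ 2)) ^+ k * gpoly Q x.
  rewrite -prodrXl -big_split; apply: eq_bigr => i _ /=.
  by rewrite /gp hornerM horner_exp hornerD hornerC hornerXn mulrA.
by rewrite normrM ler_wpM2r// ler_norm.
Qed.
End gaussian_polynomials.

(** * Hermite functions in several variables *)

Section hermite_functions.
Context {R : realType} (n : nat).
Local Notation C := R[i].
Local Notation e_ i := (delta_mx ord0 i : 'rV[R]_n).
Local Notation lr := (@lebesgue_row R n).
Implicit Types (al be : {ffun 'I_n -> nat}) (x : 'rV[R]_n).

Definition hermP al : 'I_n -> {poly R} := fun i => (Num.sqrt (@hcst R (al i)))^-1 *: @herm R (al i).
Definition hermd al : 'rV[R]_n -> R := gpoly (hermP al).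
Definition degree al : nat := \sum_i al i.

Lemma hermdE al x : hermd al x = \prod_i hfun (al i) (x ord0 i).
Proof. by apply: eq_bigr => i _; rewrite /gp /hermP hornerZ /hfun mulrA. Qed.

Lemma hermd_orthonormal al be : rintg lr (fun x => hermd al x * hermd be x) /\
  \int[lr]_x (hermd al x * hermd be x) = (al == be)%:R.
Proof.
have E x : \prod_i (hfun (al i) (x ord0 i) * hfun (be i) (x ord0 i)) = hermd al x * hermd be x.
  by rewrite !hermdE big_split.
have [h1 h2] := @rint_row_prod R n (fun i t => hfun (al i) t * hfun (be i) t) (fun i => (hfun_orthonormal (al i) (be i)).1).
split; first exact: (eq_rintg E h1).
rewrite -(eq_Rint lr E) h2.
under eq_bigr do rewrite (hfun_orthonormal _ _).2.
case: eqP => [->|ne]; first by rewrite big1// => i _; rewrite eqxx.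
have [i ni] : exists i, al i != be i.
  by apply/existsP; rewrite -negb_forall; apply/negP => /forallP H; apply: ne; apply/ffunP => i; exact/eqP.
by rewrite (bigD1 i)//= (negPf ni) mul0r.
Qed.

Lemma hermd_rwt al : exists2 M, 0 <= M & forall x, `|hermd al x| <= M * rwt x.
Proof. exact: gpoly_rwt. Qed.

Lemma hermd_upd2 al i x : gpoly (upd i (upd i (hermP al))) x = (x ord0 i ^+ 2 - (2 * (al i)%:R + 1)) * hermd al x.
Proof.
rewrite /hermd /gpoly (bigD1 i)//= [in RHS](bigD1 i)//= mulrA; congr (_ * _); last first.
  by apply: eq_bigr => k /negPf ki; rewrite /upd ki.
rewrite /gp mulrA; congr (_ * _); rewrite /upd eqxx /hermP; set c := _^-1; set h := @herm R (al i).
have -> : (c *: h)^`() - 'X * (c *: h) = c *: (h^`() - 'X * h) by rewrite derivZ scalerBr scalerAr.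
have -> : (c *: (h^`() - 'X * h))^`() - 'X * (c *: (h^`() - 'X * h)) =
    c *: ((h^`()^`() - 2 *: ('X * h^`())) + ('X * ('X * h) - h)).
  rewrite derivZ -scalerAr -scalerBr; congr (_ *: _).
  rewrite derivB derivM derivX mul1r mulrBr.
  move: (h^`()^`()) ('X * h^`()) ('X * ('X * h)) => u v w.
  by rewrite scaler_nat mulr2n; apply/polyP => k; rewrite !(coefD, coefN, coefB); ring.
by rewrite herm_eigen !(hornerZ, hornerD, hornerN, hornerM, hornerX); ring.
Qed.

Lemma oscillator_hermd al x :
  oscillator (fun y => (hermd al y)%:C) x = ((2 * (degree al)%:R + n%:R) * hermd al x)%:C.
Proof.
have pE i : cpartials [:: i; i] (fun y => (hermd al y)%:C) x = ((x ord0 i ^+ 2 - (2 * (al i)%:R + 1)) * hermd al x)%:C.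
  rewrite -hermd_upd2 /cpartials /=.
  rewrite (partials0 [:: i; i] : partial i (partial i (fun _ : 'rV[R]_n => 0 : R)) = _); apply: complex_eqP => //=.
  by rewrite -[hermd al]/(gpoly (hermP al)) -/(gpoly _) !partial_gpoly.
rewrite /oscillator; under eq_bigr do rewrite pE.
have -> : \sum_i ((x ord0 i ^+ 2 - (2 * (al i)%:R + 1)) * hermd al x)%:C =
    ((dotp x x - (2 * (degree al)%:R + n%:R)) * hermd al x)%:C.
  rewrite -(rmorph_sum (real_complex R)) -mulr_suml; congr ((_ * _)%:C).
  rewrite sumrB big_split /= -mulr_sumr -natr_sum sumr_const card_ord.
  by rewrite (_ : \sum_i x ord0 i ^+ 2 = dotp x x)//; apply: eq_bigr => i _; rewrite expr2.
by apply: complex_eqP; rewrite !(ReD, ReN, ReM, ImD, ImN, ImM) /=; ring.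
Qed.

Section integration_by_parts.
Variables (v : 'rV[R]_n -> R) (B : R) (i : 'I_n).
Hypotheses (sv : smooth v) (bv0 : forall x, `|v x| <= B) (bv1 : forall x, `|partial i v x| <= B)
  (bv2 : forall x, `|partial i (partial i v) x| <= B).

(** All the decay is carried by the gaussian factor: v and its derivatives are only bounded. *)
Lemma ibp_gpoly2 (P : 'I_n -> {poly R}) :
  \int[lr]_x (partial i (partial i v) x * gpoly P x) = \int[lr]_x (v x * gpoly (upd i (upd i P)) x).
Proof.
have B0 : 0 <= B := le_trans (normr_ge0 _) (bv0 0).
have mcont s : measurable_fun setT (partials s v) := continuous_row_measurable (sv s).1.
have step (s : seq 'I_n) (Q : 'I_n -> {poly R}) : (forall x, `|partials s v x| <= B) -> (forall x, `|partial i (partials s v) x| <= B) ->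
   \int[lr]_x (partial i (partials s v) x * gpoly Q x) = - \int[lr]_x (partials s v x * gpoly (upd i Q) x).
  move=> b0 b1.
  have [M M0 HM] := gpoly_rwt Q; have [M' M'0 HM'] := gpoly_rwt (upd i Q).
  have rM : rintg lr (fun x => (B * (M + M')) * rwt x) := rintgZ _ (@rintg_rwt R n).
  have bnd (f : 'rV[R]_n -> R) Q' (K : R) : (forall x, `|f x| <= B) -> (forall x, `|gpoly Q' x| <= K * rwt x) ->
      forall x, `|f x * gpoly Q' x| <= B * K * rwt x.
    by move=> bf bQ x; rewrite normrM -mulrA; apply: ler_pM.
  have b00 := bnd _ _ _ b0 HM; have b01 := bnd _ _ _ b0 HM'; have b10 := bnd _ _ _ b1 HM.
  have i1 : rintg lr (fun x => partial i (partials s v) x * gpoly Q x).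
    apply: rintg_le _ (rintgZ (B * M) (@rintg_rwt R n)) b10.
    by apply: measurable_funM; [exact: (mcont (i :: s))|exact: measurable_gpoly].
  have i2 : rintg lr (fun x => partials s v x * gpoly (upd i Q) x).
    apply: rintg_le _ (rintgZ (B * M') (@rintg_rwt R n)) b01.
    by apply: measurable_funM; [exact: mcont|exact: measurable_gpoly].
  have Z : \int[lr]_x (partial i (partials s v) x * gpoly Q x + partials s v x * gpoly (upd i Q) x) = 0.
    apply: (@ibp_row R n (fun x => partials s v x * gpoly Q x) _ i (B * (M + M'))).
    - move=> x; apply: is_derive_rowM; last exact: gpoly_is_derive.
      by split => //; exact: (sv s).2.
    - by apply: measurable_funM; [exact: mcont|exact: measurable_gpoly].
    - exact: rintg_meas (rintgD i1 i2).
    - move=> x; apply: le_trans (b00 x) _; rewrite ler_wpM2r ?rwt_ge0//; nra.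
    - move=> x; apply: le_trans (ler_normD _ _) _; apply: le_trans (lerD (b10 x) (b01 x)) _.
      by rewrite -mulrDl -mulrDr.
  by apply/eqP; rewrite -addr_eq0 -(RintD i1 i2) Z.
by rewrite (step [:: i] P bv1 bv2) (step [::] _ bv0 bv1) opprK.
Qed.
End integration_by_parts.

Lemma square_integrable_real (f : 'rV[R]_n -> R) : measurable_fun setT f ->
  rintg lr (fun x => f x * f x) -> square_integrable (fun x => (f x)%:C).
Proof.
move=> mf i2; split; [exact: mf|exact: measurable_cst|].
have i0 x : 0 <= f x * f x by rewrite -expr2 sqr_ge0.
have := rintg_lty i2 i0; rewrite (_ : (fun x => (f x * f x)%:E) = fun x => (normc (f x)%:C ^+ 2)%:E)//.
by apply/funext => x; rewrite normcR real_normK ?num_real.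
Qed.

(* The commutation of the oscillator with the integral holds for the real and for the
   imaginary part of the test function separately. *)
Lemma hermd_eigenspace al (j : nat) : degree al = j ->
  oscillator_eigenspace (2 * j + n)%:R (fun x => (hermd al x)%:C).
Proof.
move=> dj; have mh : measurable_fun setT (hermd al) by exact: measurable_gpoly.
have i2 := (hermd_orthonormal al al).1.
pose lam : R := (2 * j + n)%:R.
have E x : lam%:C * (hermd al x)%:C = (lam * hermd al x)%:C by rewrite rmorphM.
split.
- exact: square_integrable_real.
- rewrite (_ : (fun x => _) = fun x => (lam * hermd al x)%:C); last by apply/funext => x; exact: E.
  apply: square_integrable_real; first by apply: measurable_funM => //; exact: measurable_cst.
  by apply: eq_rintg (rintgZ (lam * lam) i2) => x; ring.
move=> u [[sr si] su].
have bnd s : exists2 B, 0 <= B & forall x, `|partials s (fun y => complex.Re (u y)) x| <= B /\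
    `|partials s (fun y => complex.Im (u y)) x| <= B.
  have [M HM] := su 0%N s; exists M.
    by apply: le_trans (HM 0); rewrite expr0 mul1r normc_ge0.
  move=> x; have := HM x; rewrite expr0 mul1r => h; split; apply: le_trans h.
    exact: (Re_le_normc (cpartials s u x)).
  exact: (Im_le_normc (cpartials s u x)).
have [M M0 HM] := hermd_rwt al.
have key (v : 'rV[R]_n -> R) : smooth v -> (forall s, exists2 B, 0 <= B & forall x, `|partials s v x| <= B) ->
   [/\ rintg lr (fun x => v x * hermd al x), rintg lr (fun x => dotp x x * v x * hermd al x),
     forall i, rintg lr (fun x => partial i (partial i v) x * hermd al x) &
   lam * \int[lr]_x (v x * hermd al x) = - (\sum_i \int[lr]_x (partial i (partial i v) x * hermd al x)) +
     \int[lr]_x (dotp x x * v x * hermd al x)].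
  move=> sv bv.
  have ig s (P : 'I_n -> {poly R}) : rintg lr (fun x => partials s v x * gpoly P x).
    have [B B0 HB] := bv s; have [K K0 HK] := gpoly_rwt P.
    apply: rintg_le _ (rintgZ (B * K) (@rintg_rwt R n)) _.
      by apply: measurable_funM; [exact: continuous_row_measurable (sv s).1|exact: measurable_gpoly].
    by move=> x; rewrite normrM -mulrA; apply: ler_pM.
  have e2 i : \int[lr]_x (partial i (partial i v) x * hermd al x) =
     \int[lr]_x (v x * gpoly (upd i (upd i (hermP al))) x).
    have [B0 B00 H0] := bv [::]; have [B1 B10 H1] := bv [:: i]; have [B2 B20 H2] := bv [:: i; i].
    apply: (@ibp_gpoly2 v (B0 + B1 + B2)) => // x.
    - by apply: le_trans (H0 x) _; lra.
    - by apply: le_trans (H1 x) _; lra.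
    - by apply: le_trans (H2 x) _; lra.
  (* The second derivatives of the Hermite function sum to |x|^2 - (2 j + n) times the function. *)
  have sumE x : v x * \sum_i gpoly (upd i (upd i (hermP al))) x = dotp x x * v x * hermd al x - lam * (v x * hermd al x).
    under eq_bigr do rewrite hermd_upd2.
    rewrite -mulr_suml sumrB big_split /= -mulr_sumr -natr_sum -/(degree al) dj sumr_const card_ord.
    rewrite /lam natrD natrM (_ : \sum_i x ord0 i ^+ 2 = dotp x x); last by apply: eq_bigr => i _; rewrite expr2.
    by ring.
  have i0 := ig [::] (hermP al).
  have is_ : rintg lr (fun x => v x * \sum_i gpoly (upd i (upd i (hermP al))) x).
    have := @rintg_sum _ _ _ lr _ (index_enum 'I_n) xpredT (fun i x => v x * gpoly (upd i (upd i (hermP al))) x) (fun i _ => ig [::] _).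
    by apply: eq_rintg => x; rewrite mulr_sumr.
  have iq : rintg lr (fun x => dotp x x * v x * hermd al x).
    by apply: eq_rintg (rintgD is_ (rintgZ lam i0)) => x; rewrite sumE /hermd /=; ring.
  split => //; first by move=> i; exact: (ig [:: i; i]).
  have S : \sum_i \int[lr]_x (partial i (partial i v) x * hermd al x) =
      \int[lr]_x (v x * \sum_i gpoly (upd i (upd i (hermP al))) x).
    under eq_bigr do rewrite e2.
    rewrite -(@Rint_sum _ _ _ lr _ _ _ _ (fun i _ => ig [::] (upd i (upd i (hermP al))))).
    by apply: eq_Rintegral => x _; rewrite mulr_sumr.
  rewrite S (eq_Rint lr sumE) (RintB iq (rintgZ _ i0)) (RintZ _ i0); ring.
have [r1 r2 r3 r4] := key _ sr (fun s => let: ex_intro2 B B0 H := bnd s in ex_intro2 _ _ B B0 (fun x => (H x).1)).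
have [j1 j2 j3 j4] := key _ si (fun s => let: ex_intro2 B B0 H := bnd s in ex_intro2 _ _ B B0 (fun x => (H x).2)).
pose vr x := complex.Re (u x); pose vi x := complex.Im (u x).
have ReO x : complex.Re (oscillator u x) = - \sum_i partial i (partial i vr) x + dotp x x * vr x.
  by rewrite /oscillator ReD ReN Re_sum ReM /= mul0r subr0.
have ImO x : complex.Im (oscillator u x) = - \sum_i partial i (partial i vi) x + dotp x x * vi x.
  by rewrite /oscillator ImD ImN Im_sum ImM /= mul0r addr0.
have osc (v : 'rV[R]_n -> R) (iv : forall i, rintg lr (fun x => partial i (partial i v) x * hermd al x))
   (iq : rintg lr (fun x => dotp x x * v x * hermd al x)) :
   \int[lr]_x ((- \sum_i partial i (partial i v) x + dotp x x * v x) * hermd al x) =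
   - (\sum_i \int[lr]_x (partial i (partial i v) x * hermd al x)) + \int[lr]_x (dotp x x * v x * hermd al x).
  have is_ := @rintg_sum _ _ _ lr _ (index_enum 'I_n) xpredT _ (fun i _ => iv i).
  rewrite -(@Rint_sum _ _ _ lr _ (index_enum 'I_n) xpredT _ (fun i _ => iv i)) -mulN1r -(RintZ _ is_) -(RintD (rintgZ _ is_) iq).
  by apply: eq_Rintegral => x _; rewrite mulrDl mulNr mulN1r mulr_suml.
apply: complex_eqP; rewrite /inner /cint /=.
  transitivity (lam * \int[lr]_x (vr x * hermd al x)).
    rewrite -(RintZ _ r1); apply: eq_Rintegral => x _; rewrite E ReM /vr.
    by case: (u x) => a b /=; rewrite mulr0 subr0; ring.
  rewrite r4 -(osc _ r3 r2); apply: eq_Rintegral => x _; rewrite ReM -ReO.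
  by case: (oscillator u x) => a b /=; rewrite mulr0 subr0.
transitivity (- (lam * \int[lr]_x (vi x * hermd al x))).
  rewrite -(RintZ _ j1) -mulN1r -(RintZ _ (rintgZ _ j1)); apply: eq_Rintegral => x _; rewrite E ImM /vi.
  by case: (u x) => a b /=; rewrite mulr0 add0r; ring.
rewrite j4 -(osc _ j3 j2) -mulN1r.
have io : rintg lr (fun x => (- \sum_i partial i (partial i vi) x + dotp x x * vi x) * hermd al x).
  have is_ := @rintg_sum _ _ _ lr _ (index_enum 'I_n) xpredT _ (fun i _ => j3 i).
  by apply: eq_rintg (rintgD (rintgN is_) j2) => x; rewrite [RHS]mulrDl mulNr [in RHS]mulr_suml.
rewrite -(RintZ _ io); apply: eq_Rintegral => x _; rewrite ImM -ImO.
by case: (oscillator u x) => a b /=; rewrite mulr0 add0r; ring.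
Qed.
End hermite_functions.

(* Expanding the exponential under the integral sign. *)
Lemma Rint_mul_expR0 d (T : measurableType d) (R : realType) (mu : {measure set T -> \bar R}) (g q : T -> R) :
  measurable_fun setT g -> measurable_fun setT q -> rintg mu (fun x => `|g x| * expR `|q x|) ->
  (forall k, rintg mu (fun x => g x * q x ^+ k)) -> (forall k, \int[mu]_x (g x * q x ^+ k) = 0) ->
  rintg mu (fun x => g x * expR (q x)) /\ \int[mu]_x (g x * expR (q x)) = 0.
Proof.
move=> mg mq iexp ik zk; pose S N x := g x * series (exp_coeff (q x)) N.
have SE N x : S N x = \sum_(0 <= k < N) (k`!%:R)^-1 * (g x * q x ^+ k).
  by rewrite /S /series /= mulr_sumr; apply: eq_bigr => k _; rewrite /exp_coeff /=; ring.
have ikk k : rintg mu (fun x => (k`!%:R)^-1 * (g x * q x ^+ k)) by exact: rintgZ (ik k).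
have iS N : rintg mu (S N).
  by apply: eq_rintg (@rintg_sum _ _ _ mu _ (index_iota 0 N) xpredT _ (fun k _ => ikk k)) => x; rewrite SE.
have zS N : \int[mu]_x S N x = 0.
  rewrite (eq_Rint mu (SE N)) (@Rint_sum _ _ _ mu _ (index_iota 0 N) xpredT _ (fun k _ => ikk k)).
  by rewrite big1// => k _; rewrite (RintZ _ (ik k)) zk mulr0.
have bS N x : `|S N x| <= `|g x| * expR `|q x|.
  rewrite /S normrM; apply: ler_wpM2l => //.
  apply: (@le_trans _ _ (series (exp_coeff `|q x|) N)).
    rewrite /series /=; apply: le_trans (ler_norm_sum _ _ _) _; apply: ler_sum => k _.
    by rewrite /exp_coeff /= normrM normrX normfV normr_nat.
  rewrite /expR; apply: nondecreasing_cvgn_le; last exact: is_cvg_series_exp_coeff.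
  by apply: nondecreasing_series => k _ _; exact: exp_coeff_ge0.
have cS x : S ^~ x @ \oo --> g x * expR (q x).
  by apply: cvgM; [exact: cvg_cst|exact: is_cvg_series_exp_coeff].
have [iG cG] := Rint_cvg (fun N => rintg_meas (iS N)) iexp cS bS; split => //.
move: cG; under eq_fun do rewrite zS.
by move=> H; apply: (@cvg_unique _ (@Rhausdorff R) _ _ _ _ H); exact: cvg_cst.
Qed.

(** * Completeness of the Hermite functions *)

Section gaussian_completeness.
Context {R : realType} (n : nat).
Local Notation lr := (@lebesgue_row R n).
Implicit Types (s : {ffun 'I_n -> nat}) (x y w : 'rV[R]_n).

Definition monom s x : R := \prod_i x ord0 i ^+ s i.
Definition rgauss (c : R) x : R := expR (- (c * dotp x x)).

Lemma rgaussE c x : rgauss c x = \prod_i expR (- (c * x ord0 i ^+ 2)).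
Proof.
rewrite /rgauss /dotp mulr_sumr -sumrN expR_sum; apply: eq_bigr => i _.
by rewrite expr2.
Qed.

Lemma rgauss_gt0 c x : 0 < rgauss c x. Proof. exact: expR_gt0. Qed.

Lemma measurable_rgauss c : measurable_fun setT (rgauss c).
Proof.
apply: measurableT_comp => //; apply: measurable_funN; apply: measurable_funM; first exact: measurable_cst.
by apply: meas_dotp.
Qed.

Lemma rintg_rgauss c : 0 < c -> rintg lr (rgauss c).
Proof.
move=> c0; have [H _] := @rint_row_prod R n (fun _ t => expR (- (c * t ^+ 2))) (fun _ => rintg_gauss c0).
by apply: eq_rintg H => x; rewrite rgaussE.
Qed.

Lemma Rint_rgauss c : 0 < c -> \int[lr]_x rgauss c x = Num.sqrt (pi / c) ^+ n.
Proof.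
move=> c0; rewrite (eq_Rint lr (rgaussE c)).
rewrite (@rint_row_prod R n (fun _ t => expR (- (c * t ^+ 2))) (fun _ => rintg_gauss c0)).2.
by under eq_bigr do rewrite (Rint_gauss c0); rewrite prodr_const card_ord.
Qed.

(** Growth slower than every gaussian exp(a |x|^2): such factors, which are closed under products,
    preserve integrability against [rgauss] at the price of half its exponent. *)
Definition moderate (p : 'rV[R]_n -> R) := measurable_fun setT p /\
  forall a, 0 < a -> exists M, forall x, `|p x| * rgauss a x <= M.

Lemma rgaussD a b x : rgauss (a + b) x = rgauss a x * rgauss b x.
Proof. by rewrite /rgauss mulrDl opprD expRD. Qed.

Lemma rgauss_half a x : rgauss a x = rgauss (a / 2) x * rgauss (a / 2) x.
Proof. by rewrite -rgaussD -splitr. Qed.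

Lemma moderateM p q : moderate p -> moderate q -> moderate (fun x => p x * q x).
Proof.
move=> [mp hp] [mq hq]; split; first exact: measurable_funM.
move=> a a0; have a2 : 0 < a / 2 by rewrite divr_gt0.
have [M HM] := hp _ a2; have [K HK] := hq _ a2; exists (M * K) => x.
rewrite (rgauss_half a) normrM mulrACA; apply: ler_pM => //; by rewrite mulr_ge0// ltW// rgauss_gt0.
Qed.

Lemma moderate_cst (c : R) : moderate (fun=> c).
Proof.
split; first exact: measurable_cst.
move=> a a0; exists `|c| => x; rewrite ler_piMr// /rgauss -expR0 ler_expR oppr_le0 mulr_ge0 ?dotp_ge0//.
exact: ltW.
Qed.

Lemma moderate_coord i : moderate (fun x => x ord0 i).
Proof.
split; first exact: measurable_coord.
move=> a a0; have [M M0 H] := @poly_gauss_bounded R 'X a 0 a0; exists M => x.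
have := H (x ord0 i); rewrite hornerX normcR mul0r addr0 => h.
apply: le_trans (le_trans h _); last by rewrite ler_piMr// wt_le1.
apply: ler_wpM2l => //; rewrite /rgauss ler_expR lerN2 ler_pM2l//.
by rewrite -(@ler_sqrt R) ?dotp_ge0// sqrtr_sqr; exact: coord_le_enorm.
Qed.

Lemma moderateX p k : moderate p -> moderate (fun x => p x ^+ k).
Proof.
move=> hp; elim: k => [|k IH].
  by under eq_fun do rewrite expr0; exact: moderate_cst.
by under eq_fun do rewrite exprS; exact: moderateM.
Qed.

Lemma moderate_monom s : moderate (monom s).
Proof.
suff H (r : seq 'I_n) : moderate (fun x => \prod_(i <- r) x ord0 i ^+ s i) by exact: H.
elim: r => [|i r IH].
  by under eq_fun do rewrite big_nil; exact: moderate_cst.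
under eq_fun do rewrite big_cons; apply: moderateM => //; apply: moderateX; exact: moderate_coord.
Qed.

Lemma moderate_exp_dotp y : moderate (fun x => expR `|dotp x y|).
Proof.
split.
  apply: measurableT_comp => //; apply: measurableT_comp => //; apply: meas_dotp => //; exact: measurable_cst.
move=> a a0; exists (expR (dotp y y / (4 * a))) => x.
rewrite ger0_norm ?expR_ge0// /rgauss -expRD ler_expR.
have cs : `|dotp x y| <= enorm x * enorm y.
  by rewrite ler_norml cauchy_schwarz andbT lerNl -dotpNl -(enormN x) cauchy_schwarz.
apply: le_trans (lerD cs (lexx _)) _; rewrite -!enorm_sqr ler_pdivlMr ?mulr_gt0//.
have := sqr_ge0 (2 * a * enorm x - enorm y); lra.
Qed.

Section annihilator.
Variable f : 'rV[R]_n -> R.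
Hypotheses (mf : measurable_fun setT f) (intf : forall a, 0 < a -> rintg lr (fun x => f x * rgauss a x)).

Lemma rintg_moderate c p : 0 < c -> moderate p -> rintg lr (fun x => f x * rgauss c x * p x).
Proof.
move=> c0 [mp hp]; have c2 : 0 < c / 2 by rewrite divr_gt0.
have [M HM] := hp _ c2.
apply: rintg_le _ (rintgZ M (rintg_norm (intf c2))) _.
  by apply: measurable_funM => //; apply: measurable_funM => //; exact: measurable_rgauss.
move=> x; rewrite (rgauss_half c).
have g0 := ltW (rgauss_gt0 (c / 2) x); rewrite !normrM (ger0_norm g0).
have := ler_wpM2l (mulr_ge0 (normr_ge0 (f x)) g0) (HM x); lra.
Qed.

Definition annihilates c := forall s, \int[lr]_x (f x * rgauss c x * monom s x) = 0.

(** The factors p are expanded one at a time, each shifting the monomial; this is why the induction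
    has to range over all monomials s. *)
Lemma annihilates_comb c (l : seq (R * {ffun 'I_n -> nat})) (p : 'rV[R]_n -> R) : 0 < c -> annihilates c ->
  moderate p -> (forall x, p x = \sum_(t <- l) t.1 * monom t.2 x) ->
  forall k s, \int[lr]_x (f x * rgauss c x * monom s x * p x ^+ k) = 0.
Proof.
move=> c0 Z mp pE; elim=> [|k IH] s.
  by rewrite -[RHS](Z s); apply: eq_Rint => x; rewrite expr0 mulr1.
have E x : f x * rgauss c x * monom s x * p x ^+ k.+1 =
    \sum_(t <- l) t.1 * (f x * rgauss c x * monom [ffun i => s i + t.2 i]%N x * p x ^+ k).
  rewrite exprS {1}pE mulrCA mulr_suml; apply: eq_bigr => t _.
  have -> : monom [ffun i => (s i + t.2 i)%N] x = monom s x * monom t.2 x.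
    by rewrite /monom -big_split; apply: eq_bigr => i _; rewrite ffunE exprD.
  by rewrite /=; ring.
have ii s' : rintg lr (fun x => f x * rgauss c x * monom s' x * p x ^+ k).
  apply: eq_rintg (rintg_moderate c0 (moderateM (moderate_monom s') (moderateX k mp))) => x.
  by rewrite mulrA.
rewrite (eq_Rint lr E) (@Rint_sum _ _ _ lr _ l xpredT _ (fun t _ => rintgZ t.1 (ii _))).
by rewrite big1// => t _; rewrite (RintZ _ (ii _)) IH mulr0.
Qed.

Lemma dotp_moderate y : moderate (fun x => dotp x y).
Proof.
have [mE HE] := moderate_exp_dotp y; split; first by apply: meas_dotp => //; exact: measurable_cst.
move=> a a0; have [M HM] := HE a a0; exists M => x; apply: le_trans (HM x).
rewrite ler_wpM2r ?(ltW (rgauss_gt0 _ _))// (ger0_norm (expR_ge0 _)).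
by apply: le_trans (expR_ge1Dx _); rewrite lerDr.
Qed.

Let unit_index i k : {ffun 'I_n -> nat} := [ffun j => if j == i then k else 0%N].
Let monom_unit i k x : monom (unit_index i k) x = x ord0 i ^+ k.
Proof.
rewrite /monom (bigD1 i)//= ffunE eqxx big1 ?mulr1// => j /negPf ji.
by rewrite ffunE ji expr0.
Qed.

Lemma sqr_moderate : moderate (fun x => dotp x x).
Proof.
split; first exact: meas_dotp.
move=> a a0; exists (a^-1) => x; rewrite ger0_norm ?dotp_ge0// /rgauss expRN.
rewrite ler_pdivrMr ?expR_gt0// mulrC ler_pdivlMr// mulrC.
by apply: le_trans (expR_ge1Dx _); rewrite lerDr.
Qed.

(** The factor exp(- c |x|^2 / 2) is expanded in powers of |x|^2. The majorant of its series is
    exp(c |x|^2 / 2), which leaves only half of the original gaussian: this is why the exponent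
    grows by a factor 3/2, and not by an arbitrary one. *)
Lemma annihilates_step c : 0 < c -> annihilates c -> annihilates (3 / 2 * c).
Proof.
move=> c0 Z s; have c2 : 0 < c / 2 by rewrite divr_gt0.
pose g x := f x * rgauss c x * monom s x; pose q x := - (c / 2) * dotp x x.
have mg : measurable_fun setT g by exact: rintg_meas (rintg_moderate c0 (moderate_monom s)).
have mq : moderate q by exact: moderateM (moderate_cst _) sqr_moderate.
have qE x : q x = \sum_(t <- [seq (- (c / 2), unit_index i 2) | i <- index_enum 'I_n]) t.1 * monom t.2 x.
  by rewrite big_map -mulr_sumr; congr (_ * _); apply: eq_bigr => i _; rewrite monom_unit expr2.
have ik k : rintg lr (fun x => g x * q x ^+ k).
  apply: eq_rintg (rintg_moderate c0 (moderateM (moderate_monom s) (moderateX k mq))) => x.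
  by rewrite /g mulrA.
have ie : rintg lr (fun x => `|g x| * expR `|q x|).
  apply: eq_rintg (rintg_norm (rintg_moderate c2 (moderate_monom s))) => x.
  have -> : `|q x| = c / 2 * dotp x x by rewrite /q normrM normrN (gtr0_norm c2) (ger0_norm (dotp_ge0 x)).
  rewrite /g !normrM.
  have -> : `|rgauss (c / 2) x| = `|rgauss c x| * expR (c / 2 * dotp x x).
    by rewrite !(ger0_norm (ltW (rgauss_gt0 _ _))) /rgauss -expRD; congr expR; field.
  by ring.
have [_ H] := Rint_mul_expR0 mg mq.1 ie ik (fun k => annihilates_comb c0 Z mq qE k s).
rewrite -[RHS]H; apply: eq_Rint => x; have -> : rgauss (3 / 2 * c) x = rgauss c x * expR (q x).
  by rewrite /rgauss /q -expRD; congr expR; field.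
by rewrite /g; ring.
Qed.

(** The series of exp <x, y> is dominated by exp |<x, y>|, which the gaussian absorbs. *)
Lemma annihilates_exp c y : 0 < c -> annihilates c -> \int[lr]_x (f x * rgauss c x * expR (dotp x y)) = 0.
Proof.
move=> c0 Z; pose g x := f x * rgauss c x.
have E x : f x * rgauss c x * monom [ffun=> 0%N] x = g x.
  by rewrite /monom big1 ?mulr1// => i _; rewrite ffunE expr0.
have mg : measurable_fun setT g by apply: measurable_funM => //; exact: measurable_rgauss.
have mq := dotp_moderate y.
have qE x : dotp x y = \sum_(t <- [seq (y ord0 i, unit_index i 1) | i <- index_enum 'I_n]) t.1 * monom t.2 x.
  by rewrite big_map; apply: eq_bigr => i _; rewrite monom_unit expr1 mulrC.
have ik k : rintg lr (fun x => g x * dotp x y ^+ k) by exact: rintg_moderate (moderateX k mq).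
have ie : rintg lr (fun x => `|g x| * expR `|dotp x y|).
  apply: eq_rintg (rintg_norm (rintg_moderate c0 (moderate_exp_dotp y))) => x.
  by rewrite normrM (ger0_norm (expR_ge0 _)).
have zk k : \int[lr]_x (g x * dotp x y ^+ k) = 0.
  by rewrite -[RHS](annihilates_comb c0 Z mq qE k [ffun=> 0%N]); apply: eq_Rint => x; rewrite E.
by have [] := Rint_mul_expR0 mg mq.1 ie ik zk.
Qed.

Hypothesis Z0 : annihilates 2^-1.
Let G x := f x * rgauss 2^-1 x.
Let iG : rintg lr G. Proof. by apply: intf; rewrite invr_gt0. Qed.

(** The exponents reached from 1/2 by iterating [annihilates_step]; what matters is that they tend
    to infinity. *)
Let cs (m : nat) : R := 2^-1 * (3 / 2) ^+ m.
Let cs_ge m : 2^-1 + m%:R / 4 <= cs m.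
Proof.
elim: m => [|m IH]; first by rewrite /cs expr0 mulr1 mul0r addr0.
have -> : cs m.+1 = 3 / 2 * cs m by rewrite /cs exprS; ring.
by rewrite -[m.+1%:R]natr1; have := ler0n R m; lra.
Qed.
Let cs_ann m : annihilates (cs m).
Proof.
have cs0 k : 0 < cs k by apply: lt_le_trans (cs_ge k); rewrite ltr_pwDl// divr_ge0.
elim: m => [|m IH]; first by rewrite /cs expr0 mulr1.
have -> : cs m.+1 = 3 / 2 * cs m by rewrite /cs exprS; ring.
exact: annihilates_step.
Qed.

(** Expanding |x - y|^2 turns a translated gaussian into a centered one times exp <x, 2 c y>, so the
    vanishing exponential integrals say that G is orthogonal to all translates of arbitrarily narrow
    gaussians. *)
Let gconv0 m y : \int[lr]_x (G x * rgauss (cs m.+1 - 2^-1) (x - y)) = 0.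
Proof.
pose c := cs m.+1 - 2^-1.
have c0 : 0 < cs m.+1 by apply: lt_le_trans (cs_ge _); rewrite ltr_pwDl// divr_ge0.
have := annihilates_exp ((2 * c) *: y) c0 (@cs_ann m.+1) => /(congr1 (fun r => rgauss c y * r)); rewrite mulr0.
rewrite -(RintZ _ (_ : rintg lr _)); last first.
  apply: eq_rintg (rintg_le _ (rintg_norm (rintg_moderate c0 (moderate_exp_dotp ((2 * c) *: y)))) _) => //.
    apply: measurable_funM; first by apply: measurable_funM => //; exact: measurable_rgauss.
    by apply: measurableT_comp => //; apply: meas_dotp => //; exact: measurable_cst.
  move=> x; rewrite !normrM ler_wpM2l// !(ger0_norm (expR_ge0 _)) ler_expR; exact: ler_norm.
move=> H; rewrite -[RHS]H; apply: eq_Rint => x; rewrite /G mulrCA -!mulrA; congr (_ * _).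
rewrite /rgauss -!expRD; congr expR; rewrite dotpZr !(dotpDl, dotpDr, dotpNl, dotpNr) (dotpC y x) /c; ring.
Qed.

(* Approximate identity: G is orthogonal to the convolutions of psi with narrow gaussians. *)
Lemma annihilates_unif_continuous (psi : 'rV[R]_n -> R) : measurable_fun setT psi -> (forall x, `|psi x| <= 1) ->
  (forall eps, 0 < eps -> exists2 del, 0 < del & forall x w, enorm w < del -> `|psi (x - w) - psi x| <= eps) ->
  \int[lr]_x (G x * psi x) = 0.
Proof.
move=> mpsi bpsi upsi; pose c m : R := cs m.+1 - 2^-1.
have cge m : m.+1%:R / 4 <= c m by rewrite /c; have := cs_ge m.+1; lra.
have c0 m : 0 < c m by apply: lt_le_trans (cge m); rewrite divr_gt0.
pose K m : R := Num.sqrt (pi / c m) ^+ n.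
have K0 m : 0 < K m by rewrite exprn_gt0// sqrtr_gt0 divr_gt0 ?pi_gt0.
have Kint m : \int[lr]_w rgauss (c m) w = K m by exact: Rint_rgauss.
have mw : measurable_fun setT (fun z : 'rV[R]_n * 'rV[R]_n => z.1 - z.2).
  by apply: meas_rowB; [exact: measurable_fst|exact: measurable_snd].
have ig m x : rintg lr (fun w => rgauss (c m) w * psi (x - w)).
  apply: rintg_le _ (rintg_rgauss (c0 m)) _.
    apply: measurable_funM; first exact: measurable_rgauss.
    apply: (measurableT_comp mpsi); apply: meas_rowB => //; exact: measurable_cst.
  by move=> w; rewrite normrM (ger0_norm (ltW (rgauss_gt0 _ _))) ler_piMr// ltW// rgauss_gt0.
pose Psi m x := (K m)^-1 * \int[lr]_w (rgauss (c m) w * psi (x - w)).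
have shiftE m x : \int[lr]_w (rgauss (c m) w * psi (x - w)) = \int[lr]_y (rgauss (c m) (x - y) * psi y).
  rewrite (mpres_Rint (mpres_rowB x) (ig m x)); apply: eq_Rint => y.
  by rewrite subKr.
have i2 m : rintg (prodm lr lr) (fun z => G z.1 * (rgauss (c m) (z.1 - z.2) * psi z.2)).
  have mh : measurable_fun setT (fun z : 'rV[R]_n * 'rV[R]_n => rgauss (c m) (z.1 - z.2) * psi z.2).
    apply: measurable_funM; first exact: measurableT_comp (measurable_rgauss _) mw.
    exact: measurableT_comp mpsi measurable_snd.
  have iy x : rintg lr (fun y => rgauss (c m) (x - y)) := mpres_rintg (mpres_rowB x) (rintg_rgauss (c0 m)).
  have iyp x : rintg lr (fun y => rgauss (c m) (x - y) * psi y).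
    apply: rintg_le _ (iy x) _.
      apply: measurable_funM => //; apply: (measurableT_comp (measurable_rgauss _)); apply: meas_rowB => //; exact: measurable_cst.
    by move=> y; rewrite normrM (ger0_norm (ltW (rgauss_gt0 _ _))) ler_piMr// ltW// rgauss_gt0.
  apply: (rintg_fubini (g := fun x => K m * `|G x|)).
  - by apply: measurable_funM => //; apply: measurableT_comp measurable_fst; exact: rintg_meas iG.
  - by move=> x /=; exact: rintgZ (iyp x).
  - exact: rintgZ (rintg_norm iG).
  move=> x /=; rewrite -Kint (mpres_Rint (mpres_rowB x) (rintg_rgauss (c0 m))) mulrC.
  rewrite -(RintZ _ (iy x)); apply: Rint_le.
  - exact: rintg_norm (rintgZ _ (iyp x)).
  - exact: rintgZ (iy x).
  move=> y; rewrite !normrM ler_wpM2l// (ger0_norm (ltW (rgauss_gt0 _ _))) ler_piMr// ltW// rgauss_gt0//.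
have ZP m : \int[lr]_x (G x * Psi m x) = 0.
  have [f1 e1] := rfubini1 (i2 m); have [f2 e2] := rfubini2 (i2 m).
  have iyp x : rintg lr (fun y => rgauss (c m) (x - y) * psi y).
    have := mpres_rintg (mpres_rowB x) (ig m x).
    by apply: eq_rintg => y; rewrite subKr.
  have E1 x : G x * Psi m x = (K m)^-1 * \int[lr]_y (G x * (rgauss (c m) (x - y) * psi y)).
    by rewrite (RintZ _ (iyp x)) /Psi shiftE mulrCA.
  rewrite (eq_Rint lr E1) (RintZ _ f1) e1 -e2 (_ : \int[lr]_y _ = 0) ?mulr0//.
  rewrite -[RHS](Rint_cst0 lr); apply: eq_Rint => y.
  have E2 x : G x * (rgauss (c m) (x - y) * psi y) = psi y * (G x * rgauss (c m) (x - y)) by ring.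
  rewrite (eq_Rint lr E2) (RintZ _ (_ : rintg lr _)) ?gconv0 ?mulr0//.
  apply: rintg_le _ (rintg_norm iG) _.
    apply: measurable_funM; first exact: rintg_meas iG.
    apply: (measurableT_comp (measurable_rgauss _)); apply: meas_rowB => //; exact: measurable_cst.
  move=> x; rewrite normrM ler_piMr// (ger0_norm (ltW (rgauss_gt0 _ _))) /rgauss -expR0 ler_expR oppr_le0.
  by rewrite mulr_ge0 ?dotp_ge0// ltW.
have mPsi m : measurable_fun setT (fun x => G x * Psi m x).
  have [f1 _] := rfubini1 (i2 m).
  have iyp x : rintg lr (fun y => rgauss (c m) (x - y) * psi y).
    have := mpres_rintg (mpres_rowB x) (ig m x).
    by apply: eq_rintg => y; rewrite subKr.
  apply: rintg_meas (eq_rintg _ (rintgZ (K m)^-1 f1)) => x.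
  by rewrite /= (RintZ _ (iyp x)) /Psi shiftE mulrCA.
have bPsi m x : `|Psi m x| <= 1.
  rewrite /Psi normrM gtr0_norm ?invr_gt0// mulrC ler_pdivrMr// mul1r -Kint.
  apply: norm_Rint_le (ig m x) (rintg_rgauss (c0 m)) _ => w.
  by rewrite normrM (ger0_norm (ltW (rgauss_gt0 _ _))) ler_piMr// ltW// rgauss_gt0.
(* For |w| < del uniform continuity gives eps. Beyond, one half of the gaussian is at most 2 / (c
   del^2), and the other half has integral sqrt(2)^n times the normalization [K m]. *)
have close m x eps del : 0 < eps -> 0 < del -> (forall w, enorm w < del -> `|psi (x - w) - psi x| <= eps) ->
   `|Psi m x - psi x| <= eps + 4 * Num.sqrt 2 ^+ n / (c m * del ^+ 2).
  move=> e0 d0 hd.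
  have c20 : 0 < c m / 2 by rewrite divr_gt0.
  have K2 : \int[lr]_w rgauss (c m / 2) w = Num.sqrt 2 ^+ n * K m.
    rewrite (Rint_rgauss c20) /K -exprMn -sqrtrM//; congr (Num.sqrt _ ^+ n); field.
    by rewrite lt0r_neq0.
  pose B : R := 4 / (c m * del ^+ 2).
  have B0 : 0 <= B by rewrite divr_ge0// mulr_ge0 ?sqr_ge0// ltW.
  have pt w : `|rgauss (c m) w * (psi (x - w) - psi x)| <= eps * rgauss (c m) w + B * rgauss (c m / 2) w.
    rewrite normrM (ger0_norm (ltW (rgauss_gt0 _ _))); have g1 := ltW (rgauss_gt0 (c m) w).
    have g2 := ltW (rgauss_gt0 (c m / 2) w).
    have [lt|ge] := ltP (enorm w) del.
      by have := ler_wpM2l g1 (hd w lt); have := mulr_ge0 B0 g2; lra.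
    have p2 : `|psi (x - w) - psi x| <= 2.
      by apply: le_trans (ler_normB _ _) _; have := bpsi (x - w); have := bpsi x; lra.
    rewrite (rgauss_half (c m)).
    have small : 2 * rgauss (c m / 2) w <= B.
      rewrite /rgauss /B expRN ler_pdivrMr ?expR_gt0// mulrAC ler_pdivlMr ?mulr_gt0 ?exprn_gt0//.
      have := expR_ge1Dx (c m / 2 * dotp w w).
      have : del ^+ 2 <= dotp w w by rewrite -enorm_sqr lerXn2r ?nnegrE ?enorm_ge0// ltW.
      move=> /(ler_wpM2l (ltW (c0 m))); lra.
    have := ler_wpM2l (mulr_ge0 g2 g2) p2; have := ler_wpM2l g2 small; have := mulr_ge0 (ltW e0) (mulr_ge0 g2 g2); lra.
  have i1 := rintg_rgauss (c0 m); have i3 := rintg_rgauss c20.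
  have id_ : rintg lr (fun w => rgauss (c m) w * (psi (x - w) - psi x)).
    by apply: eq_rintg (rintgB (ig m x) (rintgZ (psi x) i1)) => w; ring.
  have -> : Psi m x - psi x = (K m)^-1 * \int[lr]_w (rgauss (c m) w * (psi (x - w) - psi x)).
    have E w : rgauss (c m) w * (psi (x - w) - psi x) = rgauss (c m) w * psi (x - w) - psi x * rgauss (c m) w by ring.
    rewrite (eq_Rint lr E) (RintB (ig m x) (rintgZ _ i1)) (RintZ _ i1) Kint mulrBr mulrCA mulVf ?mulr1//.
    by rewrite lt0r_neq0.
  rewrite normrM gtr0_norm ?invr_gt0// mulrC ler_pdivrMr//.
  apply: le_trans (norm_Rint_le id_ (rintgD (rintgZ eps i1) (rintgZ B i3)) pt) _.
  rewrite (RintD (rintgZ eps i1) (rintgZ B i3)) !(RintZ _ i1) (RintZ _ i3) Kint K2 /B.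
  by rewrite le_eqVlt; apply/orP; left; apply/eqP; field; rewrite !lt0r_neq0.
have cP x : (fun m => G x * Psi m x) @ \oo --> G x * psi x.
  apply: cvgM; first exact: cvg_cst.
  apply/cvgrPdist_le => eps e0; have e2 : 0 < eps / 2 by rewrite divr_gt0.
  have [del d0 hd] := upsi _ e2.
  pose A : R := 4 * Num.sqrt 2 ^+ n / del ^+ 2.
  have A0 : 0 <= A by rewrite divr_ge0 ?sqr_ge0// mulr_ge0// exprn_ge0// sqrtr_ge0.
  have nb := near_nat_ge (8 * A / eps).
  apply: filterS nb => m hm; rewrite distrC; apply: le_trans (close m x _ _ e2 d0 (hd x)) _.
  have -> : 4 * Num.sqrt 2 ^+ n / (c m * del ^+ 2) = A / c m by rewrite /A; field; rewrite !lt0r_neq0.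
  suff : A / c m <= eps / 2 by lra.
  rewrite ler_pdivrMr//; move: hm; rewrite ler_pdivrMr// => hm; have := cge m; nra.
have bP m x : `|G x * Psi m x| <= `|G x| by rewrite normrM ler_piMr.
have [_] := Rint_cvg mPsi (rintg_norm iG) cP bP; under eq_fun do rewrite ZP.
by move=> H; apply: (@cvg_unique _ (@Rhausdorff R) _ _ _ _ H); exact: cvg_cst.
Qed.

Definition clamp (t : R) : R := Num.max 0 (Num.min 1 t).
Lemma clamp_itv (t : R) : 0 <= clamp t <= 1.
Proof. by rewrite /clamp le_max lexx /= ge_max ler01 ge_min lexx. Qed.
Lemma clamp_lip (s t : R) : `|clamp s - clamp t| <= `|s - t|.
Proof.
have cE (u : R) : clamp u = if u <= 0 then 0 else if 1 <= u then 1 else u.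
  rewrite /clamp; case: (leP u 0) => h; first by apply/max_idPl; rewrite ge_min h orbT.
  case: (leP 1 u) => h1; first by rewrite (max_idPr ler01).
  by rewrite (max_idPr (ltW h)).
have a1 := ler_norm (s - t); have a2 := ler_norm (t - s); rewrite distrC in a2.
rewrite ler_norml !cE; case: (leP s 0) => ?; case: (leP t 0) => ?; case: (leP 1 s) => ?; case: (leP 1 t) => ?;
  apply/andP; split; lra.
Qed.

(** A ramp of slope k that tends to the indicator of t < c as k grows; [None] imposes no constraint
    on the coordinate. *)
Let bfac (b : option R) (k t : R) : R := if b is Some c then clamp (k * (c - t)) else 1.
Let bfac_norm b k t : `|bfac b k t| <= 1.
Proof.
rewrite /bfac; case: b => [c|]; last by rewrite normr1.
by have /andP[h1 h2] := clamp_itv (k * (c - t)); rewrite ger0_norm.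
Qed.
Let pfac (r : seq 'I_n) (b : 'I_n -> option R) k x : R := \prod_(i <- r) bfac (b i) k (x ord0 i).
Let pfac_norm r b k x : `|pfac r b k x| <= 1.
Proof.
rewrite /pfac normr_prod; apply: prodr_ile1 => i _; by rewrite normr_ge0 bfac_norm.
Qed.
Let pfac_uc r b k : 0 <= k -> forall eps, 0 < eps ->
  exists2 del, 0 < del & forall x w, enorm w < del -> `|pfac r b k (x - w) - pfac r b k x| <= eps.
Proof.
move=> k0; elim: r => [|i r IH] eps e0.
  by exists 1 => // x w _; rewrite /pfac !big_nil subrr normr0 ltW.
have e2 : 0 < eps / 2 by rewrite divr_gt0.
have [d1 d10 h1] := IH _ e2.
have k1 : 0 < k + 1 by rewrite ltr_wpDl.
exists (Num.min d1 (eps / 2 / (k + 1))); first by rewrite lt_min d10 divr_gt0.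
move=> x w; rewrite lt_min => /andP[w1 w2].
rewrite /pfac !big_cons -!/(pfac _ _ _ _).
set a := bfac _ _ _; set a' := bfac _ _ _; set p := pfac _ _ _ _; set p' := pfac _ _ _ _.
have -> : a * p - a' * p' = a * (p - p') + (a - a') * p' by ring.
have ha : `|a - a'| <= eps / 2.
  rewrite /a /a' /bfac; case: (b i) => [c|]; last by rewrite subrr normr0 ltW.
  apply: le_trans (clamp_lip _ _) _; rewrite !mxE.
  rewrite (_ : _ - _ = k * w ord0 i); last by ring.
  rewrite normrM (ger0_norm k0); move: w2; rewrite ltr_pdivlMr// => w2.
  have := coord_le_enorm w i; have := normr_ge0 (w ord0 i); nra.
have hp : `|p - p'| <= eps / 2 by exact: h1.
have n1 : `|a| <= 1 by exact: bfac_norm.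
have n2 : `|p'| <= 1 by exact: pfac_norm.
apply: le_trans (ler_normD _ _) _; rewrite !normrM.
have := normr_ge0 a; have := normr_ge0 p'; have := normr_ge0 (p - p'); have := normr_ge0 (a - a').
nra.
Qed.

Let measurable_pfac r b k : measurable_fun setT (pfac r b k).
Proof.
elim: r => [|i r IH].
  by rewrite (_ : pfac [::] b k = cst 1); [exact: measurable_cst|apply/funext => x; rewrite /pfac big_nil].
rewrite (_ : pfac _ _ _ = fun x => bfac (b i) k (x ord0 i) * pfac r b k x); last first.
  by apply/funext => x; rewrite /pfac big_cons.
apply: measurable_funM => //; rewrite /bfac; case: (b i) => [c|]; last exact: measurable_cst.
apply: measurable_maxr; first exact: measurable_cst.
apply: measurable_minr; first exact: measurable_cst.
apply: measurable_funM; first exact: measurable_cst.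
by apply: measurable_funB; [exact: measurable_cst|exact: measurable_coord].
Qed.

(** Products of open half-lines and full lines: they are stable under intersection and generate the
    sigma-algebra, as Dynkin's lemma requires. *)
Definition obox (b : 'I_n -> option R) : set 'rV[R]_n :=
  [set x | forall i, if b i is Some c then x ord0 i < c else true].

Let blim (b : option R) (t : R) : R := if b is Some c then ((t < c)%R)%:R else 1.
Let obox_indic (b : 'I_n -> option R) x : \1_(obox b) x = \prod_i blim (b i) (x ord0 i) :> R.
Proof.
rewrite indicE; case: (boolP (x \in obox b)) => [/set_mem H|/negP H].
  by rewrite big1// => i _; have := H i; rewrite /blim; case: (b i) => // c ->.
have [i hi] : exists i, ~~ (if b i is Some c then x ord0 i < c else true).
  apply/existsP; rewrite -negb_forall; apply/negP => /forallP K; apply: H; exact/mem_set.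
rewrite (bigD1 i)//=; move: hi; rewrite /blim; case: (b i) => // c /negPf ->; by rewrite mul0r.
Qed.

Let bfac_cvg (b : option R) (t : R) : (fun m : nat => bfac b m.+1%:R t) @ \oo --> blim b t.
Proof.
rewrite /blim; case: b => [c|]; last exact: cvg_cst.
have [tc|tc] := ltP t c; last first.
  rewrite (_ : (fun m => _) = cst 0); first exact: cvg_cst.
  apply/funext => m; rewrite /bfac /clamp; apply/max_idPl; rewrite ge_min; apply/orP; right.
  by rewrite mulr_ge0_le0// subr_le0.
have ct : 0 < c - t by rewrite subr_gt0.
apply: (@cvg_trans _ ((fun=> 1 : R) @ \oo)); last exact: cvg_cst.
apply: near_eq_cvg; apply: filterS (near_nat_ge (c - t)^-1) => m hm.
rewrite /bfac /clamp (_ : Num.min 1 _ = 1); first by apply/esym/max_idPr.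
by apply/min_idPl; rewrite -ler_pdivrMr// div1r.
Qed.

Let gbox b : \int[lr]_x (G x * \1_(obox b) x) = 0.
Proof.
pose r := index_enum 'I_n.
have Z m : \int[lr]_x (G x * pfac r b m.+1%:R x) = 0.
  apply: annihilates_unif_continuous; [exact: measurable_pfac|exact: pfac_norm|exact: pfac_uc].
have cv x : (fun m : nat => G x * pfac r b m.+1%:R x) @ \oo --> G x * \1_(obox b) x.
  apply: cvgM; first exact: cvg_cst.
  rewrite obox_indic /pfac.
  have H (q : seq 'I_n) : (fun m : nat => \prod_(i <- q) bfac (b i) m.+1%:R (x ord0 i)) @ \oo -->
      \prod_(i <- q) blim (b i) (x ord0 i).
    elim: q => [|i q IH].
      by under eq_fun do rewrite big_nil; rewrite big_nil; exact: cvg_cst.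
    rewrite big_cons; under eq_fun do rewrite big_cons.
    by apply: cvgM => //; exact: bfac_cvg.
  exact: H.
have mm m : measurable_fun setT (fun x => G x * pfac r b m.+1%:R x).
  by apply: measurable_funM => //; exact: rintg_meas iG.
have bd m x : `|G x * pfac r b m.+1%:R x| <= `|G x| by rewrite normrM ler_piMr.
have [_] := Rint_cvg mm (rintg_norm iG) cv bd; under eq_fun do rewrite Z.
by move=> H; apply: (@cvg_unique _ (@Rhausdorff R) _ _ _ _ H); exact: cvg_cst.
Qed.

Let measurable_oboxE : @measurable _ 'rV[R]_n = <<s range obox >>.
Proof.
have mbox b : measurable (obox b).
  rewrite (_ : obox b = \big[setI/setT]_i (if b i is Some c then [set x : 'rV[R]_n | x ord0 i < c] else setT)); last first.
    apply/seteqP; split => [x hx|x].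
      by rewrite -bigcap_seq => i _ /=; have := hx i; case: (b i).
    by rewrite -bigcap_seq => hx i; have := hx i (mem_index_enum i); case: (b i).
  apply: bigsetI_measurable => i _; case: (b i) => // c.
  have := @measurable_coord R n i measurableT _ (measurable_itv `]-oo, c[).
  rewrite setTI => h; rewrite (_ : [set x : 'rV[R]_n | x ord0 i < c] = (fun x => x ord0 i) @^-1` `]-oo, c[)//.
apply/seteqP; split; last first.
  by apply: smallest_sub; [exact: sigma_algebra_measurable|move=> _ [b _ <-]; exact: mbox].
have sG := smallest_sigma_algebra setT (range obox).
apply: smallest_sub => // S; rewrite -bigcup_seq => -[i _ [Y mY <-]]; rewrite setTI.
pose H : set (set R) := [set Y | <<s range obox >> ((fun x : 'rV[R]_n => x ord0 i) @^-1` Y)].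
suff : H Y by [].
have sH : sigma_algebra setT H.
  split.
  - by rewrite /H /= preimage_set0; exact: sigma_algebra0.
  - by move=> A hA; rewrite /H /= setTD preimage_setC; exact: sigma_algebraC.
  - by move=> F hF; rewrite /H /= preimage_bigcup; exact: sigma_algebra_bigcup.
move: mY; rewrite RGenInftyO.measurableE; apply: smallest_sub => // A [c ->].
rewrite /H /= set_itvE; apply: sub_sigma_algebra.
exists (fun k => if k == i then Some c else None) => //.
apply/seteqP; split => x /=.
  by move=> /(_ i); rewrite eqxx.
by move=> xc k; case: eqP => [->|].
Qed.

(** Dynkin's lemma: the sets on which G has integral 0 contain the boxes and are stable under
    complement and countable disjoint union. *)
Let gset S : measurable S -> \int[lr]_x (G x * \1_S x) = 0.
Proof.
have mG := rintg_meas iG.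
have iS S' : measurable S' -> rintg lr (fun x => G x * \1_S' x).
  move=> mS; apply: rintg_le _ (rintg_norm iG) _.
    by apply: measurable_funM => //; exact: measurable_indic.
  by move=> x; rewrite normrM ler_piMr// indicE; case: (_ \in _); rewrite ?normr1 ?normr0.
have T0 : \int[lr]_x (G x * \1_(setT : set 'rV[R]_n) x) = 0.
  rewrite -[RHS](gbox (fun=> None)); apply: eq_Rint => x; congr (_ * _).
  by rewrite !indicE; congr (_%:R); rewrite !mem_set.
suff H S' : <<s range obox >> S' -> \int[lr]_x (G x * \1_S' x) = 0.
  by move=> mS; apply: H; rewrite -measurable_oboxE.
move: S'; apply: (dynkin_induction (P := fun S' => \int[lr]_x (G x * \1_S' x) = 0) measurable_oboxE) => //.
- move=> A B [b _ <-] [c _ <-].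
  exists (fun i => if b i is Some u then (if c i is Some v then Some (Num.min u v) else Some u) else c i) => //.
  apply/seteqP; split => [x hx|x [hb hc] i].
    by split=> i; have := hx i; case: (b i) => [u|]; case: (c i) => [v|] //; rewrite lt_min => /andP[].
  by have := hb i; have := hc i; case: (b i) => [u|]; case: (c i) => [v|] //; rewrite lt_min => -> ->.
- by move=> _ [b _ <-]; exact: gbox.
- move=> S0 mS0 Z.
  rewrite (eq_Rint lr (_ : _ =1 fun x => G x * \1_(setT : set 'rV[R]_n) x - G x * \1_S0 x)); last first.
    by move=> x; rewrite !indicE in_setC in_setT; case: (_ \in _) => /=; ring.
  by rewrite (RintB (iS _ measurableT) (iS _ mS0)) T0 Z subrr.
move=> F mF tF ZF; have mU : measurable (\bigcup_k F k) by exact: bigcupT_measurable.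
pose p (N : nat) x : R := \sum_(k < N) \1_(F k) x.
have pE N x : p N x = (x \in \bigcup_(k in [set k | (k < N)%N]) F k)%:R.
  case: (boolP (x \in _)) => [/set_mem[k /= kN xk]|/negP H].
    rewrite /p (bigD1 (Ordinal kN))//= indicE mem_set// big1 ?addr0// => i ik.
    rewrite indicE; case: (boolP (x \in F i)) => // /set_mem xi; case/eqP: ik; apply: val_inj => /=.
    by apply: (tF i k) => //; exists x.
  rewrite /p big1// => i _; rewrite indicE; case: (boolP (x \in F i)) => // /set_mem xi.
  by case: H; apply/mem_set; exists (val i) => //=.
have Zp N : \int[lr]_x (G x * p N x) = 0.
  rewrite (eq_Rint lr (_ : _ =1 fun x => \sum_(k < N) G x * \1_(F k) x)); last first.
    by move=> x; rewrite /p mulr_sumr.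
  rewrite (@Rint_sum _ _ _ lr _ (index_enum 'I_N) xpredT _ (fun k _ => iS _ (mF k))).
  by rewrite big1.
have cv x : (fun N => G x * p N x) @ \oo --> G x * \1_(\bigcup_k F k) x.
  apply: cvgM; first exact: cvg_cst.
  rewrite indicE; case: (boolP (x \in _)) => [/set_mem[k _ xk]|/negP H].
    apply: (@cvg_trans _ ((fun=> 1 : R) @ \oo)); last exact: cvg_cst.
    apply: near_eq_cvg; exists k.+1 => // N /= kN; rewrite pE mem_set//.
    by exists k.
  rewrite (_ : (fun N => _) = cst 0); first exact: cvg_cst.
  apply/funext => N; rewrite pE; case: (boolP (x \in _)) => // /set_mem[k _ xk].
  by case: H; apply/mem_set; exists k.
have mp N : measurable_fun setT (fun x => G x * p N x).
  by apply: measurable_funM => //; apply: measurable_sum => k; exact: measurable_indic.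
have bp N x : `|G x * p N x| <= `|G x|.
  by rewrite normrM ler_piMr// pE; case: (_ \in _); rewrite ?normr1 ?normr0.
have [_] := Rint_cvg mp (rintg_norm iG) cv bp; under eq_fun do rewrite Zp.
by move=> H; apply: (@cvg_unique _ (@Rhausdorff R) _ _ _ _ H); exact: cvg_cst.
Qed.

(** The integral of |G| is the difference of the integrals of G over the set where G >= 0 and over
    its complement. *)
Lemma annihilates_ae0 : {ae lr, forall x, f x = 0}.
Proof.
have mG := rintg_meas iG; pose S : set 'rV[R]_n := [set x | 0 <= G x].
have mS : measurable S.
  have := mG measurableT _ (measurable_itv `[0, +oo[); rewrite setTI.
  move=> h; rewrite (_ : S = G @^-1` `[0, +oo[)//.
  by rewrite set_itvE.
have iS S' : measurable S' -> rintg lr (fun x => G x * \1_S' x).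
  move=> mS'; apply: rintg_le _ (rintg_norm iG) _.
    by apply: measurable_funM => //; exact: measurable_indic.
  by move=> x; rewrite normrM ler_piMr// indicE; case: (_ \in _); rewrite ?normr1 ?normr0.
have Z : \int[lr]_x `|G x| = 0.
  rewrite (eq_Rint lr (_ : _ =1 fun x => G x * \1_S x - G x * \1_(~` S) x)); last first.
    move=> x; rewrite !indicE in_setC; case: (boolP (x \in S)) => [/set_mem h|/negP h] /=.
      by rewrite ger0_norm// mulr1 mulr0 subr0.
    have : ~ (0 <= G x) by move=> k; apply: h; exact/mem_set.
    by move=> /negP; rewrite -ltNge => k; rewrite ltr0_norm// mulr0 sub0r mulr1.
  by rewrite (RintB (iS _ mS) (iS _ (measurableC mS))) (gset mS) (gset (measurableC mS)) subrr.
have := Rint_eq0_ae (rintg_norm iG) (fun x => normr_ge0 (G x)) Z.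
apply: filterS => x /eqP; rewrite normr_eq0 /G mulf_eq0 => /orP[/eqP//|].
by rewrite gt_eqF// rgauss_gt0.
Qed.
End annihilator.

Lemma hermd_complete (f : 'rV[R]_n -> R) : measurable_fun setT f -> rintg lr (fun x => f x * f x) ->
  (forall al, \int[lr]_x (f x * hermd al x) = 0) -> {ae lr, forall x, f x = 0}.
Proof.
move=> mf f2 Z.
have L2 (g : 'rV[R]_n -> R) : measurable_fun setT g -> rintg lr (fun x => g x * g x) -> rintg lr (fun x => f x * g x).
  move=> mg g2; apply: rintg_le _ (rintgD f2 g2) _; first exact: measurable_funM.
  move=> x; rewrite normrM.
  have := sqr_ge0 (`|f x| - `|g x|); have : `|f x| ^+ 2 = f x * f x by rewrite real_normK ?num_real ?expr2.
  have : `|g x| ^+ 2 = g x * g x by rewrite real_normK ?num_real ?expr2.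
  by have := normr_ge0 (f x); have := normr_ge0 (g x); nra.
have ig (P : 'I_n -> {poly R}) : rintg lr (fun x => f x * gpoly P x).
  have [M M0 HM] := gpoly_rwt P; apply: L2; first exact: measurable_gpoly.
  apply: rintg_le _ (rintgZ (M * M) (@rintg_rwt R n)) _.
    by apply: measurable_funM; exact: measurable_gpoly.
  move=> x; rewrite normrM; have := HM x; have := rwt_le1 x; have := rwt_ge0 x; have := normr_ge0 (gpoly P x).
  move: `|gpoly P x| (rwt x) => u v u0 v0 v1 uv.
  have : u * u <= (M * v) * (M * v) by apply: ler_pM.
  have : (M * M) * (v * v) <= (M * M) * v by rewrite ler_wpM2l ?mulr_ge0// ler_piMr.
  lra.
(* Outside [r] the polynomial factors are Hermite polynomials; inside, they are arbitrary. Each step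
   of the induction frees one coordinate by [herm_span], until all monomials are covered. *)
have Zr (r : seq 'I_n) : forall P : 'I_n -> {poly R}, (forall i, i \notin r -> exists k, P i = @herm R k) ->
   \int[lr]_x (f x * gpoly P x) = 0.
  elim: r => [|i r IH] P hP.
    have /choice[al hal] := fun i => hP i isT.
    pose be : {ffun 'I_n -> nat} := [ffun i => al i].
    have E x : f x * gpoly P x = (\prod_i Num.sqrt (@hcst R (al i))) * (f x * hermd be x).
      rewrite /hermd /gpoly mulrCA -big_split; congr (_ * _); apply: eq_bigr => j _ /=.
      rewrite /gp /hermP ffunE hornerZ hal mulrA mulrA mulfV ?mul1r//.
      by rewrite lt0r_neq0// sqrtr_gt0 hcst_gt0.
    by rewrite (eq_Rint lr E) (RintZ _ (ig _)) Z mulr0.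
  pose Pi (p : {poly R}) : 'I_n -> {poly R} := fun k => if k == i then p else P k.
  have gE p x : gpoly (Pi p) x = gp p (x ord0 i) * \prod_(k | k != i) gp (P k) (x ord0 k).
    rewrite /gpoly (bigD1 i)//=; congr (gp _ _ * _); first by rewrite /Pi eqxx.
    by apply: eq_bigr => k /negPf ki; rewrite /Pi ki.
  have gD p q x : f x * gpoly (Pi (p + q)) x = f x * gpoly (Pi p) x + f x * gpoly (Pi q) x.
    by rewrite !gE /gp hornerD; ring.
  have gZ (c : R) p x : f x * gpoly (Pi (c *: p)) x = c * (f x * gpoly (Pi p) x).
    by rewrite !gE /gp hornerZ; ring.
  have -> : P = Pi (P i) by apply/funext => k; rewrite /Pi; case: eqP => [->|].
  apply: (@herm_span R (fun p => \int[lr]_x (f x * gpoly (Pi p) x) = 0)).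
  - by move=> p q hp hq; rewrite (eq_Rint lr (gD p q)) (RintD (ig _) (ig _)) hp hq addr0.
  - by move=> c p hp; rewrite (eq_Rint lr (gZ c p)) (RintZ _ (ig _)) hp mulr0.
  move=> k; apply: IH => j jr; rewrite /Pi; case: eqP => [_|/eqP ji]; first by exists k.
  by apply: hP; rewrite inE negb_or ji.
apply: annihilates_ae0 => //.
  move=> a a0; apply: L2; first exact: measurable_rgauss.
  by apply: eq_rintg (rintg_rgauss (addr_gt0 a0 a0)) => x; rewrite rgaussD.
move=> s; rewrite -[RHS](Zr (index_enum 'I_n) (fun i => 'X^(s i))); last first.
  by move=> i; rewrite mem_index_enum.
apply: eq_Rint => x; rewrite -mulrA; congr (_ * _); rewrite rgaussE /monom /gpoly -big_split.
by apply: eq_bigr => i _; rewrite /gp /= hornerXn mulrC (mulrC 2^-1).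
Qed.
End gaussian_completeness.

(** * Square-integrable functions *)

Section square_integrable_functions.
Context {R : realType} (n : nat).
Local Notation C := R[i].
Local Notation lr := (@lebesgue_row R n).
Implicit Types (f g : 'rV[R]_n -> C).

Lemma square_integrable_meas f : square_integrable f -> cmeas f.
Proof. by case. Qed.

Lemma square_integrable_rintg f : square_integrable f -> rintg lr (fun x => normc (f x) ^+ 2).
Proof.
move=> [m1 m2 fin]; apply: ge0_rintg => // [|x]; last exact: sqr_ge0.
by apply: measurable_funX; exact: cmeas_normc.
Qed.

Lemma square_integrable_of f : cmeas f -> rintg lr (fun x => normc (f x) ^+ 2) -> square_integrable f.
Proof. by move=> [m1 m2] i2; split => //; apply: (rintg_lty i2) => x; exact: sqr_ge0. Qed.

Lemma cintg_mulL2 f g : square_integrable f -> square_integrable g -> cintg lr (fun x => f x * g x).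
Proof.
move=> sf sg; have mf := square_integrable_meas sf; have mg := square_integrable_meas sg.
apply: (cintg_le (cmeasM mf mg) (rintgD (square_integrable_rintg sf) (square_integrable_rintg sg))) => x.
rewrite Normc.normcM; have := sqr_ge0 (normc (f x) - normc (g x)).
have := mulr_ge0 (normc_ge0 (f x)) (normc_ge0 (g x)); lra.
Qed.

Lemma square_integrable_conj f : square_integrable f -> square_integrable (fun x => conjc (f x)).
Proof.
move=> sf; apply: square_integrable_of; first exact: cmeas_conj (square_integrable_meas sf).
by apply: eq_rintg (square_integrable_rintg sf) => x; rewrite normc_conj.
Qed.

Lemma square_integrableD f g : square_integrable f -> square_integrable g ->
  square_integrable (fun x => f x + g x).
Proof.
move=> sf sg; have mf := square_integrable_meas sf; have mg := square_integrable_meas sg.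
apply: square_integrable_of; first exact: cmeasD.
have i2 := rintgD (rintgZ 2 (square_integrable_rintg sf)) (rintgZ 2 (square_integrable_rintg sg)).
apply: rintg_le _ i2 _; first by apply: measurable_funX; apply: cmeas_normc; exact: cmeasD.
move=> x; rewrite ger0_norm ?sqr_ge0//; apply: sqr_triangle; [exact: normc_ge0|exact: normcD_le].
Qed.

Lemma square_integrableZ (c : C) f : square_integrable f -> square_integrable (fun x => c * f x).
Proof.
move=> sf; have mf := square_integrable_meas sf; apply: square_integrable_of.
  by apply: cmeasM => //; exact: cmeas_cst.
apply: eq_rintg (rintgZ (normc c ^+ 2) (square_integrable_rintg sf)) => x.
by rewrite Normc.normcM exprMn.
Qed.

Lemma square_integrable_sum I (r : seq I) (f : I -> 'rV[R]_n -> C) : (forall i, square_integrable (f i)) ->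
  square_integrable (fun x => \sum_(i <- r) f i x).
Proof.
move=> sf; elim: r => [|i r IH].
  rewrite (_ : (fun x => _) = fun=> 0); last by apply/funext => x; rewrite big_nil.
  apply: square_integrable_of; first exact: cmeas_cst.
  by apply: eq_rintg (rintg0 lr) => x; rewrite Normc.normc0 expr0n.
rewrite (_ : (fun x => _) = fun x => f i x + \sum_(j <- r) f j x); first exact: square_integrableD.
by apply/funext => x; rewrite big_cons.
Qed.

Lemma innerDr f g h : square_integrable f -> square_integrable g -> square_integrable h ->
  inner f (fun x => g x + h x) = inner f g + inner f h.
Proof.
move=> sf sg sh; have sf' := square_integrable_conj sf.
rewrite /inner -(cintD (cintg_mulL2 sf' sg) (cintg_mulL2 sf' sh)).
by apply: eq_cint => x; rewrite mulrDr.
Qed.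

Lemma innerZr (c : C) f g : square_integrable f -> square_integrable g ->
  inner f (fun x => c * g x) = c * inner f g.
Proof.
move=> sf sg; rewrite /inner -(cintZ _ (cintg_mulL2 (square_integrable_conj sf) sg)).
by apply: eq_cint => x; rewrite mulrCA.
Qed.

Lemma inner_sumr I (r : seq I) (c : I -> C) f (g : I -> 'rV[R]_n -> C) : square_integrable f ->
  (forall i, square_integrable (g i)) ->
  inner f (fun x => \sum_(i <- r) c i * g i x) = \sum_(i <- r) c i * inner f (g i).
Proof.
move=> sf sg; rewrite /inner.
have ii i : cintg lr (fun x => c i * (conjc (f x) * g i x)).
  exact: cintgZ (cintg_mulL2 (square_integrable_conj sf) (sg i)).
transitivity (cint lr (fun x => \sum_(i <- r) c i * (conjc (f x) * g i x))).
  by apply: eq_cint => x; rewrite mulr_sumr; apply: eq_bigr => i _; rewrite mulrCA.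
rewrite (@cint_sum _ _ R lr _ r xpredT _ (fun i _ => ii i)); apply: eq_bigr => i _.
by rewrite (cintZ _ (cintg_mulL2 (square_integrable_conj sf) (sg i))).
Qed.

Lemma inner_conj f g : square_integrable f -> square_integrable g -> inner g f = conjc (inner f g).
Proof.
move=> sf sg; rewrite /inner -cint_conj; last exact: cintg_mulL2 (square_integrable_conj sf) sg.
by apply: eq_cint => x; rewrite conjcM conjcK mulrC.
Qed.

Lemma inner_ae f f' g g' : square_integrable f -> square_integrable f' -> square_integrable g -> square_integrable g' ->
  {ae lr, forall x, f x = f' x} -> {ae lr, forall x, g x = g' x} -> inner f g = inner f' g'.
Proof.
move=> [m1 m2 _] [m3 m4 _] [m5 m6 _] [m7 m8 _] ef eg; apply: cint_ae.
- by apply: cmeasM; [apply: cmeas_conj; split|split].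
- by apply: cmeasM; [apply: cmeas_conj; split|split].
by apply: filterS2 ef eg => x -> ->.
Qed.
End square_integrable_functions.

(** * From an arbitrary eigenbasis to the Hermite basis *)

Section eigenspace_basis.
Context {R : realType} (n : nat).
Local Notation C := R[i].
Local Notation lr := (@lebesgue_row R n).
Local Notation idx := {ffun 'I_n -> nat}.

Definition hermc (al : idx) (x : 'rV[R]_n) : C := (hermd al x)%:C.

Lemma square_integrable_hermc al : square_integrable (hermc al).
Proof.
apply: square_integrable_real; first exact: measurable_gpoly.
exact: (hermd_orthonormal al al).1.
Qed.

Lemma inner_hermc al be : inner (hermc al) (hermc be) = (al == be)%:R.
Proof.
rewrite /inner (_ : cint _ _ = cint lr (fun x => (hermd al x * hermd be x)%:C)); last first.
  by apply: eq_cint => x; rewrite /hermc conjc_real rmorphM.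
by rewrite cint_real (hermd_orthonormal al be).2 rmorph_nat.
Qed.

(** The Hermite function is itself a test function in the weak equation of f. Being an eigenfunction
    for another eigenvalue, it multiplies the inner product by a nonzero difference of
    eigenvalues. *)
Lemma inner_hermc_eigen al j f : oscillator_eigenspace (2 * j + n)%:R f -> degree al != j ->
  inner (hermc al) f = 0.
Proof.
move=> [sf sg H] dj; have := H _ (schwartz_gpoly (hermP al)).
rewrite -/(hermd al) -/(hermc al) (innerZr _ (square_integrable_hermc al) sf).
have -> : oscillator (hermc al) = fun x => (2 * (degree al)%:R + n%:R)%:C * hermc al x.
  by apply/funext => x; rewrite /hermc oscillator_hermd rmorphM.
have -> : inner (fun x => (2 * (degree al)%:R + n%:R)%:C * hermc al x) f =
   (2 * (degree al)%:R + n%:R)%:C * inner (hermc al) f.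
  rewrite /inner -(cintZ _ (cintg_mulL2 (square_integrable_conj (square_integrable_hermc al)) sf)).
  by apply: eq_cint => x; rewrite conjcM conjc_real mulrA.
move=> /eqP; rewrite -subr_eq0 -mulrBl mulf_eq0 => /orP[|/eqP//].
rewrite -rmorphB => /eqP/(congr1 (@complex.Re R)) /= /eqP.
rewrite natrD natrM subr_eq0 => /eqP/addIr/mulfI h.
have /eqP := h (ltac:(by rewrite pnatr_eq0)); rewrite eqr_nat eq_sym (negPf dj)//.
Qed.

Lemma hermc_complete f : square_integrable f -> (forall al, inner (hermc al) f = 0) -> {ae lr, forall x, f x = 0}.
Proof.
move=> sf Z; have [m1 m2 _] := sf; have i2 := square_integrable_rintg sf.
have part (p : 'rV[R]_n -> R) : measurable_fun setT p -> (forall x, p x ^+ 2 <= normc (f x) ^+ 2) ->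
   (forall al, \int[lr]_x (p x * hermd al x) = 0) -> {ae lr, forall x, p x = 0}.
  move=> mp bp zp; apply: hermd_complete => //; apply: rintg_le _ i2 _; first exact: measurable_funM.
  by move=> x; rewrite -expr2 ger0_norm ?sqr_ge0.
have E al : inner (hermc al) f = (\int[lr]_x (complex.Re (f x) * hermd al x) +i*
    \int[lr]_x (complex.Im (f x) * hermd al x))%C.
  by apply: complex_eqP; rewrite /inner /cint /=; apply: eq_Rint => x; rewrite ?ReM ?ImM /=; ring.
have r0 : {ae lr, forall x, complex.Re (f x) = 0}.
  apply: part => // [x|al]; last by have := E al; rewrite Z => -[].
  by rewrite normc_sqr lerDl sqr_ge0.
have r1 : {ae lr, forall x, complex.Im (f x) = 0}.
  apply: part => // [x|al]; last by have := E al; rewrite Z => -[].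
  by rewrite normc_sqr lerDr sqr_ge0.
by apply: filterS2 r0 r1 => x h1 h2; exact: complex_eqP.
Qed.

(** Orthonormality of e gives D D^* = 1. Expanding the Hermite functions in e, which spans the
    eigenspace, gives a left inverse of D, necessarily D^*. Both identities are kept because N = m
    is not known beforehand and follows from them. *)
Lemma eigenspace_basis (j N m : nat) (e : 'I_N -> 'rV[R]_n -> C) (al : 'I_m -> idx) :
  orthonormal_basis (@oscillator_eigenspace R n (2 * j + n)%N%:R) e ->
  injective al -> (forall i, degree (al i) = j) -> (forall be, degree be = j -> exists i, al i = be) ->
  exists D : 'M[C]_(N, m), [/\ D *m map_mx conjc D^T = 1%:M, map_mx conjc D^T *m D = 1%:M &
    forall k, {ae lr, forall x, e k x = \sum_i D k i * hermc (al i) x}].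
Proof.
move=> [eE eO eS] ial dal sal; pose D : 'M[C]_(N, m) := \matrix_(k, i) inner (hermc (al i)) (e k).
have se k : square_integrable (e k) by case: (eE k).
have sh := square_integrable_hermc.
have shs (c : 'I_m -> C) : square_integrable (fun x => \sum_i c i * hermc (al i) x).
  by apply: square_integrable_sum => i; exact: square_integrableZ.
have expand k : {ae lr, forall x, e k x = \sum_i D k i * hermc (al i) x}.
  (* The difference between [e k] and its candidate expansion is orthogonal to the Hermite functions
     of degree j by construction, and to the others because both terms are. *)
  pose f x := e k x + -1 * \sum_i D k i * hermc (al i) x.
  have sf : square_integrable f by apply: square_integrableD => //; exact: square_integrableZ.
  have Z be : inner (hermc be) f = 0.
    rewrite /f innerDr//; last exact: square_integrableZ.
    rewrite innerZr// inner_sumr//.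
    have [dj|dj] := eqVneq (degree be) j; last first.
      rewrite (inner_hermc_eigen (eE k) dj) add0r mulN1r big1 ?oppr0// => i _.
      rewrite inner_hermc; case: eqP => [bi|]; last by rewrite mulr0.
      by case/eqP: dj; rewrite bi.
    have [i ib] := sal _ dj; rewrite (bigD1 i)//= inner_hermc ib eqxx mulr1 big1 ?addr0; last first.
      move=> i' ii; rewrite inner_hermc; case: eqP => [bi|]; last by rewrite mulr0.
      by case/eqP: ii; apply: ial; rewrite ib.
    by rewrite mxE ib mulN1r subrr.
  have := hermc_complete sf Z; apply: filterS => x; rewrite /f mulN1r => /eqP.
  by rewrite subr_eq0 => /eqP.
have DD : D *m map_mx conjc D^T = 1%:M.
  apply/matrixP => k l; rewrite !mxE.
  have := eO l k; rewrite (inner_ae (se l) (shs _) (se k) (shs _) (expand l) (expand k)) inner_sumr// eq_sym => <-.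
  apply: eq_bigr => i _; rewrite !mxE; congr (_ * _).
  rewrite (inner_conj (sh _) (shs _)) inner_sumr//; congr conjc.
  rewrite (bigD1 i)//= inner_hermc eqxx mulr1 big1 ?addr0//; last first.
    move=> i' ii; rewrite inner_hermc; case: eqP => [/ial bi|]; last by rewrite mulr0.
    by case/eqP: ii.
  by rewrite mxE.
have /choice[B HB] : forall i, exists c : 'I_N -> C, {ae lr, forall x, hermc (al i) x = \sum_k c k * e k x}.
  by move=> i; apply: eS; rewrite /hermc; exact: hermd_eigenspace.
pose B' : 'M[C]_(m, N) := \matrix_(i, k) B i k.
have BD : B' *m D = 1%:M.
  apply/matrixP => i i'; rewrite !mxE.
  have sB : square_integrable (fun x => \sum_k B i k * e k x).
    by apply: square_integrable_sum => k; exact: square_integrableZ.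
  have aux : {ae lr, forall x, hermc (al i') x = hermc (al i') x} by exact: filterE.
  have := inner_hermc (al i') (al i); rewrite (inner_ae (sh _) (sh _) (sh _) sB aux (HB i)) inner_sumr//.
  rewrite (inj_eq ial) eq_sym => <-; apply: eq_bigr => k _; by rewrite !mxE.
exists D; split => //.
have -> : map_mx conjc D^T = B' by rewrite -[LHS]mul1mx -BD -mulmxA DD mulmx1.
exact: BD.
Qed.
End eigenspace_basis.

(** * Symbols *)

Section differences.
Context {R : realType} {n : nat} {V : zmodType}.
Implicit Types (a b : 'rV[R]_n -> V) (w z : 'rV[R]_n).

(** Symbol estimates use finite differences in place of derivatives: these commute with averaging
    without any differentiation under the integral sign. *)
Definition dif w a z : V := a (z + w) - a z.
Definition difs (ws : seq 'rV[R]_n) a : 'rV[R]_n -> V := foldr dif a ws.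
End differences.

Section japanese_bracket.
Context {R : realType} {n : nat}.
Implicit Types (z w v : 'rV[R]_n).

Definition jb z : R := 1 + enorm z.

Lemma jb_ge1 z : 1 <= jb z. Proof. by rewrite lerDl enorm_ge0. Qed.
Lemma jb_gt0 z : 0 < jb z. Proof. exact: lt_le_trans ltr01 (jb_ge1 z). Qed.
Lemma jbN z : jb (- z) = jb z. Proof. by rewrite /jb enormN. Qed.
Lemma jb_peetre z v : jb z <= jb (z + v) * jb v.
Proof.
have : enorm z <= enorm (z + v) + enorm v.
  by rewrite -{1}(addrK v z); apply: le_trans (enorm_triangle _ _) _; rewrite enormN.
have := enorm_ge0 (z + v); have := enorm_ge0 v; rewrite /jb; nra.
Qed.

Lemma enorm_mono v w : (forall i, `|v ord0 i| <= `|w ord0 i|) -> enorm v <= enorm w.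
Proof.
move=> H; rewrite /enorm ler_sqrt ?dotp_ge0//; apply: ler_sum => i _.
by rewrite -!expr2 -(real_normK (num_real (v ord0 i))) -(real_normK (num_real (w ord0 i))) lerXn2r ?nnegrE.
Qed.

(** Each 1 + z_i^2 is at most (1 + |z|)^2. This is where the order 2 n, from which a symbol is
    dominated by the integrable weight [rwt], comes from. *)
Lemma jb_rwt z : (jb z ^+ (2 * n))^-1 <= rwt z.
Proof.
rewrite /rwt /wt prodfV lef_pV2 ?posrE ?exprn_gt0 ?jb_gt0//; last first.
  by apply: prodr_gt0 => i _; exact: oneDsqr_gt0.
rewrite exprM -[X in _ <= _ ^+ X]card_ord -prodr_const; apply: ler_prod => i _.
rewrite (ltW (oneDsqr_gt0 _))/=.
have h := coord_le_enorm z i; have h0 := normr_ge0 (z ord0 i).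
have : z ord0 i ^+ 2 = `|z ord0 i| ^+ 2 by rewrite real_normK ?num_real.
by rewrite /jb; nra.
Qed.

Lemma moderate_jbX k : moderate (fun z => jb z ^+ k).
Proof.
apply: moderateX; split.
  by apply: measurable_funD; [exact: measurable_cst|exact: meas_enorm].
move=> a a0; have [M1 H1] := (moderate_cst n 2).2 a a0; have [M2 H2] := (@sqr_moderate R n).2 a a0.
exists (M1 + M2) => x; apply: le_trans (lerD (H1 x) (H2 x)); rewrite -mulrDl ler_wpM2r ?(ltW (rgauss_gt0 _ _))//.
rewrite !ger0_norm ?dotp_ge0 ?(ltW (jb_gt0 _))// -enorm_sqr /jb.
have := sqr_ge0 (enorm x - 2^-1); lra.
Qed.

Lemma rintg_rgauss_moderate c (p : 'rV[R]_n -> R) : 0 < c -> moderate p ->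
  rintg (lebesgue_row n) (fun x => rgauss c x * p x).
Proof.
move=> c0 [mp hp]; have c2 : 0 < c / 2 by rewrite divr_gt0.
have [M HM] := hp _ c2.
apply: rintg_le _ (rintgZ M (rintg_rgauss n c2)) _.
  by apply: measurable_funM => //; exact: measurable_rgauss.
move=> x; rewrite (rgauss_half c); have g0 := ltW (rgauss_gt0 (c / 2) x).
by rewrite !normrM (ger0_norm g0); have := ler_wpM2l g0 (HM x); lra.
Qed.
End japanese_bracket.

(** * Symbol classes and gaussian averaging *)

Section symbols.
Context {R : realType} {n : nat}.
Local Notation C := R[i].
Local Notation lr := (@lebesgue_row R n).
Implicit Types (a : 'rV[R]_n -> C) (z w : 'rV[R]_n).

(* Symbols of order -m: each difference gains one power of decay, at the price of a
   polynomial loss in the increments. *)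
Definition symb (m : nat) a : Prop := cmeas a /\
  forall k, exists B K, forall ws, size ws = k -> forall z,
    normc (difs ws a z) <= B * (\prod_(w <- ws) jb w ^+ K) * (jb z ^+ (m + k))^-1.

Definition gden w : R := (Num.sqrt pi ^+ n)^-1 * rgauss 1 w.

Lemma gden_ge0 w : 0 <= gden w.
Proof. by rewrite mulr_ge0 ?(ltW (rgauss_gt0 _ _))// invr_ge0 exprn_ge0// sqrtr_ge0. Qed.

Lemma rintg_gden : rintg lr gden. Proof. exact: rintgZ (rintg_rgauss n ltr01). Qed.

Lemma Rint_gden : \int[lr]_w gden w = 1.
Proof.
rewrite (RintZ _ (rintg_rgauss n ltr01)) (Rint_rgauss n ltr01) divr1 mulVf//.
by rewrite expf_neq0// lt0r_neq0// sqrtr_gt0 pi_gt0.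
Qed.

Lemma measurable_gden : measurable_fun setT gden.
Proof. exact: rintg_meas rintg_gden. Qed.

Definition gconv a z : C := cint lr (fun w => (gden w)%:C * a (z - w)).

Lemma symb_bounded m a : symb m a -> exists2 B, 0 <= B & forall z, normc (a z) <= B.
Proof.
move=> [_ /(_ 0%N)[B [K H]]]; have B0 : 0 <= B * (jb (0 : 'rV[R]_n) ^+ m)^-1.
  by apply: le_trans (normc_ge0 (a 0)) _; have := H [::] erefl 0; rewrite big_nil mulr1 addn0.
have b0 : 0 <= B by move: B0; rewrite pmulr_lge0// invr_gt0 exprn_gt0// jb_gt0.
exists B => // z; apply: le_trans (H [::] erefl z) _; rewrite big_nil mulr1 ler_piMr//.
by rewrite invf_le1 ?exprn_ege1 ?jb_ge1// exprn_gt0// jb_gt0.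
Qed.

Lemma symb_rwt m a : (2 * n <= m)%N -> symb m a -> exists2 B, 0 <= B & forall z, normc (a z) <= B * rwt z.
Proof.
move=> nm [_ /(_ 0%N)[B [K H]]]; have B0 : 0 <= B * (jb (0 : 'rV[R]_n) ^+ m)^-1.
  by apply: le_trans (normc_ge0 (a 0)) _; have := H [::] erefl 0; rewrite big_nil mulr1 addn0.
have b0 : 0 <= B by move: B0; rewrite pmulr_lge0// invr_gt0 exprn_gt0// jb_gt0.
exists B => // z; apply: le_trans (H [::] erefl z) _; rewrite big_nil mulr1; apply: ler_wpM2l => //.
apply: le_trans (jb_rwt z); rewrite addn0 lef_pV2 ?posrE ?exprn_gt0 ?jb_gt0//.
by apply: ler_weXn2l => //; exact: jb_ge1.
Qed.

Section convolution.
Variables (a : 'rV[R]_n -> C) (B : R).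
Hypotheses (ma : cmeas a) (ba : forall z, normc (a z) <= B).

Let meas_shift z : cmeas (fun w => a (z - w)).
Proof. by apply: cmeas_comp => //; apply: meas_rowB => //; exact: measurable_cst. Qed.

Lemma cintg_gconv z : cintg lr (fun w => (gden w)%:C * a (z - w)).
Proof.
apply: (cintg_le _ (rintgZ B rintg_gden)).
  by apply: cmeasM => //; apply: cmeas_real; exact: measurable_gden.
move=> w; rewrite Normc.normcM normcR ger0_norm ?gden_ge0// mulrC.
by rewrite ler_wpM2r ?gden_ge0.
Qed.

(** A gaussian factor in z makes the integrand jointly integrable, so that Fubini's theorem provides
    measurability in z; [rgauss (-1)] then divides this factor out. *)
Lemma cmeas_gconv : cmeas (gconv a).
Proof.
have i2 : cintg (prodm lr lr) (fun p => (rgauss 1 p.1)%:C * ((gden p.2)%:C * a (p.1 - p.2))).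
  apply: (cintg_le _ (rintgX (rintg_rgauss n ltr01) (rintgZ B rintg_gden))).
    apply: cmeasM; first by apply: cmeas_real; exact: measurableT_comp (measurable_rgauss 1) measurable_fst.
    apply: cmeasM; first by apply: cmeas_real; exact: measurableT_comp measurable_gden measurable_snd.
    by apply: cmeas_comp => //; apply: meas_rowB; [exact: measurable_fst|exact: measurable_snd].
  move=> p; rewrite !Normc.normcM !normcR !ger0_norm ?gden_ge0 ?(ltW (rgauss_gt0 _ _))//.
  by rewrite ler_wpM2l ?(ltW (rgauss_gt0 _ _))// mulrC ler_wpM2r ?gden_ge0.
have [i1 _] := cfubini1 i2.
have m1 : cmeas (fun z => (rgauss (-1) z)%:C) by apply: cmeas_real; exact: measurable_rgauss.
apply: eq_cmeas (cmeasM m1 (cintg_meas i1)) => z /=.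
rewrite (cintZ _ (cintg_gconv z)) mulrA -rmorphM -rgaussD addNr /rgauss mul0r oppr0 expR0.
by rewrite mul1r.
Qed.

Lemma gconv_le z : normc (gconv a z) <= B.
Proof.
have B0 : 0 <= B := le_trans (normc_ge0 _) (ba 0).
apply: le_trans (normc_cint_le (cintg_gconv z) (rintgZ B rintg_gden) _) _.
  move=> w; rewrite Normc.normcM normcR ger0_norm ?gden_ge0// mulrC.
  by rewrite ler_wpM2r ?gden_ge0.
by rewrite (RintZ _ rintg_gden) Rint_gden mulr1.
Qed.

Lemma gconv_remainder z : a z - gconv a z = - cint lr (fun w => (gden w)%:C * dif (- w) a z).
Proof.
have i1 : cintg lr (fun w => (gden w)%:C) := cintg_real rintg_gden.
have i2 := cintgZ (a z) i1.
rewrite (_ : cint lr _ = cint lr (fun w => (gden w)%:C * a (z - w) - a z * (gden w)%:C)); last first.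
  by apply: eq_cint => w; rewrite /dif mulrBr (mulrC (a z)).
by rewrite (cintB (cintg_gconv z) i2) (cintZ _ i1) cint_real Rint_gden mulr1 opprB.
Qed.

(** As the gaussian has mass 1, a minus its average is, up to sign, an average of first differences
    of a. Its k-fold differences are thus averages of (k+1)-fold differences of a. *)
Lemma difs_gconv_remainder ws z :
  cintg lr (fun w => (gden w)%:C * difs (rcons ws (- w)) a z) /\
  difs ws (fun z => a z - gconv a z) z = - cint lr (fun w => (gden w)%:C * difs (rcons ws (- w)) a z).
Proof.
elim: ws z => [|v ws IH] z.
  split; last exact: gconv_remainder.
  have i2 := cintgB (cintg_gconv z) (cintgZ (a z) (cintg_real rintg_gden)).
  by apply: eq_cintg i2 => w; rewrite /= /dif mulrBr (mulrC (a z)).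
have [i1 e1] := IH (z + v); have [i2 e2] := IH z.
have E w : (gden w)%:C * difs (rcons ws (- w)) a (z + v) - (gden w)%:C * difs (rcons ws (- w)) a z =
   (gden w)%:C * difs (rcons (v :: ws) (- w)) a z by rewrite -mulrBr.
split; first exact: eq_cintg E (cintgB i1 i2).
rewrite -(eq_cint lr E) (cintB i1 i2) opprB /= {1}/dif e1 e2 opprK addrC.
by [].
Qed.
End convolution.

(** The additional difference gains one order of decay; its increment costs a power of [jb w], whose
    integral against the gaussian is finite. *)
Lemma symb_remainder m a : symb m a -> symb m.+1 (fun z => a z - gconv a z).
Proof.
move=> sa; have [B B0 ba] := symb_bounded sa; have [ma ha] := sa.
split; first by apply: cmeasB => //; exact: cmeas_gconv ba.
move=> k; have [D [K H]] := ha k.+1.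
have iK : rintg lr (fun w => gden w * jb w ^+ K).
  apply: eq_rintg (rintgZ (Num.sqrt pi ^+ n)^-1 (rintg_rgauss_moderate ltr01 (moderate_jbX K))) => w.
  by rewrite mulrA.
pose J := \int[lr]_w (gden w * jb w ^+ K).
exists (D * J), K => ws sw z; have [i1 ->] := difs_gconv_remainder ma ba ws z.
rewrite normcN.
pose c := D * (\prod_(w <- ws) jb w ^+ K) * (jb z ^+ (m.+1 + k))^-1.
apply: le_trans (normc_cint_le i1 (rintgZ c iK) _) _.
  move=> w; rewrite Normc.normcM normcR ger0_norm ?gden_ge0//.
  have := H (rcons ws (- w)); rewrite size_rcons sw => /(_ erefl z) h.
  apply: le_trans (ler_wpM2l (gden_ge0 w) h) _.
  rewrite big_rcons /= jbN addnS -addSn /c; lra.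
by rewrite (RintZ _ iK) -/J /c; lra.
Qed.

Definition remainder a : 'rV[R]_n -> C := fun z => a z - gconv a z.

Lemma symb_iter m a : symb 0 a -> symb m (iter m remainder a).
Proof. by move=> sa; elim: m => [//|m IH]; exact: symb_remainder. Qed.

Lemma gconv_decomposition m a z :
  a z = \sum_(k < m) gconv (iter k remainder a) z + iter m remainder a z.
Proof.
elim: m => [|m IH]; first by rewrite big_ord0 add0r.
rewrite big_ord_recr /= IH -addrA; congr (_ + _).
by rewrite {3}/remainder addrC subrK.
Qed.
End symbols.

(** * Homogeneous functions as symbols *)

Section homogeneous.
Context {R : realType} {n : nat}.
Local Notation C := R[i].
Local Notation e_ i := (delta_mx ord0 i : 'rV[R]_n).
Implicit Types (a D : 'rV[R]_n -> R) (z w v y : 'rV[R]_n).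

Lemma is_derive_shift a v w z df : is_derive (z + w) v a df -> is_derive z v (fun y => a (y + w)) df.
Proof.
move=> [d1 d2].
have E : (fun h : R => h^-1 *: (((fun y => a (y + w)) \o shift z) (h *: v) - a (z + w))) =
    (fun h : R => h^-1 *: ((a \o shift (z + w)) (h *: v) - a (z + w))).
  by apply/funext => h /=; rewrite addrA.
by split; [rewrite /derivable E|rewrite -d2 /derive E].
Qed.

Lemma difs_is_derive a i ws z : smooth a -> is_derive z (e_ i) (difs ws a) (difs ws (partial i a) z).
Proof.
move=> sa; elim: ws z => [|w ws IH] z /=.
  by split; [exact: (sa [::]).2|].
exact: is_deriveB (is_derive_shift (IH (z + w))) (IH z).
Qed.

(** The path from z to z + v changes one coordinate at a time, since only partial derivatives are at
    hand. Its points z + u have every coordinate of u bounded by that of v. *)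
Lemma path_mean_value (D : 'rV[R]_n -> R) (D' : 'I_n -> 'rV[R]_n -> R) (v z : 'rV[R]_n) (B : R) : (forall y i, is_derive y (e_ i) D (D' i y)) ->
  (forall (u : 'rV[R]_n) i, (forall k, `|u ord0 k| <= `|v ord0 k|) -> `|D' i (z + u)| <= B) ->
  `|D (z + v) - D z| <= (\sum_i `|v ord0 i|) * B.
Proof.
move=> dD bD; pose p (r : seq 'I_n) : 'rV[R]_n := \row_k (if k \in r then v ord0 k else 0).
have step (r : seq 'I_n) : uniq r -> `|D (z + p r) - D z| <= (\sum_(i <- r) `|v ord0 i|) * B.
  elim: r => [_|i r IH /= /andP[ir ur]].
    rewrite big_nil mul0r (_ : p [::] = 0) ?addr0 ?subrr ?normr0//.
    by apply/rowP => k; rewrite !mxE.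
  have pE : z + p (i :: r) = z + p r + v ord0 i *: e_ i.
    apply/rowP => k; rewrite addr_delta_coord !mxE inE; case: eqP => [->|_] /=.
      by rewrite (negPf ir) addr0.
    by rewrite addr0.
  have dl (s : R) : is_derive s (1 : R) (fun s : R => D (z + p r + (v ord0 i * s) *: e_ i))
      (D' i (z + p r + (v ord0 i * s) *: e_ i) * v ord0 i).
    have dl1 (t : R) : is_derive t (1 : R) (fun t : R => D (z + p r + t *: e_ i)) (D' i (z + p r + t *: e_ i)).
      by have [d1 d2] := dD (z + p r + t *: e_ i) i; rewrite -d2; exact: is_derive_line.
    have dm : is_derive s (1 : R) (fun s : R => v ord0 i * s) (v ord0 i).
      by have := @is_deriveZ R R^o R^o id (v ord0 i) s 1 1 (is_derive_id s 1); rewrite /GRing.scale /= mulr1.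
    exact: (is_derive1_comp (dl1 _) dm).
  have [s hs sE] := @MVT _ _ _ 0 1 ltr01 (fun s _ => dl s)
    (derivable_within_continuous (fun s _ => @ex_derive _ _ _ _ _ _ _ (dl s))).
  move: sE; rewrite mulr1 mulr0 scale0r addr0 subr0 mulr1 -pE => sE.
  move: hs; rewrite in_itv /= => /andP[s0 s1].
  have b1 : `|D (z + p (i :: r)) - D (z + p r)| <= `|v ord0 i| * B.
    rewrite sE normrM mulrC ler_wpM2l// -addrA; apply: bD => k.
    rewrite addr_delta_coord mxE; case: eqP => [->|_] /=.
      by rewrite (negPf ir) add0r normrM (gtr0_norm s0) ler_piMr// ltW.
    by rewrite addr0; case: (k \in r); rewrite ?normr0.
  rewrite big_cons mulrDl (_ : D _ - D z = (D (z + p (i :: r)) - D (z + p r)) + (D (z + p r) - D z)); last by ring.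
  by apply: le_trans (ler_normD _ _) _; apply: lerD => //; exact: IH.
have := step (index_enum 'I_n) (index_enum_uniq _).
by rewrite (_ : p _ = v)//; apply/rowP => k; rewrite mxE mem_index_enum.
Qed.

Definition psymb (m : nat) a := smooth a /\
  forall s, exists B, forall z, `|partials s a z| <= B * (jb z ^+ (m + size s))^-1.

Lemma psymb_partial m a i : psymb m a -> psymb m.+1 (partial i a).
Proof.
move=> [sa ha]; have E s : partials s (partial i a) = partials (rcons s i) a by rewrite /partials foldr_rcons.
split; first by move=> s; rewrite E; exact: sa.
by move=> s; have [B HB] := ha (rcons s i); exists B => z; rewrite E addSnnS -(size_rcons s i).
Qed.

(** The outermost difference is bounded by partial derivatives at intermediate points z + u, and
    [jb_peetre] brings the weight back from z + u to z at the price of a power of [jb v]. *)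
Lemma psymb_difs k m a : psymb m a -> exists B K, 0 <= B /\ forall ws, size ws = k -> forall z,
  `|difs ws a z| <= B * (\prod_(w <- ws) jb w ^+ K) * (jb z ^+ (m + k))^-1.
Proof.
elim: k m a => [|k IH] m a pa.
  have [sa ha] := pa; have [B HB] := ha [::].
  exists (Num.max 0 B), 0%N; split; first by rewrite le_max lexx.
  move=> [|//] _ z; rewrite big_nil mulr1; apply: le_trans (HB z) _.
  by rewrite ler_wpM2r ?invr_ge0 ?exprn_ge0 ?(ltW (jb_gt0 _))// le_max lexx orbT.
have /choice[BK HBK] : forall i, exists BK : R * nat, 0 <= BK.1 /\ forall ws, size ws = k -> forall z,
   `|difs ws (partial i a) z| <= BK.1 * (\prod_(w <- ws) jb w ^+ BK.2) * (jb z ^+ (m.+1 + k))^-1.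
  by move=> i; have [B [K H]] := IH _ _ (psymb_partial i pa); exists (B, K).
pose B := \sum_i (BK i).1; pose K := (\sum_i (BK i).2)%N; pose M := (m.+1 + k)%N.
have B0 : 0 <= B by apply: sumr_ge0 => i _; exact: (HBK i).1.
(* K serves the other increments; M is the power of [jb v] lost in moving the weight, and the
   additional 1 bounds the sum of the |v_i|. *)
exists (n%:R * B), (K + M.+1)%N; split; first by rewrite mulr_ge0.
move=> [//|v ws] [sw] z; rewrite /= {1}/dif.
have pr_ge0 K' : 0 <= \prod_(w <- ws) jb w ^+ K'.
  by apply: prodr_ge0 => w _; rewrite exprn_ge0// ltW// jb_gt0.
pose P := \prod_(w <- ws) jb w ^+ K.
have leP K' : (K' <= K)%N -> \prod_(w <- ws) jb w ^+ K' <= P.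
  move=> kk; apply: ler_prod => w _; rewrite exprn_ge0 ?(ltW (jb_gt0 _))//=.
  by apply: ler_weXn2l => //; exact: jb_ge1.
have h := @path_mean_value (difs ws a) (fun i => difs ws (partial i a)) v z (B * P * (jb v ^+ M * (jb z ^+ M)^-1))
   (fun y i => difs_is_derive i ws y pa.1).
apply: le_trans (h _) _.
  move=> u i hu; have [b0 /(_ ws sw (z + u)) hb] := HBK i.
  apply: le_trans hb _; apply: ler_pM; first by rewrite mulr_ge0.
  - by rewrite invr_ge0 exprn_ge0// ltW// jb_gt0.
  - apply: ler_pM => //; first by rewrite /B (bigD1 i)//= lerDl sumr_ge0// => j _; exact: (HBK j).1.
    by apply: leP; rewrite /K (bigD1 i)//= leq_addr.
  rewrite -/M ler_pdivlMr ?exprn_gt0 ?jb_gt0// mulrC ler_pdivrMr ?exprn_gt0 ?jb_gt0// -exprMn.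
  apply: lerXn2r; rewrite ?nnegrE ?mulr_ge0 ?(ltW (jb_gt0 _))//.
  apply: le_trans (jb_peetre z u) _; rewrite mulrC ler_wpM2r ?(ltW (jb_gt0 _))// /jb lerD2l.
  exact: enorm_mono.
have sv : \sum_i `|v ord0 i| <= n%:R * jb v.
  have -> : n%:R * jb v = \sum_(i < n) jb v by rewrite sumr_const card_ord mulr_natl.
  by apply: ler_sum => i _; apply: le_trans (coord_le_enorm v i) _; rewrite lerDr.
have Q0 : 0 <= B * P * (jb v ^+ M * (jb z ^+ M)^-1).
  by rewrite !mulr_ge0 ?invr_ge0 ?exprn_ge0 ?(ltW (jb_gt0 _))// pr_ge0.
apply: le_trans (ler_wpM2r Q0 sv) _.
rewrite big_cons (_ : (m + k.+1)%N = M); last by rewrite /M addnS addSn.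
have -> : n%:R * jb v * (B * P * (jb v ^+ M * (jb z ^+ M)^-1)) = n%:R * B * (jb v ^+ M.+1 * P) * (jb z ^+ M)^-1.
  by rewrite exprS; ring.
apply: ler_wpM2r; first by rewrite invr_ge0 exprn_ge0// ltW// jb_gt0.
apply: ler_wpM2l; first by rewrite mulr_ge0.
apply: ler_pM; rewrite ?pr_ge0 ?exprn_ge0 ?(ltW (jb_gt0 _))//.
  by apply: ler_weXn2l; [exact: jb_ge1|exact: leq_addl].
apply: ler_prod => w _; rewrite exprn_ge0 ?(ltW (jb_gt0 _))//=.
by apply: ler_weXn2l; [exact: jb_ge1|exact: leq_addr].
Qed.

Lemma continuous_bounded_ball D (r : R) : continuous D -> exists2 B, 0 <= B & forall z, enorm z <= r -> `|D z| <= B.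
Proof.
move=> cD; pose S : set 'rV[R]_n := [set z | forall i, `[- r, r]%classic (z ord0 i)].
have cS : compact S by apply: (@rV_compact _ n (fun=> `[-r, r]%classic)) => i; exact: segment_compact.
have [M [Mr HM]] := compact_bounded (continuous_compact (continuous_subspaceT cD) cS).
exists (Num.max 0 (M + 1)); first by rewrite le_max lexx.
move=> z zr; rewrite le_max; apply/orP; right; apply: (HM (M + 1)); first by rewrite ltrDl.
exists z => // i; rewrite /= in_itv /= -ler_norml.
exact: le_trans (coord_le_enorm z i) zr.
Qed.

(** Derivatives of order k are homogeneous of degree -k. The strict inequality makes the domain
    open, so that the identity can be differentiated again. *)
Lemma homogeneous_partials a (eps : R) : smooth a -> (forall (l : R) z, 1 <= l -> eps <= enorm z -> a (l *: z) = a z) ->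
  forall s (l : R) z, 1 <= l -> eps < enorm z -> l ^+ size s * partials s a (l *: z) = partials s a z.
Proof.
move=> sa ha; elim=> [|i s IH] l z l1 ez; first by rewrite /= expr0 mul1r ha// ltW.
pose D := partials s a; rewrite /= /partial -/D.
have op : \forall y \near z, l ^+ size s * D (l *: y) = D y.
  have : \forall y \near z, eps < enorm y.
    have := @enorm_continuous R n z; move=> /cvgr_gt /(_ _ ez); exact.
  by apply: filterS => y; exact: IH.
have dD : is_derive z (e_ i) (fun y => l ^+ size s * D (l *: y)) (l ^+ size s * ('D_(e_ i) D (l *: z) * l)).
  apply: is_derive_row.
  have dl1 (t : R) : is_derive t (1 : R) (fun t : R => D (l *: z + t *: e_ i)) ('D_(e_ i) D (l *: z + t *: e_ i)).
    by apply: is_derive_line; exact: (sa s).2.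
  have dm : is_derive (0 : R) (1 : R) (fun s : R => l * s) l.
    by have := @is_deriveZ R R^o R^o id l 0 1 1 (is_derive_id (0 : R^o) (1 : R^o)); rewrite /GRing.scale /= mulr1.
  have := is_derive1_comp (dl1 (l * 0)) dm; rewrite mulr0 scale0r addr0 => H.
  have H2 := @is_deriveZ R R^o R^o _ (l ^+ size s) _ _ _ H.
  rewrite (_ : (fun t : R => _) = l ^+ size s \*: ((fun t : R => D (l *: z + t *: e_ i)) \o (fun s : R => l * s)))//.
  by apply/funext => t /=; rewrite scalerDr scalerA.
have [d1 d2] := dD; rewrite -(near_eq_derive _ op) // d2 exprS; ring.
Qed.

(** Inside the ball of radius r the derivatives are bounded by compactness. Outside, homogeneity
    reduces to the sphere of radius r, with a factor (r / |z|)^k that is the required decay. *)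
Lemma homogeneous_psymb a (eps r : R) : 0 < eps -> eps < r -> smooth a ->
  (forall (l : R) z, 1 <= l -> eps <= enorm z -> a (l *: z) = a z) -> psymb 0 a.
Proof.
move=> e0 er sa ha; split => // s; have r0 : 0 < r := lt_trans e0 er.
have [B B0 HB] := continuous_bounded_ball r (sa s).1.
exists (B * (1 + r) ^+ size s) => z; rewrite add0n.
have jp := exprn_gt0 (size s) (jb_gt0 z).
rewrite ler_pdivlMr//.
have [zr|rz] := leP (enorm z) r.
  apply: ler_pM => //; [exact: ltW|exact: HB|].
  by apply: lerXn2r; rewrite ?nnegrE ?(ltW (jb_gt0 _)) ?addr_ge0 ?(ltW r0)// /jb lerD2l.
have z0 : 0 < enorm z := lt_trans r0 rz.
pose y := (r / enorm z) *: z; have ye : enorm y = r.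
  by rewrite enormZ gtr0_norm ?divr_gt0// divfK// lt0r_neq0.
have zE : z = (enorm z / r) *: y.
  by rewrite /y scalerA mulrA divfK ?lt0r_neq0// divff ?lt0r_neq0// scale1r.
have l1 : 1 <= enorm z / r by rewrite ler_pdivlMr// mul1r ltW.
have := homogeneous_partials sa ha s l1 (_ : eps < enorm y); rewrite ye -zE => /(_ er) H.
have l0 : 0 < enorm z / r by rewrite divr_gt0.
have -> : partials s a z = (r / enorm z) ^+ size s * partials s a y.
  rewrite -H mulrA -exprMn (_ : r / enorm z * (enorm z / r) = 1) ?expr1n ?mul1r//.
  by field; rewrite !lt0r_neq0.
rewrite normrM ger0_norm ?exprn_ge0 ?divr_ge0 ?(ltW r0) ?(ltW z0)// mulrAC -exprMn mulrC.
apply: ler_pM => //.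
- by rewrite exprn_ge0// mulr_ge0 ?(ltW (jb_gt0 _))// divr_ge0// ltW.
- by apply: HB; rewrite ye.
have q0 : 0 <= r / enorm z by rewrite divr_ge0// ltW.
have p0 : 0 <= r / enorm z * jb z by rewrite mulr_ge0// ltW// jb_gt0.
apply: lerXn2r; rewrite ?nnegrE ?addr_ge0 ?(ltW r0)//.
rewrite /jb mulrDr mulr1 divfK ?lt0r_neq0// lerD2r ler_pdivrMr// mul1r.
exact: ltW.
Qed.
End homogeneous.

Lemma symbol_S11_symb (R : realType) (d : nat) (A : 'rV[R]_(d + d) -> R[i]) : symbol_S11 A -> symb 0 A.
Proof.
move=> [[sr si] [eps [e0 e2 hA]]].
have pr : psymb 0 (fun x => complex.Re (A x)) by apply: (homogeneous_psymb e0 e2) => // l z l1 ez; rewrite hA.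
have pi_ : psymb 0 (fun x => complex.Im (A x)) by apply: (homogeneous_psymb e0 e2) => // l z l1 ez; rewrite hA.
split; first by split; [exact: continuous_row_measurable (sr [::]).1|exact: continuous_row_measurable (si [::]).1].
move=> k; have [B1 [K1 [b1 H1]]] := psymb_difs k pr; have [B2 [K2 [b2 H2]]] := psymb_difs k pi_.
have dRe ws z : complex.Re (difs ws A z) = difs ws (fun x => complex.Re (A x)) z.
  by elim: ws z => [//|w ws IH] z /=; rewrite /dif ReD ReN !IH.
have dIm ws z : complex.Im (difs ws A z) = difs ws (fun x => complex.Im (A x)) z.
  by elim: ws z => [//|w ws IH] z /=; rewrite /dif ImD ImN !IH.
exists (B1 + B2), (K1 + K2)%N => ws sw z.
apply: le_trans (normc_le_ReIm _) _; rewrite dRe dIm; apply: le_trans (lerD (H1 ws sw z) (H2 ws sw z)) _.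
rewrite -!mulrDl; apply: ler_wpM2r; first by rewrite invr_ge0 exprn_ge0// ltW// jb_gt0.
have leP K : (K <= K1 + K2)%N -> \prod_(w <- ws) jb w ^+ K <= \prod_(w <- ws) jb w ^+ (K1 + K2).
  move=> kk; apply: ler_prod => w _; rewrite exprn_ge0 ?(ltW (jb_gt0 _))//=.
  by apply: ler_weXn2l => //; exact: jb_ge1.
by rewrite mulrDl; apply: lerD; apply: ler_wpM2l => //; apply: leP; [exact: leq_addr|exact: leq_addl].
Qed.

(** * Weyl quantization in the Hermite basis *)

Section parametric_integral.
Context d1 d2 (T1 : measurableType d1) (T2 : measurableType d2) {R : realType}.
Variables (m2 : {sigma_finite_measure set T2 -> \bar R}).
Local Notation C := R[i].

(** Tonelli's theorem for the positive and negative parts; no integrability is involved, as [fine]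
    is measurable on all extended reals. *)
Lemma measurable_Rint (f : T1 * T2 -> R) : measurable_fun setT f ->
  measurable_fun setT (fun x => \int[m2]_y f (x, y)).
Proof.
move=> mf; have mE : measurable_fun setT (EFin \o f) by exact/measurable_EFinP.
have mp : measurable_fun setT (fun x => \int[m2]_y ((EFin \o f)^\+ (x, y)))%E.
  by apply: measurable_fun_fubini_tonelli_F; [exact: measurable_funepos|move=> z; exact: funepos_ge0].
have mn : measurable_fun setT (fun x => \int[m2]_y ((EFin \o f)^\- (x, y)))%E.
  by apply: measurable_fun_fubini_tonelli_F; [exact: measurable_funeneg|move=> z; exact: funeneg_ge0].
rewrite (_ : (fun x => _) = fine \o (fun x => \int[m2]_y ((EFin \o f)^\+ (x, y)) - \int[m2]_y ((EFin \o f)^\- (x, y)))%E).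
  by apply: measurableT_comp => //; exact: emeasurable_funB.
by apply/funext => x; rewrite /Rintegral [in LHS]integralE /=; congr (fine (_ - _)%E); apply: eq_integral => y _; rewrite ?funeposE ?funenegE.
Qed.

Lemma cmeas_cint (f : T1 * T2 -> C) : cmeas f -> cmeas (fun x => cint m2 (fun y => f (x, y))).
Proof.
move=> [mr mi]; split; first exact: (@measurable_Rint (fun z => complex.Re (f z)) mr).
exact: (@measurable_Rint (fun z => complex.Im (f z)) mi).
Qed.
End parametric_integral.

(** * Bessel's inequality *)

Section bessel_inequality.
Context d (T : measurableType d) {R : realType} (mu : {measure set T -> \bar R}).
Local Notation C := R[i].
Variables (I : finType) (u : I -> T -> C) (f : T -> C).
Hypotheses (mu_ : forall i, cmeas (u i)) (mf : cmeas f).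
Hypothesis (ou : forall i j, cintg mu (fun x => u i x * conjc (u j x)) /\
  cint mu (fun x => u i x * conjc (u j x)) = (i == j)%:R).
Hypothesis (f2 : rintg mu (fun x => normc (f x) ^+ 2)).

Let u2 i : rintg mu (fun x => normc (u i x) ^+ 2).
Proof. by have [[+ _] _] := ou i i; apply: eq_rintg => x; rewrite mulcJ. Qed.

Lemma cintg_fconj i : cintg mu (fun x => f x * conjc (u i x)).
Proof.
apply: (cintg_le _ (rintgD f2 (u2 i))).
  by apply: cmeasM => //; exact: cmeas_conj.
move=> x; rewrite Normc.normcM normc_conj; have := sqr_ge0 (normc (f x) - normc (u i x)).
have := normc_ge0 (f x); have := normc_ge0 (u i x); nra.
Qed.

(** The integral of |f - sum c_i u_i|^2 is nonnegative; the two cross terms and the double sum each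
    integrate to the sum of the |c_i|^2. *)
Lemma bessel : \sum_i normc (cint mu (fun x => f x * conjc (u i x))) ^+ 2 <= \int[mu]_x (normc (f x) ^+ 2).
Proof.
have [c cE] : {c | forall i, cint mu (fun x => f x * conjc (u i x)) = c i} by eexists.
have fc := cintg_fconj.
rewrite (eq_bigr (fun i => normc (c i) ^+ 2)) => [|i _]; last by rewrite cE.
have iF : cintg mu (fun x => (normc (f x) ^+ 2)%:C) := cintg_real f2.
have i1 : cintg mu (fun x => \sum_i conjc (c i) * (f x * conjc (u i x))).
  by apply: cintg_sum => i _; exact: (cintgZ (conjc (c i)) (fc i)).
have i2 : cintg mu (fun x => \sum_i c i * conjc (f x * conjc (u i x))).
  by apply: cintg_sum => i _; exact: (cintgZ (c i) (cintg_conj (fc i))).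
have i3 : cintg mu (fun x => \sum_i \sum_j (c i * conjc (c j)) * (u i x * conjc (u j x))).
  by apply: cintg_sum => i _; apply: cintg_sum => j _; apply: cintgZ; exact: (ou i j).1.
have E x : (normc (f x - \sum_i c i * u i x) ^+ 2)%:C =
    (((normc (f x) ^+ 2)%:C - \sum_i conjc (c i) * (f x * conjc (u i x))) -
     \sum_i c i * conjc (f x * conjc (u i x))) +
    \sum_i \sum_j (c i * conjc (c j)) * (u i x * conjc (u j x)).
  rewrite -mulcJ conjcB conjc_sum -mulcJ mulrBl !mulrBr opprB addrA [RHS]addrAC; congr (_ - _ + _ - _).
  - by rewrite big_distrr /=; apply: eq_bigr => i _; rewrite conjcM mulrCA.
  - rewrite big_distrl /=; apply: eq_bigr => i _; rewrite big_distrr /=; apply: eq_bigr => j _.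
    by rewrite conjcM; ring.
  - by rewrite big_distrl /=; apply: eq_bigr => i _; rewrite conjcM conjcK; ring.
have S1 : cint mu (fun x => \sum_i conjc (c i) * (f x * conjc (u i x))) = \sum_i (normc (c i) ^+ 2)%:C.
  rewrite (@cint_sum _ _ R mu _ (index_enum I) xpredT _ (fun i _ => cintgZ (conjc (c i)) (fc i))).
  by apply: eq_bigr => i _; rewrite cintZ// cE -mulcJ mulrC.
have S2 : cint mu (fun x => \sum_i c i * conjc (f x * conjc (u i x))) = \sum_i (normc (c i) ^+ 2)%:C.
  rewrite (@cint_sum _ _ R mu _ (index_enum I) xpredT _ (fun i _ => cintgZ (c i) (cintg_conj (fc i)))).
  by apply: eq_bigr => i _; rewrite cintZ ?cint_conj//; [rewrite cE -mulcJ|exact: cintg_conj].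
have S3 : cint mu (fun x => \sum_i \sum_j (c i * conjc (c j)) * (u i x * conjc (u j x))) = \sum_i (normc (c i) ^+ 2)%:C.
  rewrite (@cint_sum _ _ R mu _ (index_enum I) xpredT (fun i x => \sum_j (c i * conjc (c j)) * (u i x * conjc (u j x)))); last first.
    by move=> i _; apply: cintg_sum => j _; apply: cintgZ; exact: (ou i j).1.
  apply: eq_bigr => i _.
  rewrite (@cint_sum _ _ R mu _ (index_enum I) xpredT _ (fun j _ => cintgZ (c i * conjc (c j)) (ou i j).1)).
  rewrite (eq_bigr (fun j => c i * conjc (c j) * (i == j)%:R)) => [|j _]; last first.
    by rewrite (cintZ _ (ou i j).1) (ou i j).2.
  rewrite (bigD1 i)//= big1 => [|j ji]; first by rewrite eqxx addr0 mulr1 mulcJ.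
  by rewrite eq_sym (negPf ji) mulr0.
have iT := cintgD (cintgB (cintgB iF i1) i2) i3.
have := cintD (cintgB (cintgB iF i1) i2) i3.
rewrite (cintB (cintgB iF i1) i2) (cintB iF i1) S1 S2 S3 subrK cint_real -rmorph_sum -rmorphB.
rewrite -(eq_cint mu E) cint_real => /complexI H.
rewrite -subr_ge0 -H; apply: Rintegral_ge0 => x _; exact: sqr_ge0.
Qed.
End bessel_inequality.

(** * Gaussian Weyl symbols on the line *)

Section wave_packets.
Context {R : realType}.
Local Notation C := R[i].
Local Notation lam := (@lebesgue_measure R).
Local Notation toC := (map_poly (real_complex R)).

(** The y-integrand, at frequency zeta, of the Weyl transform of the n-th Hermite function for the
    symbol exp(- (q - p)^2) of the position q alone. *)
Definition wavef n (x zeta p y : R) : C :=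
  (expR (- ((x + y) / 2 - p) ^+ 2) * hfun n y)%:C * cexpi ((x - y) * zeta).
Definition wave n (x zeta p : R) : C := cint lam (fun y => wavef n x zeta p y).

Lemma expRN_sqr_le1 (t : R) : expR (- t ^+ 2) <= 1.
Proof. by rewrite -[leRHS]expR0 ler_expR oppr_le0 sqr_ge0. Qed.

Lemma measurable_wavef d (T : measurableType d) n (x zeta p y : T -> R) :
  measurable_fun setT x -> measurable_fun setT zeta -> measurable_fun setT p -> measurable_fun setT y ->
  cmeas (fun t => wavef n (x t) (zeta t) (p t) (y t)).
Proof.
move=> mx mz mp my; apply: cmeasM.
  apply: cmeas_real; apply: measurable_funM.
    apply: measurableT_comp => //; apply: measurableT_comp => //; apply: measurable_funX.
    apply: measurable_funB => //; apply: measurable_funM => //; exact: measurable_funD.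
  exact: measurableT_comp (measurable_hfun n) my.
by apply: cmeas_cexpi; apply: measurable_funM => //; exact: measurable_funB.
Qed.

Lemma normc_wavef_le n : exists2 M, 0 <= M & forall x zeta p y, normc (wavef n x zeta p y) <= M * wt y.
Proof.
have [M M0 HM] := hfun_wt (R := R) n; exists M => // x zeta p y.
rewrite /wavef Normc.normcM normc_cexpi mulr1 normcR normrM (ger0_norm (expR_ge0 _)).
apply: le_trans (HM y); rewrite ler_piMl//; exact: expRN_sqr_le1.
Qed.

Lemma cintg_wavef n x zeta p : @cintg _ (measurableTypeR R) R lam (fun y => wavef n x zeta p y).
Proof.
have [M M0 HM] := normc_wavef_le n.
apply: (cintg_le _ (rintgZ M (rintg_wt))); last by move=> y; exact: HM.
by apply: measurable_wavef => //; exact: measurable_cst.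
Qed.

Lemma measurable_wave d (T : measurableType d) n (x zeta p : T -> R) :
  measurable_fun setT x -> measurable_fun setT zeta -> measurable_fun setT p ->
  cmeas (fun t => wave n (x t) (zeta t) (p t)).
Proof.
move=> mx mz mp.
have := @cmeas_cint _ _ T (measurableTypeR R) R lam (fun z => wavef n (x z.1) (zeta z.1) (p z.1) z.2); apply.
by apply: measurable_wavef => //; exact: measurableT_comp _ measurable_fst.
Qed.

Section decay.
Variable br : R.
(** Differentiation of P times exp(- 3 y^2 / 4 + br y). The coefficient 3/4 is 1/4 + 1/2, from the
    gaussian at the midpoint (x + y) / 2 and from the Hermite function. *)
Let L (P : {poly C}) : {poly C} := P^`() + (br%:C%:P - (2 * (3 / 4))%:C *: 'X) * P.

(** One integration by parts shows that L acts under the integral as multiplication by i zeta;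
    applying it twice gives - zeta^2. *)
Lemma gauss_twisted_ibp (P : {poly C}) (zeta : R) (b := (br +i* (- zeta))%C) :
  (1 + zeta ^+ 2)%:C * cint lam (fun y => P.[y%:C] * cgauss (3 / 4) b y) =
  cint lam (fun y => (P - L (L P)).[y%:C] * cgauss (3 / 4) b y).
Proof.
have a0 : 0 < 3 / 4 :> R by rewrite divr_gt0.
have iP Q := cintg_poly_cgauss a0 Q b.
have step Q : cint lam (fun y => (L Q).[y%:C] * cgauss (3 / 4) b y) =
    (0 +i* zeta)%C * cint lam (fun y => Q.[y%:C] * cgauss (3 / 4) b y).
  have := cint_deriv_poly_cgauss a0 Q b.
  have -> : Q^`() + (b%:P - (2 * (3 / 4))%:C *: 'X) * Q = L Q - (0 +i* zeta)%C *: Q.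
    have -> : b = br%:C - (0 +i* zeta)%C by apply: complex_eqP; rewrite /= ?subr0 ?sub0r.
    by rewrite /L -!mul_polyC polyCB; ring.
  rewrite -(eq_cint lam (_ : forall y, (L Q).[y%:C] * cgauss (3 / 4) b y - (0 +i* zeta)%C * (Q.[y%:C] * cgauss (3 / 4) b y) = _)); last first.
    by move=> y; rewrite (hornerD (L Q)) hornerN hornerZ; ring.
  by rewrite (cintB (iP _) (cintgZ _ (iP _))) (cintZ _ (iP _)) => /eqP; rewrite subr_eq0 => /eqP.
have E y : (P - L (L P)).[y%:C] * cgauss (3 / 4) b y = P.[y%:C] * cgauss (3 / 4) b y - (L (L P)).[y%:C] * cgauss (3 / 4) b y.
  by rewrite (hornerD P) hornerN; ring.
rewrite (eq_cint lam E).
rewrite (cintB (iP _) (iP _)) !step mulrA -[X in X - _]mul1r -mulrBl; congr (_ * _).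
by apply: complex_eqP; rewrite ?ReD ?ImD ?ReN ?ImN ?ReM ?ImM /=; ring.
Qed.

(** The dependence on the drift [br] is kept explicit because in [wave_le] it is p - x/2, which is
    unbounded; its quadratic growth is absorbed there by a gaussian. *)
Lemma twisted_ibp_le (P : {poly C}) (y : R) :
  normc (P - L (L P)).[y%:C] <= 8 * (1 + br ^+ 2) *
    (normc (((4 *: (1 + 'X^2)) * P).[y%:C]) + normc (((4 *: (1 + 'X^2)) * P^`()).[y%:C]) + normc (((4 *: (1 + 'X^2)) * P^`()^`()).[y%:C])).
Proof.
pose t : C := (br - 3 / 2 * y)%:C.
have -> : (P - L (L P)).[y%:C] = P.[y%:C] - (P^`()^`().[y%:C] + 2%:C * (t * P^`().[y%:C]) - (3 / 2)%:C * P.[y%:C] + t * t * P.[y%:C]).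
  rewrite /L !(derivD, derivM, derivN, derivC, derivZ, derivX) !hornerE /t.
  rewrite rmorphB !rmorphM /=.
  rewrite !fmorphV !rmorph_nat.
  by field.
have q0 : normc (4 *: (1 + 'X^2) : {poly C}).[y%:C] = 4 + 4 * y ^+ 2.
  have -> : (4 *: (1 + 'X^2) : {poly C}).[y%:C] = (4 * (1 + y ^+ 2))%:C.
    have -> : (4 * (1 + y ^+ 2))%:C = 4 * (1 + y%:C ^+ 2) :> C.
      by rewrite !(rmorphM, rmorphD, rmorph1, rmorph_nat, expr2).
    by rewrite !hornerE ?expr2.
  by rewrite normcR ger0_norm ?mulrDr ?mulr1// addr_ge0// mulr_ge0// sqr_ge0.
rewrite !hornerM !Normc.normcM q0.
have n1 := normc_ge0 P.[y%:C]; have n2 := normc_ge0 P^`().[y%:C]; have n3 := normc_ge0 P^`()^`().[y%:C].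
have nt : normc t <= `|br| + 3 / 2 * `|y|.
  rewrite normcR; apply: le_trans (ler_normB _ _) _; rewrite normrM (ger0_norm (_ : 0 <= 3 / 2))//.
have h : normc (P.[y%:C] - (P^`()^`().[y%:C] + 2%:C * (t * P^`().[y%:C]) - (3 / 2)%:C * P.[y%:C] + t * t * P.[y%:C])) <=
   normc P.[y%:C] + (normc P^`()^`().[y%:C] + 2 * (normc t * normc P^`().[y%:C]) + 3 / 2 * normc P.[y%:C] + normc t * normc t * normc P.[y%:C]).
  apply: le_trans (normcB_le _ _) _; rewrite lerD2l.
  apply: le_trans (normcD_le _ _) _; rewrite !Normc.normcM lerD2r.
  apply: le_trans (normcB_le _ _) _; rewrite !Normc.normcM normcR ger0_norm// lerD2r.
  by apply: le_trans (normcD_le _ _) _; rewrite !Normc.normcM normcR ger0_norm.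
apply: le_trans h _.
have t0 := normc_ge0 t; have b2 : `|br| ^+ 2 = br ^+ 2 by rewrite real_normK ?num_real.
have y2 : `|y| ^+ 2 = y ^+ 2 by rewrite real_normK ?num_real.
rewrite -b2 -y2; move: nt t0 n1 n2 n3 (normr_ge0 br) (normr_ge0 y).
move: (normc t) (normc P.[y%:C]) (normc P^`().[y%:C]) (normc P^`()^`().[y%:C]) `|br| `|y| => s A B D b v.
move=> st s0 A0 B0 D0 b0 v0.
have s2 : s ^+ 2 <= 5 * (1 + b ^+ 2) * (1 + v ^+ 2).
  have : s ^+ 2 <= (b + 3 / 2 * v) ^+ 2 by rewrite lerXn2r ?nnegrE ?addr_ge0 ?mulr_ge0.
  have := sqr_ge0 (b - 3 / 2 * v); have : 0 <= b ^+ 2 * v ^+ 2 by rewrite mulr_ge0 ?sqr_ge0.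
  have := sqr_ge0 v; have := sqr_ge0 b; lra.
have q1 : 1 <= (1 + b ^+ 2) * (1 + v ^+ 2).
  have : 0 <= b ^+ 2 * v ^+ 2 by rewrite mulr_ge0 ?sqr_ge0.
  have := sqr_ge0 v; have := sqr_ge0 b; lra.
have -> : 8 * (1 + b ^+ 2) * ((4 + 4 * v ^+ 2) * A + (4 + 4 * v ^+ 2) * B + (4 + 4 * v ^+ 2) * D) =
  32 * ((1 + b ^+ 2) * (1 + v ^+ 2)) * (A + B + D) by ring.
move: s2; rewrite -mulrA; move: ((1 + b ^+ 2) * (1 + v ^+ 2)) q1 => q q1 s2.
have h1 : A + (D + 2 * (s * B) + 3 / 2 * A + s * s * A) <= (4 + s ^+ 2) * (A + B + D).
  have : 0 <= (s - 1) ^+ 2 * B by rewrite mulr_ge0// sqr_ge0.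
  have : 0 <= s ^+ 2 * D by rewrite mulr_ge0// sqr_ge0.
  lra.
apply: le_trans h1 _; apply: ler_wpM2r; [by rewrite !addr_ge0|lra].
Qed.
End decay.

Lemma wave_exponent (v y : R) : - v ^+ 2 + (- (3 / 4 * y ^+ 2) + - v * y) <= - (v ^+ 2 / 2) + - (4^-1 * y ^+ 2) :> R.
Proof. have := sqr_ge0 (v + y); lra. Qed.

Lemma sqr_expR_le (v : R) : (1 + v ^+ 2) * expR (- (v ^+ 2 / 2)) <= 4 * expR (- (v ^+ 2 / 4)).
Proof.
have -> : - (v ^+ 2 / 2) = - (v ^+ 2 / 4) + - (v ^+ 2 / 4) by field.
rewrite expRD mulrA ler_wpM2r ?expR_ge0//.
rewrite [X in _ * X]expRN -ler_pdivlMr ?invr_gt0 ?expR_gt0// invrK.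
have := expR_ge1Dx (v ^+ 2 / 4); have := sqr_ge0 v; lra.
Qed.

(** With v = x/2 - p, the decay in zeta comes from the two integrations by parts, and the decay in v
    from the bound of the quadratic exponent in v and y by - v^2/2 - y^2/4, half of which pays for 1
    + v^2. *)
Lemma wave_le n : exists2 M, 0 <= M & forall x zeta p,
  normc (wave n x zeta p) <= M * wt zeta * expR (- ((x / 2 - p) ^+ 2 / 4)).
Proof.
pose P : {poly C} := toC (herm n).
have c4 : 0 < 4^-1 :> R by rewrite invr_gt0.
have [M1 M10 H1] := poly_gauss_bounded ((4 *: (1 + 'X^2)) * P) 0 c4.
have [M2 M20 H2] := poly_gauss_bounded ((4 *: (1 + 'X^2)) * P^`()) 0 c4.
have [M3 M30 H3] := poly_gauss_bounded ((4 *: (1 + 'X^2)) * P^`()^`()) 0 c4.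
pose k : R := (Num.sqrt (hcst n))^-1.
have k0 : 0 <= k by rewrite invr_ge0 sqrtr_ge0.
pose W : R := \int[lam]_y (wt y).
have W0 : 0 <= W by apply: Rintegral_ge0 => y _; exact: wt_ge0.
pose M := M1 + M2 + M3.
have M0 : 0 <= M by rewrite !addr_ge0.
exists (k * 32 * M * W); first by rewrite !mulr_ge0.
move=> x zeta p; pose v := x / 2 - p; pose b := ((- v) +i* (- zeta))%C.
pose c0 : C := (k * expR (- v ^+ 2))%:C * cexpi (x * zeta).
have E y : wavef n x zeta p y = c0 * (P.[y%:C] * cgauss (3 / 4) b y).
  rewrite /wavef /c0 /cgauss /P hornerC_map /hfun -/k /=.
  rewrite (_ : (x - y) * zeta = x * zeta + - zeta * y); last by ring.
  rewrite cexpiD (_ : expR (- ((x + y) / 2 - p) ^+ 2) * _ = k * expR (- v ^+ 2) * ((herm n).[y] * expR (- (3 / 4 * y ^+ 2) + - v * y))); last first.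
    rewrite (_ : - ((x + y) / 2 - p) ^+ 2 = - v ^+ 2 + (- (3 / 4 * y ^+ 2) + - v * y) + y ^+ 2 / 2); last by rewrite /v; field.
    rewrite expRD [X in X * _ = _]mulrC expRD (expRN (y ^+ 2 / 2)); have := expR_gt0 (y ^+ 2 / 2).
    by move=> h; field; rewrite lt0r_neq0.
  by rewrite !rmorphM; ring.
have a0 : 0 < 3 / 4 :> R by rewrite divr_gt0.
rewrite /wave (eq_cint lam E) (cintZ _ (cintg_poly_cgauss a0 P b)).
have z0 : 0 < 1 + zeta ^+ 2 := oneDsqr_gt0 zeta.
have G := gauss_twisted_ibp (- v) P zeta.
have key : normc (cint lam (fun y => P.[y%:C] * cgauss (3 / 4) b y)) * (1 + zeta ^+ 2) <=
    (8 * (1 + v ^+ 2) * M * expR (v ^+ 2 / 2)) * W.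
  have -> : normc (cint lam (fun y => P.[y%:C] * cgauss (3 / 4) b y)) * (1 + zeta ^+ 2) =
     normc ((1 + zeta ^+ 2)%:C * cint lam (fun y => P.[y%:C] * cgauss (3 / 4) b y)).
    by rewrite Normc.normcM normcR gtr0_norm// mulrC.
  rewrite G; rewrite -(RintZ _ (rintg_wt)).
  apply: (normc_cint_le (cintg_poly_cgauss a0 _ b) (rintgZ _ (rintg_wt))) => y.
  rewrite Normc.normcM normc_cgauss /=.
  have T := twisted_ibp_le (- v) P y; rewrite sqrrN in T.
  have e1 : expR (- (3 / 4 * y ^+ 2) + - v * y) <= expR (v ^+ 2 / 2) * expR (- (4^-1 * y ^+ 2)).
    by rewrite -expRD ler_expR; have := wave_exponent v y; lra.
  apply: le_trans (ler_pM (normc_ge0 _) (expR_ge0 _) T e1) _.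
  have := H1 y; have := H2 y; have := H3 y; rewrite mul0r addr0.
  have := expR_ge0 (v ^+ 2 / 2); have : 0 <= 8 * (1 + v ^+ 2) by rewrite mulr_ge0// addr_ge0// sqr_ge0.
  move: (8 * (1 + v ^+ 2)) (expR (v ^+ 2 / 2)) (expR (- (4^-1 * y ^+ 2))) (wt y) (normc _) (normc _) (normc _).
  move=> q f g w A1 A2 A3 q0 f0 h3 h2 h1.
  have -> : q * (A1 + A2 + A3) * (f * g) = (q * f) * (A1 * g + A2 * g + A3 * g) by ring.
  have -> : q * M * f * w = (q * f) * (M1 * w + M2 * w + M3 * w) by rewrite /M; ring.
  by apply: ler_wpM2l; [exact: mulr_ge0|lra].
rewrite Normc.normcM /c0 Normc.normcM normc_cexpi mulr1 normcR ger0_norm ?mulr_ge0 ?expR_ge0//.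
rewrite -ler_pdivlMr// in key.
apply: le_trans (ler_wpM2l _ key) _; first by rewrite mulr_ge0 ?expR_ge0.
have s1 := sqr_expR_le v.
have e2 : expR (- v ^+ 2) * expR (v ^+ 2 / 2) = expR (- (v ^+ 2 / 2)) by rewrite -expRD; congr expR; field.
rewrite -/v /wt.
have -> : k * expR (- v ^+ 2) * (8 * (1 + v ^+ 2) * M * expR (v ^+ 2 / 2) * W / (1 + zeta ^+ 2)) =
   8 * k * M * W * (1 + zeta ^+ 2)^-1 * ((1 + v ^+ 2) * expR (- (v ^+ 2 / 2))) by rewrite -e2; ring.
have -> : k * 32 * M * W / (1 + zeta ^+ 2) * expR (- (v ^+ 2 / 4)) =
   8 * k * M * W * (1 + zeta ^+ 2)^-1 * (4 * expR (- (v ^+ 2 / 4))) by ring.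
by apply: ler_wpM2l => //; rewrite !mulr_ge0// invr_ge0 ltW.
Qed.

Lemma rintg_gauss_shift (q : R) : @rintg _ (measurableTypeR R) R lam (fun zeta => expR (- (zeta - q) ^+ 2)).
Proof.
have := mpres_rintg (lebesgue_addr (- q)) (rintg_gauss (@ltr01 R)).
by apply: eq_rintg => t; rewrite mul1r.
Qed.

Lemma cint_gauss_shift (q s : R) : cint lam (fun zeta => (expR (- (zeta - q) ^+ 2))%:C * cexpi (s * zeta)) =
  (Num.sqrt pi * expR (- (s ^+ 2 / 4)))%:C * cexpi (s * q).
Proof.
have i0 : @cintg _ (measurableTypeR R) R lam (fun x => (expR (- (1 * x ^+ 2)))%:C * cexpi (s * x)).
  apply: (cintg_le _ (rintg_gauss (@ltr01 R))).
    apply: cmeasM; first by apply: cmeas_real; exact: rintg_meas (rintg_gauss (@ltr01 R)).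
    by apply: cmeas_cexpi; exact: measurable_funM.
  by move=> x; rewrite Normc.normcM normcR normc_cexpi mulr1 ger0_norm ?expR_ge0.
have := cint_gauss_cexpi (@ltr01 R) s; rewrite divr1 mulr1 => <-.
rewrite (mpres_cint (lebesgue_addr (- q)) i0) mulrC -cintZ; last first.
  exact: (mpres_cintg (lebesgue_addr (- q)) i0).
apply: eq_cint => t; rewrite mul1r mulrCA -cexpiD; congr (_ * cexpi _); ring.
Qed.

(** In one dimension, the Weyl operator of a gaussian centered at (p, q) is the projection on the
    coherent state at (p, q). The factor 2 pi is the one that [weyl] divides by. *)
Lemma wave_coherent m n p q : let F x zeta := (hfun m x * (pi^-1 * expR (- (zeta - q) ^+ 2)))%:C * wave n x zeta p in
  cint lam (fun x => cint lam (fun zeta => F x zeta)) = (2 * pi)%:C * (psi1 m p q * conjc (psi1 n p q)).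
Proof.
move=> F; pose g x zeta := (expR (- (zeta - q) ^+ 2))%:C : C.
pose cst : R := pi^-1 * Num.sqrt pi.
have [M M0 HM] := normc_wavef_le n.
have mG : measurable_fun [set: measurableTypeR R] (fun zeta : R => expR (- (zeta - q) ^+ 2)) := rintg_meas (rintg_gauss_shift q).
have iC m' z : @cintg _ (measurableTypeR R) R lam (fun y => (expR (- ((p - y) ^+ 2 / 2)) * hfun m' y)%:C * cexpi (y * z)).
  have [M' M'0 HM'] := hfun_wt (R := R) m'.
  apply: (cintg_le _ (rintgZ M' (rintg_wt))).
    apply: cmeasM; last by apply: cmeas_cexpi; exact: measurable_funM.
    apply: cmeas_real; apply: measurable_funM; last exact: measurable_hfun.
    apply: measurableT_comp => //; apply: measurableT_comp => //; apply: measurable_funM => //.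
    by apply: measurable_funX; apply: measurable_funB.
  move=> y; rewrite Normc.normcM normc_cexpi mulr1 normcR normrM (ger0_norm (expR_ge0 _)).
  by apply: le_trans (HM' y); rewrite ler_piMl// -[leRHS]expR0 ler_expR oppr_le0 divr_ge0// sqr_ge0.
have [Zc ZE] : {Z : C | cint lam (fun y => (expR (- ((p - y) ^+ 2 / 2)) * hfun n y)%:C * cexpi (y * q)) = Z} by eexists.
have inner x : cint lam (fun zeta => F x zeta) =
    cst%:C * ((expR (- ((p - x) ^+ 2 / 2)) * hfun m x)%:C * cexpi (x * q)) *
    conjc Zc.
  have i2 : cintg (prodm lam lam) (fun z : measurableTypeR R * measurableTypeR R => (expR (- (z.1 - q) ^+ 2))%:C * wavef n x z.1 p z.2).
    apply: (cintg_le _ (rintgX (rintg_gauss_shift q) (rintgZ M (rintg_wt)))).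
      apply: cmeasM; first by apply: cmeas_real; exact: measurableT_comp mG measurable_fst.
      by apply: measurable_wavef => //; exact: measurable_cst.
    move=> z; rewrite Normc.normcM normcR (ger0_norm (expR_ge0 _)).
    by apply: ler_wpM2l; [exact: expR_ge0|exact: HM].
  have E1 zeta : F x zeta = (hfun m x * pi^-1)%:C * cint lam (fun y => (expR (- (zeta - q) ^+ 2))%:C * wavef n x zeta p y).
    by rewrite (cintZ _ (cintg_wavef _ _ _ _)) /F /wave !rmorphM; ring.
  have /= SW := cfubini_swap i2; rewrite (eq_cint lam E1) (cintZ _ (cfubini1 i2).1) SW.
  have E2 y : cint lam (fun zeta => (expR (- (zeta - q) ^+ 2))%:C * wavef n x zeta p y) =
     (Num.sqrt pi * expR (- ((p - x) ^+ 2 / 2)))%:C * cexpi (x * q) * conjc ((expR (- ((p - y) ^+ 2 / 2)) * hfun n y)%:C * cexpi (y * q)).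
    pose k : C := (expR (- ((x + y) / 2 - p) ^+ 2) * hfun n y)%:C.
    have E3 zeta : (expR (- (zeta - q) ^+ 2))%:C * wavef n x zeta p y = k * ((expR (- (zeta - q) ^+ 2))%:C * cexpi ((x - y) * zeta)).
      by rewrite /wavef -/k; ring.
    rewrite (eq_cint lam E3) cintZ; last first.
      apply: (cintg_le _ (rintg_gauss_shift q)).
        by apply: cmeasM; [exact: cmeas_real|apply: cmeas_cexpi; exact: measurable_funM].
      by move=> t; rewrite Normc.normcM normcR normc_cexpi mulr1 ger0_norm ?expR_ge0.
    rewrite cint_gauss_shift conjcM conjc_real -cexpiN (_ : (x - y) * q = x * q + - (y * q)); last by ring.
    rewrite cexpiD /k.
    (* The parallelogram identity separates x from y: this is where the variance of the gaussian has
       to match that of the coherent states. *)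
    have ee : expR (- ((x + y) / 2 - p) ^+ 2) * expR (- ((x - y) ^+ 2 / 4)) = expR (- ((p - x) ^+ 2 / 2)) * expR (- ((p - y) ^+ 2 / 2)).
      by rewrite -!expRD; congr expR; field.
    transitivity ((Num.sqrt pi * hfun n y * (expR (- ((x + y) / 2 - p) ^+ 2) * expR (- ((x - y) ^+ 2 / 4))))%:C * (cexpi (x * q) * cexpi (- (y * q)))).
      by rewrite !rmorphM; ring.
    by rewrite ee !rmorphM; ring.
  rewrite (eq_cint lam E2) cintZ; last exact: cintg_conj.
  rewrite (cint_conj (iC n q)) ZE /cst; move: (conjc Zc) (cexpi (x * q)) (expR _) (hfun m x) (Num.sqrt _) (pi^-1) => Z E0 a b c0 c1.
  by rewrite !rmorphM; ring.
rewrite (eq_cint lam inner) -ZE coherent_hfun.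
rewrite (eq_cint lam (_ : forall x, _ = (cst%:C * conjc ((Num.sqrt (2 * pi * Num.sqrt pi))%:C * psi1 n p q)) *
   ((expR (- ((p - x) ^+ 2 / 2)) * hfun m x)%:C * cexpi (x * q)))); last by move=> x; ring.
rewrite (cintZ _ (iC m q)) coherent_hfun conjcM conjc_real.
have sp : Num.sqrt pi * Num.sqrt pi = pi :> R by rewrite -expr2 sqr_sqrtr// pi_ge0.
have ss : Num.sqrt (2 * pi * Num.sqrt pi) * Num.sqrt (2 * pi * Num.sqrt pi) = 2 * pi * Num.sqrt pi :> R.
  by rewrite -expr2 sqr_sqrtr// !mulr_ge0 ?pi_ge0 ?sqrtr_ge0.
transitivity ((cst * (Num.sqrt (2 * pi * Num.sqrt pi) * Num.sqrt (2 * pi * Num.sqrt pi)))%:C * (psi1 m p q * conjc (psi1 n p q))).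
  by rewrite !rmorphM; ring.
rewrite ss; congr (_%:C * _); rewrite /cst.
have -> : pi^-1 * Num.sqrt pi * (2 * pi * Num.sqrt pi) = 2 * (Num.sqrt pi * Num.sqrt pi) * (pi^-1 * pi) :> R by ring.
by rewrite sp mulVf ?mulr1// lt0r_neq0// pi_gt0.
Qed.
End wave_packets.

(* The definitions of [cint] and of the modulus as pairs and square roots would otherwise be exposed by simplification. *)
Local Arguments cint : simpl never.
Local Arguments Normc.normc : simpl never.

(** * Weyl integrands in several variables *)

Section weyl_integrands.
Context {R : realType} {d : nat}.
Local Notation C := R[i].
Local Notation lr := (@lebesgue_row R d).
Local Notation lr2 := (@lebesgue_row R (d + d)).
Local Notation lam := (@lebesgue_measure R).
Implicit Types (al be : {ffun 'I_d -> nat}) (x xi y p : 'rV[R]_d) (w z : 'rV[R]_(d + d)).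

Definition weylf (A : 'rV[R]_(d + d) -> C) al x xi y : C :=
  cexpi (dotp (x - y) xi) * A (row_mx (2^-1 *: (x + y)) xi) * hermc al y.

Lemma rintg_hermd al : rintg lr (hermd (R := R) al).
Proof. exact: rintg_gpoly. Qed.

Lemma measurable_hermd al : measurable_fun setT (hermd (R := R) al).
Proof. exact: measurable_gpoly. Qed.

Lemma cmeas_weylf d0 (T : measurableType d0) A al (x xi y : T -> 'rV[R]_d) : cmeas A ->
  measurable_fun setT x -> measurable_fun setT xi -> measurable_fun setT y ->
  cmeas (fun t => weylf A al (x t) (xi t) (y t)).
Proof.
move=> mA mx mz my; apply: cmeasM; first apply: cmeasM.
- by apply: cmeas_cexpi; apply: meas_dotp => //; exact: meas_rowB.
- by apply: cmeas_comp => //; apply: meas_row_mx => //; apply: meas_rowZ; exact: meas_rowD.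
- by apply: cmeas_real; exact: measurableT_comp (measurable_hermd al) my.
Qed.

Lemma normc_weylf A al x xi y : normc (weylf A al x xi y) = normc (A (row_mx (2^-1 *: (x + y)) xi)) * `|hermd al y|.
Proof. by rewrite /weylf !Normc.normcM normc_cexpi mul1r normcR. Qed.

Lemma cintg_weylf A B al x xi : cmeas A -> (forall z, normc (A z) <= B) -> cintg lr (weylf A al x xi).
Proof.
move=> mA bA; apply: (cintg_le _ (rintgZ B (rintg_norm (rintg_hermd al)))).
  by apply: cmeas_weylf => //; exact: measurable_cst.
by move=> y; rewrite normc_weylf ler_wpM2r.
Qed.

Lemma cmeas_weyl_inner d0 (T : measurableType d0) A al (x xi : T -> 'rV[R]_d) : cmeas A ->
  measurable_fun setT x -> measurable_fun setT xi -> cmeas (fun t => cint lr (weylf A al (x t) (xi t))).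
Proof.
move=> mA mx mz; have := @cmeas_cint _ _ T 'rV[R]_d R lr (fun t => weylf A al (x t.1) (xi t.1) t.2).
by apply; apply: cmeas_weylf => //; exact: measurableT_comp _ measurable_fst.
Qed.

Lemma cmeas_weyl A al : cmeas A -> @cmeas _ 'rV[R]_d R (weyl A (hermc al)).
Proof.
move=> mA; apply: cmeasM; first exact: cmeas_cst.
have := @cmeas_cint _ _ 'rV[R]_d 'rV[R]_d R lr (fun t => cint lr (weylf A al t.1 t.2)).
by apply; exact: cmeas_weyl_inner.
Qed.

Definition waved al x xi p : C := \prod_i wave (al i) (x ord0 i) (xi ord0 i) (p ord0 i).
Definition psid al w : C := \prod_i psi1 (al i) (lsubmx w ord0 i) (rsubmx w ord0 i).

Lemma rgauss_le1 n (c : R) (v : 'rV[R]_n) : 0 <= c -> rgauss c v <= 1.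
Proof. by move=> c0; rewrite -[leRHS]expR0 ler_expR oppr_le0 mulr_ge0// dotp_ge0. Qed.

Lemma wavedE al x xi p : cint lr (fun y => (rgauss 1 (2^-1 *: (x + y) - p))%:C * cexpi (dotp (x - y) xi) * hermc al y) =
  waved al x xi p.
Proof.
rewrite /waved /wave; have [_ <-] := cint_row_prod (fun i => cintg_wavef (al i) (x ord0 i) (xi ord0 i) (p ord0 i)).
apply: eq_cint => y; rewrite /hermc hermdE rgaussE /dotp cexpi_sum !rmorph_prod -!big_split /=.
apply: eq_bigr => i _; rewrite /wavef; have -> : (2^-1 *: (x + y) - p) ord0 i = (x ord0 i + y ord0 i) / 2 - p ord0 i by rewrite !mxE mulrC.
have -> : (x - y) ord0 i = x ord0 i - y ord0 i by rewrite !mxE.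
by rewrite mul1r mulrAC -rmorphM.
Qed.

Lemma normc_waved_le al : exists2 M, 0 <= M & forall x xi p,
  normc (waved al x xi p) <= M * rwt xi * rgauss 4^-1 (2^-1 *: x - p).
Proof.
have /choice[M HM] : forall i, exists M, 0 <= M /\ forall x zeta p : R,
  normc (wave (al i) x zeta p) <= M * wt zeta * expR (- ((x / 2 - p) ^+ 2 / 4)).
  by move=> i; have [M M0 H] := wave_le (R := R) (al i); exists M.
exists (\prod_i M i); first by apply: prodr_ge0 => i _; exact: (HM i).1.
move=> x xi p; rewrite /waved normc_prod /rwt rgaussE -!big_split /=.
apply: ler_prod => i _; rewrite normc_ge0 /= !mxE (mulrC 2^-1) (mulrC 4^-1); exact: (HM i).2.
Qed.

Lemma cmeas_waved d0 (T : measurableType d0) al (x xi p : T -> 'rV[R]_d) :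
  measurable_fun setT x -> measurable_fun setT xi -> measurable_fun setT p ->
  cmeas (fun t => waved al (x t) (xi t) (p t)).
Proof.
move=> mx mz mp; apply: cmeas_prod => i _.
by apply: measurable_wave; exact: measurableT_comp (measurable_coord i) _.
Qed.

Lemma gden_row x xi w : gden (row_mx x xi - w) =
  (pi ^+ d)^-1 * (rgauss 1 (x - lsubmx w) * rgauss 1 (xi - rsubmx w)).
Proof.
rewrite /gden exprD -exprMn -expr2 sqr_sqrtr ?pi_ge0//; congr (_ * _).
rewrite !rgaussE big_split_ord /=; congr (_ * _); apply: eq_bigr => i _.
  by rewrite !mxE (unsplitK (inl _)).
by rewrite !mxE (unsplitK (inr _)).
Qed.

Lemma meas_lsubmx : measurable_fun setT (fun w => lsubmx w : 'rV[R]_d).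
Proof.
apply: measurable_rowP => i; rewrite (_ : (fun w => _) = (fun w => w ord0 (lshift d i))).
  exact: measurable_coord.
by apply/funext => w; rewrite mxE.
Qed.

Lemma meas_rsubmx : measurable_fun setT (fun w => rsubmx w : 'rV[R]_d).
Proof.
apply: measurable_rowP => i; rewrite (_ : (fun w => _) = (fun w => w ord0 (rshift d i))).
  exact: measurable_coord.
by apply/funext => w; rewrite mxE.
Qed.

(** A gaussian in w dominating the integrand of the averaged symbol; by translation invariance its
    mass [gKint] depends on neither x nor xi. *)
Definition gK x xi w : R := rgauss 4^-1 (2^-1 *: x - lsubmx w) * rgauss 1 (xi - rsubmx w).
Definition gKint : R := Num.sqrt (pi / 4^-1) ^+ d * Num.sqrt (pi / 1) ^+ d.

Lemma gK_int x xi : rintg lr2 (gK x xi) /\ \int[lr2]_w gK x xi w = gKint.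
Proof.
have c4 : 0 < 4^-1 :> R by rewrite invr_gt0.
have i1 := mpres_rintg (mpres_rowB (2^-1 *: x)) (rintg_rgauss d c4).
have i2 := mpres_rintg (mpres_rowB xi) (rintg_rgauss d (@ltr01 R)).
have i12 := rintgX i1 i2; have ms := @mpres_row_split R d d.
split; first exact: (mpres_rintg ms i12).
rewrite -(mpres_Rint ms i12) -(rfubini1 i12).2 /=.
rewrite (eq_Rint lr (_ : forall s, _ = Num.sqrt (pi / 1) ^+ d * rgauss 4^-1 (2^-1 *: x - s))).
  by rewrite (RintZ _ i1) -(mpres_Rint (mpres_rowB (2^-1 *: x)) (rintg_rgauss d c4)) (Rint_rgauss d c4) mulrC.
move=> s; rewrite (RintZ _ i2) -(mpres_Rint (mpres_rowB xi) (rintg_rgauss d (@ltr01 R))) (Rint_rgauss d (@ltr01 R)).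
by rewrite mulrC.
Qed.

Lemma measurable_gK d0 (T : measurableType d0) (x xi : T -> 'rV[R]_d) (w : T -> 'rV[R]_(d + d)) :
  measurable_fun setT x -> measurable_fun setT xi -> measurable_fun setT w ->
  measurable_fun setT (fun t => gK (x t) (xi t) (w t)).
Proof.
move=> mx mz mw; apply: measurable_funM.
  apply: (measurableT_comp (measurable_rgauss _)); apply: meas_rowB; first exact: meas_rowZ.
  exact: measurableT_comp meas_lsubmx mw.
apply: (measurableT_comp (measurable_rgauss _)); apply: meas_rowB => //.
exact: measurableT_comp meas_rsubmx mw.
Qed.

End weyl_integrands.

(** * Averaged symbols as anti-Wick operators *)

Section weyl_of_convolution.
Context {R : realType} {d : nat}.
Local Notation C := R[i].
Local Notation lr := (@lebesgue_row R d).
Local Notation lr2 := (@lebesgue_row R (d + d)).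
Local Notation lam := (@lebesgue_measure R).
Variables (a : 'rV[R]_(d + d) -> C) (B : R).
Hypotheses (ma : cmeas a) (ba : forall z, normc (a z) <= B).
Implicit Types (al be : {ffun 'I_d -> nat}) (x xi y p : 'rV[R]_d) (w z : 'rV[R]_(d + d)).

Let B0 : 0 <= B := le_trans (normc_ge0 _) (ba 0).
Let cd : R := (pi ^+ d)^-1.
Let cd0 : 0 <= cd. Proof. by rewrite invr_ge0 exprn_ge0// pi_ge0. Qed.

(** The integrand in the center w of the gaussian, once the y-integral of the Weyl formula has been
    carried out. *)
Let Jf be x xi w : C := a w * (cd * rgauss 1 (xi - rsubmx w))%:C * waved be x xi (lsubmx w).

Lemma gconvE z : gconv a z = cint lr2 (fun w => (gden (z - w))%:C * a w).
Proof.
have i0 : cintg lr2 (fun w => (gden (z - w))%:C * a w).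
  apply: (cintg_le _ (rintgZ B (mpres_rintg (mpres_rowB z) (@rintg_gden R (d + d))))).
    apply: cmeasM => //; apply: cmeas_real; apply: (measurableT_comp (@measurable_gden R (d + d))).
    by apply: meas_rowB => //; exact: measurable_cst.
  by move=> w; rewrite Normc.normcM normcR ger0_norm ?gden_ge0// mulrC ler_wpM2r ?gden_ge0.
rewrite (mpres_cint (mpres_rowB z) i0); apply: eq_cint => w.
by rewrite subKr.
Qed.

Lemma weyl_gconv_inner be x xi : cint lr (weylf (gconv a) be x xi) = cint lr2 (Jf be x xi).
Proof.
pose F (t : 'rV[R]_d * 'rV[R]_(d + d)) : C := cexpi (dotp (x - t.1) xi) *
  ((gden (row_mx (2^-1 *: (x + t.1)) xi - t.2))%:C * a t.2) * hermc be t.1.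
pose H (t : 'rV[R]_d * 'rV[R]_(d + d)) : R := `|hermd be t.1| * (B * gden (row_mx (2^-1 *: (x + t.1)) xi - t.2)).
have mrow : measurable_fun setT (fun t : 'rV[R]_d * 'rV[R]_(d + d) => row_mx (2^-1 *: (x + t.1)) xi - t.2).
  apply: meas_rowB; last exact: measurable_snd.
  apply: meas_row_mx; last exact: measurable_cst.
  by apply: meas_rowZ; apply: meas_rowD; [exact: measurable_cst|exact: measurable_fst].
have mg : measurable_fun setT (fun t : 'rV[R]_d * 'rV[R]_(d + d) => gden (row_mx (2^-1 *: (x + t.1)) xi - t.2)).
  exact: measurableT_comp (@measurable_gden R (d + d)) mrow.
have mh : measurable_fun setT (fun t : 'rV[R]_d * 'rV[R]_(d + d) => hermd be t.1).
  exact: measurableT_comp (measurable_hermd be) measurable_fst.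
have ig y : rintg lr2 (fun w => B * gden (row_mx (2^-1 *: (x + y)) xi - w)).
  by apply: rintgZ; exact: (mpres_rintg (mpres_rowB _) (@rintg_gden R (d + d))).
have iF : cintg (prodm lr lr2) F.
  apply: (@cintg_fubini _ _ _ _ _ lr lr2 F (fun y => B * `|hermd be y|) H).
  - apply: cmeasM; last exact: cmeas_real.
    apply: cmeasM.
      apply: cmeas_cexpi; apply: meas_dotp; last exact: measurable_cst.
      by apply: meas_rowB; [exact: measurable_cst|exact: measurable_fst].
    by apply: cmeasM; [exact: cmeas_real|exact: cmeas_comp ma measurable_snd].
  - by apply: measurable_funM; [exact: measurableT_comp|exact: measurable_funM].
  - move=> t; rewrite /F /H !Normc.normcM normc_cexpi mul1r !normcR (ger0_norm (gden_ge0 _)) mulrC.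
    by rewrite ler_wpM2l// mulrC ler_wpM2r ?gden_ge0.
  - by move=> y; have := rintgZ `|hermd be y| (ig y); exact.
  - by apply: rintgZ; apply: rintg_norm; exact: rintg_hermd.
  - move=> y; rewrite /H /= (RintZ _ (ig y)) (RintZ _ (mpres_rintg (mpres_rowB _) (@rintg_gden R (d + d)))).
    by rewrite -(mpres_Rint (mpres_rowB _) (@rintg_gden R (d + d))) Rint_gden mulr1 mulrC.
have /= SW := cfubini_swap iF.
transitivity (cint lr (fun y => cint lr2 (fun w => F (y, w)))).
  apply: eq_cint => y; rewrite /weylf gconvE /F /=.
  have i1 : cintg lr2 (fun w => (gden (row_mx (2^-1 *: (x + y)) xi - w))%:C * a w).
    apply: (cintg_le _ (ig y)).
      apply: cmeasM => //; apply: cmeas_real; apply: (measurableT_comp (@measurable_gden R (d + d))).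
      by apply: meas_rowB => //; exact: measurable_cst.
    by move=> w; rewrite Normc.normcM normcR ger0_norm ?gden_ge0// mulrC ler_wpM2r ?gden_ge0.
  have E w : cexpi (dotp (x - y) xi) * ((gden (row_mx (2^-1 *: (x + y)) xi - w))%:C * a w) * hermc be y =
     (cexpi (dotp (x - y) xi) * hermc be y) * ((gden (row_mx (2^-1 *: (x + y)) xi - w))%:C * a w) by ring.
  by rewrite (eq_cint lr2 E) (cintZ _ i1); ring.
rewrite SW; apply: eq_cint => w.
have E y : F (y, w) = (a w * (cd * rgauss 1 (xi - rsubmx w))%:C) *
   ((rgauss 1 (2^-1 *: (x + y) - lsubmx w))%:C * cexpi (dotp (x - y) xi) * hermc be y).
  by rewrite /F /= gden_row -/cd !rmorphM; ring.
rewrite (eq_cint lr E) cintZ ?wavedE//.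
apply: (cintg_le _ (rintg_norm (rintg_hermd be))).
  apply: cmeasM; last by apply: cmeas_real; exact: measurable_hermd.
  apply: cmeasM.
    apply: cmeas_real; apply: (measurableT_comp (measurable_rgauss _)).
    apply: meas_rowB; last exact: measurable_cst.
    by apply: meas_rowZ; apply: meas_rowD => //; exact: measurable_cst.
  apply: cmeas_cexpi; apply: meas_dotp; last exact: measurable_cst.
  by apply: meas_rowB => //; exact: measurable_cst.
move=> y; rewrite !Normc.normcM normc_cexpi mulr1 !normcR (ger0_norm (ltW (rgauss_gt0 _ _))).
by rewrite ler_piMl// rgauss_le1.
Qed.

Section bounds.
Variable be : {ffun 'I_d -> nat}.
Variable M : R.
Hypotheses (M0 : 0 <= M) (HM : forall x xi p, normc (waved be x xi p) <= M * rwt xi * rgauss 4^-1 (2^-1 *: x - p)).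

Let Jf_le x xi w : normc (Jf be x xi w) <= (B * cd * M * rwt xi) * gK x xi w.
Proof.
rewrite /Jf !Normc.normcM normcR ger0_norm; last by rewrite mulr_ge0// ltW// rgauss_gt0.
have g0 := ltW (rgauss_gt0 1 (xi - rsubmx w)).
have h : normc (a w) * (cd * rgauss 1 (xi - rsubmx w)) <= B * (cd * rgauss 1 (xi - rsubmx w)).
  by rewrite ler_wpM2r// mulr_ge0.
apply: le_trans (ler_pM _ (normc_ge0 _) h (HM x xi (lsubmx w))) _.
  by rewrite mulr_ge0 ?normc_ge0// mulr_ge0.
by rewrite /gK le_eqVlt; apply/orP; left; apply/eqP; ring.
Qed.

Let cmeas_Jf d0 (T : measurableType d0) (x xi : T -> 'rV[R]_d) (w : T -> 'rV[R]_(d + d)) :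
  measurable_fun setT x -> measurable_fun setT xi -> measurable_fun setT w ->
  cmeas (fun t => Jf be (x t) (xi t) (w t)).
Proof.
move=> mx mz mw; apply: cmeasM; last first.
  by apply: cmeas_waved => //; exact: measurableT_comp meas_lsubmx mw.
apply: cmeasM; first exact: cmeas_comp.
apply: cmeas_real; apply: measurable_funM; first exact: measurable_cst.
apply: (measurableT_comp (measurable_rgauss _)); apply: meas_rowB => //.
exact: measurableT_comp meas_rsubmx mw.
Qed.

Let cintg_Jf x xi : cintg lr2 (Jf be x xi).
Proof.
apply: (cintg_le _ (rintgZ _ (gK_int x xi).1)); last by move=> w; exact: Jf_le.
by apply: cmeas_Jf => //; exact: measurable_cst.
Qed.

Lemma weyl_gconv_inner_le x xi : normc (cint lr (weylf (gconv a) be x xi)) <= (B * cd * M * (@gKint R d)) * rwt xi.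
Proof.
rewrite weyl_gconv_inner; apply: le_trans (normc_cint_le (cintg_Jf x xi) (rintgZ _ (gK_int x xi).1) (Jf_le x xi)) _.
by rewrite (RintZ _ (gK_int x xi).1) (gK_int x xi).2 le_eqVlt; apply/orP; left; apply/eqP; ring.
Qed.

Lemma cintg_weyl_gconv_aux x : cintg lr (fun xi => cint lr (weylf (gconv a) be x xi)).
Proof.
apply: (cintg_le _ (rintgZ _ (@rintg_rwt R d))); last by move=> xi; exact: weyl_gconv_inner_le.
by apply: cmeas_weyl_inner; [exact: cmeas_gconv ma ba|exact: measurable_cst|exact: measurable_id].
Qed.

Let wG al w i (s t : R) : C := (hfun (al i) s * (pi^-1 * expR (- (t - rsubmx w ord0 i) ^+ 2)))%:C *
  wave (be i) s t (lsubmx w ord0 i).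

(** For a fixed center w the integrand in (x, xi) is a product over the coordinates, each factor
    being given by [wave_coherent]. *)
Lemma weyl_gconv_fixed (al : {ffun 'I_d -> nat}) w :
  cint (prodm lr lr) (fun t => hermc al t.1 * Jf be t.1 t.2 w) =
  ((2 * pi) ^+ d)%:C * (a w * psid al w * conjc (psid be w)).
Proof.
have E (t : 'rV[R]_d * 'rV[R]_d) : hermc al t.1 * Jf be t.1 t.2 w = a w * \prod_i wG al w i (t.1 ord0 i) (t.2 ord0 i).
  have -> : \prod_i wG al w i (t.1 ord0 i) (t.2 ord0 i) =
      (\prod_i (hfun (al i) (t.1 ord0 i) * (pi^-1 * expR (- (t.2 ord0 i - rsubmx w ord0 i) ^+ 2))))%:C *
      waved be t.1 t.2 (lsubmx w) by rewrite /wG big_split /= rmorph_prod.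
  have -> : \prod_i (hfun (al i) (t.1 ord0 i) * (pi^-1 * expR (- (t.2 ord0 i - rsubmx w ord0 i) ^+ 2))) =
      hermd al t.1 * (cd * rgauss 1 (t.2 - rsubmx w)).
    rewrite big_split /= [X in _ * X = _]big_split /= prodr_const card_ord exprVn -/cd hermdE rgaussE.
    by congr (_ * (_ * _)); apply: eq_bigr => i _; rewrite !mxE mul1r.
  by rewrite /hermc /Jf !rmorphM; ring.
have iP : cintg (prodm lr lr) (fun t => hermc al t.1 * Jf be t.1 t.2 w).
  apply: (cintg_le _ (rintgX (rintg_norm (rintg_hermd al)) (rintgZ (B * cd * M) (@rintg_rwt R d)))).
    apply: cmeasM; first by apply: cmeas_real; exact: measurableT_comp (measurable_hermd al) measurable_fst.
    by apply: cmeas_Jf => //; exact: measurable_cst.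
  move=> t; rewrite Normc.normcM normcR ler_wpM2l//; apply: le_trans (Jf_le _ _ _) _.
  by rewrite ler_piMr ?mulr_ge0 ?rwt_ge0// /gK mulr_ile1 ?(ltW (rgauss_gt0 _ _)) ?rgauss_le1// invr_ge0.
have iG1 i s : @cintg _ (measurableTypeR R) R lam (wG al w i s).
  have [K K0 HK] := wave_le (R := R) (be i).
  apply: (cintg_le _ (rintgZ (`|hfun (al i) s| * pi^-1 * K) rintg_wt)).
    apply: cmeasM; last by apply: measurable_wave => //; exact: measurable_cst.
    apply: cmeas_real; apply: measurable_funM => //; apply: measurable_funM => //.
    by apply: measurableT_comp => //; apply: measurableT_comp => //; apply: measurable_funX; exact: measurable_funB.
  move=> t; rewrite /wG Normc.normcM normcR (normrM (hfun _ _)) (normrM pi^-1) (ger0_norm (expR_ge0 _)) (ger0_norm (_ : 0 <= pi^-1)) ?invr_ge0 ?pi_ge0//.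
  have h1 := expRN_sqr_le1 (t - rsubmx w ord0 i).
  have h2 : normc (wave (be i) s t (lsubmx w ord0 i)) <= K * wt t.
    apply: le_trans (HK _ _ _) _; rewrite ler_piMr ?mulr_ge0 ?wt_ge0// -[leRHS]expR0 ler_expR oppr_le0 divr_ge0// sqr_ge0.
    by [].
  have -> : `|hfun (al i) s| * pi^-1 * K * wt t = (`|hfun (al i) s| * pi^-1) * (K * wt t) by ring.
  apply: ler_pM => //; first by rewrite !mulr_ge0 ?invr_ge0 ?pi_ge0 ?expR_ge0.
    exact: normc_ge0.
  by rewrite ler_wpM2l// ler_piMr// invr_ge0 pi_ge0.
have iG2 i : cintg (prodm lam lam) (fun t : measurableTypeR R * measurableTypeR R => wG al w i t.1 t.2).
  have [K K0 HK] := wave_le (R := R) (be i); have [K' K'0 HK'] := hfun_wt (R := R) (al i).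
  apply: (cintg_le _ (rintgX (rintgZ K' rintg_wt) (rintgZ (pi^-1 * K) rintg_wt))).
    apply: cmeasM; last by apply: measurable_wave => //; exact: measurable_cst.
    apply: cmeas_real; apply: measurable_funM; first exact: measurableT_comp (measurable_hfun _) measurable_fst.
    apply: measurable_funM => //.
    by apply: measurableT_comp => //; apply: measurableT_comp => //; apply: measurable_funX; exact: measurable_funB.
  move=> t; rewrite /wG Normc.normcM normcR (normrM (hfun _ _)) (normrM pi^-1) (ger0_norm (expR_ge0 _)) (ger0_norm (_ : 0 <= pi^-1)) ?invr_ge0 ?pi_ge0//.
  have h1 := expRN_sqr_le1 (t.2 - rsubmx w ord0 i).
  have h2 : normc (wave (be i) t.1 t.2 (lsubmx w ord0 i)) <= K * wt t.2.
    apply: le_trans (HK _ _ _) _; rewrite ler_piMr ?mulr_ge0 ?wt_ge0// -[leRHS]expR0 ler_expR oppr_le0 divr_ge0// sqr_ge0.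
    by [].
  have AE (a1 a2 a3 a4 : R) : a1 * (a2 * a3) * a4 = a1 * (a2 * (a3 * a4)) by rewrite !mulrA.
  rewrite AE -(mulrA pi^-1 K); apply: ler_pM => //; first by rewrite !mulr_ge0 ?invr_ge0 ?pi_ge0 ?expR_ge0 ?normc_ge0.
  rewrite ler_wpM2l ?invr_ge0 ?pi_ge0//; apply: le_trans h2; rewrite ler_piMl// normc_ge0.
  by [].
have [_ <-] := cfubini1 iP.
have E1 x : cint lr (fun xi => hermc al (x, xi).1 * Jf be (x, xi).1 (x, xi).2 w) = a w * \prod_i cint lam (wG al w i (x ord0 i)).
  have [i1 e1] := cint_row_prod (fun i => iG1 i (x ord0 i)).
  by rewrite (eq_cint lr (fun xi => E (x, xi))) /= (cintZ _ i1) e1.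
rewrite (eq_cint lr E1).
have [i1 e1] := cint_row_prod (fun i => (cfubini1 (iG2 i)).1).
rewrite (cintZ _ i1) e1 (eq_bigr (fun i => (2 * pi)%:C * (psi1 (al i) (lsubmx w ord0 i) (rsubmx w ord0 i) *
   conjc (psi1 (be i) (lsubmx w ord0 i) (rsubmx w ord0 i))))); last by move=> i _; exact: wave_coherent.
have PE : \prod_i (psi1 (al i) (lsubmx w ord0 i) (rsubmx w ord0 i) * conjc (psi1 (be i) (lsubmx w ord0 i) (rsubmx w ord0 i))) =
    psid al w * conjc (psid be w) by rewrite /psid conjc_prod -big_split.
by rewrite big_split PE /= prodr_const card_ord -rmorphXn; ring.
Qed.

(** Fubini's theorem moves the integral in w outside. It applies only after the y-integral is done,
    when the integrand is dominated by the Hermite function in x, by [rwt] in xi and by [gK] in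
    w. *)
Lemma weyl_gconv_matrix_aux (al : {ffun 'I_d -> nat}) :
  cintg lr (fun x => hermc al x * weyl (gconv a) (hermc be) x) /\
  inner (hermc al) (weyl (gconv a) (hermc be)) = cint lr2 (fun w => a w * psid al w * conjc (psid be w)).
Proof.
pose F (t : ('rV[R]_d * 'rV[R]_d) * 'rV[R]_(d + d)) : C := hermc al t.1.1 * Jf be t.1.1 t.1.2 t.2.
pose H (t : ('rV[R]_d * 'rV[R]_d) * 'rV[R]_(d + d)) : R := (`|hermd al t.1.1| * (B * cd * M * rwt t.1.2)) * gK t.1.1 t.1.2 t.2.
have m11 : measurable_fun setT (fun t : ('rV[R]_d * 'rV[R]_d) * 'rV[R]_(d + d) => t.1.1) := measurableT_comp measurable_fst measurable_fst.
have m12 : measurable_fun setT (fun t : ('rV[R]_d * 'rV[R]_d) * 'rV[R]_(d + d) => t.1.2) := measurableT_comp measurable_snd measurable_fst.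
have mh := measurableT_comp (measurable_hermd al) m11.
have iF : cintg (prodm (prodm lr lr) lr2) F.
  apply: (@cintg_fubini _ _ _ _ _ (prodm lr lr) lr2 F (fun t => `|hermd al t.1| * ((B * cd * M * (@gKint R d)) * rwt t.2)) H).
  - by apply: cmeasM; [exact: cmeas_real|apply: cmeas_Jf].
  - apply: measurable_funM; last exact: measurable_gK.
    apply: measurable_funM; first exact: measurableT_comp.
    by apply: measurable_funM => //; exact: measurableT_comp (rintg_meas (@rintg_rwt R d)) m12.
  - by move=> t; rewrite /F /H Normc.normcM normcR -mulrA ler_wpM2l//; exact: Jf_le.
  - by move=> t; have := rintgZ (`|hermd al t.1| * (B * cd * M * rwt t.2)) (gK_int t.1 t.2).1; exact.
  - by have := rintgX (rintg_norm (rintg_hermd al)) (rintgZ (B * cd * M * @gKint R d) (@rintg_rwt R d)); exact.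
  - move=> t; rewrite /H /= (RintZ _ (gK_int _ _).1) (gK_int _ _).2 le_eqVlt; apply/orP; left; apply/eqP; ring.
have [i1 e1] := cfubini1 iF; have [_ e2] := cfubini2 iF.
have E1 t : cint lr2 (fun w => F (t, w)) = hermc al t.1 * cint lr (weylf (gconv a) be t.1 t.2).
  by rewrite /F /= (cintZ _ (cintg_Jf _ _)) weyl_gconv_inner.
have [i3 e3] := cfubini1 (eq_cintg E1 i1).
have E3 x : cint lr (fun xi => hermc al (x, xi).1 * cint lr (weylf (gconv a) be (x, xi).1 (x, xi).2)) =
    hermc al x * cint lr (fun xi => cint lr (weylf (gconv a) be x xi)).
  by rewrite /= (cintZ _ (cintg_weyl_gconv_aux x)).
pose k : C := ((2 * pi) ^- d)%:C.
have E4 x : k * (hermc al x * cint lr (fun xi => cint lr (weylf (gconv a) be x xi))) = hermc al x * weyl (gconv a) (hermc be) x.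
  by rewrite mulrCA.
split; first exact: eq_cintg E4 (cintgZ k (eq_cintg E3 i3)).
have E5 x : conjc (hermc al x) * weyl (gconv a) (hermc be) x = k * (hermc al x * cint lr (fun xi => cint lr (weylf (gconv a) be x xi))).
  by rewrite E4 /hermc conjc_real.
rewrite /inner (eq_cint lr E5) (cintZ _ (eq_cintg E3 i3)) -(eq_cint lr E3) e3 -(eq_cint (prodm lr lr) E1) e1 -e2.
rewrite (eq_cint lr2 (weyl_gconv_fixed al)) -cintZ; last first.
  exact: (eq_cintg (weyl_gconv_fixed al) (cfubini2 iF).1).
apply: eq_cint => w; rewrite mulrA -rmorphM mulVf ?mul1r//.
by rewrite expf_neq0// mulf_neq0// lt0r_neq0// pi_gt0.
Qed.
End bounds.

(* An anti-Wick operator: the [psid al] are the coherent-state transforms of the Hermite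
   functions. *)
Lemma weyl_gconv_matrix al be :
  cintg lr (fun x => hermc al x * weyl (gconv a) (hermc be) x) /\
  inner (hermc al) (weyl (gconv a) (hermc be)) = cint lr2 (fun w => a w * psid al w * conjc (psid be w)).
Proof. by have [M M0 HM] := normc_waved_le (R := R) be; exact: weyl_gconv_matrix_aux M0 HM al. Qed.

Lemma cintg_weyl_gconv be x : cintg lr (fun xi => cint lr (weylf (gconv a) be x xi)).
Proof.
by have [M M0 HM] := normc_waved_le (R := R) be; first [exact: (cintg_weyl_gconv_aux HM x)|exact: (cintg_weyl_gconv_aux M0 HM x)].
Qed.
End weyl_of_convolution.

Section mollified_limit.
Context d (T : measurableType d) {R : realType} (mu : {measure set T -> \bar R}).
Local Notation C := R[i].

Lemma cint_mollify (u : T -> C) (g : nat -> T -> R) : cintg mu u ->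
  (forall n, measurable_fun setT (g n)) -> (forall n t, 0 <= g n t <= 1) ->
  (forall t, g ^~ t @ \oo --> (1 : R)) ->
  (fun n => complex.Re (cint mu (fun t => u t * (g n t)%:C))) @ \oo --> complex.Re (cint mu u) /\
  (fun n => complex.Im (cint mu (fun t => u t * (g n t)%:C))) @ \oo --> complex.Im (cint mu u).
Proof.
move=> [ir ii] mg g01 cg.
have main f : rintg mu f -> (fun n => \int[mu]_t (f t * g n t)) @ \oo --> \int[mu]_t f t.
  move=> intf; apply: (Rint_cvg _ (rintg_norm intf) _ _).2.
  - by move=> n; apply: measurable_funM => //; exact: rintg_meas intf.
  - by move=> t; rewrite -[X in _ --> X]mulr1; apply: cvgM => //; exact: cvg_cst.
  - move=> n t; have /andP[g0 g1] := g01 n t.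
    by rewrite normrM (ger0_norm g0) ler_piMr.
split.
  rewrite (_ : (fun n => _) = fun n => \int[mu]_t (complex.Re (u t) * g n t)); first exact: main.
  by apply/funext => n; apply: eq_Rint => t; rewrite ReM /= mulr0 subr0.
rewrite (_ : (fun n => _) = fun n => \int[mu]_t (complex.Im (u t) * g n t)); first exact: main.
by apply/funext => n; apply: eq_Rint => t; rewrite ImM /= mulr0 add0r.
Qed.
End mollified_limit.

(** * Decaying symbols as Hilbert-Schmidt operators *)

Section weyl_of_decaying.
Context {R : realType} {d : nat}.
Local Notation C := R[i].
Local Notation lr := (@lebesgue_row R d).
Local Notation lam := (@lebesgue_measure R).
Variables (r : 'rV[R]_(d + d) -> C) (B : R).
Hypotheses (mr : cmeas r) (br : forall z, normc (r z) <= B * rwt z).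
Implicit Types (al be : {ffun 'I_d -> nat}) (x xi y q s : 'rV[R]_d).

Lemma rwt_row_mx q xi : rwt (row_mx q xi) = rwt q * rwt xi :> R.
Proof.
rewrite /rwt big_split_ord /=; congr (_ * _); apply: eq_bigr => i _.
  by rewrite row_mxEl.
by rewrite row_mxEr.
Qed.

Lemma measurable_rwt n : measurable_fun setT (@rwt R n).
Proof. exact: (rintg_meas (@rintg_rwt R n)). Qed.

Let B0 : 0 <= B.
Proof.
have /(le_trans (normc_ge0 _)) := br 0; rewrite pmulr_lge0// /rwt.
by apply: prodr_gt0 => i _; exact: wt_gt0.
Qed.

Let bB z : normc (r z) <= B.
Proof. by apply: le_trans (br z) _; rewrite ler_piMr// rwt_le1. Qed.

Let W : R := \int[lr]_x rwt x.
Let W0 : 0 <= W. Proof. by apply: Rintegral_ge0 => x _; exact: rwt_ge0. Qed.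

(** Up to the factor (2 pi)^-d, the integral kernel of the Weyl operator in terms of the midpoint q
    and the difference s: a Fourier transform of the symbol in xi. *)
Let ker q s : C := cint lr (fun xi => cexpi (dotp s xi) * r (row_mx q xi)).

Let meas_ker0 d0 (T : measurableType d0) (q s xi : T -> 'rV[R]_d) :
  measurable_fun setT q -> measurable_fun setT s -> measurable_fun setT xi ->
  cmeas (fun t => cexpi (dotp (s t) (xi t)) * r (row_mx (q t) (xi t))).
Proof.
move=> mq ms mx; apply: cmeasM; first by apply: cmeas_cexpi; exact: meas_dotp.
by apply: cmeas_comp => //; exact: meas_row_mx.
Qed.

Let ker0_le q s xi : normc (cexpi (dotp s xi) * r (row_mx q xi)) <= (B * rwt q) * rwt xi.
Proof. by rewrite Normc.normcM normc_cexpi mul1r -mulrA -rwt_row_mx. Qed.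

Let cintg_ker0 q s : cintg lr (fun xi => cexpi (dotp s xi) * r (row_mx q xi)).
Proof.
apply: (cintg_le _ (rintgZ (B * rwt q) (@rintg_rwt R d))); last by move=> xi; exact: ker0_le.
by apply: meas_ker0 => //; exact: measurable_cst.
Qed.

Let ker_le q s : normc (ker q s) <= B * W * rwt q.
Proof.
apply: le_trans (normc_cint_le (cintg_ker0 q s) (rintgZ (B * rwt q) (@rintg_rwt R d)) (ker0_le q s)) _.
by rewrite (RintZ _ (@rintg_rwt R d)) mulrAC.
Qed.

Let meas_ker d0 (T : measurableType d0) (q s : T -> 'rV[R]_d) :
  measurable_fun setT q -> measurable_fun setT s -> cmeas (fun t => ker (q t) (s t)).
Proof.
move=> mq ms; have := @cmeas_cint _ _ T 'rV[R]_d R lr (fun t => cexpi (dotp (s t.1) t.2) * r (row_mx (q t.1) t.2)).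
by apply; apply: meas_ker0 => //; exact: measurableT_comp _ measurable_fst.
Qed.

Let cintg_pair be x : cintg (prodm lr lr) (fun t => weylf r be x t.1 t.2).
Proof.
apply: (cintg_le _ (rintgX (rintgZ B (@rintg_rwt R d)) (rintg_norm (rintg_hermd be)))).
  by apply: cmeas_weylf => //; exact: measurable_cst.
move=> t; rewrite normc_weylf ler_wpM2r//; apply: le_trans (br _) _.
by rewrite rwt_row_mx ler_wpM2l// ler_piMl ?rwt_ge0 ?rwt_le1.
Qed.

Lemma cintg_weyl_decay be x : cintg lr (fun xi => cint lr (weylf r be x xi)).
Proof. exact: (cfubini1 (cintg_pair be x)).1. Qed.

Let k : C := ((2 * pi) ^- d)%:C.

Let weyl_ker be x : weyl r (hermc be) x = k * cint lr (fun y => ker (2^-1 *: (x + y)) (x - y) * hermc be y).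
Proof.
have /= SW := cfubini_swap (cintg_pair be x).
transitivity (k * cint lr (fun xi => cint lr (fun y => weylf r be x xi y))); first by [].
rewrite SW; congr (_ * _); apply: eq_cint => y.
rewrite mulrC -(cintZ _ (cintg_ker0 _ _)); apply: eq_cint => xi.
by rewrite /weylf mulrC.
Qed.

Let KK (t : 'rV[R]_d * 'rV[R]_d) : C := ker (2^-1 *: (t.1 + t.2)) (t.1 - t.2).
Let uu (ab : {ffun 'I_d -> nat} * {ffun 'I_d -> nat}) (t : 'rV[R]_d * 'rV[R]_d) : C := hermc ab.1 t.1 * hermc ab.2 t.2.

Let meas_KK : cmeas KK.
Proof.
apply: meas_ker; first by apply: meas_rowZ; apply: meas_rowD; [exact: measurable_fst|exact: measurable_snd].
by apply: meas_rowB; [exact: measurable_fst|exact: measurable_snd].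
Qed.

Let meas_uu ab : cmeas (uu ab).
Proof.
apply: cmeasM; apply: cmeas_real.
  exact: measurableT_comp (measurable_hermd _) measurable_fst.
exact: measurableT_comp (measurable_hermd _) measurable_snd.
Qed.

Let uuJ ab t : conjc (uu ab t) = uu ab t.
Proof. by rewrite /uu conjcM /hermc !conjc_real. Qed.

Let cintg_KKu ab : cintg (prodm lr lr) (fun t => KK t * uu ab t).
Proof.
apply: (cintg_le _ (rintgX (rintgZ (B * W) (rintg_norm (rintg_hermd ab.1))) (rintg_norm (rintg_hermd ab.2)))).
  exact: cmeasM.
move=> t; rewrite /uu !Normc.normcM !normcR -[X in _ <= X]mulrA; apply: ler_wpM2r; first exact: mulr_ge0.
by apply: le_trans (ker_le _ _) _; rewrite ler_piMr ?rwt_le1// mulr_ge0.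
Qed.

Lemma weyl_decay_matrix al be :
  cintg lr (fun x => hermc al x * weyl r (hermc be) x) /\
  inner (hermc al) (weyl r (hermc be)) = k * cint (prodm lr lr) (fun t => KK t * uu (al, be) t).
Proof.
have [i1 e1] := cfubini1 (cintg_KKu (al, be)).
have ik x : cintg lr (fun y => ker (2^-1 *: (x + y)) (x - y) * hermc be y).
  apply: (cintg_le _ (rintgZ (B * W) (rintg_norm (rintg_hermd be)))).
    apply: cmeasM; last by apply: cmeas_real; exact: measurable_hermd.
    apply: meas_ker; last by apply: meas_rowB => //; exact: measurable_cst.
    by apply: meas_rowZ; apply: meas_rowD => //; exact: measurable_cst.
  move=> y; rewrite Normc.normcM normcR ler_wpM2r//.
  by apply: le_trans (ker_le _ _) _; rewrite ler_piMr ?rwt_le1// mulr_ge0.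
have E x : k * cint lr (fun y => KK (x, y) * uu (al, be) (x, y)) = hermc al x * weyl r (hermc be) x.
  rewrite weyl_ker mulrCA; congr (_ * _); rewrite -(cintZ _ (ik x)); apply: eq_cint => y.
  by rewrite /KK /uu /=; ring.
split; first exact: eq_cintg E (cintgZ k i1).
rewrite -e1 -(cintZ _ i1); apply: eq_cint => x.
by rewrite E /hermc conjc_real.
Qed.

Lemma cint_rgauss_cexpi c (v : 'rV[R]_d) : 0 < c ->
  cintg lr (fun s => (rgauss c s)%:C * cexpi (dotp s v)) /\
  cint lr (fun s => (rgauss c s)%:C * cexpi (dotp s v)) = (Num.sqrt (pi / c) ^+ d * rgauss (4 * c)^-1 v)%:C.
Proof.
move=> c0.
have i1 i : @cintg _ (measurableTypeR R) R lam (fun t => (expR (- (c * t ^+ 2)))%:C * cexpi (v ord0 i * t)).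
  apply: (cintg_le _ (rintg_gauss c0)).
    apply: cmeasM; first by apply: cmeas_real; exact: rintg_meas (rintg_gauss c0).
    by apply: cmeas_cexpi; exact: measurable_funM.
  by move=> t; rewrite Normc.normcM normcR normc_cexpi mulr1 ger0_norm ?expR_ge0.
have [i2 e2] := cint_row_prod i1.
have E s : \prod_i ((expR (- (c * s ord0 i ^+ 2)))%:C * cexpi (v ord0 i * s ord0 i)) = (rgauss c s)%:C * cexpi (dotp s v).
  rewrite big_split /= -rmorph_prod -rgaussE /dotp cexpi_sum; congr (_ * _).
  by apply: eq_bigr => i _; rewrite mulrC.
split; first exact: eq_cintg E i2.
rewrite -(eq_cint lr E) e2 (eq_bigr (fun i => (Num.sqrt (pi / c) * expR (- ((4 * c)^-1 * v ord0 i ^+ 2)))%:C)) => [|i _]; last first.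
  by rewrite (cint_gauss_cexpi c0) (mulrC (4 * c)^-1).
by rewrite -rmorph_prod big_split /= prodr_const card_ord -rgaussE.
Qed.

(* Plancherel in the difference variable, with a Gaussian regularization. *)
Let ker_plancherel c q : 0 < c ->
  \int[lr]_s (normc (ker q s) ^+ 2 * rgauss c s) <= B ^+ 2 * W * (2 * pi) ^+ d * rwt q.
Proof.
move=> c0; pose g xi := r (row_mx q xi).
have mg : cmeas g by apply: cmeas_comp => //; apply: meas_row_mx => //; exact: measurable_cst.
pose F (t : 'rV[R]_d * ('rV[R]_d * 'rV[R]_d)) : C := (rgauss c t.1)%:C * ((cexpi (dotp t.1 t.2.1) * g t.2.1) * conjc (cexpi (dotp t.1 t.2.2) * g t.2.2)).
have m1 : measurable_fun setT (fun t : 'rV[R]_d * ('rV[R]_d * 'rV[R]_d) => t.2.1) := measurableT_comp measurable_fst measurable_snd.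
have m2 : measurable_fun setT (fun t : 'rV[R]_d * ('rV[R]_d * 'rV[R]_d) => t.2.2) := measurableT_comp measurable_snd measurable_snd.
have iw := rintgZ (B * rwt q) (@rintg_rwt R d).
have iF : cintg (prodm lr (prodm lr lr)) F.
  apply: (cintg_le _ (rintgX (rintg_rgauss d c0) (rintgX iw iw))).
    apply: cmeasM; first by apply: cmeas_real; exact: measurableT_comp (measurable_rgauss c) measurable_fst.
    apply: cmeasM.
      by apply: cmeasM; [apply: cmeas_cexpi; exact: meas_dotp|exact: cmeas_comp mg m1].
    apply: cmeas_conj.
    by apply: cmeasM; [apply: cmeas_cexpi; exact: meas_dotp|exact: cmeas_comp mg m2].
  move=> t; rewrite /F Normc.normcM [X in _ * X <= _]Normc.normcM normc_conj normcR ger0_norm ?(ltW (rgauss_gt0 _ _))//.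
  apply: ler_wpM2l; first exact: ltW (rgauss_gt0 _ _).
  by apply: ler_pM; rewrite ?normc_ge0//; exact: ker0_le.
have E1 s : cint (prodm lr lr) (fun t => F (s, t)) = (normc (ker q s) ^+ 2 * rgauss c s)%:C.
  pose h (z : 'rV[R]_d * 'rV[R]_d) := cexpi (dotp s z.1) * r (row_mx q z.1) * conjc (cexpi (dotp s z.2) * r (row_mx q z.2)).
  have ix : cintg (prodm lr lr) h := cintgX (cintg_ker0 q s) (cintg_conj (cintg_ker0 q s)).
  have EF t : F (s, t) = (rgauss c s)%:C * h t by [].
  rewrite (eq_cint (prodm lr lr) EF) (cintZ _ ix) /h.
  rewrite (cintX (cintg_ker0 q s) (cintg_conj (cintg_ker0 q s))) (cint_conj (cintg_ker0 q s)).
  by rewrite mulcJ mulrC -rmorphM.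
have [i1 e1] := cfubini1 iF; have [i2 e2] := cfubini2 iF.
pose G (v : 'rV[R]_d) : R := Num.sqrt (pi / c) ^+ d * rgauss (4 * c)^-1 v.
have c4 : 0 < (4 * c)^-1 by rewrite invr_gt0 mulr_gt0.
have iG : rintg lr G by exact: rintgZ (rintg_rgauss d c4).
have G0 v : 0 <= G v by rewrite mulr_ge0 ?exprn_ge0 ?sqrtr_ge0// ltW// rgauss_gt0.
(* Integrating in s first produces a gaussian of the difference of the two frequencies. Its mass
   does not depend on c, so the bound is uniform in the regularization. *)
have IG : \int[lr]_v G v = (2 * pi) ^+ d.
  rewrite (RintZ _ (rintg_rgauss d c4)) (Rint_rgauss d c4) -exprMn -sqrtrM ?divr_ge0 ?pi_ge0 ?(ltW c0)//.
  rewrite invrK (_ : pi / c * (pi * (4 * c)) = (2 * pi) ^+ 2); last by field; exact: lt0r_neq0.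
  by rewrite sqrtr_sqr ger0_norm// mulr_ge0// pi_ge0.
have E2 t : cint lr (fun s => F (s, t)) = (g t.1 * conjc (g t.2)) * (G (t.1 - t.2))%:C.
  have [j1 j2] := cint_rgauss_cexpi (t.1 - t.2) c0.
  rewrite -j2 -(cintZ _ j1); apply: eq_cint => s; rewrite /F /= conjcM -cexpiN dotpDr dotpNr cexpiD; ring.
have ixi u : rintg lr (fun v => G (u - v)) by exact: (mpres_rintg (mpres_rowB u) iG).
pose H (t : 'rV[R]_d * 'rV[R]_d) : R := (B ^+ 2 * rwt q * rwt t.1) * G (t.1 - t.2).
have H0 t : 0 <= H t.
  apply: mulr_ge0; [|exact: G0]; apply: mulr_ge0; [|exact: rwt_ge0].
  by apply: mulr_ge0; [exact: sqr_ge0|exact: rwt_ge0].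
have IH u : \int[lr]_v `|H (u, v)| = (B ^+ 2 * rwt q * (2 * pi) ^+ d) * rwt u.
  rewrite (eq_Rint lr (_ : forall v, _ = (B ^+ 2 * rwt q * rwt u) * G (u - v))); last by move=> v; rewrite ger0_norm.
  by rewrite (RintZ _ (ixi u)) -(mpres_Rint (mpres_rowB u) iG) IG mulrAC.
have iH : rintg (prodm lr lr) H.
  apply: (rintg_fubini (g := fun u => (B ^+ 2 * rwt q * (2 * pi) ^+ d) * rwt u)).
  - apply: measurable_funM; first by apply: measurable_funM => //; exact: measurableT_comp (measurable_rwt (n := d)) measurable_fst.
    by apply: (measurableT_comp (rintg_meas iG)); apply: meas_rowB; [exact: measurable_fst|exact: measurable_snd].
  - by move=> u; have := rintgZ (B ^+ 2 * rwt q * rwt u) (ixi u); exact.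
  - exact: (rintgZ _ (@rintg_rwt R d)).
  - by move=> u; rewrite IH.
have IHt : \int[prodm lr lr]_t H t = B ^+ 2 * rwt q * (2 * pi) ^+ d * W.
  rewrite -(rfubini1 iH).2 (eq_Rint lr (_ : forall u, _ = (B ^+ 2 * rwt q * (2 * pi) ^+ d) * rwt u)).
    by rewrite (RintZ _ (@rintg_rwt R d)).
  by move=> u; rewrite -IH; apply: eq_Rint => v; rewrite ger0_norm.
have HE := normc_cint_le (eq_cintg E2 i2) iH (_ : forall t, normc (g t.1 * conjc (g t.2) * (G (t.1 - t.2))%:C) <= H t).
have key : \int[lr]_s (normc (ker q s) ^+ 2 * rgauss c s) <= normc (cint (prodm lr lr) (fun t => g t.1 * conjc (g t.2) * (G (t.1 - t.2))%:C)).
  rewrite -(eq_cint (prodm lr lr) E2) e2 -e1 (eq_cint lr E1) cint_real normcR ler_norm.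
  by [].
apply: le_trans key _; apply: le_trans (HE _) _.
  move=> t; rewrite !Normc.normcM normc_conj normcR (ger0_norm (G0 _)) ler_wpM2r//.
  have h1 : normc (g t.1) <= B * (rwt q * rwt t.1) by rewrite -rwt_row_mx; exact: br.
  have h2 : normc (g t.2) <= B by exact: bB.
  apply: le_trans (ler_pM (normc_ge0 _) (normc_ge0 _) h1 h2) _.
  by rewrite le_eqVlt; apply/orP; left; apply/eqP; ring.
by rewrite IHt le_eqVlt; apply/orP; left; apply/eqP; ring.
Qed.

Let hsc : R := B ^+ 2 * W * (2 * pi) ^+ d * W.

(** Square integrability is obtained for the regularized kernel, in midpoint and difference
    coordinates, with a bound uniform in c. This is the function to which Bessel's inequality is
    applied. *)
Let KK_mollified c : 0 < c ->
  rintg (prodm lr lr) (fun t => normc (KK t * (rgauss c (t.1 - t.2))%:C) ^+ 2) /\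
  \int[prodm lr lr]_t (normc (KK t * (rgauss c (t.1 - t.2))%:C) ^+ 2) <= hsc.
Proof.
move=> c0; have c2 : 0 < c + c by rewrite addr_gt0.
pose f (t : 'rV[R]_d * 'rV[R]_d) : R := normc (KK t * (rgauss c (t.1 - t.2))%:C) ^+ 2.
pose g (t : 'rV[R]_d * 'rV[R]_d) : R := normc (ker t.1 t.2) ^+ 2 * rgauss (c + c) t.2.
have fg t : f (t.1 + 2^-1 *: t.2, t.1 - 2^-1 *: t.2) = g t.
  rewrite /f /g /KK /= Normc.normcM normcR ger0_norm ?(ltW (rgauss_gt0 _ _))// exprMn rgaussD expr2.
  rewrite (_ : 2^-1 *: (t.1 + 2^-1 *: t.2 + (t.1 - 2^-1 *: t.2)) = t.1); last first.
    by apply/rowP => i; rewrite !mxE; field.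
  rewrite (_ : t.1 + 2^-1 *: t.2 - (t.1 - 2^-1 *: t.2) = t.2); last by apply/rowP => i; rewrite !mxE; field.
  by rewrite !expr2.
have mf : measurable_fun setT f.
  apply: measurable_funX; apply: cmeas_normc; apply: cmeasM => //; apply: cmeas_real.
  by apply: (measurableT_comp (measurable_rgauss _)); apply: meas_rowB; [exact: measurable_fst|exact: measurable_snd].
have mg : measurable_fun setT g.
  apply: measurable_funM; last exact: measurableT_comp (measurable_rgauss _) measurable_snd.
  by apply: measurable_funX; apply: cmeas_normc; apply: meas_ker; [exact: measurable_fst|exact: measurable_snd].
have g0 t : 0 <= g t by rewrite mulr_ge0 ?exprn_ge0 ?normc_ge0// ltW// rgauss_gt0.
have gsec q : rintg lr (fun s => g (q, s)).
  apply: (rintg_le _ (rintgZ ((B * W) ^+ 2) (rintg_rgauss d c2))).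
    apply: measurable_funM; last exact: measurable_rgauss.
    by apply: measurable_funX; apply: cmeas_normc; apply: meas_ker; [exact: measurable_cst|exact: measurable_id].
  move=> s; rewrite ger0_norm// /g /= ler_wpM2r ?(ltW (rgauss_gt0 _ _))//.
  apply: lerXn2r; rewrite ?nnegrE ?normc_ge0 ?mulr_ge0//.
  by apply: le_trans (ker_le q s) _; rewrite ler_piMr ?rwt_le1// mulr_ge0.
have gbd q : \int[lr]_s `|g (q, s)| <= B ^+ 2 * W * (2 * pi) ^+ d * rwt q.
  rewrite (eq_Rint lr (_ : forall s, _ = normc (ker q s) ^+ 2 * rgauss (c + c) s)); first exact: ker_plancherel.
  by move=> s; rewrite ger0_norm.
have ig : rintg (prodm lr lr) g.
  by apply: (rintg_fubini mg gsec (rintgZ (B ^+ 2 * W * (2 * pi) ^+ d) (@rintg_rwt R d))).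
have mp := @mpres_midpoint R d.
have Ef : (\int[prodm lr lr]_t (f t)%:E = \int[prodm lr lr]_t (g t)%:E)%E.
  rewrite (mpres_ge0 mp (f := EFin \o f)).
  - by apply: eq_integral => t _; rewrite /= fg.
  - exact/measurable_EFinP.
  - by move=> t; rewrite lee_fin sqr_ge0.
have if_ : rintg (prodm lr lr) f.
  by apply: ge0_rintg => //; [move=> t; exact: sqr_ge0|rewrite Ef; exact: rintg_lty].
split=> //; rewrite (_ : \int[prodm lr lr]_t _ = \int[prodm lr lr]_t g t); last by rewrite /Rintegral Ef.
rewrite -(rfubini1 ig).2 /hsc -(RintZ _ (@rintg_rwt R d)).
apply: Rint_le; [exact: (rfubini1 ig).1|exact: rintgZ (@rintg_rwt R d)|].
by move=> q; apply: le_trans (gbd q); apply: Rint_le => //; [exact: rintg_norm|move=> s; exact: ler_norm].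
Qed.

Lemma cvg_seq_sum I (s : seq I) (f : nat -> I -> R) (l : I -> R) : (forall i, f ^~ i @ \oo --> l i) ->
  (fun n => \sum_(i <- s) f n i) @ \oo --> \sum_(i <- s) l i.
Proof.
move=> cf; elim: s => [|i s IH].
  rewrite big_nil (_ : (fun n => _) = fun=> 0); first exact: cvg_cst.
  by apply/funext => n; rewrite big_nil.
rewrite big_cons (_ : (fun n => _) = fun n => f n i + \sum_(i <- s) f n i); first exact: cvgD.
by apply/funext => n; rewrite big_cons.
Qed.

Lemma cvg_rgauss n (v : 'rV[R]_n) : (fun k => rgauss k.+1%:R^-1 v) @ \oo --> (1 : R).
Proof.
have h : (fun k : nat => - (k.+1%:R^-1 * dotp v v)) @ \oo --> (0 : R).
  rewrite -[X in _ --> X]oppr0 -(mul0r (dotp v v)); apply: cvgN; apply: cvgM; last exact: cvg_cst.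
  exact: cvg_harmonic.
rewrite -[X in _ --> X]expR0; apply: continuous_cvg => //.
exact: continuous_expR.
Qed.

(** Bessel's inequality for the regularized kernel and the orthonormal products of two Hermite
    functions; the regularization is then removed in the finite sum. The bound is the same for every
    finite family. *)
Lemma weyl_decay_hs (I : finType) (al : I -> {ffun 'I_d -> nat}) : injective al ->
  \sum_i \sum_j normc (inner (hermc (al i)) (weyl r (hermc (al j)))) ^+ 2 <= normc k ^+ 2 * hsc.
Proof.
move=> ial; pose u (ij : I * I) := uu (al ij.1, al ij.2).
have ou ij kl : cintg (prodm lr lr) (fun t => u ij t * conjc (u kl t)) /\
    cint (prodm lr lr) (fun t => u ij t * conjc (u kl t)) = (ij == kl)%:R.
  have h (a b : {ffun 'I_d -> nat}) : cintg lr (fun x => hermc a x * hermc b x) /\ cint lr (fun x => hermc a x * hermc b x) = (a == b)%:R.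
    split; first exact: cintg_mulL2 (square_integrable_hermc a) (square_integrable_hermc b).
    by rewrite -inner_hermc; apply: eq_cint => x; rewrite /hermc conjc_real.
  have E t : hermc (al ij.1) t.1 * hermc (al kl.1) t.1 * (hermc (al ij.2) t.2 * hermc (al kl.2) t.2) = u ij t * conjc (u kl t).
    by rewrite /u uuJ /uu /=; ring.
  split; first exact: eq_cintg E (cintgX (h _ _).1 (h _ _).1).
  rewrite -(eq_cint (prodm lr lr) E) (cintX (h _ _).1 (h _ _).1) !(h _ _).2 !(inj_eq ial) -natrM mulnb.
  by clear E; move: ij kl => [a b] [a' b']; rewrite xpair_eqE.
pose v (n : nat) (ij : I * I) := cint (prodm lr lr) (fun t => (KK t * uu (al ij.1, al ij.2) t) * (rgauss n.+1%:R^-1 (t.1 - t.2))%:C).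
have n0 (n : nat) : 0 < n.+1%:R^-1 :> R by rewrite invr_gt0.
have bv n : \sum_ij normc (v n ij) ^+ 2 <= hsc.
  have [i1 h1] := KK_mollified (n0 n).
  have mf : cmeas (fun t => KK t * (rgauss n.+1%:R^-1 (t.1 - t.2))%:C).
    apply: cmeasM => //; apply: cmeas_real.
    by apply: (measurableT_comp (measurable_rgauss _)); apply: meas_rowB; [exact: measurable_fst|exact: measurable_snd].
  have := bessel (fun ij => meas_uu (al ij.1, al ij.2)) mf ou i1.
  move/le_trans => /(_ _ h1); apply: le_trans; rewrite le_eqVlt; apply/orP; left; apply/eqP.
  apply: eq_bigr => ij _; congr (normc _ ^+ 2); apply: eq_cint => t.
  by rewrite /u uuJ mulrAC.
pose l ij := cint (prodm lr lr) (fun t => KK t * uu (al ij.1, al ij.2) t).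
have cv ij : (fun n => normc (v n ij) ^+ 2) @ \oo --> normc (l ij) ^+ 2.
  have [] := @cint_mollify _ _ R (prodm lr lr) _ (fun n t => rgauss n.+1%:R^-1 (t.1 - t.2)) (cintg_KKu (al ij.1, al ij.2)).
  - move=> n; apply: (measurableT_comp (measurable_rgauss _)).
    by apply: meas_rowB; [exact: measurable_fst|exact: measurable_snd].
  - by move=> n t; rewrite (ltW (rgauss_gt0 _ _)) rgauss_le1// ltW.
  - by move=> t; exact: cvg_rgauss.
  move=> cr ci; rewrite normc_sqr (_ : (fun n => _) = fun n => complex.Re (v n ij) ^+ 2 + complex.Im (v n ij) ^+ 2).
    by apply: cvgD; rewrite expr2; under eq_fun do rewrite expr2; apply: cvgM.
  by apply/funext => n; rewrite normc_sqr.
have cs : (fun n => \sum_ij normc (v n ij) ^+ 2) @ \oo --> \sum_ij normc (l ij) ^+ 2.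
  exact: (@cvg_seq_sum _ (index_enum _) (fun n ij => normc (v n ij) ^+ 2) (fun ij => normc (l ij) ^+ 2) cv).
have bl : \sum_ij normc (l ij) ^+ 2 <= hsc.
  by apply: (ler_cvg_to cs (cvg_cst hsc)); exact: nearW.
rewrite (eq_bigr (fun i => \sum_j normc k ^+ 2 * normc (l (i, j)) ^+ 2)) => [|i _]; last first.
  by apply: eq_bigr => j _; rewrite (weyl_decay_matrix _ _).2 Normc.normcM exprMn.
by rewrite pair_big /= -mulr_sumr ler_wpM2l ?sqr_ge0//.
Qed.
End weyl_of_decaying.

(** * Coherent-state transforms in phase space *)

Section phase_space_products.
Context {R : realType} {d : nat}.
Local Notation C := R[i].
Local Notation lr := (@lebesgue_row R d).
Local Notation lam := (@lebesgue_measure R).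

(** For functions that factor over the pairs (x_i, xi_i): the product formula is applied in xi for
    each fixed x, then in x. The second hypothesis asks for integrable sections at every point, not
    almost every one. *)
Lemma cint_row_prod2 (u : 'I_d -> measurableTypeR R * measurableTypeR R -> C) :
  (forall i, cintg (prodm lam lam) (u i)) -> (forall i s, @cintg _ (measurableTypeR R) R lam (fun t => u i (s, t))) ->
  cintg (prodm lr lr) (fun z => \prod_i u i (z.1 ord0 i, z.2 ord0 i)) /\
  cint (prodm lr lr) (fun z => \prod_i u i (z.1 ord0 i, z.2 ord0 i)) = \prod_i cint (prodm lam lam) (u i).
Proof.
move=> iu is_.
have iz i := cfubini1 (iu i).
have inu i : rintg (prodm lam lam) (fun z => normc (u i z)) := cintg_normc (iu i).
have jn := rint_row_prod (fun i => (rfubini1 (inu i)).1).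
have jx (x : 'rV[R]_d) := rint_row_prod (fun i => cintg_normc (is_ i (x ord0 i))).
have mc (i : 'I_d) : measurable_fun setT (fun z : 'rV[R]_d * 'rV[R]_d => (z.1 ord0 i, z.2 ord0 i) : measurableTypeR R * measurableTypeR R).
  apply/measurable_fun_pairP; split.
    exact: measurableT_comp (measurable_coord i) measurable_fst.
  exact: measurableT_comp (measurable_coord i) measurable_snd.
have mu i : cmeas (fun z : 'rV[R]_d * 'rV[R]_d => u i (z.1 ord0 i, z.2 ord0 i)).
  exact: cmeas_comp (cintg_meas (iu i)) (mc i).
have ip : cintg (prodm lr lr) (fun z => \prod_i u i (z.1 ord0 i, z.2 ord0 i)).
  apply: (@cintg_fubini _ _ _ _ _ lr lr _ _ (fun z => \prod_i normc (u i (z.1 ord0 i, z.2 ord0 i))) _ _ _ _ jn.1).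
  - by apply: cmeas_prod => i _; exact: mu.
  - have h : cmeas (fun z : 'rV[R]_d * 'rV[R]_d => \prod_i u i (z.1 ord0 i, z.2 ord0 i)) by apply: cmeas_prod => i _; exact: mu.
    rewrite [X in measurable_fun _ X](_ : _ = fun z : 'rV[R]_d * 'rV[R]_d => normc (\prod_i u i (z.1 ord0 i, z.2 ord0 i))); first exact: cmeas_normc h.
    by apply/funext => z; rewrite normc_prod.
  - by move=> z; rewrite normc_prod.
  - by move=> x; exact: (jx x).1.
  - by move=> x; rewrite /= (jx x).2.
split=> //; have [_ <-] := cfubini1 ip.
have E (x : 'rV[R]_d) : cint lr (fun y => \prod_i u i ((x, y).1 ord0 i, (x, y).2 ord0 i)) = \prod_i cint lam (fun t => u i (x ord0 i, t)).
  by have [_ <-] := cint_row_prod (fun i => is_ i (x ord0 i)).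
rewrite (eq_cint lr E); have [_ ->] := cint_row_prod (fun i => (iz i).1).
by apply: eq_bigr => i _; exact: (iz i).2.
Qed.

Lemma normc_psi1_le m (x : R) : exists2 M, 0 <= M & forall zeta, normc (psi1 m x zeta) <= M * wt zeta.
Proof.
pose P : {poly C} := ((x%:C)%:P + (0 +i* 1)%C *: 'X) ^+ m.
have c4 : 0 < 4^-1 :> R by rewrite invr_gt0.
have [M M0 HM] := poly_gauss_bounded P 0 c4.
pose k : R := (Num.sqrt (2 * pi * 2 ^+ m * m`!%:R))^-1.
have k0 : 0 <= k by rewrite invr_ge0 sqrtr_ge0.
exists (k * M); first exact: mulr_ge0.
move=> zeta; rewrite /psi1 !Normc.normcM normc_cexpi mulr1 normcR -/k normrM (ger0_norm k0) (ger0_norm (expR_ge0 _)).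
have -> : (x +i* zeta)%C ^+ m = P.[zeta%:C].
  rewrite /P horner_exp !hornerE; congr (_ ^+ m); apply: complex_eqP; rewrite ?ReD ?ImD ?ReM ?ImM /=; ring.
rewrite -!mulrA; apply: ler_wpM2l => //; apply: le_trans (HM zeta).
rewrite mulrC; apply: ler_wpM2l; first exact: normc_ge0.
rewrite ler_expR mul0r addr0 mulrDl opprD (mulrC 4^-1) -[leRHS]add0r lerD2r oppr_le0.
by rewrite divr_ge0// sqr_ge0.
Qed.

Lemma cmeas_psi1 m : cmeas (fun z : measurableTypeR R * measurableTypeR R => psi1 m z.1 z.2).
Proof.
have m1 : measurable_fun [set: measurableTypeR R * measurableTypeR R] (fun z => z.1 : R) := measurable_fst.
have m2 : measurable_fun [set: measurableTypeR R * measurableTypeR R] (fun z => z.2 : R) := measurable_snd.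
apply: cmeasM; first apply: cmeasM.
- apply: cmeas_real; apply: measurable_funM => //; apply: measurableT_comp => //; apply: measurableT_comp => //.
  by apply: measurable_funM => //; apply: measurable_funD; exact: measurable_funX.
- by apply: cmeas_cexpi; apply: measurable_funM => //; exact: measurable_funM.
- elim: m => [|m IH]; first exact: cmeas_cst.
  apply: (eq_cmeas (u := fun z : measurableTypeR R * measurableTypeR R => (z.1 +i* z.2)%C * (z.1 +i* z.2)%C ^+ m)); first by move=> z; rewrite exprS.
  by apply: cmeasM => //; split.
Qed.

Lemma psid_orthonormal (al be : {ffun 'I_d -> nat}) :
  cintg (lebesgue_row (d + d)) (fun w => psid (R := R) al w * conjc (psid be w)) /\
  cint (lebesgue_row (d + d)) (fun w => psid (R := R) al w * conjc (psid be w)) = (al == be)%:R.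
Proof.
pose u (i : 'I_d) (z : measurableTypeR R * measurableTypeR R) : C := psi1 (al i) z.1 z.2 * conjc (psi1 (be i) z.1 z.2).
have iu i : cintg (prodm lam lam) (u i) := (psi1_orthonormal (al i) (be i)).1.
have is_ i s : @cintg _ (measurableTypeR R) R lam (fun t => u i (s, t)).
  have [M1 M10 H1] := normc_psi1_le (al i) s; have [M2 M20 H2] := normc_psi1_le (be i) s.
  apply: (cintg_le _ (rintgZ (M1 * M2) rintg_wt)).
    apply: (cmeas_comp (f := u i)); first exact: cintg_meas (iu i).
    by apply/measurable_fun_pairP; split; [exact: measurable_cst|exact: measurable_id].
  move=> t; rewrite /u Normc.normcM normc_conj.
  apply: le_trans (ler_pM (normc_ge0 _) (normc_ge0 _) (H1 t) (H2 t)) _.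
  have -> : M1 * wt t * (M2 * wt t) = (M1 * M2 * wt t) * wt t by ring.
  by rewrite ler_piMr ?wt_le1// !mulr_ge0 ?wt_ge0.
have [i1 e1] := cint_row_prod2 iu is_.
have ms := @mpres_row_split R d d.
have E w : \prod_i u i ((lsubmx w, rsubmx w).1 ord0 i, (lsubmx w, rsubmx w).2 ord0 i) = psid al w * conjc (psid be w).
  by rewrite /psid conjc_prod -big_split.
split; first exact: (eq_cintg E (mpres_cintg ms i1)).
rewrite -(eq_cint _ E) -(mpres_cint ms i1) e1 (eq_bigr (fun i => (al i == be i)%:R)) => [|i _]; last exact: (psi1_orthonormal _ _).2.
case: eqVneq => [->|ab]; first by rewrite big1// => i _; rewrite eqxx.
have [i ai] : exists i, al i != be i.
  by apply/existsP; apply: contraNT ab => /existsPn h; apply/eqP/ffunP => i; apply/eqP; have := h i; rewrite negbK.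
by rewrite (bigD1 i)//= (negPf ai) mul0r.
Qed.

Lemma cmeas_psid al : cmeas (psid (R := R) (d := d) al).
Proof.
apply: cmeas_prod => i _.
have m1 : measurable_fun setT (fun w : 'rV[R]_(d + d) => lsubmx w ord0 i : measurableTypeR R) := measurableT_comp (measurable_coord i) meas_lsubmx.
have m2 : measurable_fun setT (fun w : 'rV[R]_(d + d) => rsubmx w ord0 i : measurableTypeR R) := measurableT_comp (measurable_coord i) meas_rsubmx.
exact: (cmeas_comp (cmeas_psi1 (al i)) (measurable_fun_pair m1 m2)).
Qed.

Lemma rintg_psid2 al : rintg (lebesgue_row (d + d)) (fun w => normc (psid (R := R) (d := d) al w) ^+ 2).
Proof. by have [[+ _] _] := psid_orthonormal al al; apply: eq_rintg => w; rewrite mulcJ. Qed.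

Lemma Rint_psid2 al : \int[lebesgue_row (d + d)]_w (normc (psid (R := R) (d := d) al w) ^+ 2) = 1.
Proof.
have [_] := psid_orthonormal al al; rewrite eqxx => h; apply: (@complexI R).
rewrite -cint_real; transitivity (cint (lebesgue_row (d + d)) (fun w => psid (R := R) al w * conjc (psid al w))).
  by apply: eq_cint => w; rewrite mulcJ.
by rewrite h.
Qed.

Section coherent_matrix.
Variables (a : 'rV[R]_(d + d) -> C) (B : R).
Hypotheses (ma : cmeas a) (ba : forall z, normc (a z) <= B).

Lemma rintg_apsid al : rintg (lebesgue_row (d + d)) (fun w => normc (a w * psid al w) ^+ 2).
Proof.
apply: (rintg_le _ (rintgZ (B ^+ 2) (rintg_psid2 al))).
  by apply: measurable_funX; apply: cmeas_normc; apply: cmeasM => //; exact: cmeas_psid.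
move=> w; rewrite ger0_norm ?sqr_ge0// Normc.normcM exprMn ler_wpM2r ?sqr_ge0//.
by rewrite lerXn2r ?nnegrE ?normc_ge0//; exact: le_trans (normc_ge0 _) (ba 0).
Qed.

Lemma coherent_matrix_row (I : finType) (al : I -> {ffun 'I_d -> nat}) be : injective al ->
  \sum_i normc (cint (lebesgue_row (d + d)) (fun w => a w * psid be w * conjc (psid (al i) w))) ^+ 2 <= B ^+ 2.
Proof.
move=> ial.
have := @bessel _ _ R (lebesgue_row (d + d)) I (fun i => psid (al i)) (fun w => a w * psid be w)
  (fun i => cmeas_psid (al i)) (cmeasM ma (cmeas_psid be)) _ (rintg_apsid be).
move=> /(_ _)/le_trans; apply.
  move=> i j; have [h1 h2] := psid_orthonormal (al i) (al j); split=> //.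
  by rewrite h2 (inj_eq ial).
rewrite -[leRHS]mulr1 -(Rint_psid2 be) -(RintZ _ (rintg_psid2 be)).
apply: Rint_le; [exact: rintg_apsid|exact: rintgZ (rintg_psid2 be)|].
move=> w; rewrite Normc.normcM exprMn ler_wpM2r ?sqr_ge0//.
by rewrite lerXn2r ?nnegrE ?normc_ge0//; exact: le_trans (normc_ge0 _) (ba 0).
Qed.
End coherent_matrix.
End phase_space_products.

(** * Exponential polynomials and multi-indices of given degree *)

Section exponential_coefficients.
Context {R : realType}.

(** The series of exp(t X) truncated after degree j. Up to that degree, products of such polynomials
    have the coefficients of the exponential of the sum. *)
Definition expoly (j : nat) (t : R) : {poly R} := \poly_(k < j.+1) (t ^+ k / k`!%:R).

Lemma expM_coef j s t (P Q : {poly R}) : (forall k, (k <= j)%N -> P`_k = s ^+ k / k`!%:R) ->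
  (forall k, (k <= j)%N -> Q`_k = t ^+ k / k`!%:R) ->
  forall k, (k <= j)%N -> (P * Q)`_k = (s + t) ^+ k / k`!%:R.
Proof.
move=> HP HQ k kj; rewrite coefM addrC exprDn mulr_suml; apply: eq_bigr => i _.
have ik : (i <= k)%N by rewrite -ltnS.
rewrite HP ?(leq_trans ik kj)// HQ ?(leq_trans (leq_subr _ _) kj)//.
have fk : k`!%:R != 0 :> R by rewrite pnatr_eq0 -lt0n fact_gt0.
have fi : i`!%:R != 0 :> R by rewrite pnatr_eq0 -lt0n fact_gt0.
have fki : (k - i)`!%:R != 0 :> R by rewrite pnatr_eq0 -lt0n fact_gt0.
have := bin_fact ik; move/(congr1 (fun n : nat => n%:R : R)); rewrite !natrM => bf.
rewrite -[_ *+ 'C(k, i)]mulr_natl -[in RHS]bf.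
have c0 : ('C(k, i))%:R != 0 :> R by rewrite pnatr_eq0 -lt0n bin_gt0.
by field; rewrite fi fki c0.
Qed.

Lemma expoly_prod_coef j (I : finType) (t : I -> R) k : (k <= j)%N ->
  (\prod_i expoly j (t i))`_k = (\sum_i t i) ^+ k / k`!%:R.
Proof.
move: k; apply: (big_ind2 (fun (P : {poly R}) s => forall k, (k <= j)%N -> P`_k = s ^+ k / k`!%:R)).
- by move=> [|k] _; rewrite coef1 ?expr0 ?fact0 ?divr1// expr0n mul0r.
- by move=> P s Q s' HP HQ; exact: expM_coef.
- by move=> i _ k kj; rewrite coef_poly ltnS kj.
Qed.
End exponential_coefficients.

Section levels.
Variables (d j : nat).

(** Bounding the entries by j, which the degree forces anyway, makes the multi-indices of degree j a
    finite type. *)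
Definition level : finType := {b : {ffun 'I_d -> 'I_j.+1} | \sum_i (b i : nat) == j}.
Definition lev (b : level) : {ffun 'I_d -> nat} := [ffun i => val b i : nat].

Lemma lev_inj : injective lev.
Proof.
move=> b c /ffunP bc; apply/val_inj/ffunP => i; apply/val_inj.
by have := bc i; rewrite !ffunE.
Qed.

Lemma degree_lev b : degree (lev b) = j.
Proof.
rewrite /degree (eq_bigr (fun i => val b i : nat)); first exact/eqP/(valP b).
by move=> i _; rewrite ffunE.
Qed.

Lemma lev_surj be : degree be = j -> exists b, lev b = be.
Proof.
move=> dj.
have lt i : (be i < j.+1)%N by rewrite ltnS -dj /degree (bigD1 i)//= leq_addr.
pose b : {ffun 'I_d -> 'I_j.+1} := [ffun i => Ordinal (lt i)].
have hb : \sum_i (b i : nat) == j.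
  by rewrite -[X in _ == X]dj /degree; apply/eqP; apply: eq_bigr => i _; rewrite ffunE.
by exists (exist _ b hb); apply/ffunP => i; rewrite !ffunE.
Qed.

(** The multi-indices (k, j - k, 0, ..., 0) with 0 <= k <= j are j + 1 in number: this is where d >=
    2 is used. *)
Lemma card_level : (2 <= d)%N -> (j < #|level|)%N.
Proof.
move=> d2; pose i0 := Ordinal (ltnW d2); pose i1 := Ordinal d2.
pose b (k : 'I_j.+1) : {ffun 'I_d -> 'I_j.+1} := [ffun i => if i == i0 then k else if i == i1 then rev_ord k else ord0].
have hb k : \sum_i (b k i : nat) == j.
  rewrite (bigD1 i0)//= (bigD1 i1)//= big1 => [|i /andP[h0 h1]]; last by rewrite ffunE (negPf h0) (negPf h1).
  by rewrite addr0 /b !ffunE eqxx /=; change (is_true (k + (j.+1 - k.+1) == j)%N); rewrite subSS subnKC// -ltnS.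
have : injective (fun k => exist _ (b k) (hb k) : level).
  by move=> k l /(congr1 val)/ffunP/(_ i0); rewrite !ffunE eqxx.
by move/leq_card; rewrite card_ord.
Qed.
End levels.

Section level_density.
Context {R : realType} {d : nat}.
Local Notation C := R[i].
Local Notation lr2 := (@lebesgue_row R (d + d)).
Implicit Types (w : 'rV[R]_(d + d)).

(* The sum of the squared moduli of the [psid al] over the level j. *)
Definition eta (j : nat) w : R := ((2 * pi) ^- d) * ((dotp w w / 2) ^+ j / j`!%:R) * rgauss 2^-1 w.

Let tt w (i : 'I_d) : R := (lsubmx w ord0 i ^+ 2 + rsubmx w ord0 i ^+ 2) / 2.

(** The multinomial formula, read off the coefficient of X^j in a product of truncated
    exponentials. *)
Lemma sum_multinomial j (t : 'I_d -> R) :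
  \sum_(b : level d j) \prod_i (t i ^+ lev b i / (lev b i)`!%:R) = (\sum_i t i) ^+ j / j`!%:R.
Proof.
rewrite -(expoly_prod_coef t (leqnn j)).
have E i : expoly j (t i) = \sum_(k < j.+1) (t i ^+ k / k`!%:R) *: 'X^k by rewrite /expoly poly_def.
rewrite (eq_bigr _ (fun i _ => E i)) bigA_distr_bigA /= coef_sum.
rewrite (bigID (fun f : {ffun 'I_d -> 'I_j.+1} => \sum_i (f i : nat) == j)) /= [X in _ = _ + X]big1 => [|f fj]; last first.
  rewrite scaler_prod coefZ -(big_morph (fun k => 'X^k : {poly R}) (exprD _) (expr0 _)).
  by rewrite coefXn eq_sym (negPf fj) mulr0.
rewrite addr0 [RHS](reindex_omap (val : level d j -> _) insub) /=; last first.
  by move=> f fj; rewrite insubT.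
apply: eq_big => [b|b _]; first by move: (valP b) => /= ->; rewrite (valK b) eqxx.
apply/esym; rewrite scaler_prod coefZ -(big_morph (fun k => 'X^k : {poly R}) (exprD _) (expr0 _)).
rewrite coefXn eq_sym (valP b) mulr1; apply: eq_bigr => i _.
by rewrite ffunE.
Qed.

Lemma sum_psid2 j w : \sum_(b : level d j) normc (psid (R := R) (lev b) w) ^+ 2 = eta j w.
Proof.
have S : \sum_i tt w i = dotp w w / 2.
  rewrite /tt -mulr_suml big_split /dotp big_split_ord /=; congr (_ / 2).
  by congr (_ + _); apply: eq_bigr => i _; rewrite mxE expr2.
have G : \prod_i expR (- tt w i) = rgauss 2^-1 w.
  by rewrite -expR_sum sumrN S /rgauss mulrC.
rewrite (eq_bigr (fun b : level d j => ((2 * pi) ^- d * rgauss 2^-1 w) * \prod_i (tt w i ^+ lev b i / (lev b i)`!%:R))) => [|b _].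
  by rewrite -mulr_sumr sum_multinomial S /eta; ring.
rewrite /psid normc_prod -prodrXl (eq_bigr (fun i => (2 * pi)^-1 * ((tt w i ^+ lev b i / (lev b i)`!%:R) * expR (- tt w i)))) => [|i _].
  by rewrite big_split big_split /= prodr_const card_ord exprVn G; ring.
by rewrite psi1_sqr /tt; ring.
Qed.

Lemma eta_ge0 j w : 0 <= eta j w.
Proof. by rewrite -sum_psid2; apply: sumr_ge0 => b _; exact: sqr_ge0. Qed.

Lemma rintg_eta j : rintg lr2 (eta j).
Proof.
apply: (eq_rintg (sum_psid2 j)); apply: (@rintg_sum _ _ _ _ _ (index_enum (level d j)) xpredT (fun b w => normc (psid (lev b) w) ^+ 2)) => b _.
exact: rintg_psid2.
Qed.

Lemma Rint_eta j : \int[lr2]_w eta j w = #|level d j|%:R.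
Proof.
rewrite -(eq_Rint lr2 (sum_psid2 j)).
rewrite (@Rint_sum _ _ _ lr2 _ (index_enum (level d j)) xpredT (fun b w => normc (psid (lev b) w) ^+ 2)); last first.
  by move=> b _; exact: rintg_psid2.
by rewrite (eq_bigr (fun=> 1)) ?sumr_const// => b _; exact: Rint_psid2.
Qed.

Lemma pow_fact_le_expR (t : R) j : 0 <= t -> t ^+ j / j`!%:R <= expR t.
Proof.
move=> t0; case: j => [|j].
  by rewrite expr0 fact0 divr1; apply: le_trans (expR_ge1Dx t); rewrite lerDl.
by apply: le_trans (expR_ge1Dxn j t0); rewrite lerDr.
Qed.
End level_density.

(** * Trace asymptotics *)

Section admissible_symbols.
Context {R : realType} {d : nat}.
Local Notation C := R[i].
Local Notation lr := (@lebesgue_row R d).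
Local Notation lr2 := (@lebesgue_row R (d + d)).
Local Notation idx := {ffun 'I_d -> nat}.
Local Notation mult j := (#|level d j|%:R : R).
Implicit Types (A : 'rV[R]_(d + d) -> C) (T : idx -> idx -> C) (L : C) (al be : idx).

(** [weyl] iterates an integral that is total, so that it is additive in the symbol only where every
    stage converges. These conditions say so for the integrals in xi and in x; for the one in y,
    boundedness of A suffices. *)
Definition wpiece A := [/\ cmeas A, exists B, forall z, normc (A z) <= B,
  forall be x, cintg lr (fun xi => cint lr (weylf A be x xi)) &
  forall al be, cintg lr (fun x => hermc al x * weyl A (hermc be) x)].

Definition wmat A al be : C := inner (hermc al) (weyl A (hermc be)).

Lemma wmatE A al be : wmat A al be = cint lr (fun x => hermc al x * weyl A (hermc be) x).
Proof. by apply: eq_cint => x; rewrite /hermc conjc_real. Qed.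

Local Opaque wmat.

Lemma weylE A be x : weyl A (hermc be) x = ((2 * pi) ^- d)%:C * cint lr (fun xi => cint lr (weylf A be x xi)).
Proof. by []. Qed.

Lemma wpieceD A1 A2 : wpiece A1 -> wpiece A2 -> wpiece (fun z => A1 z + A2 z) /\
  forall al be, wmat (fun z => A1 z + A2 z) al be = wmat A1 al be + wmat A2 al be.
Proof.
move=> [m1 [B1 b1] o1 h1] [m2 [B2 b2] o2 h2].
have E1 be x xi : cint lr (weylf A1 be x xi) + cint lr (weylf A2 be x xi) = cint lr (weylf (fun z => A1 z + A2 z) be x xi).
  rewrite -(cintD (cintg_weylf be x xi m1 b1) (cintg_weylf be x xi m2 b2)); apply: eq_cint => y.
  by rewrite /weylf mulrDr mulrDl.
have E2 be x : weyl A1 (hermc be) x + weyl A2 (hermc be) x = weyl (fun z => A1 z + A2 z) (hermc be) x.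
  by rewrite !weylE -mulrDr -(cintD (o1 be x) (o2 be x)) (eq_cint lr (E1 be x)).
have E3 al be x : hermc al x * weyl A1 (hermc be) x + hermc al x * weyl A2 (hermc be) x = hermc al x * weyl (fun z => A1 z + A2 z) (hermc be) x.
  by rewrite -mulrDr E2.
split; last by move=> al be; rewrite !wmatE -(cintD (h1 al be) (h2 al be)) (eq_cint lr (E3 al be)).
split.
- exact: cmeasD.
- by exists (B1 + B2) => z; apply: le_trans (normcD_le _ _) _; exact: lerD.
- by move=> be x; exact: (eq_cintg (E1 be x) (cintgD (o1 be x) (o2 be x))).
- by move=> al be; exact: (eq_cintg (E3 al be) (cintgD (h1 al be) (h2 al be))).
Qed.

Definition hs_bounded T := exists2 K : R, 0 <= K & forall j,
  \sum_(b : level d j) \sum_(c : level d j) normc (T (lev b) (lev c)) ^+ 2 <= K * mult j.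

(** This amounts to o(N_j) once N_j tends to infinity, in a form that is stable under sums and does
    not refer to that limit. *)
Definition small (t : nat -> C) := forall eps : R, 0 < eps -> exists K : R, forall j,
  normc (t j) <= K + eps * mult j.

Lemma smallD s t : small s -> small t -> small (fun j => s j + t j).
Proof.
move=> hs ht eps e0; have e2 : 0 < eps / 2 by rewrite divr_gt0.
have [K1 h1] := hs _ e2; have [K2 h2] := ht _ e2; exists (K1 + K2) => j.
by apply: le_trans (normcD_le _ _) _; have := h1 j; have := h2 j; lra.
Qed.

Lemma eq_small s t : s =1 t -> small s -> small t.
Proof. by move=> st hs eps e0; have [K h] := hs _ e0; exists K => j; rewrite -st. Qed.

Definition admissible A L := [/\ wpiece A, hs_bounded (wmat A) &
  small (fun j => \sum_(b : level d j) wmat A (lev b) (lev b) - L * (mult j)%:C)].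

Lemma double_sum_le (s1 s2 K1 K2 m : R) : s1 <= K1 * m -> s2 <= K2 * m -> 2 * s1 + 2 * s2 <= (2 * K1 + 2 * K2) * m.
Proof. by lra. Qed.

Lemma trace_sum_split (t t1 t2 L1 L2 m : C) : t = t1 + t2 -> t1 - L1 * m + (t2 - L2 * m) = t - (L1 + L2) * m.
Proof. by move=> ->; ring. Qed.

Lemma admissibleD A1 A2 L1 L2 : admissible A1 L1 -> admissible A2 L2 ->
  admissible (fun z => A1 z + A2 z) (L1 + L2).
Proof.
move=> [p1 [K1 K10 h1] s1] [p2 [K2 K20 h2] s2]; have [p12 E] := wpieceD p1 p2.
split=> //.
  exists (2 * K1 + 2 * K2) => [|j]; first by rewrite addr_ge0// mulr_ge0.
  apply: le_trans (_ : \sum_(b : level d j) \sum_(c : level d j) (2 * normc (wmat A1 (lev b) (lev c)) ^+ 2 + 2 * normc (wmat A2 (lev b) (lev c)) ^+ 2) <= _).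
    apply: ler_sum => b _; apply: ler_sum => c _; rewrite E.
    by apply: sqr_triangle; [exact: normc_ge0|exact: normcD_le].
  have S2 (I : finType) (f g : I -> R) : \sum_i (2 * f i + 2 * g i) = 2 * \sum_i f i + 2 * \sum_i g i.
    by rewrite big_split -!mulr_sumr.
  rewrite (eq_bigr _ (fun b _ => S2 _ (fun c : level d j => normc (wmat A1 (lev b) (lev c)) ^+ 2) (fun c => normc (wmat A2 (lev b) (lev c)) ^+ 2))).
  rewrite (S2 _ (fun b : level d j => \sum_(c : level d j) normc (wmat A1 (lev b) (lev c)) ^+ 2)
    (fun b => \sum_(c : level d j) normc (wmat A2 (lev b) (lev c)) ^+ 2)).
  exact: double_sum_le (h1 j) (h2 j).
have TE j : \sum_(b : level d j) wmat (fun z => A1 z + A2 z) (lev b) (lev b) =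
    \sum_(b : level d j) wmat A1 (lev b) (lev b) + \sum_(b : level d j) wmat A2 (lev b) (lev b).
  by rewrite -big_split; apply: eq_bigr => b _; exact: E.
by apply: eq_small (smallD s1 s2) => j; exact: (trace_sum_split L1 L2 _ (TE j)).
Qed.

Lemma eq_admissible A A' L : A =1 A' -> admissible A L -> admissible A' L.
Proof. by move=> /funext ->. Qed.

Lemma wpiece_gconv a B : cmeas a -> (forall z, normc (a z) <= B) -> wpiece (gconv a).
Proof.
move=> ma ba; split; first exact: cmeas_gconv ma ba.
- by exists B; exact: gconv_le ma ba.
- by move=> be x; exact: cintg_weyl_gconv ma ba be x.
- by move=> al be; exact: (weyl_gconv_matrix ma ba al be).1.
Qed.

Lemma wmat_gconv a B al be : cmeas a -> (forall z, normc (a z) <= B) ->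
  wmat (gconv a) al be = cint lr2 (fun w => a w * psid al w * conjc (psid be w)).
Proof. by move=> ma ba; exact: (weyl_gconv_matrix ma ba al be).2. Qed.

Lemma hs_bounded_gconv a B : cmeas a -> (forall z, normc (a z) <= B) -> hs_bounded (wmat (gconv a)).
Proof.
move=> ma ba; exists (B ^+ 2) => [|j]; first exact: sqr_ge0.
rewrite mulr_natr -sumr_const; apply: ler_sum => b _.
rewrite (eq_bigr (fun c : level d j => normc (cint lr2 (fun w => a w * psid (lev b) w * conjc (psid (lev c) w))) ^+ 2)) => [|c _].
  exact: (coherent_matrix_row ma ba (lev b) (@lev_inj d j)).
by rewrite (wmat_gconv _ _ ma ba).
Qed.

Lemma cintg_eta a B j : cmeas a -> (forall z, normc (a z) <= B) -> cintg lr2 (fun w => a w * (eta j w)%:C).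
Proof.
move=> ma ba; apply: (cintg_le _ (rintgZ B (@rintg_eta R d j))).
  by apply: cmeasM => //; apply: cmeas_real; exact: rintg_meas (@rintg_eta R d j).
by move=> w; rewrite Normc.normcM normcR ger0_norm ?eta_ge0// ler_wpM2r ?eta_ge0.
Qed.

Lemma trace_gconv a B j : cmeas a -> (forall z, normc (a z) <= B) ->
  \sum_(b : level d j) wmat (gconv a) (lev b) (lev b) = cint lr2 (fun w => a w * (eta j w)%:C).
Proof.
move=> ma ba.
have iP (b : level d j) : cintg lr2 (fun w => a w * psid (lev b) w * conjc (psid (lev b) w)).
  apply: (cintg_le _ (rintgZ B (rintg_psid2 (lev b)))).
    apply: cmeasM; last exact: cmeas_conj (cmeas_psid _).
    by apply: cmeasM => //; exact: cmeas_psid.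
  move=> w; rewrite !Normc.normcM normc_conj -mulrA -expr2.
  by rewrite ler_wpM2r ?sqr_ge0.
rewrite (eq_bigr (fun b : level d j => cint lr2 (fun w => a w * psid (lev b) w * conjc (psid (lev b) w)))) => [|b _]; last exact: wmat_gconv ma ba.
rewrite -(@cint_sum _ _ R lr2 _ (index_enum (level d j)) xpredT _ (fun b _ => iP b)).
apply: eq_cint => w; rewrite -sum_psid2 rmorph_sum mulr_sumr; apply: eq_bigr => b _.
by rewrite -mulrA mulcJ.
Qed.

Lemma eta_le j w : eta (R := R) (d := d) j w <= (2 * pi) ^- d.
Proof.
have p0 : 0 <= (2 * pi) ^- d :> R by rewrite invr_ge0 exprn_ge0// mulr_ge0// pi_ge0.
rewrite /eta -mulrA ler_piMr//.
have t0 : 0 <= dotp w w / 2 by rewrite divr_ge0// dotp_ge0.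
have := pow_fact_le_expR j t0; have := expR_gt0 (dotp w w / 2).
rewrite /rgauss (mulrC 2^-1) expRN => e0 h.
by rewrite ler_pdivrMr// mul1r.
Qed.

(** On the ball exp(rho^2 - |w|^2) >= 1, so the constant bound of [eta] can be traded for an
    integrable gaussian that does not depend on j. *)
Lemma eta_ball (rho : R) j w : enorm w <= rho ->
  eta (R := R) (d := d) j w <= (2 * pi) ^- d * expR (rho ^+ 2) * rgauss 1 w.
Proof.
move=> wr; apply: le_trans (eta_le j w) _.
have p0 : 0 <= (2 * pi) ^- d :> R by rewrite invr_ge0 exprn_ge0// mulr_ge0// pi_ge0.
rewrite -mulrA ler_peMr// /rgauss -expRD -[leLHS]expR0 ler_expR mul1r subr_ge0 -enorm_sqr.
by rewrite lerXn2r ?nnegrE ?enorm_ge0//; exact: le_trans (enorm_ge0 w) wr.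
Qed.

Lemma admissible_gconv_decay k a : symb k.+1 a -> admissible (gconv a) 0.
Proof.
move=> sa; have [B B0 ba] := symb_bounded sa; have [ma ha] := sa.
split; [exact: wpiece_gconv ma ba|exact: hs_bounded_gconv ma ba|].
have [D [K hD]] := ha 0%N.
have D1 w : normc (a w) <= D * (jb w)^-1.
  apply: le_trans (hD [::] erefl w) _; rewrite big_nil mulr1 addn0.
  have D0 : 0 <= D.
    have := le_trans (normc_ge0 _) (hD [::] erefl w); rewrite big_nil mulr1 pmulr_lge0// invr_gt0.
    by rewrite exprn_gt0// jb_gt0.
  rewrite ler_wpM2l// lef_pV2 ?posrE ?exprn_gt0 ?jb_gt0// -[leLHS]expr1.
  by apply: ler_weXn2l => //; exact: jb_ge1.
have D0 : 0 <= D by have := le_trans (normc_ge0 _) (D1 0); rewrite pmulr_lge0// invr_gt0 jb_gt0.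
(* Outside the ball of radius D / eps the symbol, bounded by D / (1 + |w|), is at most eps; inside,
   [eta_ball] gives a contribution bounded in j. *)
move=> eps e0; pose rho := D / eps; have r0 : 0 <= rho by rewrite divr_ge0// ltW.
pose c := D * ((2 * pi) ^- d * expR (rho ^+ 2)).
have ig := rintgZ c (rintg_rgauss (d + d) (@ltr01 R)).
exists (\int[lr2]_w (c * rgauss 1 w)) => j; rewrite mul0r subr0 (trace_gconv j ma ba).
have ie := rintgZ eps (@rintg_eta R d j).
apply: le_trans (normc_cint_le (cintg_eta j ma ba) (rintgD ig ie) _) _; last first.
  by rewrite (RintD ig ie) (RintZ _ (@rintg_eta R d j)) Rint_eta.
move=> w; rewrite Normc.normcM normcR ger0_norm ?eta_ge0//.
have h0 := eta_ge0 j w; have g0 : 0 <= c * rgauss 1 w.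
  rewrite !mulr_ge0 ?expR_ge0 ?(ltW (rgauss_gt0 _ _))// invr_ge0 exprn_ge0// mulr_ge0// pi_ge0.
  by [].
have [wr|rw] := leP (enorm w) rho.
  have aD : normc (a w) <= D.
    by apply: le_trans (D1 w) _; rewrite ler_piMr// invf_le1 ?jb_ge1// jb_gt0.
  have h1 := eta_ball j wr; have h2 : 0 <= eps * eta j w by rewrite mulr_ge0// ltW.
  apply: le_trans (ler_pM (normc_ge0 _) h0 aD h1) _; rewrite mulrA -/c; lra.
have h1 : normc (a w) <= eps.
  apply: le_trans (D1 w) _; rewrite ler_pdivrMr ?jb_gt0//.
  move: rw; rewrite /rho ltr_pdivrMr// /jb => rw; lra.
have := ler_wpM2r h0 h1; lra.
Qed.

Lemma admissible_decay r B : cmeas r -> (forall z, normc (r z) <= B * rwt z) -> admissible r 0.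
Proof.
move=> mr br.
have B0 : 0 <= B.
  have /(le_trans (normc_ge0 _)) := br 0; rewrite pmulr_lge0// /rwt.
  by apply: prodr_gt0 => i _; exact: wt_gt0.
have [K hK] : exists K, forall j, \sum_(b : level d j) \sum_(c : level d j) normc (wmat r (lev b) (lev c)) ^+ 2 <= K.
  by eexists => j; exact: (weyl_decay_hs mr br (@lev_inj d j)).
have hK0 j : 0 <= \sum_(b : level d j) \sum_(c : level d j) normc (wmat r (lev b) (lev c)) ^+ 2.
  by apply: sumr_ge0 => b _; apply: sumr_ge0 => c _; exact: sqr_ge0.
have K0 : 0 <= K := le_trans (hK0 0%N) (hK 0%N).
split.
- split=> //.
  + by exists B => z; apply: le_trans (br z) _; rewrite ler_piMr// rwt_le1.
  + by move=> be x; exact: cintg_weyl_decay mr br be x.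
  + by move=> al be; exact: (weyl_decay_matrix mr br al be).1.
- exists K => // j; have [m0|m0] := posnP #|level d j|; last first.
    by apply: le_trans (hK j) _; rewrite ler_peMr// ler1n.
  rewrite m0 mulr0 big1// => b _; exfalso.
  by have := max_card (pred1 b); rewrite m0 card1.
move=> eps e0; exists (K / eps) => j; rewrite mul0r subr0.
apply: le_trans (normc_sum_le _ _ _) _.
(* Used in place of Cauchy-Schwarz: it bounds the trace by the squared Hilbert-Schmidt norm over eps
   plus eps N_j, which is the shape of [small]. *)
have h t : 0 <= t -> t <= t ^+ 2 / eps + eps :> R.
  move=> t0; rewrite -(ler_pM2r e0) mulrDl divfK ?lt0r_neq0//.
  have := sqr_ge0 (t - eps / 2); have := sqr_ge0 eps; lra.
apply: le_trans (_ : \sum_(b : level d j) (normc (wmat r (lev b) (lev b)) ^+ 2 / eps + eps) <= _).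
  by apply: ler_sum => b _; apply: h; exact: normc_ge0.
rewrite big_split /= sumr_const -(mulr_natr eps) lerD2r -mulr_suml ler_wpM2r ?invr_ge0 ?(ltW e0)//.
apply: le_trans (hK j); apply: ler_sum => b _.
by rewrite (bigD1 b)//= lerDl; apply: sumr_ge0 => c _; exact: sqr_ge0.
Qed.

Section homogeneous_average.
Variables (L2 : probability 'rV[R]_(d + d) R) (A : 'rV[R]_(d + d) -> C) (B : R).
Hypotheses (hL2 : uniform_on_sphere (Num.sqrt 2) L2) (hA : symbol_S11 A) (bA : forall z, normc (A z) <= B).

Let sq2 : 0 < Num.sqrt 2 :> R. Proof. by rewrite sqrtr_gt0. Qed.

(** The part of [eta] outside the open ball of radius sqrt 2, where the symbol is homogeneous. *)
Let W j (w : 'rV[R]_(d + d)) : R := eta j w * ((Num.sqrt 2 <= enorm w)%R)%:R.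

Let W_le j w : 0 <= eta j w - W j w <= (2 * pi) ^- d * expR 2 * rgauss 1 w.
Proof.
rewrite /W; have [h|h] := leP (Num.sqrt 2) (enorm w).
  rewrite mulr1 subrr lexx /= !mulr_ge0 ?expR_ge0 ?(ltW (rgauss_gt0 _ _))// invr_ge0 exprn_ge0// mulr_ge0// pi_ge0.
  by [].
rewrite mulr0 subr0 eta_ge0 /=; have := eta_ball j (ltW h); rewrite sqr_sqrtr//.
Qed.

Let meas_ind : measurable_fun setT (fun w : 'rV[R]_(d + d) => ((Num.sqrt 2 <= enorm w)%R)%:R : R).
Proof.
rewrite (_ : (fun w => _) = \1_[set w : 'rV[R]_(d + d) | Num.sqrt 2 <= enorm w]); last first.
  apply/funext => w; rewrite indicE; case: (boolP (Num.sqrt 2 <= enorm w)) => h; first by rewrite mem_set.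
  by rewrite memNset//; exact/negP.
apply: measurable_indic.
have := (meas_enorm (@measurable_id _ 'rV[R]_(d + d) setT)) measurableT _ (measurable_itv `[Num.sqrt 2, +oo[).
rewrite setTI; congr (measurable _); apply/seteqP; split=> w /=; rewrite in_itv /= andbT//.
Qed.

Let rintg_W j : rintg lr2 (W j).
Proof.
apply: (rintg_le _ (@rintg_eta R d j)).
  by apply: measurable_funM; [have h := rintg_meas (@rintg_eta R d j); exact: h|exact: meas_ind].
move=> w; have h0 := eta_ge0 j w; rewrite /W; case: (Num.sqrt 2 <= enorm w).
  by rewrite mulr1 ger0_norm.
by rewrite mulr0 normr0.
Qed.

(** Outside the ball [radial_average] gives an exact equality. The whole error is the integral of f
    minus its mean against [eta j - W j], which lives in the ball and has an integrable majorant
    independent of j. *)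
Let avg (f : 'rV[R]_(d + d) -> R) : smooth f -> (forall z, `|f z| <= B) ->
  (forall l z, 1 <= l -> Num.sqrt 2 <= enorm z -> f (l *: z) = f z) ->
  exists K : R, forall j, `|\int[lr2]_w (f w * eta j w) - (\int[L2]_x f x) * mult j| <= K.
Proof.
move=> sf bf hf; pose l := \int[L2]_x f x; pose g (w : 'rV[R]_(d + d)) : R := (2 * pi) ^- d * expR 2 * rgauss 1 w.
have ig : rintg lr2 g := rintgZ _ (rintg_rgauss (d + d) (@ltr01 R)).
exists (\int[lr2]_w ((B + `|l|) * g w)) => j.
have mf := continuous_row_measurable (sf [::]).1.
have ife h : rintg lr2 h -> rintg lr2 (fun w => f w * h w).
  move=> ih; apply: (rintg_le _ (rintgZ B (rintg_norm ih))).
    by apply: measurable_funM => //; exact: rintg_meas ih.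
  by move=> w; rewrite normrM ler_wpM2r.
have ra := @radial_average R (d + d) (Num.sqrt 2) L2 sq2 hL2 f (W j) B (sf [::]).1 bf _ _ (rintg_W j) _ _.
have {}ra : \int[lr2]_w (f w * W j w) = l * \int[lr2]_w W j w.
  apply: ra.
  - move=> z hz; have z0 : 0 < enorm z := lt_le_trans sq2 hz.
    have zE : z = (Num.sqrt 2 / enorm z)^-1 *: ((Num.sqrt 2 / enorm z) *: z).
      by rewrite scalerA mulVf ?scale1r// lt0r_neq0// divr_gt0.
    rewrite [in LHS]zE hf//; first by rewrite invf_div ler_pdivlMr// mul1r.
    by rewrite enormZ gtr0_norm ?divr_gt0// divfK// lt0r_neq0.
  - by move=> z; rewrite /W mulr_ge0 ?eta_ge0.
  - by move=> z hz; rewrite /W leNgt hz mulr0.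
  - by move=> Q z QQ; rewrite /W /eta /rgauss -!enorm_sqr !enorm_mul.
have E w : (f w - l) * (eta j w - W j w) = (f w * eta j w - f w * W j w) - l * (eta j w - W j w) by ring.
have ie := @rintg_eta R d j.
have -> : \int[lr2]_w (f w * eta j w) - l * mult j = \int[lr2]_w ((f w - l) * (eta j w - W j w)).
  rewrite (eq_Rint lr2 E) (RintB (rintgB (ife _ ie) (ife _ (rintg_W j))) (rintgZ _ (rintgB ie (rintg_W j)))).
  rewrite (RintB (ife _ ie) (ife _ (rintg_W j))) (RintZ _ (rintgB ie (rintg_W j))) (RintB ie (rintg_W j)).
  by rewrite ra Rint_eta; ring.
have ii : rintg lr2 (fun w => (f w - l) * (eta j w - W j w)).
  exact: (eq_rintg (fun w => esym (E w)) (rintgB (rintgB (ife _ ie) (ife _ (rintg_W j))) (rintgZ _ (rintgB ie (rintg_W j))))).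
apply: norm_Rint_le => //; first exact: rintgZ.
move=> w; have /andP[w0 w1] := W_le j w; rewrite normrM (ger0_norm w0).
by apply: ler_pM => //; apply: le_trans (ler_normB _ _) _; rewrite lerD2r.
Qed.

Lemma admissible_gconv_symbol : cmeas A -> admissible (gconv A) (cint L2 A).
Proof.
move=> mA; split; [exact: wpiece_gconv mA bA|exact: hs_bounded_gconv mA bA|].
have [[sr si] [eps0 [e0 e2 hom]]] := hA.
have hom2 l z : 1 <= l -> Num.sqrt 2 <= enorm z -> A (l *: z) = A z.
  by move=> l1 hz; apply: hom => //; exact: le_trans (ltW e2) hz.
have [K1 h1] := avg sr (fun z => le_trans (Re_le_normc _) (bA z)) (fun l z l1 hz => congr1 (@complex.Re R) (hom2 l z l1 hz)).
have [K2 h2] := avg si (fun z => le_trans (Im_le_normc _) (bA z)) (fun l z l1 hz => congr1 (@complex.Im R) (hom2 l z l1 hz)).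
move=> eps ep; exists (K1 + K2) => j; rewrite (trace_gconv j mA bA).
have m0 : 0 <= eps * mult j by rewrite mulr_ge0// ltW.
apply: le_trans (normc_le_ReIm _) _.
apply: le_trans (_ : K1 + K2 <= _); last by rewrite lerDl.
apply: lerD.
  apply: le_trans (h1 j); rewrite ReD ReN ReM /= mulr0 subr0 le_eqVlt; apply/orP; left; apply/eqP; congr (`| _ - _ |).
  by apply: eq_Rint => w; rewrite ReM /= mulr0 subr0.
apply: le_trans (h2 j); rewrite ImD ImN ImM /= mulr0 add0r le_eqVlt; apply/orP; left; apply/eqP; congr (`| _ - _ |).
by apply: eq_Rint => w; rewrite ImM /= mulr0 add0r.
Qed.
End homogeneous_average.

Lemma admissible_symbol (L2 : probability 'rV[R]_(d + d) R) A :
  uniform_on_sphere (Num.sqrt 2) L2 -> symbol_S11 A -> admissible A (cint L2 A).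
Proof.
move=> hL2 hA; have sA := symbol_S11_symb hA; have [B B0 bA] := symb_bounded sA.
(* By induction on the number of terms, each being added to r: the term k = 0 carries the limit,
   while those with k > 0 have negative order and contribute 0. *)
have main n r : admissible r 0 ->
    admissible (fun z => \sum_(k < n.+1) gconv (iter k remainder A) z + r z) (cint L2 A).
  elim: n r => [|n IH] r ar.
    apply: eq_admissible (_ : admissible (fun z => gconv A z + r z) _); first by move=> z; rewrite big_ord1.
    have ag := admissible_gconv_symbol hL2 hA bA sA.1.
    by have := admissibleD ag ar; rewrite addr0; exact.
  apply: eq_admissible (IH (fun z => gconv (iter n.+1 remainder A) z + r z) _).
    by move=> z; rewrite [in RHS]big_ord_recr /= addrA.
  have ag := admissible_gconv_decay (symb_iter n.+1 sA).
  by have := admissibleD ag ar; rewrite addr0; exact.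
(* A remainder of order at most - 2 (d + d) is dominated by [rwt] on phase space; the successor
   matches the n.+1 terms of [main]. *)
pose m := (2 * (d + d)).+1.
have [D D0 hD] := symb_rwt (leqW (leqnn (2 * (d + d)))) (symb_iter m sA).
have ar := admissible_decay (symb_iter m sA).1 hD.
apply: eq_admissible (main _ _ ar) => z; rewrite -/m.
by rewrite [RHS](gconv_decomposition m A z).
Qed.
End admissible_symbols.

(** * Random bases *)

Section weyl_linearity.
Context {R : realType} {d : nat}.
Local Notation C := R[i].
Local Notation lr := (@lebesgue_row R d).
Local Notation idx := {ffun 'I_d -> nat}.
Variables (A : 'rV[R]_(d + d) -> C) (I : finType) (c : I -> C) (al : I -> idx) (phi : 'rV[R]_d -> C).
Hypotheses (pA : wpiece A) (sphi : square_integrable phi)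
  (ephi : {ae lr, forall x, phi x = \sum_i c i * hermc (al i) x}).

(** The identity holds at every x although phi is known only almost everywhere, since phi enters
    under an integral. *)
Lemma weyl_lincomb x : weyl A phi x = \sum_i c i * weyl A (hermc (al i)) x.
Proof.
have [mA [B bA] o1 _] := pA.
have inn xi : cint lr (fun y => cexpi (dotp (x - y) xi) * A (row_mx (2^-1 *: (x + y)) xi) * phi y) =
    \sum_i c i * cint lr (weylf A (al i) x xi).
  have iw i : cintg lr (fun y => c i * weylf A (al i) x xi y) := cintgZ (c i) (cintg_weylf (al i) x xi mA bA).
  transitivity (cint lr (fun y => \sum_i c i * weylf A (al i) x xi y)); last first.
    rewrite (@cint_sum _ _ R lr _ (index_enum I) xpredT _ (fun i _ => iw i)).
    by apply: eq_bigr => i _; exact: (cintZ _ (cintg_weylf (al i) x xi mA bA)).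
  apply: cint_ae.
  - apply: cmeasM; last exact: square_integrable_meas.
    apply: cmeasM.
      apply: cmeas_cexpi; apply: meas_dotp; last exact: measurable_cst.
      by apply: meas_rowB; [exact: measurable_cst|exact: measurable_id].
    apply: cmeas_comp => //; apply: meas_row_mx; last exact: measurable_cst.
    by apply: meas_rowZ; apply: meas_rowD; [exact: measurable_cst|exact: measurable_id].
  - by apply: cmeas_sum => i _; exact: cintg_meas (iw i).
  - apply: filterS ephi => y ->; rewrite mulr_sumr; apply: eq_bigr => i _.
    by rewrite /weylf mulrCA.
rewrite /weyl (eq_cint lr inn).
have io i := cintgZ (c i) (o1 (al i) x).
rewrite (@cint_sum _ _ R lr _ (index_enum I) xpredT _ (fun i _ => io i)) mulr_sumr; apply: eq_bigr => i _.
by rewrite (cintZ _ (o1 (al i) x)) mulrCA.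
Qed.

Lemma inner_weyl_lincomb : inner phi (weyl A phi) =
  \sum_i conjc (c i) * \sum_k wmat A (al i) (al k) * c k.
Proof.
have [mA _ _ o2] := pA.
have mw k : cmeas (fun x => c k * weyl A (hermc (al k)) x) by apply: cmeasM; [exact: cmeas_cst|exact: cmeas_weyl].
have iz i k : cintg lr (fun x => conjc (c i) * c k * (hermc (al i) x * weyl A (hermc (al k)) x)) := cintgZ _ (o2 (al i) (al k)).
transitivity (cint lr (fun x => \sum_i \sum_k conjc (c i) * c k * (hermc (al i) x * weyl A (hermc (al k)) x))).
  apply: cint_ae.
  - apply: cmeasM; first exact: cmeas_conj (square_integrable_meas sphi).
    rewrite (_ : weyl A phi = fun x => \sum_k c k * weyl A (hermc (al k)) x); last by apply/funext => x; exact: weyl_lincomb.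
    by apply: cmeas_sum => k _; exact: mw.
  - by apply: cmeas_sum => i _; apply: cmeas_sum => k _; exact: cintg_meas (iz i k).
  - apply: filterS ephi => x hx; rewrite weyl_lincomb hx conjc_sum mulr_suml; apply: eq_bigr => i _.
    by rewrite mulr_sumr; apply: eq_bigr => k _; rewrite conjcM {1}/hermc conjc_real -/(hermc (al i) x); ring.
rewrite (@cint_sum _ _ R lr _ (index_enum I) xpredT (fun i x => \sum_k conjc (c i) * c k * (hermc (al i) x * weyl A (hermc (al k)) x))); last first.
  by move=> i _; apply: cintg_sum => k _; exact: iz.
apply: eq_bigr => i _.
rewrite (@cint_sum _ _ R lr _ (index_enum I) xpredT _ (fun k _ => iz i k)) mulr_sumr; apply: eq_bigr => k _.
by rewrite (cintZ _ (o2 _ _)) -wmatE; ring.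
Qed.
End weyl_linearity.

Section matrices.
Context {R : realType}.
Local Notation C := R[i].
Local Notation cj M := (map_mx (@conjc R) M).

Lemma cjK m n (M : 'M[C]_(m, n)) : cj (cj M) = M.
Proof. by apply/matrixP => i k; rewrite !mxE conjcK. Qed.

Lemma hsnorm2_trace n (M : 'M[C]_n) : (hsnorm2 M)%:C = \tr (M *m cj M^T).
Proof.
rewrite /hsnorm2 rmorph_sum; apply: eq_bigr => i _; rewrite mxE rmorph_sum; apply: eq_bigr => k _.
by rewrite !mxE mulcJ.
Qed.

Lemma qform_mulmx n (l : 'I_n) (M : 'M[C]_n) (U : unitary_group R n) :
  qform l M U = (cj (val U) *m (M *m (val U)^T)) l l.
Proof.
rewrite mxE; apply: eq_bigr => b _; rewrite !mxE; congr (_ * _); apply: eq_bigr => k _.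
by rewrite mxE.
Qed.

Section change_of_basis.
Variables (n m : nat) (D : 'M[C]_(n, m)) (T : 'M[C]_m).
Hypothesis (DD : cj D^T *m D = 1%:M).

Let DcD : D^T *m cj D = 1%:M.
Proof. by apply: trmx_inj; rewrite trmx_mul trmxK map_trmx DD trmx1. Qed.

Lemma trace_change_basis : \tr (cj D *m T *m D^T) = \tr T.
Proof. by rewrite mxtrace_mulC mulmxA DcD mul1mx. Qed.

Lemma hsnorm2_change_basis : hsnorm2 (cj D *m T *m D^T) = hsnorm2 T.
Proof.
apply: (@complexI R); rewrite !hsnorm2_trace.
have -> : cj (cj D *m T *m D^T)^T = cj D *m cj T^T *m D^T.
  by rewrite !trmx_mul trmxK !map_mxM map_trmx cjK mulmxA.
rewrite mulmxA mxtrace_mulC !mulmxA DcD mul1mx -(mulmxA T) DcD mulmx1.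
by [].
Qed.
End change_of_basis.
End matrices.

(** * The matrix of the quantized symbol in a given eigenbasis *)

Section level_matrix.
Context {R : realType} {d j N : nat}.
Local Notation C := R[i].
Local Notation lr := (@lebesgue_row R d).
Variables (A : 'rV[R]_(d + d) -> C) (e : 'I_N -> 'rV[R]_d -> C).
Hypotheses (pA : wpiece A)
  (he : orthonormal_basis (@oscillator_eigenspace R d (2 * j + d)%N%:R) e).

Lemma level_matrix : N = #|level d j| /\ exists M : 'M[C]_N,
  [/\ forall U l, inner (rotate e U l) (weyl A (rotate e U l)) = qform l M U,
      \tr M = \sum_(b : level d j) wmat A (lev b) (lev b) &
      hsnorm2 M = \sum_(b : level d j) \sum_(c : level d j) normc (wmat A (lev b) (lev c)) ^+ 2].
Proof.
pose m := #|level d j|; pose al (i : 'I_m) : {ffun 'I_d -> nat} := lev (enum_val i).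
have re (F : level d j -> R) : \sum_b F b = \sum_(i < m) F (enum_val i).
  by rewrite (reindex _ (onW_bij _ (enum_val_bij (level d j)))).
have reC (F : level d j -> C) : \sum_b F b = \sum_(i < m) F (enum_val i).
  by rewrite (reindex _ (onW_bij _ (enum_val_bij (level d j)))).
have ial : injective al by move=> i k /lev_inj/enum_val_inj.
have dal i : degree (al i) = j by exact: degree_lev.
have sal be : degree be = j -> exists i, al i = be.
  by move=> /lev_surj[b <-]; exists (enum_rank b); rewrite /al enum_rankK.
have [D [D1 D2 eD]] := eigenspace_basis he ial dal sal.
split; first by apply/eqP; rewrite eqn_leq (mulmx1_min D1) (mulmx1_min D2).
pose T : 'M[C]_m := \matrix_(i, k) wmat A (al i) (al k).
(* The Hermite coordinates of the l-th rotated vector are the l-th row of U D, so the form of T at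
   this row is the form of conj(D) T D^T at the l-th row of U. *)
exists (map_mx (@conjc R) D *m T *m D^T); split.
- move=> U l; pose c i := (val U *m D) l i.
  have se k : square_integrable (e k) by have [/(_ k)[]] := he.
  have sr : square_integrable (rotate e U l).
    by apply: square_integrable_sum => k; exact: square_integrableZ.
  have er : {ae lr, forall x, rotate e U l x = \sum_i c i * hermc (al i) x}.
    have H : forall s : seq 'I_N, {ae lr, forall x, forall k, k \in s -> e k x = \sum_i D k i * hermc (al i) x}.
      elim=> [|k s IH]; first by apply: aeW => x k; rewrite in_nil.
      apply: filterS2 (eD k) IH => x hk hs k'; rewrite inE => /orP[/eqP->//|]; exact: hs.
    apply: filterS (H (index_enum 'I_N)) => x hx; rewrite /rotate.
    rewrite (eq_bigr (fun k => \sum_i val U l k * (D k i * hermc (al i) x))) => [|k _]; last first.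
      by rewrite hx ?mem_index_enum// mulr_sumr.
    rewrite exchange_big; apply: eq_bigr => i _; rewrite /c mxE mulr_suml.
    by apply: eq_bigr => k _; rewrite mulrA.
  rewrite (inner_weyl_lincomb pA sr er) qform_mulmx.
  transitivity ((map_mx (@conjc R) (val U *m D) *m (T *m (val U *m D)^T)) l l).
    rewrite mxE; apply: eq_bigr => i _; rewrite [in RHS]mxE; congr (_ * _).
    rewrite mxE; apply: eq_bigr => k _; rewrite [T _ _]mxE; congr (_ * _).
    by rewrite [RHS]mxE.
  by rewrite map_mxM trmx_mul !mulmxA.
- by rewrite (trace_change_basis _ D2) reC; apply: eq_bigr => i _; rewrite mxE.
- rewrite (hsnorm2_change_basis _ D2) re; apply: eq_bigr => i _; rewrite re; apply: eq_bigr => k _.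
  by rewrite mxE.
Qed.
End level_matrix.

Section sixth_moments.
Context {R : realType} (n : nat) (mu : probability (unitary_group R n) R).
Hypothesis (hmu : haar_probability mu) (n0 : (0 < n)%N).
Variables (M : 'M[R[i]]_n) (K : R).
Hypothesis (hM : hsnorm2 M <= K * n%:R).

(** The sum over the basis stands for the maximum, which it dominates; its expectation is N times
    O(N^-3). *)
Definition deviation6 (U : unitary_group R n) : R := \sum_l normc (qform l M U - \tr M / n%:R) ^+ 6.

Let meas_dev l : measurable_fun setT (fun U : unitary_group R n => normc (qform l M U - \tr M / n%:R) ^+ 6).
Proof.
by apply: measurable_funX; apply: cmeas_normc; apply: cmeasB; [exact: cmeas_qform|exact: cmeas_cst].
Qed.

Lemma deviation6_ge0 U : 0 <= deviation6 U.
Proof. by apply: sumr_ge0 => l _; rewrite exprn_ge0// normc_ge0. Qed.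

Let rintg_dev l : rintg mu (fun U => normc (qform l M U - \tr M / n%:R) ^+ 6).
Proof.
apply: (@rintg_bounded _ _ mu _ ((1 + hsnorm2 M + normc (\tr M / n%:R)) ^+ 6)); first exact: meas_dev.
move=> U.
rewrite ger0_norm ?exprn_ge0 ?normc_ge0//; apply: lerXn2r; rewrite ?nnegrE ?normc_ge0//.
  by rewrite !addr_ge0 ?normc_ge0 ?hsnorm2_ge0.
apply: le_trans (normcB_le _ _) _; rewrite lerD2r.
have := qform_le l M U; have := normc_ge0 (qform l M U); have := sqr_ge0 (normc (qform l M U) - 1).
move: (normc _) => t; nra.
Qed.

Lemma measurable_deviation6 : measurable_fun setT deviation6.
Proof. by apply: measurable_sum => l; exact: meas_dev. Qed.

Lemma rintg_deviation6 : rintg mu deviation6.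
Proof.
by apply: (@rintg_sum _ _ _ _ _ (index_enum 'I_n) xpredT (fun l U => normc (qform l M U - \tr M / n%:R) ^+ 6)) => l _; exact: rintg_dev.
Qed.

Lemma Rint_deviation6 : \int[mu]_U deviation6 U <= 384 * 1000 * K ^+ 3 / n%:R ^+ 2.
Proof.
have np : 0 < n%:R :> R by rewrite ltr0n.
rewrite (@Rint_sum _ _ _ mu _ (index_enum 'I_n) xpredT (fun l U => normc (qform l M U - \tr M / n%:R) ^+ 6)) => [|l _]; last exact: rintg_dev.
apply: le_trans (_ : \sum_(l < n) (384 * 1000 * K ^+ 3 / n%:R ^+ 3) <= _).
  apply: ler_sum => l _; have h := haar_moment6 hmu n0 l M.
  have h3 : hsnorm2 M ^+ 3 <= (K * n%:R) ^+ 3.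
    by apply: lerXn2r; rewrite ?nnegrE ?hsnorm2_ge0//; exact: le_trans (hsnorm2_ge0 _) hM.
  have c0 : 0 <= 384 * 1000 :> R := mulr_ge0 (ler0n R 384) (ler0n R 1000).
  have := le_trans h (ler_wpM2l c0 h3).
  rewrite -ler_pdivlMl ?exprn_gt0// => /le_trans; apply.
  rewrite le_eqVlt; apply/orP; left; apply/eqP; field; exact: lt0r_neq0.
rewrite sumr_const card_ord -mulr_natr le_eqVlt; apply/orP; left; apply/eqP; field; exact: lt0r_neq0.
Qed.

Lemma deviation6_le U l (t : R) : 0 <= t -> deviation6 U <= t ^+ 6 -> normc (qform l M U - \tr M / n%:R) <= t.
Proof.
move=> t0 h; rewrite leNgt; apply/negP => lt.
have : t ^+ 6 < normc (qform l M U - \tr M / n%:R) ^+ 6 by rewrite ltrXn2r ?nnegrE ?normc_ge0.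
apply/negP; rewrite -leNgt; apply: le_trans h; rewrite /deviation6 (bigD1 l)//= lerDl.
by apply: sumr_ge0 => k _; rewrite exprn_ge0// normc_ge0.
Qed.
End sixth_moments.

Section marginals.
Context {R : realType} {N : nat -> nat}.
Variables (rhoj : forall j, probability (unitary_group R (N j)) R) (rho : probability (basis_space R N) R).
Hypothesis hrho : product_probability rhoj rho.

Lemma mpres_marginal j : mpres rho (rhoj j) (fun B : basis_space R N => B j).
Proof.
split.
  move=> _ Y mY; rewrite setTI; apply: sub_sigma_algebra.
  by exists j, Y.
move=> Y mY.
(* A cylinder: Y at the index j and the whole group elsewhere. As the groups depend on the index, Y
   is transported along a proof of i = j. *)
pose S i : set (unitary_group R (N i)) := [set U | forall E : i = j, Y (eq_rect i (fun k => unitary_group R (N k)) U j E)].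
have SE : S j = Y.
  by apply/seteqP; split=> U /=; [move/(_ erefl)|move=> YU E; rewrite (eq_irrelevance E erefl)].
have SN i : i != j -> S i = setT.
  by move=> ij; apply/seteqP; split=> // U _ E; rewrite E eqxx in ij.
have mS i : measurable (S i).
  by have [->|ij] := eqVneq i j; [rewrite SE|rewrite SN//; exact: measurableT].
have := hrho j.+1 mS; rewrite (_ : [set B | _] = (fun B : basis_space R N => B j) @^-1` Y); last first.
  apply/seteqP; split=> B /=; first by move/(_ j (ltnSn j)); rewrite SE.
  by move=> YB i _; have [->|ij] := eqVneq i j; [rewrite SE|rewrite SN].
move=> hr; apply: etrans hr _; rewrite big_ord_recr /= SE big1 ?mul1e// => i _.
by rewrite SN ?probability_setT// neq_ltn ltn_ord.
Qed.
End marginals.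

(** * Almost sure convergence and conclusion *)

Section borel_cantelli.
Context d (T : measurableType d) {R : realType} (mu : {measure set T -> \bar R}).

(** The series of the f n has finite integral, so it converges almost everywhere and its terms tend
    to 0; no events have to be introduced. *)
Lemma ae_cvg0_summable (f : nat -> T -> R) (C : R) : (forall n, measurable_fun setT (f n)) ->
  (forall n t, 0 <= f n t) -> (forall n, (\int[mu]_t (f n t)%:E <= (C / n.+1%:R ^+ 2)%:E)%E) ->
  {ae mu, forall t, (fun n => f n t) @ \oo --> (0 : R)}.
Proof.
move=> mf f0 hf.
have C0 : 0 <= C.
  have : (0 <= \int[mu]_t (f 0%N t)%:E)%E by apply: integral_ge0 => t _; rewrite lee_fin.
  by move/le_trans => /(_ _ (hf 0%N)); rewrite lee_fin expr1n divr1.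
have mfE n : measurable_fun setT (fun t => (f n t)%:E) by exact/measurable_EFinP.
(* The partial sums of 1 / i^2 are at most 2 - 1 / n, by induction. *)
have S n : \sum_(0 <= i < n.+1) (C / i.+1%:R ^+ 2) <= 2 * C - C / n.+1%:R.
  elim: n => [|n IH]; first by rewrite big_nat1 expr1n !divr1; lra.
  rewrite big_nat_recr//=; apply: le_trans (lerD IH (lexx _)) _; rewrite -addrA lerD2l.
  have p1 : 0 < n.+1%:R :> R by rewrite ltr0n.
  have p2 : n.+2%:R = n.+1%:R + 1 :> R by rewrite natr1.
  rewrite p2; move: (n.+1%:R : R) p1 => p p0.
  have p10 : 0 < p + 1 by rewrite addr_gt0.
  have -> : - (C / p) + C / (p + 1) ^+ 2 = - (C / (p + 1)) - C / (p * (p + 1) ^+ 2).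
    by field; rewrite !lt0r_neq0.
  by rewrite lerBlDr lerDl divr_ge0// mulr_ge0 ?sqr_ge0// ltW.
have fin : (\int[mu]_t \sum_(0 <= n <oo) (f n t)%:E < +oo)%E.
  rewrite integral_nneseries//; last by move=> n t _; rewrite lee_fin.
  apply: (@le_lt_trans _ _ (2 * C)%:E); last exact: ltry.
  apply: lime_le.
    by apply: is_cvg_nneseries => n _ _; apply: integral_ge0 => t _; rewrite lee_fin.
  apply: nearW => n; apply: le_trans (_ : (\sum_(0 <= i < n) (C / i.+1%:R ^+ 2)%:E <= _)%E); first by apply: lee_sum => i _.
  rewrite sumEFin lee_fin; case: n => [|n]; first by rewrite big_nil mulr_ge0.
  by apply: le_trans (S n) _; rewrite lerBlDr lerDl divr_ge0.
have mS : measurable_fun setT (fun t => \sum_(0 <= n <oo) (f n t)%:E)%E.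
  by apply: ge0_emeasurable_sum => [n t _ _|n _]; [rewrite lee_fin|exact: mfE].
have iS : mu.-integrable setT (fun t => \sum_(0 <= n <oo) (f n t)%:E)%E.
  apply/integrableP; split=> //; under eq_integral => t _.
    rewrite gee0_abs; last by apply: nneseries_ge0 => n _ _; rewrite lee_fin.
    over.
  exact: fin.
apply: filterS (integrable_ae measurableT iS) => t /(_ I) ft.
apply: cvg_series_cvg_0; apply: nondecreasing_is_cvgn.
  by apply/nondecreasing_seqP => n; rewrite seriesSr lerDl.
exists (fine (\sum_(0 <= n <oo) (f n t)%:E)%E) => _ [n _ <-].
rewrite -lee_fin fineK// /series /= -sumEFin.
by apply: nneseries_lim_ge => k _ _; rewrite lee_fin.
Qed.
End borel_cantelli.

Theorem theorem1p6 (R : realType) (d : nat) (hd : (2 <= d)%N)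
    (N : nat -> nat) (e : forall j : nat, 'I_(N j) -> 'rV[R]_d -> R[i])
    (he : forall j : nat,
       orthonormal_basis (@oscillator_eigenspace R d (2 * j + d)%N%:R) (e j))
    (rhoj : forall j : nat, probability (unitary_group R (N j)) R)
    (hrhoj : forall j : nat, haar_probability (rhoj j))
    (rho : probability (basis_space R N) R)
    (hrho : product_probability rhoj rho)
    (L2 : probability 'rV[R]_(d + d) R)
    (hL2 : uniform_on_sphere (Num.sqrt 2) L2)
    (A : 'rV[R]_(d + d) -> R[i]) (hA : symbol_S11 A) :
  {ae rho, forall B : basis_space R N,
    (fun j : nat => max_deviation A (cint L2 A) (rotate (e j) (B j)))
      @ \oo --> (0 : R)}.
Proof.
have [pA [K K0 hK] sA] := admissible_symbol hL2 hA.
have NE j := (level_matrix pA (he j)).1.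
pose M j := sval (cid (level_matrix pA (he j)).2).
have HM j : [/\ forall U l, inner (rotate (e j) U l) (weyl A (rotate (e j) U l)) = qform l (M j) U,
      \tr (M j) = \sum_(b : level d j) wmat A (lev b) (lev b) &
      hsnorm2 (M j) = \sum_(b : level d j) \sum_(c : level d j) normc (wmat A (lev b) (lev c)) ^+ 2].
  exact: svalP (cid (level_matrix pA (he j)).2).
have jN j : (j < N j)%N by rewrite NE; exact: card_level.
have N0 j : (0 < N j)%N := leq_ltn_trans (leq0n j) (jN j).
have hs j : hsnorm2 (M j) <= K * (N j)%:R by have [_ _ ->] := HM j; rewrite NE; exact: hK.
pose f j (B : basis_space R N) : R := deviation6 (M j) (B j).
have mp j := mpres_marginal hrho j.
have mf j : measurable_fun setT (f j) by exact: measurableT_comp (measurable_deviation6 (M j)) (mp j).1.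
(* The marginal of rho at j is Haar measure, and N_j >= j + 1 turns O(1/N_j^2) into a summable
   bound. *)
have If j : (\int[rho]_B (f j B)%:E <= ((384 * 1000 * K ^+ 3) / j.+1%:R ^+ 2)%:E)%E.
  have <- : (\int[rhoj j]_U (deviation6 (M j) U)%:E = \int[rho]_B (f j B)%:E)%E.
    apply: (mpres_ge0 (mp j) (f := fun U => (deviation6 (M j) U)%:E)).
      by apply/measurable_EFinP; exact: measurable_deviation6.
    by move=> U; rewrite lee_fin deviation6_ge0.
  rewrite -(EFin_Rint (rintg_deviation6 (rhoj j) (M j))) lee_fin.
  apply: le_trans (Rint_deviation6 (hrhoj j) (N0 j) (hs j)) _.
  apply: ler_wpM2l; first exact: (mulr_ge0 (mulr_ge0 (ler0n R 384) (ler0n R 1000)) (exprn_ge0 3 K0)).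
  rewrite lef_pV2 ?posrE ?exprn_gt0 ?ltr0n//.
  by apply: lerXn2r; rewrite ?nnegrE// ler_nat.
have := ae_cvg0_summable mf (fun j B => deviation6_ge0 (M j) (B j)) If.
apply: filterS => B cB; apply/cvgr0Pnorm_le => eps eps0.
(* One third bounds the fluctuation around the normalized trace; the other two bound the constant
   and the linear part of the trace error once divided by N_j. *)
have e3 : 0 < eps / 3 by rewrite divr_gt0.
have [K1 hK1] := sA _ e3.
have ev1 : \forall j \near \oo, f j B <= (eps / 3) ^+ 6.
  move/cvgr0Pnorm_le : cB => /(_ _ (exprn_gt0 6 e3)); apply: filterS => j.
  by rewrite ger0_norm// deviation6_ge0.
have ev2 : \forall j \near \oo, K1 / (N j)%:R <= eps / 3.
  have [k hk] : exists k, K1 / (eps / 3) <= k.+1%:R.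
    have [k _ /(_ k (leqnn k)) hk] := near_nat_ge (K1 / (eps / 3)); by exists k.
  exists k => // j /= kj; have Np : 0 < (N j)%:R :> R by rewrite ltr0n.
  rewrite ler_pdivrMr// mulrC -ler_pdivrMr//; apply: le_trans hk _.
  by rewrite ler_nat; exact: leq_ltn_trans kj (jN j).
apply: filterS2 ev1 ev2 => j h1 h2.
have Np : 0 < (N j)%:R :> R by rewrite ltr0n.
have tr : normc (\tr (M j) / (N j)%:R - cint L2 A) <= 2 * (eps / 3).
  have [_ trE _] := HM j.
  have -> : \tr (M j) / (N j)%:R - cint L2 A = ((N j)%:R^-1)%:C * (\tr (M j) - cint L2 A * ((N j)%:R)%:C).
    have -> : (N j)%:R = ((N j)%:R)%:C :> R[i] by rewrite rmorph_nat.
    rewrite -fmorphV mulrBr mulrC (mulrC (cint _ _)) mulrA -rmorphM mulVf ?mul1r//; exact: lt0r_neq0.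
  rewrite Normc.normcM normcR ger0_norm ?invr_ge0// mulrC ler_pdivrMr// trE.
  have := hK1 j; rewrite -NE; move/le_trans; apply.
  by move: h2; rewrite ler_pdivrMr// => h2; lra.
rewrite /max_deviation ger0_norm; last first.
  by apply: (big_ind (fun x : R => 0 <= x)) => // [x y x0 y0|l _]; [rewrite le_max x0|exact: normc_ge0].
apply/bigmax_leP; split; first exact: ltW.
move=> l _; have [-> _ _] := HM j.
have h3 := deviation6_le (M := M j) (U := B j) l (ltW e3) h1.
rewrite (_ : qform _ _ _ - _ = (qform l (M j) (B j) - \tr (M j) / (N j)%:R) + (\tr (M j) / (N j)%:R - cint L2 A)); last by ring.
by apply: le_trans (normcD_le _ _) _; lra.
Qed.
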